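(* For $n\ge1$, as a $(\mathfrak{gl}_\infty,\mathfrak{gl}_{[n]})$-bicrystal, we have $$\mathcal E^n\simeq\bigsqcup_{\substack{\mu\in\mathscr P\\ \mu_1\le n}}\mathbf B_\mu\times\mathbf B_{[n]}(\omega_{\mu'}).$$
   Context: $\mathfrak{gl}_\infty$ is the Lie algebra of complex $\mathbb{Z}\times\mathbb{Z}$ matrices with finitely many nonzero entries, with weights $\epsilon_i$ dual to $E_{ii}$, simple coroots $h_i=E_{ii}-E_{i+1,i+1}$ and simple roots $\epsilon_i-\epsilon_{i+1}$ ($i\in\mathbb{Z}$); $\mathfrak{gl}_{[n]}$ is the subalgebra spanned by $E_{ij}$, $1\le i,j\le n$. Crystals are in Kashiwara's sense, with tensor product $B_1\otimes B_2=B_1\times B_2$, $\mathrm{wt}$ additive, $\tilde e_i(b_1\otimes b_2)=\tilde e_ib_1\otimes b_2$ if $\varphi_i(b_1)\ge\varepsilon_i(b_2)$ and $b_1\otimes\tilde e_ib_2$ otherwise, $\tilde f_i(b_1\otimes b_2)=\tilde f_ib_1\otimes b_2$ if $\varphi_i(b_1)>\varepsilon_i(b_2)$ and $b_1\otimes\tilde f_ib_2$ otherwise. $\mathcal E^n$ is the set of matrices $A=(a_{ij})_{1\le i\le n,\,j\in\mathbb{Z}}$ with entries in $\{0,1\}$ and finitely many entries equal to $1$. $\mathfrak{gl}_\infty$-structure on $\mathcal E^n$: for a single row $(a_j)_{j\in\mathbb{Z}}$, $\mathrm{wt}=\sum_ja_j\epsilon_j$, $\tilde f_k$ ($k\in\mathbb{Z}$)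 replaces $(a_k,a_{k+1})=(1,0)$ by $(0,1)$ and gives $\mathbf 0$ otherwise, and $\tilde e_k$ replaces $(0,1)$ by $(1,0)$ and gives $\mathbf 0$ otherwise; $A$ with rows $A_1,\dots,A_n$ is identified with $A_1\otimes\cdots\otimes A_n$. $\mathfrak{gl}_{[n]}$-structure on $\mathcal E^n$: $\mathrm{wt}_{[n]}(A)=\sum_{i=1}^n(\sum_ja_{ij})\epsilon_i$; for $1\le l\le n-1$, $\tilde F_l$ on a single column replaces $(a_l,a_{l+1})=(1,0)$ by $(0,1)$ and gives $\mathbf 0$ otherwise, $\tilde E_l$ does the reverse, and $A$ with columns $A^j$ is identified with the tensor product of its columns taken in order of decreasing $j$, $\cdots\otimes A^{j+1}\otimes A^j\otimes A^{j-1}\otimes\cdots$ (only finitely many columns are nonzero; zero columns are trivial). The operators $\tilde e_k,\tilde f_k$ commute with $\tilde E_l,\tilde F_l$, so $\mathcal E^n$ is a $(\mathfrak{gl}_\infty,\mathfrak{gl}_{[n]})$-bicrystal. A product $B\times B'$ of a $\mathfrak{gl}_\infty$-crystal and a $\mathfrak{gl}_{[n]}$-crystal is a bicrystal with operators acting on the respective factors; isomorphisms of bicrystals preserve both crystal structures. $\mathscr P$ is the set of partitions, $\mu'$ the conjugate of $\mu$. $\mathbf B=\mathbb{Z}$ is the crystal of the natural representation of $U_q(\mathfrak{gl}_\infty)$: $\mathrm{wt}(i)=\epsilon_i$, $\tilde f_i(i)=i+1$, $\tilde f_j(i)=\mathbf 0$ for $j\neq i$. $\mathbf B_\mu$ is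 the set of semistandard tableaux of shape $\mu$ with entries in $\mathbb{Z}$, a crystal by identifying a tableau with the tensor product in $\mathbf B^{\otimes|\mu|}$ of the letters of its column word (columns right to left, each top to bottom); $\mathbf B_\emptyset$ is the trivial one-element crystal. For a weakly decreasing $\lambda\in\mathbb{Z}^n$, $\omega_\lambda=\lambda_1\epsilon_1+\cdots+\lambda_n\epsilon_n$ and $\mathbf B_{[n]}(\omega_\lambda)$ is the crystal base of the irreducible $U_q(\mathfrak{gl}_{[n]})$-module of highest weight $\omega_\lambda$ (for $n=1$, a single element of weight $\lambda_1\epsilon_1$); $\mu'$ with $\mu_1\le n$ is padded with zeros to length $n$. *)

(* Defs.v *)
From HB Require Import structures.
From mathcomp Require Import all_boot all_order all_algebra.
From mathcomp Require Import finmap freeg.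

Set Implicit Arguments.
Unset Strict Implicit.
Unset Printing Implicit Defensive.

Import Order.TTheory GRing.Theory Num.Theory.
Local Open Scope ring_scope.

(* Combinatorial data of gl: [pos] indexes the matrix units E_jj, and the      *)
(* i-th simple root is eps_(lo i) - eps_(hi i).                                *)
Record gl_datum := GlDatum {
  node : eqType;
  pos : choiceType;
  lo : node -> pos;
  hi : node -> pos }.

Definition gl_inf : gl_datum := @GlDatum int int id (fun k => k + 1).

(* The nodes 1, ..., n-1 and the positions 1, ..., n are counted from 0.       *)
Definition gl_fin (n : nat) : gl_datum :=
  @GlDatum 'I_n.-1 'I_n (widen_ord (leq_pred n))
    (fun i => Ordinal (etrans (esym (ltn_predRL i n)) (ltn_ord i))).

Section Weights.
Variable D : gl_datum.

Definition weight := {freeg (pos D) / int}.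

Definition eps_wt (j : pos D) : weight := << j >>.

Definition root (i : node D) : weight := eps_wt (lo i) - eps_wt (hi i).

Definition coroot (i : node D) (la : weight) : int :=
  coeff (lo i) la - coeff (hi i) la.

End Weights.

(* [None] is the element 0 outside the crystal.  All the crystals considered   *)
(* here have finite eps_i and phi_i, so the value -oo is left out.             *)
Record crystal_on (D : gl_datum) (B : Type) := CrystalOn {
  wt : B -> weight D;
  ceps : node D -> B -> int;
  cphi : node D -> B -> int;
  ce : node D -> B -> option B;
  cf : node D -> B -> option B }.

Record is_crystal (D : gl_datum) (B : Type) (c : crystal_on D B) : Prop := {
  crystal_phi : forall i b, cphi c i b = ceps c i b + coroot i (wt c b);
  crystal_e : forall i b b', ce c i b = Some b' ->
    [/\ wt c b' = wt c b + root i, ceps c i b' = ceps c i b - 1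
      & cphi c i b' = cphi c i b + 1];
  crystal_f : forall i b b', cf c i b = Some b' ->
    [/\ wt c b' = wt c b - root i, ceps c i b' = ceps c i b + 1
      & cphi c i b' = cphi c i b - 1];
  crystal_ef : forall i b b', cf c i b = Some b' <-> ce c i b' = Some b }.

Record crystal (D : gl_datum) := Crystal {
  elt :> choiceType;
  str :> crystal_on D elt }.

(* The crystal of words b_1 ... b_k, identified with b_1 (x) ... (x) b_k; the  *)
(* empty word is the trivial crystal, and b :: s is b (x) s.                   *)
Section Words.
Variables (D : gl_datum) (B : Type) (c : crystal_on D B).

Definition word_wt (s : seq B) : weight D := \sum_(b <- s) wt c b.

Fixpoint word_eps (i : node D) (s : seq B) : int :=
  if s is b :: s' then
    Num.max (ceps c i b) (word_eps i s' - coroot i (wt c b))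
  else 0.

Fixpoint word_phi (i : node D) (s : seq B) : int :=
  if s is b :: s' then
    Num.max (cphi c i b + coroot i (word_wt s')) (word_phi i s')
  else 0.

Fixpoint word_e (i : node D) (s : seq B) : option (seq B) :=
  if s is b :: s' then
    if cphi c i b >= word_eps i s' then omap (cons^~ s') (ce c i b)
    else omap (cons b) (word_e i s')
  else None.

Fixpoint word_f (i : node D) (s : seq B) : option (seq B) :=
  if s is b :: s' then
    if cphi c i b > word_eps i s' then omap (cons^~ s') (cf c i b)
    else omap (cons b) (word_f i s')
  else None.

Definition word_crystal : crystal_on D (seq B) :=
  CrystalOn word_wt word_eps word_phi word_e word_f.

End Words.

Record bicrystal (D1 D2 : gl_datum) := Bicrystal {
  bielt :> choiceType;
  fst_str : crystal_on D1 bielt;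
  snd_str : crystal_on D2 bielt }.

Record is_bicrystal (D1 D2 : gl_datum) (X : bicrystal D1 D2) : Prop := {
  bicrystal_fst : is_crystal (fst_str X);
  bicrystal_snd : is_crystal (snd_str X);
  bicrystal_ee : forall k l x,
    obind (ce (snd_str X) l) (ce (fst_str X) k x) =
    obind (ce (fst_str X) k) (ce (snd_str X) l x);
  bicrystal_ef : forall k l x,
    obind (cf (snd_str X) l) (ce (fst_str X) k x) =
    obind (ce (fst_str X) k) (cf (snd_str X) l x);
  bicrystal_fe : forall k l x,
    obind (ce (snd_str X) l) (cf (fst_str X) k x) =
    obind (cf (fst_str X) k) (ce (snd_str X) l x);
  bicrystal_ff : forall k l x,
    obind (cf (snd_str X) l) (cf (fst_str X) k x) =
    obind (cf (fst_str X) k) (cf (snd_str X) l x) }.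

Record preserves (D : gl_datum) (B B' : Type) (c : crystal_on D B)
    (c' : crystal_on D B') (h : B -> B') : Prop := {
  preserves_wt : forall b, wt c' (h b) = wt c b;
  preserves_eps : forall i b, ceps c' i (h b) = ceps c i b;
  preserves_phi : forall i b, cphi c' i (h b) = cphi c i b;
  preserves_e : forall i b, ce c' i (h b) = omap h (ce c i b);
  preserves_f : forall i b, cf c' i (h b) = omap h (cf c i b) }.

Definition bicrystal_iso (D1 D2 : gl_datum) (X Y : bicrystal D1 D2) : Prop :=
  [/\ is_bicrystal X, is_bicrystal Y
    & exists h : X -> Y,
        [/\ bijective h, preserves (fst_str X) (fst_str Y) h
          & preserves (snd_str X) (snd_str Y) h]].

Definition prod_bicrystal (D1 D2 : gl_datum)
    (B1 : crystal D1) (B2 : crystal D2) : bicrystal D1 D2 :=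
  @Bicrystal D1 D2 (B1 * B2)%type
    (CrystalOn (fun b => wt B1 b.1)
       (fun i b => ceps B1 i b.1) (fun i b => cphi B1 i b.1)
       (fun i b => omap (pair^~ b.2) (ce B1 i b.1))
       (fun i b => omap (pair^~ b.2) (cf B1 i b.1)))
    (CrystalOn (fun b => wt B2 b.2)
       (fun i b => ceps B2 i b.2) (fun i b => cphi B2 i b.2)
       (fun i b => omap (pair b.1) (ce B2 i b.2))
       (fun i b => omap (pair b.1) (cf B2 i b.2))).

Definition sum_crystal_on (D : gl_datum) (J : Type) (B : J -> Type)
    (c : forall j, crystal_on D (B j)) : crystal_on D {j : J & B j} :=
  CrystalOn (fun x => wt (c (tag x)) (tagged x))
    (fun i x => ceps (c (tag x)) i (tagged x))
    (fun i x => cphi (c (tag x)) i (tagged x))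
    (fun i x => omap (Tagged B) (ce (c (tag x)) i (tagged x)))
    (fun i x => omap (Tagged B) (cf (c (tag x)) i (tagged x))).

Definition sum_bicrystal (D1 D2 : gl_datum) (J : choiceType)
    (X : J -> bicrystal D1 D2) : bicrystal D1 D2 :=
  @Bicrystal D1 D2 {j : J & X j}
    (sum_crystal_on (fun j => fst_str (X j)))
    (sum_crystal_on (fun j => snd_str (X j))).

(* The rows (for gl_inf) and the columns (for gl_fin n) of the 0-1 matrices.   *)
Section Vectors.
Variable D : gl_datum.

Definition vec := {fsfun pos D -> bool with false}.

Definition vec_wt (a : vec) : weight D := \sum_(j <- finsupp a) eps_wt j.

Definition vec_eps (i : node D) (a : vec) : int := (~~ a (lo i) && a (hi i))%:Z.

Definition vec_phi (i : node D) (a : vec) : int := (a (lo i) && ~~ a (hi i))%:Z.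

Definition vec_e (i : node D) (a : vec) : option vec :=
  if ~~ a (lo i) && a (hi i)
  then Some [fsfun a with lo i |-> true, hi i |-> false] else None.

Definition vec_f (i : node D) (a : vec) : option vec :=
  if a (lo i) && ~~ a (hi i)
  then Some [fsfun a with lo i |-> false, hi i |-> true] else None.

Definition vec_crystal : crystal_on D vec :=
  CrystalOn vec_wt vec_eps vec_phi vec_e vec_f.

End Vectors.

Section Matrices.
Variable n : nat.

Definition mat01 := {fsfun 'I_n * int -> bool with false}.

Definition mk_mat (J : seq int) (a : 'I_n -> int -> bool) : mat01 :=
  [fsfun x in [fset x in allpairs pair (enum 'I_n) J]%fset => a x.1 x.2 | false].

Definition mat_row (A : mat01) (i : 'I_n) : vec gl_inf :=
  [fsfun j in [fset x.2 | x in finsupp A]%fset => A (i, j) | false].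

Definition mat_col (A : mat01) (j : int) : vec (gl_fin n) :=
  [fsfun i in [fset x.1 | x in finsupp A]%fset => A (i, j) | false].

Definition rows (A : mat01) : seq (vec gl_inf) :=
  [seq mat_row A i | i <- enum 'I_n].

Definition of_rows (s : seq (vec gl_inf)) : mat01 :=
  mk_mat (flatten [seq (finsupp r : seq int) | r <- s])
    (fun i j => nth [fsfun] s i j).

Definition mat_inf_crystal : crystal_on gl_inf mat01 :=
  let c := word_crystal (vec_crystal gl_inf) in
  CrystalOn (fun A => wt c (rows A))
    (fun k A => ceps c k (rows A)) (fun k A => cphi c k (rows A))
    (fun k A => omap of_rows (ce c k (rows A)))
    (fun k A => omap of_rows (cf c k (rows A))).

(* The indices of the nonzero columns, in decreasing order; the operators send *)
(* a zero column to 0, so that no other column matters.                        *)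
Definition col_index (A : mat01) : seq int :=
  sort >=%R [fset x.2 | x in finsupp A]%fset.

Definition cols (A : mat01) : seq (vec (gl_fin n)) :=
  [seq mat_col A j | j <- col_index A].

Definition of_cols (J : seq int) (s : seq (vec (gl_fin n))) : mat01 :=
  mk_mat J (fun i j => nth [fsfun] s (index j J) i).

Definition mat_fin_crystal : crystal_on (gl_fin n) mat01 :=
  let c := word_crystal (vec_crystal (gl_fin n)) in
  CrystalOn (fun A => wt c (cols A))
    (fun l A => ceps c l (cols A)) (fun l A => cphi c l (cols A))
    (fun l A => omap (of_cols (col_index A)) (ce c l (cols A)))
    (fun l A => omap (of_cols (col_index A)) (cf c l (cols A))).

Definition mat_bicrystal : bicrystal gl_inf (gl_fin n) :=
  Bicrystal mat_inf_crystal mat_fin_crystal.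

End Matrices.

Record intpart := IntPart {
  parts :> seq nat;
  _ : sorted geq parts && (0%N \notin parts) }.

HB.instance Definition _ := [isSub for parts].
HB.instance Definition _ := [Choice of intpart by <:].

(* mu_(j+1) and mu'_(j+1). *)
Definition part (mu : intpart) (j : nat) : nat := nth 0%N mu j.
Definition conj_part (mu : intpart) (j : nat) : nat := count (ltn j) mu.

Definition natural_crystal : crystal_on gl_inf int :=
  @CrystalOn gl_inf int (@eps_wt gl_inf)
    (fun i b => (b == i + 1)%:Z) (fun i b => (b == i)%:Z)
    (fun i b => if b == i + 1 then Some i else None)
    (fun i b => if b == i then Some (i + 1) else None).

Section Tableaux.
Variable mu : intpart.

(* Columns from right to left, each from top to bottom. *)
Definition cells : seq (nat * nat) :=
  [seq (i, j) | j <- rev (iota 0 (part mu 0)), i <- iota 0 (conj_part mu j)].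

(* A tableau is the sequence of its rows; [x.1] is the row of the cell x.      *)
Definition entry (T : seq (seq int)) (x : nat * nat) : int :=
  nth 0 (nth [::] T x.1) x.2.

Definition semistandard (T : seq (seq int)) : bool :=
  [&& map size T == mu,
      all (fun x => (x.1 == 0%N) || (entry T (x.1.-1, x.2) < entry T x)) cells
    & all (fun x => (x.2 == 0%N) || (entry T (x.1, x.2.-1) <= entry T x)) cells].

Definition ssyt := {T : seq (seq int) | semistandard T}.

Definition reading (T : ssyt) : seq int := [seq entry (val T) x | x <- cells].

(* Every word obtained from the reading word of a tableau by a crystal operator *)
(* is again such a reading word, so that [insub] loses nothing there.          *)
Definition unread (w : seq int) : option ssyt :=
  insub [seq [seq nth 0 w (index (i, j) cells) | j <- iota 0 (part mu i)]
        | i <- iota 0 (size mu)].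

Definition ssyt_crystal : crystal gl_inf :=
  let c := word_crystal natural_crystal in
  @Crystal gl_inf ssyt
    (CrystalOn (fun T => wt c (reading T))
       (fun k T => ceps c k (reading T)) (fun k T => cphi c k (reading T))
       (fun k T => obind unread (ce c k (reading T)))
       (fun k T => obind unread (cf c k (reading T)))).

End Tableaux.

(* Crystal bases are taken at q = 0, over the ring [regular0] of the rational  *)
(* functions without pole there.                                              *)
Definition Qq := {fraction {poly rat}}.
Local Notation "p %:F" := (@FracField.tofrac {poly rat} p).
Definition q : Qq := 'X%:F.
Definition const_Qq (a : rat) : Qq := a%:P%:F.

Definition regular0 (x : Qq) : Prop :=
  exists a b : {poly rat}, b.[0] != 0 /\ x = a%:F / b%:F.

Definition q_int (k : nat) : Qq := (q ^+ k - q ^- k) / (q - q^-1).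
Definition q_fact (k : nat) : Qq := \prod_(1 <= j < k.+1) q_int j.

Section QuantumGroup.
Variable n : nat.
Let D := gl_fin n.

(* Finite-dimensional modules over U_q(gl_n): the generators q^(E_jj) and      *)
(* q^(-E_jj) act by [Uq_t j] and [Uq_tV j].                                    *)
Record Uq_module := UqModule {
  Uq_sort :> vectType Qq;
  Uq_e : node D -> 'End(Uq_sort);
  Uq_f : node D -> 'End(Uq_sort);
  Uq_t : pos D -> 'End(Uq_sort);
  Uq_tV : pos D -> 'End(Uq_sort);
  Uq_tK : forall j v, Uq_tV j (Uq_t j v) = v;
  Uq_tVK : forall j v, Uq_t j (Uq_tV j v) = v;
  Uq_tC : forall j k v, Uq_t j (Uq_t k v) = Uq_t k (Uq_t j v);
  Uq_te : forall j i v,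
    Uq_t j (Uq_e i v) = q ^ coeff j (root i) *: Uq_e i (Uq_t j v);
  Uq_tf : forall j i v,
    Uq_t j (Uq_f i v) = q ^ (- coeff j (root i)) *: Uq_f i (Uq_t j v);
  Uq_ef : forall i k v,
    Uq_e i (Uq_f k v) - Uq_f k (Uq_e i v) =
    if i == k then (q - q^-1)^-1 *:
      (Uq_t (lo i) (Uq_tV (hi i) v) - Uq_tV (lo i) (Uq_t (hi i) v))
    else 0;
  Uq_eC : forall (i k : 'I_n.-1) v, (i.+1 < k)%N ->
    Uq_e i (Uq_e k v) = Uq_e k (Uq_e i v);
  Uq_fC : forall (i k : 'I_n.-1) v, (i.+1 < k)%N ->
    Uq_f i (Uq_f k v) = Uq_f k (Uq_f i v);
  Uq_e_serre : forall (i k : 'I_n.-1) v, (i == k.+1 :> nat) || (k == i.+1 :> nat) ->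
    Uq_e i (Uq_e i (Uq_e k v)) - (q + q^-1) *: Uq_e i (Uq_e k (Uq_e i v))
      + Uq_e k (Uq_e i (Uq_e i v)) = 0;
  Uq_f_serre : forall (i k : 'I_n.-1) v, (i == k.+1 :> nat) || (k == i.+1 :> nat) ->
    Uq_f i (Uq_f i (Uq_f k v)) - (q + q^-1) *: Uq_f i (Uq_f k (Uq_f i v))
      + Uq_f k (Uq_f i (Uq_f i v)) = 0 }.

Section Module.
Variable V : Uq_module.

Definition in_wt_space (la : weight D) (v : V) : Prop :=
  forall j, Uq_t V j v = q ^ coeff j la *: v.

Definition Uq_submodule (W : {vspace V}) : Prop :=
  [/\ forall i v, v \in W -> Uq_e V i v \in W,
      forall i v, v \in W -> Uq_f V i v \in W,
      forall j v, v \in W -> Uq_t V j v \in W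
    & forall j v, v \in W -> Uq_tV V j v \in W].

Definition irreducible_hw (la : weight D) : Prop :=
  (exists2 v : V, v != 0 &
     in_wt_space la v /\ forall i, Uq_e V i v = 0) /\
  (forall W : {vspace V}, Uq_submodule W -> W = 0%VS \/ W = fullv).

Definition divided_f (i : node D) (k : nat) (v : V) : V :=
  (q_fact k)^-1 *: iter k (Uq_f V i) v.

(* u = \sum_k f_i^(k) u_k, with s = [:: u_0; u_1; ...], is the decomposition   *)
(* of the vector u of weight la into i-strings.                                *)
Definition string_decomp (i : node D) (la : weight D) (u : V) (s : seq V) :
    Prop :=
  u = \sum_(k < size s) divided_f i k s`_k /\
  forall k, (k < size s)%N ->
    [/\ Uq_e V i s`_k = 0, in_wt_space (la + root i *+ k) s`_k
      & s`_k != 0 -> (k%:Z <= coroot i (la + root i *+ k))].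

(* v = ~e_i u and v = ~f_i u for u of weight la. *)
Definition kashiwara_e (i : node D) (la : weight D) (u v : V) : Prop :=
  exists2 s, string_decomp i la u s &
    v = \sum_(1 <= k < size s) divided_f i k.-1 s`_k.

Definition kashiwara_f (i : node D) (la : weight D) (u v : V) : Prop :=
  exists2 s, string_decomp i la u s &
    v = \sum_(k < size s) divided_f i k.+1 s`_k.

Record crystal_lattice (L : V -> Prop) : Prop := {
  lattice_free : exists2 X : (\dim {:V}).-tuple V, basis_of {:V} X &
    forall u, L u <-> forall k, regular0 (coord X k u);
  lattice_wt : forall u, L u -> exists s : seq (weight D * V),
    u = \sum_(x <- s) x.2 /\
    forall x, x \in s -> L x.2 /\ in_wt_space x.1 x.2;
  lattice_e : forall i la u v, L u -> kashiwara_e i la u v -> L v;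
  lattice_f : forall i la u v, L u -> kashiwara_f i la u v -> L v }.

Definition in_qL (L : V -> Prop) (u : V) : Prop := L (q^-1 *: u).

(* The weight, operators and basis element of each b in [C] are recorded by a  *)
(* representative [r b] in L of its class modulo qL; the classes form a basis  *)
(* of the Q-vector space L / qL.                                               *)
Record crystal_base (L : V -> Prop) (C : crystal D) (r : C -> V) : Prop := {
  base_lattice : crystal_lattice L;
  base_mem : forall b, L (r b) /\ in_wt_space (wt C b) (r b);
  base_span : forall u, L u -> exists (s : seq C) (a : C -> rat),
    in_qL L (u - \sum_(b <- s) const_Qq (a b) *: r b);
  base_free : forall (s : seq C) (a : C -> rat), uniq s ->
    in_qL L (\sum_(b <- s) const_Qq (a b) *: r b) ->
    forall b, b \in s -> a b = 0;
  base_e : forall i b, exists2 v, kashiwara_e i (wt C b) (r b) v &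
    in_qL L (v - oapp r 0 (ce C i b));
  base_f : forall i b, exists2 v, kashiwara_f i (wt C b) (r b) v &
    in_qL L (v - oapp r 0 (cf C i b));
  base_ef : forall i b b', cf C i b = Some b' <-> ce C i b' = Some b }.

End Module.

(* m is the largest k such that the k-th iterate of g is defined at b. *)
Definition string_length (B : Type) (g : B -> option B) (b : B) (m : nat) :=
  iter m (obind g) (Some b) <> None /\ iter m.+1 (obind g) (Some b) = None.

Definition is_hw_crystal (la : weight D) (C : crystal D) : Prop :=
  (exists (V : Uq_module) (L : V -> Prop) (r : C -> V),
     irreducible_hw V la /\ crystal_base L r) /\
  forall i b,
    (exists2 m : nat, ceps C i b = m%:Z & string_length (ce C i) b m) /\
    (exists2 m : nat, cphi C i b = m%:Z & string_length (cf C i) b m).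

Definition omega (la : 'I_n -> int) : weight D := \sum_i eps_wt (D := D) i *~ la i.

End QuantumGroup.

(* Main.v *)
From HB Require Import structures.
Require Import Defs.
From mathcomp Require Import all_boot all_order all_algebra.
From mathcomp Require Import perm fingroup.
From mathcomp Require Import finmap freeg.
From mathcomp Require Import boolp.
From mathcomp Require Import zify ring lra.

(** Why the decomposition holds.

    Both crystal structures on matrices come from the tensor product rule for sites
    that carry a single bit: an operator f_k of gl_infinity exchanges two adjacent
    columns, with the rows as sites, and F_l of gl_n exchanges two adjacent rows, with
    the columns as sites.  Two such operators interact only in a 2 x 2 block, and
    checking this block shows that they commute and that each structure preserves the
    weights and string lengths of the other one (cross_ff, cross_fe, cross_ee).  So, in
    the connected component of a matrix for both structures, each element is determined
    by an element of the component for one structure and one of the component for the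
    other.  bicrystal_decomposition makes this precise: it suffices to give a base point
    a mu for every mu, parametrizations of its components for gl_infinity and for gl_n by
    the two factors, and to show that these components meet every matrix, and that
    different mu do not interfere.

    The base point is the matrix of the diagram of mu upside down: its rows are initial
    segments of the columns 0, 1, ..., of lengths mu'_n <= ... <= mu'_1.  It is lowest for
    gl_n.  The lowest matrices are exactly the tableaux, with the columns from right to
    left written as rows (lowestP, lowest_tabmat): the signature condition for F_l says
    that adjacent columns of the tableau are weakly increasing along the rows.  All lowest
    matrices with the same row sums are connected by gl_infinity (lowest_conn), because,
    raised as far as possible in a window of columns, they become the same diagram
    (lowest_justified); and every matrix can be lowered to one of them.  This gives the
    component of a tableau, and the separation of the different mu.

    The component for gl_n consists of the matrices in a window of columns that are
    highest for the row operators of the window and have the column sums of the diagram.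
    It has to be identified with the given crystal base of an irreducible module V, about
    which only the definition is known.  The functions on the boxes of bits are the tensor
    product of the exterior algebras of the columns, a module over the quantum gl_n; and
    the quantum group of the row operators, with the parameter - q, commutes with it
    (qcross, skew Howe duality).  V embeds into the functions killed by the row operators,
    with its highest weight vector mapped to the indicator function of the diagram
    (intertwiner_exists).  This uses that a regular function killed by the row operators
    lives at q = 0 on boxes highest for them, and that the only such box which is highest
    for gl_n too is the diagram.

    To compare the crystal lattice of V with the functions regular at q = 0, the linear
    forms gam are used: they are congruent at q = 0 to the values of a function, and in
    these coordinates e, f and Kashiwara's operators are the crystal operators of boxes up
    to q-integers (gam_qe, gam_qf, gam_string_e).  By induction from the highest weight the
    lattice is the lattice of the vectors with regular values, and each element of the
    crystal becomes at q = 0 the indicator function of one box (lattice_crystal). *)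

Set Implicit Arguments.
Unset Strict Implicit.
Unset Printing Implicit Defensive.

Import Order.TTheory GRing.Theory Num.Theory.

(** * Signatures and chains of sites *)

Section Signature.
Variables (I : eqType) (u d : I -> bool).

(** The tensor product rule for a sequence of sites on each of which strings have
    length at most one: f can act at the site i when u i holds, and e when d i
    does.  sg_eps and sg_phi give the lengths of the strings, sg_e and sg_f the
    site at which e and f act. *)
Fixpoint sg_eps (J : seq I) : nat :=
  if J is i :: J' then d i + (sg_eps J' - u i) else 0.

Fixpoint sg_phi (J : seq I) : nat :=
  if J is i :: J' then sg_phi J' + (u i - sg_eps J') else 0.

Fixpoint sg_e (J : seq I) : option I :=
  if J is i :: J' then
    if sg_eps J' <= u i then (if d i then Some i else None) else sg_e J'
  else None.

Fixpoint sg_f (J : seq I) : option I :=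
  if J is i :: J' then
    if sg_eps J' < u i then (if u i then Some i else None) else sg_f J'
  else None.

Lemma sg_phi_eps J : sg_phi J + count d J = sg_eps J + count u J.
Proof. by elim: J => //= i J IH; lia. Qed.

Lemma sg_eps_cat J1 J2 :
  sg_eps (J1 ++ J2) = sg_eps J1 + (sg_eps J2 - sg_phi J1).
Proof. by elim: J1 => [|i J1 IH] /=; rewrite ?subn0 // IH; lia. Qed.

Lemma sg_phi_cat J1 J2 :
  sg_phi (J1 ++ J2) = sg_phi J2 + (sg_phi J1 - sg_eps J2).
Proof. by elim: J1 => [|i J1 IH] /=; rewrite ?addn0 // IH sg_eps_cat; lia. Qed.

Hypothesis ud : forall i, ~~ (u i && d i).

Lemma sg_eN J : (sg_e J == None) = (sg_eps J == 0).
Proof.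
elim: J => //= i J IH; have := ud i.
case: ifP => H; last by rewrite IH; case: (d i) => /=; case: (u i) H => //=; lia.
by case: (d i); case: (u i) H => //= H _; rewrite ?add0n ?subn_eq0 ?H // addn_eq0 andbC; case: (sg_eps J) H.
Qed.

Lemma sg_fN J : (sg_f J == None) = (sg_phi J == 0).
Proof.
elim: J => //= i J IH; have := ud i.
case: ifP => H; last by rewrite IH; case: (d i) => /=; case: (u i) H => //=; lia.
by case: (d i); case: (u i) H => //= H _; rewrite ?add0n ?subn_eq0 ?H // addn_eq0 andbC; case: (sg_eps J) H.
Qed.

Lemma sg_f_cat J1 J2 :
  sg_f (J1 ++ J2) = if sg_eps J2 < sg_phi J1 then sg_f J1 else sg_f J2.
Proof.
elim: J1 => //= i J1 IH; have := ud i; rewrite sg_eps_cat IH.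
case: (u i) => /= ud'; case: ifP => H1.
- by rewrite !ifT //; lia.
- case: ifP => H2; [rewrite ifT ?ifF //; lia | rewrite ifF //; lia].
- by rewrite ifT //; lia.
- by rewrite ifF //; lia.
Qed.

Lemma sg_e_mem J i : sg_e J = Some i -> (i \in J) && d i.
Proof.
elim: J => //= j J IH; case: ifP => _; last by move=> /IH /andP[h ->]; rewrite inE h orbT.
by case: ifP => // dj [<-]; rewrite inE eqxx.
Qed.

Lemma sg_f_mem J i : sg_f J = Some i -> (i \in J) && u i.
Proof.
elim: J => //= j J IH; case: ifP => _; last by move=> /IH /andP[h ->]; rewrite inE h orbT.
by case: ifP => // dj [<-]; rewrite inE eqxx.
Qed.

(** The lattice word condition: e vanishes only if no prefix has more sites for e
    than for f; for f, the same with suffixes. *)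
Lemma sg_eps0_count J1 J2 : sg_eps (J1 ++ J2) = 0 -> count d J1 <= count u J1.
Proof. by rewrite sg_eps_cat; have := sg_phi_eps J1; lia. Qed.

Lemma sg_phi0_count J1 J2 : sg_phi (J1 ++ J2) = 0 -> count u J2 <= count d J2.
Proof. by rewrite sg_phi_cat; have := sg_phi_eps J2; lia. Qed.

Lemma sg_phi0 J : (forall n, count u (drop n J) <= count d (drop n J)) ->
  sg_phi J = 0.
Proof.
elim: J => //= i J IH H.
have pJ : sg_phi J = 0 by apply: IH => n; have := H n.+1.
have := H 0; have := sg_phi_eps J; have := ud i; rewrite pJ /=.
by case: (u i); case: (d i) => //=; lia.
Qed.

End Signature.

Lemma eq_sg (I : eqType) (u d u' d' : I -> bool) J :
  {in J, u =1 u'} -> {in J, d =1 d'} ->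
  [/\ sg_eps u d J = sg_eps u' d' J, sg_phi u d J = sg_phi u' d' J,
      sg_e u d J = sg_e u' d' J & sg_f u d J = sg_f u' d' J].
Proof.
elim: J => //= i J IH Hu Hd.
have [||-> -> -> ->] := IH.
- by move=> j jJ; apply: Hu; rewrite inE jJ orbT.
- by move=> j jJ; apply: Hd; rewrite inE jJ orbT.
by rewrite Hu ?Hd ?inE ?eqxx.
Qed.

Lemma sg_map (I I' : eqType) (g : I' -> I) (u d : I -> bool) J :
  [/\ sg_eps u d (map g J) = sg_eps (u \o g) (d \o g) J,
      sg_phi u d (map g J) = sg_phi (u \o g) (d \o g) J,
      sg_e u d (map g J) = omap g (sg_e (u \o g) (d \o g) J) &
      sg_f u d (map g J) = omap g (sg_f (u \o g) (d \o g) J)].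
Proof.
elim: J => //= i J [-> -> -> ->]; split=> //; by do 2?case: ifP.
Qed.

(** Relates the sequence of the nonzero columns of a matrix to a fixed sequence of
    columns that contains it. *)
Lemma sg_filter (I : eqType) (u d : I -> bool) (P : pred I) J :
  (forall i, ~~ (u i && d i)) ->
  (forall i, i \in J -> ~~ P i -> ~~ u i && ~~ d i) ->
  [/\ sg_eps u d (filter P J) = sg_eps u d J,
      sg_phi u d (filter P J) = sg_phi u d J,
      sg_e u d (filter P J) = sg_e u d J &
      sg_f u d (filter P J) = sg_f u d J].
Proof.
move=> ud; elim: J => //= i J IH H.
have [|h1 h2 h3 h4] := IH; first by move=> j jJ; apply: H; rewrite inE jJ orbT.
case: ifP => Pi /=; first by rewrite h1 h2 h3 h4.
have /andP[/negbTE ui /negbTE di] : ~~ u i && ~~ d i by apply: H; rewrite ?inE ?eqxx ?Pi.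
rewrite ui di h1 h2 h3 h4; split; rewrite ?subn0 ?sub0n ?addn0 //.
by case: ifP => // H0; apply/eqP; rewrite sg_eN //; lia.
Qed.

Section Chain.
Variables (T : Type) (I : eqType) (sw : I -> T -> T) (up dn : I -> T -> bool).

(** States T in which the sites act by commuting involutions: sw i turns a state in
    which f can act at i into one in which e can, and both e and f at i are sw i.
    The other sites do not notice it. *)
Record chain : Prop := {
  ch_ud : forall t i, ~~ (up i t && dn i t);
  ch_up : forall i t, up i (sw i t) = dn i t;
  ch_dn : forall i t, dn i (sw i t) = up i t;
  ch_swK : forall i, involutive (sw i);
  ch_upN : forall i j t, i != j -> up i (sw j t) = up i t;
  ch_dnN : forall i j t, i != j -> dn i (sw j t) = dn i t;
  ch_swC : forall i j t, sw i (sw j t) = sw j (sw i t) }.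

Definition ch_eps J t := sg_eps (up^~ t) (dn^~ t) J.
Definition ch_phi J t := sg_phi (up^~ t) (dn^~ t) J.
Definition ch_e J t := omap (sw^~ t) (sg_e (up^~ t) (dn^~ t) J).
Definition ch_f J t := omap (sw^~ t) (sg_f (up^~ t) (dn^~ t) J).

Hypothesis ch : chain.

Lemma sg_swN J i t : i \notin J ->
  [/\ ch_eps J (sw i t) = ch_eps J t, ch_phi J (sw i t) = ch_phi J t,
   sg_e (up^~ (sw i t)) (dn^~ (sw i t)) J = sg_e (up^~ t) (dn^~ t) J &
   sg_f (up^~ (sw i t)) (dn^~ (sw i t)) J = sg_f (up^~ t) (dn^~ t) J].
Proof.
move=> iJ; apply: eq_sg => j jJ; have ji : j != i by apply: contraNneq iJ => <-.
  by rewrite (ch_upN ch).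
by rewrite (ch_dnN ch).
Qed.

Lemma sg_f_sw J t i : uniq J -> sg_f (up^~ t) (dn^~ t) J = Some i ->
  [/\ sg_e (up^~ (sw i t)) (dn^~ (sw i t)) J = Some i,
    ch_eps J (sw i t) = (ch_eps J t).+1 &
    ch_phi J t = (ch_phi J (sw i t)).+1].
Proof.
rewrite /ch_eps /ch_phi; elim: J => //= j J IH /andP[jJ uJ].
have := ch_ud ch t j; case: ifP => H.
  case: ifP => // uj ud [<-]; have [] := sg_swN t jJ; rewrite /ch_eps /ch_phi => -> -> _ _.
  rewrite /= ?(ch_up ch) ?(ch_dn ch) uj; move: H ud; rewrite uj; case: (dn j t) => //=.
  by split => //; [rewrite ifT //| |]; lia.
move=> ud Hi; have /andP[iJ ui] := sg_f_mem Hi.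
have ji : j != i by apply: contraNneq jJ => ->.
have [h1 h2 h3] := IH uJ Hi; rewrite h1 h2 h3 (ch_upN ch) ?(ch_dnN ch) //.
split; [rewrite ifF //| |]; lia.
Qed.

Lemma sg_e_sw J t i : uniq J -> sg_e (up^~ t) (dn^~ t) J = Some i ->
  [/\ sg_f (up^~ (sw i t)) (dn^~ (sw i t)) J = Some i,
    ch_phi J (sw i t) = (ch_phi J t).+1 &
    ch_eps J t = (ch_eps J (sw i t)).+1].
Proof.
rewrite /ch_eps /ch_phi; elim: J => //= j J IH /andP[jJ uJ].
have := ch_ud ch t j; case: ifP => H.
  case: ifP => // uj ud [<-]; have [] := sg_swN t jJ; rewrite /ch_eps /ch_phi => -> -> _ _.
  rewrite /= ?(ch_up ch) ?(ch_dn ch) uj; move: H ud; rewrite andbT; case: (up j t) => //= H _.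
  by split => //; [rewrite ifT //| |]; lia.
move=> ud Hi; have /andP[iJ ui] := sg_e_mem Hi.
have ji : j != i by apply: contraNneq jJ => ->.
have [h1 h2 h3] := IH uJ Hi; rewrite h1 h2 h3 (ch_upN ch) ?(ch_dnN ch) //.
split; [rewrite ifF //| |]; lia.
Qed.

Variable J : seq I.
Hypothesis uJ : uniq J.

Lemma ch_fP t t' : ch_f J t = Some t' ->
  [/\ ch_e J t' = Some t, ch_eps J t' = (ch_eps J t).+1
    & ch_phi J t = (ch_phi J t').+1].
Proof.
rewrite /ch_f /ch_e; case E: (sg_f _ _ _) => [i|] //= [<-].
have [-> -> ->] := sg_f_sw uJ E; by rewrite /= (ch_swK ch).
Qed.

Lemma ch_eP t t' : ch_e J t = Some t' ->
  [/\ ch_f J t' = Some t, ch_phi J t' = (ch_phi J t).+1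
    & ch_eps J t = (ch_eps J t').+1].
Proof.
rewrite /ch_f /ch_e; case E: (sg_e _ _ _) => [i|] //= [<-].
have [-> -> ->] := sg_e_sw uJ E; by rewrite /= (ch_swK ch).
Qed.

Lemma ch_efP t t' : ch_f J t = Some t' <-> ch_e J t' = Some t.
Proof. by split=> [/ch_fP[]|/ch_eP[]]. Qed.

Lemma ch_eN t : ch_e J t = None <-> ch_eps J t = 0.
Proof.
have := sg_eN (ch_ud ch t) J; rewrite /ch_e /ch_eps.
by case: (sg_e _ _ _) => [i|] /= /esym; [move/negbT/eqP => H; split|move/eqP].
Qed.

Lemma ch_fN t : ch_f J t = None <-> ch_phi J t = 0.
Proof.
have := sg_fN (ch_ud ch t) J; rewrite /ch_f /ch_phi.
by case: (sg_f _ _ _) => [i|] /= /esym; [move/negbT/eqP => H; split|move/eqP].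
Qed.

End Chain.

(** * Commutation of row and column operators *)

(** Arrays of bits, through reading and writing an entry; only these two laws enter
    the commutation of the operators. *)
Record grid (T : Type) (A : eqType) (get : T -> A -> bool) (put : A -> bool -> T -> T) : Prop := {
  gr_inj : forall t t', get t =1 get t' -> t = t';
  gr_put : forall a v t x, get (put a v t) x = if x == a then v else get t x }.

Section Grid.
Variables (T : Type) (A : eqType) (get : T -> A -> bool) (put : A -> bool -> T -> T).
Hypothesis gr : grid get put.

Definition swp (a b : A) (t : T) : T := put a (get t b) (put b (get t a) t).
Definition grid_up a b t := get t a && ~~ get t b.
Definition grid_dn a b t := ~~ get t a && get t b.

Lemma swpE a b t x : get (swp a b t) x =
  if x == a then get t b else if x == b then get t a else get t x.
Proof. by rewrite /swp !(gr_put gr). Qed.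

Lemma swp_l a b t : get (swp a b t) a = get t b.
Proof. by rewrite swpE eqxx. Qed.
Lemma swp_r a b t : get (swp a b t) b = get t a.
Proof. by rewrite swpE eqxx; case: eqP => [->|]. Qed.
Lemma swpN a b t x : x != a -> x != b -> get (swp a b t) x = get t x.
Proof. by rewrite swpE => /negbTE -> /negbTE ->. Qed.

Lemma swpC a b a' b' t : a != a' -> a != b' -> b != a' -> b != b' ->
  swp a b (swp a' b' t) = swp a' b' (swp a b t).
Proof.
move=> h1 h2 h3 h4; apply: (gr_inj gr) => x; rewrite !swpE.
have [->|xa] := eqVneq x a.
  by rewrite (negbTE h1) (negbTE h2) (negbTE h3) (negbTE h4).
have [->|xb] := eqVneq x b.
  by rewrite (negbTE h1) (negbTE h2) (negbTE h3) (negbTE h4).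
rewrite ![a' == _]eq_sym ![b' == _]eq_sym (negbTE h1) (negbTE h2) (negbTE h3) (negbTE h4).
by case: eqP => // _; case: eqP => // _; rewrite (negbTE xa) (negbTE xb).
Qed.

Lemma grid_chain (I : eqType) (c1 c2 : I -> A) : injective c1 -> injective c2 ->
  (forall i j, c1 i != c2 j) ->
  chain (fun i => swp (c1 i) (c2 i)) (fun i => grid_up (c1 i) (c2 i)) (fun i => grid_dn (c1 i) (c2 i)).
Proof.
move=> i1 i2 i12; have i21 i j : c2 i != c1 j by rewrite eq_sym.
have E1 i j : i != j -> c1 i != c1 j by apply: contra_neq => /i1.
have E2 i j : i != j -> c2 i != c2 j by apply: contra_neq => /i2.
split=> [t i|i t|i t|i t|i j t ij|i j t ij|i j t].
- by rewrite /grid_up /grid_dn; case: (get t _); case: (get t _).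
- by rewrite /grid_up /grid_dn swp_l swp_r andbC.
- by rewrite /grid_up /grid_dn swp_l swp_r andbC.
- apply: (gr_inj gr) => x; rewrite swpE; case: eqVneq => [->|xa]; first by rewrite swp_r.
  by case: eqVneq => [->|xb]; rewrite ?swp_l ?swpN.
- by rewrite /grid_up !swpN ?E1 ?E2.
- by rewrite /grid_dn !swpN ?E1 ?E2.
- by have [->//|ij] := eqVneq i j; rewrite swpC ?E1 ?E2.
Qed.
End Grid.

Section Block.
Variables (I : eqType) (u d u' d' : I -> bool) (J1 M J2 : seq I).
Hypothesis ud : forall i, ~~ (u i && d i).
Hypothesis ud' : forall i, ~~ (u' i && d' i).
Hypothesis uE : forall i, i \notin M -> u i = u' i.
Hypothesis dE : forall i, i \notin M -> d i = d' i.
Hypothesis JM : uniq (J1 ++ M ++ J2).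
Hypothesis eM : sg_eps u d M = sg_eps u' d' M.
Hypothesis fM : sg_phi u d M = sg_phi u' d' M.

(** The tensor product rule sees of a block M only eps and phi.  So, when the signs
    change inside M without changing these two numbers, f acts before and after at
    the same site outside M, or both times inside M. *)
Lemma block_sg :
  [/\ sg_eps u d (J1 ++ M ++ J2) = sg_eps u' d' (J1 ++ M ++ J2),
      sg_phi u d (J1 ++ M ++ J2) = sg_phi u' d' (J1 ++ M ++ J2) &
      (sg_f u d (J1 ++ M ++ J2) = sg_f u' d' (J1 ++ M ++ J2) /\
       forall i, sg_f u d (J1 ++ M ++ J2) = Some i -> i \notin M)
   \/ (sg_f u d (J1 ++ M ++ J2) = sg_f u d M /\ sg_f u' d' (J1 ++ M ++ J2) = sg_f u' d' M)].
Proof.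
move: JM; rewrite !cat_uniq => /and3P[_ /hasPn h1 /and3P[_ /hasPn h2 _]].
have N1 i : i \in J1 -> i \notin M.
  by apply: contraL => iM; apply: h1; rewrite mem_cat iM.
have N2 i : i \in J2 -> i \notin M by exact: h2.
have [||e1 f1 _ s1] := @eq_sg I u d u' d' J1; [by move=> i /N1/uE|by move=> i /N1/dE|].
have [||e2 f2 _ s2] := @eq_sg I u d u' d' J2; [by move=> i /N2/uE|by move=> i /N2/dE|].
rewrite !sg_eps_cat !sg_phi_cat !sg_f_cat // !sg_eps_cat e1 f1 e2 f2 eM fM; split=> //.
have S1 i : sg_f u' d' J1 = Some i -> i \notin M by move=> /sg_f_mem/andP[/N1].
have S2 i : sg_f u' d' J2 = Some i -> i \notin M by move=> /sg_f_mem/andP[/N2].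
by case: ifP => h; rewrite ?s1; [left|case: ifP => h'; rewrite ?s2; [right|left]].
Qed.
End Block.

(** Two adjacent rows and two adjacent columns meet in four entries, a and b above
    c and d.  The rows exchange a with b and c with d, the columns a with c and b
    with d; the statements about these bits are checked on the 16 cases. *)
Section Block22.
Variables (T : Type) (A : eqType) (get : T -> A -> bool) (put : A -> bool -> T -> T).
Hypothesis gr : grid get put.
Variables (a b c d : A).
Hypothesis abcd : uniq [:: a; b; c; d].
Local Notation swp := (swp get put).
Local Notation gup := (grid_up get).
Local Notation gdn := (grid_dn get).

Definition put4 (t : T) (v1 v2 v3 v4 : bool) : T :=
  put a v1 (put b v2 (put c v3 (put d v4 t))).

Lemma put4E t : t = put4 t (get t a) (get t b) (get t c) (get t d).
Proof.
apply: (gr_inj gr) => x; rewrite /put4 !(gr_put gr).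
by do 4?[case: eqVneq => [->//|_]].
Qed.

Lemma get4 t v1 v2 v3 v4 :
  [/\ get (put4 t v1 v2 v3 v4) a = v1, get (put4 t v1 v2 v3 v4) b = v2,
      get (put4 t v1 v2 v3 v4) c = v3 & get (put4 t v1 v2 v3 v4) d = v4].
Proof.
move: abcd; rewrite /= !inE !negb_or => /and4P[/and3P[h1 h2 h3] /andP[h4 h5] h6 _].
rewrite /put4 !(gr_put gr) !eqxx.
by rewrite ![b == _]eq_sym ![c == _]eq_sym ![d == _]eq_sym !(negbTE h1, negbTE h2, negbTE h3, negbTE h4, negbTE h5, negbTE h6).
Qed.

Lemma swp4 t v1 v2 v3 v4 :
  [/\ swp a b (put4 t v1 v2 v3 v4) = put4 t v2 v1 v3 v4,
      swp c d (put4 t v1 v2 v3 v4) = put4 t v1 v2 v4 v3,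
      swp a c (put4 t v1 v2 v3 v4) = put4 t v3 v2 v1 v4 &
      swp b d (put4 t v1 v2 v3 v4) = put4 t v1 v4 v3 v2].
Proof.
have [ga gb gc gd] := get4 t v1 v2 v3 v4.
move: abcd; rewrite /= !inE !negb_or => /and4P[/and3P[h1 h2 h3] /andP[h4 h5] h6 _].
by split; apply: (gr_inj gr) => x; rewrite (swpE gr) ?ga ?gb ?gc ?gd /put4 !(gr_put gr);
  case: (eqVneq x a) => [xa|xa]; rewrite ?xa ?(negbTE h1) ?(negbTE h2) ?(negbTE h3) ?eqxx //;
  case: (eqVneq x b) => [xb|xb]; rewrite ?xb ?(negbTE h4) ?(negbTE h5) ?eqxx //;
  case: (eqVneq x c) => [xc|xc]; rewrite ?xc ?(negbTE h6) ?eqxx //;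
  case: (eqVneq x d) => [xd|xd].
Qed.

(* The columns are read from right to left: k' comes before k. *)
Variables (Ic Ir : eqType) (k k' : Ic) (lo hi : Ir).
Variables (swc : Ic -> T -> T) (upc dnc : Ic -> T -> bool).
Variables (swr : Ir -> T -> T) (upr dnr : Ir -> T -> bool).
Hypothesis sck : swc k = swp a c. Hypothesis sck' : swc k' = swp b d.
Hypothesis uck : upc k = gup a c. Hypothesis uck' : upc k' = gup b d.
Hypothesis dck : dnc k = gdn a c. Hypothesis dck' : dnc k' = gdn b d.
Hypothesis srl : swr lo = swp a b. Hypothesis srh : swr hi = swp c d.
Hypothesis url : upr lo = gup a b. Hypothesis urh : upr hi = gup c d.
Hypothesis drl : dnr lo = gdn a b. Hypothesis drh : dnr hi = gdn c d.
Local Notation fc := (ch_f swc upc dnc [:: k'; k]).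
Local Notation fr := (ch_f swr upr dnr [:: lo; hi]).

Lemma fc_put4 t v1 v2 v3 v4 : fc (put4 t v1 v2 v3 v4) =
  if [&& v2, ~~ v4 & ~~ (~~ v1 && v3)] then Some (put4 t v1 v4 v3 v2)
  else if v1 && ~~ v3 then Some (put4 t v3 v2 v1 v4) else None.
Proof.
have [s1 s2 s3 s4] := swp4 t v1 v2 v3 v4; have [ga gb gc gd] := get4 t v1 v2 v3 v4.
rewrite /ch_f /= !(uck, uck', dck, dck') /grid_up /grid_dn ga gb gc gd.
by case: v1 v2 v3 v4 s3 s4 {s1 s2 ga gb gc gd} => -[] [] [] s3 s4 //=; rewrite ?sck ?sck' ?s3 ?s4.
Qed.

Lemma fr_put4 t v1 v2 v3 v4 : fr (put4 t v1 v2 v3 v4) =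
  if [&& v1, ~~ v2 & ~~ (~~ v3 && v4)] then Some (put4 t v2 v1 v3 v4)
  else if v3 && ~~ v4 then Some (put4 t v1 v2 v4 v3) else None.
Proof.
have [s1 s2 s3 s4] := swp4 t v1 v2 v3 v4; have [ga gb gc gd] := get4 t v1 v2 v3 v4.
rewrite /ch_f /= !(url, urh, drl, drh) /grid_up /grid_dn ga gb gc gd.
by case: v1 v2 v3 v4 s1 s2 {s3 s4 ga gb gc gd} => -[] [] [] s1 s2 //=; rewrite ?srl ?srh ?s1 ?s2.
Qed.

Lemma mid_ff t : obind fr (fc t) = obind fc (fr t).
Proof.
rewrite [t]put4E; move: (get t a) (get t b) (get t c) (get t d) => v1 v2 v3 v4.
by rewrite fc_put4 fr_put4; case: v1 v2 v3 v4 => -[] [] [] /=; rewrite ?fc_put4 ?fr_put4.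
Qed.

Lemma mid_fc t t' : fc t = Some t' ->
  ch_eps upr dnr [:: lo; hi] t' = ch_eps upr dnr [:: lo; hi] t /\
  ch_phi upr dnr [:: lo; hi] t' = ch_phi upr dnr [:: lo; hi] t.
Proof.
rewrite [t]put4E; move: (get t a) (get t b) (get t c) (get t d) => v1 v2 v3 v4.
rewrite fc_put4 /ch_eps /ch_phi /= !(url, urh, drl, drh) /grid_up /grid_dn.
have G := get4 t; case: v1 v2 v3 v4 => -[] [] [] //= -[<-];
 by rewrite !(fun v1 v2 v3 v4 => let: And4 h _ _ _ := G v1 v2 v3 v4 in h,
  fun v1 v2 v3 v4 => let: And4 _ h _ _ := G v1 v2 v3 v4 in h,
  fun v1 v2 v3 v4 => let: And4 _ _ h _ := G v1 v2 v3 v4 in h,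
  fun v1 v2 v3 v4 => let: And4 _ _ _ h := G v1 v2 v3 v4 in h).
Qed.

Lemma mid_fr t t' : fr t = Some t' ->
  ch_eps upc dnc [:: k'; k] t' = ch_eps upc dnc [:: k'; k] t /\
  ch_phi upc dnc [:: k'; k] t' = ch_phi upc dnc [:: k'; k] t.
Proof.
rewrite [t]put4E; move: (get t a) (get t b) (get t c) (get t d) => v1 v2 v3 v4.
rewrite fr_put4 /ch_eps /ch_phi /= !(uck, uck', dck, dck') /grid_up /grid_dn.
have G := get4 t; case: v1 v2 v3 v4 => -[] [] [] //= -[<-];
 by rewrite !(fun v1 v2 v3 v4 => let: And4 h _ _ _ := G v1 v2 v3 v4 in h,
  fun v1 v2 v3 v4 => let: And4 _ h _ _ := G v1 v2 v3 v4 in h,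
  fun v1 v2 v3 v4 => let: And4 _ _ h _ := G v1 v2 v3 v4 in h,
  fun v1 v2 v3 v4 => let: And4 _ _ _ h := G v1 v2 v3 v4 in h).
Qed.
End Block22.

Lemma sg_f_mid (I : eqType) (u d : I -> bool) (J1 M J2 : seq I) j :
  (forall i, ~~ (u i && d i)) -> uniq (J1 ++ M ++ J2) -> j \in M ->
  sg_f u d (J1 ++ M ++ J2) = Some j -> sg_f u d M = Some j.
Proof.
move=> ud; rewrite !cat_uniq => /and3P[_ /hasPn h1 /and3P[_ /hasPn h2 _]] jM.
rewrite !sg_f_cat //; case: ifP => _.
  by move=> /sg_f_mem/andP[j1 _]; have := h1 j; rewrite mem_cat jM j1 => /(_ isT).
case: ifP => // _ /sg_f_mem/andP[j2 _]; have := h2 j j2; by rewrite jM.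
Qed.

Section Cross.
Variables (T : Type) (Ic Ir : eqType).
Variables (swc : Ic -> T -> T) (upc dnc : Ic -> T -> bool).
Variables (swr : Ir -> T -> T) (upr dnr : Ir -> T -> bool).
Variables (J1 Mc J2 : seq Ic) (R1 Mr R2 : seq Ir).
Local Notation J := (J1 ++ Mc ++ J2).
Local Notation R := (R1 ++ Mr ++ R2).

(** Operators that exchange two adjacent rows have the columns as sites (swc), those
    that exchange two adjacent columns have the rows as sites (swr).  They interact
    only where the two columns, the block Mc, meet the two rows, the block Mr. *)
Record cross : Prop := {
  cr_c : chain swc upc dnc;
  cr_r : chain swr upr dnr;
  cr_J : uniq J;
  cr_R : uniq R;
  cr_far : forall i j t, (j \notin Mc) || (i \notin Mr) ->
    [/\ upr i (swc j t) = upr i t, dnr i (swc j t) = dnr i t,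
        upc j (swr i t) = upc j t, dnc j (swr i t) = dnc j t &
        swc j (swr i t) = swr i (swc j t)];
  cr_fc : forall t t', ch_f swc upc dnc Mc t = Some t' ->
    ch_eps upr dnr Mr t' = ch_eps upr dnr Mr t /\ ch_phi upr dnr Mr t' = ch_phi upr dnr Mr t;
  cr_fr : forall t t', ch_f swr upr dnr Mr t = Some t' ->
    ch_eps upc dnc Mc t' = ch_eps upc dnc Mc t /\ ch_phi upc dnc Mc t' = ch_phi upc dnc Mc t;
  cr_ff : forall t, obind (ch_f swr upr dnr Mr) (ch_f swc upc dnc Mc t) =
     obind (ch_f swc upc dnc Mc) (ch_f swr upr dnr Mr t) }.
End Cross.

Lemma cross_sym T Ic Ir swc upc dnc swr upr dnr J1 Mc J2 R1 Mr R2 :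
  @cross T Ic Ir swc upc dnc swr upr dnr J1 Mc J2 R1 Mr R2 ->
  @cross T Ir Ic swr upr dnr swc upc dnc R1 Mr R2 J1 Mc J2.
Proof.
case=> *; split=> // i j t; rewrite orbC => h.
by have [] : [/\ upr j (swc i t) = upr j t, dnr j (swc i t) = dnr j t,
        upc i (swr j t) = upc i t, dnc i (swr j t) = dnc i t &
        swc i (swr j t) = swr j (swc i t)] by auto.
Qed.

Section CrossTheory.
Variables (T : Type) (Ic Ir : eqType).
Variables (swc : Ic -> T -> T) (upc dnc : Ic -> T -> bool).
Variables (swr : Ir -> T -> T) (upr dnr : Ir -> T -> bool).
Variables (J1 Mc J2 : seq Ic) (R1 Mr R2 : seq Ir).
Local Notation J := (J1 ++ Mc ++ J2).
Local Notation R := (R1 ++ Mr ++ R2).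
Hypothesis cr : cross swc upc dnc swr upr dnr J1 Mc J2 R1 Mr R2.

(** A step at a site outside Mc changes no sign of the other family, and a step
    inside Mc is a step of f on Mc alone, to which cr_fc applies. *)
Lemma cross_block t j : sg_f (upc^~ t) (dnc^~ t) J = Some j ->
  [/\ forall i, i \notin Mr -> upr i t = upr i (swc j t),
      forall i, i \notin Mr -> dnr i t = dnr i (swc j t),
      sg_eps (upr^~ t) (dnr^~ t) Mr = sg_eps (upr^~ (swc j t)) (dnr^~ (swc j t)) Mr &
      sg_phi (upr^~ t) (dnr^~ t) Mr = sg_phi (upr^~ (swc j t)) (dnr^~ (swc j t)) Mr].
Proof.
move=> Ej; have [jM|jM] := boolP (j \in Mc); last first.
  have far i := cr_far cr t (introT (@orP (j \notin Mc) (i \notin Mr)) (or_introl jM)).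
  split=> [i _|i _||]; try by have [] := far i.
    by have [] := @eq_sg _ (upr^~ t) (dnr^~ t) (upr^~ (swc j t)) (dnr^~ (swc j t)) Mr;
      move=> // i _; have [] := far i.
  by have [] := @eq_sg _ (upr^~ t) (dnr^~ t) (upr^~ (swc j t)) (dnr^~ (swc j t)) Mr;
    move=> // i _; have [] := far i.
have Em := sg_f_mid (ch_ud (cr_c cr) t) (cr_J cr) jM Ej.
have fm : ch_f swc upc dnc Mc t = Some (swc j t) by rewrite /ch_f Em.
have := cr_fc cr fm; rewrite /ch_eps /ch_phi => -[-> ->].
by split=> // i iM; have [|] := @cr_far _ _ _ _ _ _ _ _ _ _ _ _ _ _ _ cr i j t; rewrite ?iM ?orbT.
Qed.

Lemma cross_fc t t' : ch_f swc upc dnc J t = Some t' ->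
  ch_eps upr dnr R t' = ch_eps upr dnr R t /\ ch_phi upr dnr R t' = ch_phi upr dnr R t.
Proof.
rewrite {1}/ch_f; case Ej: (sg_f _ _ _) => [j|] //= [<-].
have [h1 h2 h3 h4] := cross_block Ej.
rewrite /ch_eps /ch_phi.
by have [-> -> _] := block_sg (ch_ud (cr_r cr) t) (ch_ud (cr_r cr) (swc j t)) h1 h2 (cr_R cr) h3 h4.
Qed.
End CrossTheory.

Section CrossComm.
Variables (T : Type) (Ic Ir : eqType).
Variables (swc : Ic -> T -> T) (upc dnc : Ic -> T -> bool).
Variables (swr : Ir -> T -> T) (upr dnr : Ir -> T -> bool).
Variables (J1 Mc J2 : seq Ic) (R1 Mr R2 : seq Ir).
Local Notation J := (J1 ++ Mc ++ J2).
Local Notation R := (R1 ++ Mr ++ R2).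
Hypothesis cr : cross swc upc dnc swr upr dnr J1 Mc J2 R1 Mr R2.
Let rc := cross_sym cr.
Local Notation fC := (ch_f swc upc dnc J).
Local Notation eC := (ch_e swc upc dnc J).
Local Notation fR := (ch_f swr upr dnr R).
Local Notation eR := (ch_e swr upr dnr R).

(** Let the two operators act at the sites j and i.  If j is not in Mc, or i not in
    Mr, the site of the other operator stays the same after each step, and the
    exchanges at j and i commute; otherwise this is cr_ff. *)
Lemma cross_ff t : obind fR (fC t) = obind fC (fR t).
Proof.
case Ec: (fC t) => [t1|]; last first.
  case Er: (fR t) => [t2|] //=; apply/esym/(ch_fN (cr_c cr)).
  by have [_ ->] := cross_fc rc Er; apply/(ch_fN (cr_c cr)).
case Er: (fR t) => [t2|]; last first.
  by apply/(ch_fN (cr_r cr)); have [_ ->] := cross_fc cr Ec; apply/(ch_fN (cr_r cr)).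
move: Ec Er; rewrite /ch_f.
case Ej: (sg_f (upc^~ t) _ _) => [j|] //= [<-]; case Ei: (sg_f (upr^~ t) _ _) => [i|] //= [<-].
have [h1 h2 h3 h4] := cross_block cr Ej; have [g1 g2 g3 g4] := cross_block rc Ei.
have [_ _ Br] := block_sg (ch_ud (cr_r cr) t) (ch_ud (cr_r cr) (swc j t)) h1 h2 (cr_R cr) h3 h4.
have [_ _ Bc] := block_sg (ch_ud (cr_c cr) t) (ch_ud (cr_c cr) (swr i t)) g1 g2 (cr_J cr) g3 g4.
have far := @cr_far _ _ _ _ _ _ _ _ _ _ _ _ _ _ _ cr i j t.
have [jM|jM] := boolP (j \in Mc); last first.
  have [_ _ _ _ sC] := far (introT orP (or_introl jM)).
  have Ei' : sg_f (upr^~ (swc j t)) (dnr^~ (swc j t)) R = Some i.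
    rewrite -Ei; have [] // := @eq_sg _ (upr^~ (swc j t)) (dnr^~ (swc j t)) (upr^~ t) (dnr^~ t) R;
    by move=> i' _; have [] := @cr_far _ _ _ _ _ _ _ _ _ _ _ _ _ _ _ cr i' j t; rewrite ?jM.
  rewrite Ei' /=; case: Bc => [[<- _]|[E _]]; first by rewrite Ej /= sC.
  by move: jM; rewrite E in Ej; have /andP[->] := sg_f_mem Ej.
have [iM|iM] := boolP (i \in Mr); last first.
  have [_ _ _ _ sC] := far (introT orP (or_intror iM)).
  have Ej' : sg_f (upc^~ (swr i t)) (dnc^~ (swr i t)) J = Some j.
    rewrite -Ej; have [] // := @eq_sg _ (upc^~ (swr i t)) (dnc^~ (swr i t)) (upc^~ t) (dnc^~ t) J;
    by move=> j' _; have [] := @cr_far _ _ _ _ _ _ _ _ _ _ _ _ _ _ _ cr i j' t; rewrite ?iM ?orbT.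
  rewrite Ej' /=; case: Br => [[<- _]|[E _]]; first by rewrite Ei /= sC.
  by move: iM; rewrite E in Ei; have /andP[->] := sg_f_mem Ei.
case: Bc => [[_ /(_ _ Ej)]|[Ejm ->]]; first by rewrite jM.
case: Br => [[_ /(_ _ Ei)]|[Eim ->]]; first by rewrite iM.
have := cr_ff cr t; rewrite /ch_f -Ejm Ej -Eim Ei /=.
by [].
Qed.

Lemma cross_inv_fc t t' : fC t = Some t' ->
  ch_eps upr dnr R t' = ch_eps upr dnr R t /\ ch_phi upr dnr R t' = ch_phi upr dnr R t.
Proof. exact: cross_fc cr t t'. Qed.
Let efR := ch_efP (cr_r cr) (cr_R cr).
Let efC := ch_efP (cr_c cr) (cr_J cr).

(** e inverts f, and it is defined on the same states before and after a step of the
    other family, since eps and phi are invariant. *)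
Lemma cross_fe t : obind eR (fC t) = obind fC (eR t).
Proof.
case Er: (eR t) => [t1|] /=; last first.
  case Ec: (fC t) => [u|] //=; apply/(ch_eN (cr_r cr)).
  by have [-> _] := cross_inv_fc Ec; apply/(ch_eN (cr_r cr)).
move/efR: Er => Er; have := cross_ff t1; rewrite Er /= => <-.
case Ec: (fC t1) => [u|] //=; have [_ ph] := cross_inv_fc Ec.
case Eu: (fR u) => [u'|] /=; first by apply/efR.
by move/(ch_fN (cr_r cr)): Eu; rewrite ph => /(ch_fN (cr_r cr)); rewrite Er.
Qed.

Lemma cross_ee t : obind eR (eC t) = obind eC (eR t).
Proof.
case Ec: (eC t) => [t1|] /=; last first.
  case Er: (eR t) => [u|] //=; apply/esym/(ch_eN (cr_c cr)).
  move/efR: Er => Er; have [<- _] := cross_fc rc Er; exact/(ch_eN (cr_c cr)).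
move/efC: Ec => Ec; have := cross_fe t1; rewrite Ec /= => ->.
case Er: (eR t1) => [u|] //=.
move/efR: (Er) => Er'; have [_ ph] := cross_fc rc Er'.
case Eu: (fC u) => [u'|] /=; first by apply/esym/efC.
by move/(ch_fN (cr_c cr)): Eu; rewrite -ph => /(ch_fN (cr_c cr)); rewrite Ec.
Qed.
End CrossComm.

(** * Arrays that are extremal for both structures *)

Section Justified.
Variables (n m : nat) (a : nat -> nat -> bool).
Hypothesis a_supp : forall i j, a i j -> (i < n) && (j < m).
Hypothesis rows_hw : forall k r, r <= n ->
  count (fun i => ~~ a i k && a i k.+1) (iota 0 r)
  <= count (fun i => a i k && ~~ a i k.+1) (iota 0 r).

(** If there were no such row i', the rows up to i would form a prefix with more sites
    for e than for f. *)
Lemma row_before i k : a i k.+1 -> ~~ a i k ->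
  exists2 i', i' < i & a i' k && ~~ a i' k.+1.
Proof.
move=> h1 h2; have /andP[ii _] := a_supp h1.
have := rows_hw k ii.
have : 0 < count (fun i => ~~ a i k && a i k.+1) (iota 0 i.+1).
  by rewrite -has_count; apply/hasP; exists i; rewrite ?mem_iota ?h1 ?h2 //=.
move=> /leq_trans h /h; rewrite -has_count => /hasP[i' + h3].
rewrite mem_iota /= ltnS leq_eqVlt => /orP[/eqP e|]; last by exists i'.
by move: h3; rewrite e (negbTE h2).
Qed.

Lemma justified_le i j j' : (forall j, a i j.+1 -> a i j) -> j' <= j -> a i j -> a i j'.
Proof.
move=> h; elim: j => [|j IH]; first by rewrite leqn0 => /eqP ->.
by rewrite leq_eqVlt => /orP[/eqP->//|]; rewrite ltnS => /IH hj /h.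
Qed.

(** Induction on the rows.  A row whose predecessors are left-justified and contained
    in each other is contained in the preceding one, by the condition on the columns,
    and it is left-justified: a gap in it would also be one in an earlier row, by
    row_before.  So the array is a Young diagram. *)
Lemma highest_justified :
  (forall l c, l.+1 < n ->
    count (fun j => ~~ a l j && a l.+1 j) (iota c (m - c))
    <= count (fun j => a l j && ~~ a l.+1 j) (iota c (m - c))) ->
  (forall i j, a i j.+1 -> a i j) /\ (forall i j, a i.+1 j -> a i j).
Proof.
move=> cols_hw.
have bad l c j : a l.+1 j -> c <= j -> (forall j', c <= j' -> ~~ a l j') -> False.
  move=> h cj hl; have /andP[ln jm] := a_supp h; have := cols_hw l c ln.
  have : 0 < count (fun j => ~~ a l j && a l.+1 j) (iota c (m - c)).
    by rewrite -has_count; apply/hasP; exists j; [rewrite mem_iota; lia|rewrite h hl].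
  move=> /leq_trans h' /h'; rewrite -has_count => /hasP[j'].
  by rewrite mem_iota => /andP[cj' _]; rewrite (negbTE (hl _ cj')).
have mono l : (forall j, a l j.+1 -> a l j) -> forall j, a l.+1 j -> a l j.
  move=> LJ j h; apply: contraT => nl; case: (bad l j j h) => // j' jj'.
  by apply: contra nl; apply: justified_le jj'.
have H i : (forall j, a i j.+1 -> a i j) /\ (forall i', i' <= i -> forall j, a i j -> a i' j).
  elim: i => [|i [LJ mo]].
    split=> [j h|i' + j]; last by rewrite leqn0 => /eqP ->.
    by apply: contraT => h2; have [] := row_before h h2.
  have mi := mono i LJ.
  split=> [k h|i' + j]; last by rewrite leq_eqVlt => /orP[/eqP ->//|/mo h /mi/h].
  apply: contraT => h2; have [i' ii' /andP[h3 h4]] := row_before h h2.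
  case: (bad i k.+1 k.+1 h) => // j' kj'; apply: contra h4 => h5.
  by apply: (mo i' ii'); apply: justified_le h5.
by split=> i; have [] := H i => // LJ _; exact: mono.
Qed.

(** The same induction with the inclusions of the rows reversed; the array is a Young
    diagram upside down. *)
Lemma lowest_justified :
  (forall l c, l.+1 < n ->
    count (fun j => a l j && ~~ a l.+1 j) (iota 0 c)
    <= count (fun j => ~~ a l j && a l.+1 j) (iota 0 c)) ->
  (forall i j, a i j.+1 -> a i j) /\ (forall i j, i.+1 < n -> a i j -> a i.+1 j).
Proof.
move=> cols_lw.
have bad l j : l.+1 < n -> a l j -> ~~ a l.+1 j -> (forall j', j' <= j -> a l j') -> False.
  move=> ln h1 h2 hl; have := cols_lw l j.+1 ln.
  have : 0 < count (fun j => a l j && ~~ a l.+1 j) (iota 0 j.+1).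
    by rewrite -has_count; apply/hasP; exists j; [rewrite mem_iota; lia|rewrite h1 h2].
  move=> /leq_trans h' /h'; rewrite -has_count => /hasP[j'].
  by rewrite mem_iota /= ltnS => jj'; rewrite hl.
have mono l : (forall j, a l j.+1 -> a l j) -> forall j, l.+1 < n -> a l j -> a l.+1 j.
  move=> LJ j ln h; apply: contraT => nl; case: (bad l j) => // j' jj'.
  exact: justified_le h.
have H i : i < n -> (forall j, a i j.+1 -> a i j) /\ (forall i', i' <= i -> forall j, a i' j -> a i j).
  elim: i => [|i IH] ni.
    split=> [j h|i' + j]; last by rewrite leqn0 => /eqP ->.
    by apply: contraT => h2; have [] := row_before h h2.
  have [LJ mo] := IH (ltnW ni); have mi j := mono i LJ j ni.
  split=> [k h|i' + j]; last by rewrite leq_eqVlt => /orP[/eqP ->//|/mo h /h/mi].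
  apply: contraT => h2; have [i' ii' /andP[h3 h4]] := row_before h h2.
  have h5 := mo i' ii' k h3; case: (bad i k ni h5 h2) => j' jj'.
  exact: justified_le h5.
split=> i j; last by move=> ni; apply: mono => //; have [] := H i (ltnW ni).
move=> h; have /andP[ni _] := a_supp h; have [LJ _] := H i ni; exact: LJ.
Qed.
End Justified.

Local Open Scope ring_scope.

(** * Quantum operators on functions and their crystal coordinates *)

Section QuantumInt.
Variables (K : fieldType) (p : K).
Definition qint (k : nat) : K := (p ^+ k - p ^- k) / (p - p^-1).
Hypotheses (p0 : p != 0) (p1 : p ^+ 2 - 1 != 0).

Lemma qint0 : qint 0 = 0.
Proof. by rewrite /qint expr0 invr1 subrr mul0r. Qed.

Lemma qint_den : p - p^-1 != 0.
Proof.
apply: contraNneq p1 => h; have -> : p ^+ 2 - 1 = p * (p - p^-1) by field.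
by rewrite h mulr0.
Qed.

Lemma qint1 : qint 1 = 1.
Proof. by rewrite /qint !expr1 divff // qint_den. Qed.

Lemma qintS k : qint k.+1 = p ^+ k + p^-1 * qint k.
Proof. by rewrite /qint !exprS; field; rewrite p0 -expr2 p1 expf_neq0. Qed.

Lemma qintS' k : qint k.+1 = p ^- k + p * qint k.
Proof. by rewrite /qint !exprS; field; rewrite p0 -expr2 p1 expf_neq0. Qed.

End QuantumInt.

Section ChainWeight.
Variables (T : Type) (I : eqType) (sw : I -> T -> T) (up dn : I -> T -> bool).
Hypothesis ch : chain sw up dn.
Local Notation eps := (ch_eps up dn).
Local Notation phi := (ch_phi up dn).
Local Notation cf := (ch_f sw up dn).
Local Notation ce := (ch_e sw up dn).

(** The weight of t for the sl_2 that acts on the chain. *)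
Definition chain_wt J t : int := (phi J t)%:Z - (eps J t)%:Z.

Lemma ce_mem J t t' : ce J t = Some t' -> exists2 j, j \in J & t' = sw j t.
Proof.
rewrite /ch_e; case E: (sg_e _ _ _) => [i|] //= [<-]; exists i => //.
by have /andP[] := sg_e_mem E.
Qed.

Lemma cf_mem J t t' : cf J t = Some t' -> exists2 j, j \in J & t' = sw j t.
Proof.
rewrite /ch_f; case E: (sg_f _ _ _) => [i|] //= [<-]; exists i => //.
by have /andP[] := sg_f_mem E.
Qed.

Definition site_sign i t : int := (up i t)%:Z - (dn i t)%:Z.

Lemma chwt_cons i J t : chain_wt (i :: J) t = site_sign i t + chain_wt J t.
Proof.
rewrite /chain_wt /site_sign; have := ch_ud ch t i.
have := sg_phi_eps (up^~ t) (dn^~ t) (i :: J); rewrite -/(ch_phi up dn (i :: J) t) -/(ch_eps up dn (i :: J) t) /=.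
have := sg_phi_eps (up^~ t) (dn^~ t) J; rewrite -/(ch_phi up dn J t) -/(ch_eps up dn J t) /=.
lia.
Qed.

End ChainWeight.

Section QChain.
Variables (T : Type) (I : eqType) (sw : I -> T -> T) (up dn : I -> T -> bool).
Variables (K : fieldType) (p : K).
Hypothesis ch : chain sw up dn.
Hypotheses (p0 : p != 0) (p1 : p ^+ 2 - 1 != 0).
Local Notation eps := (ch_eps up dn).
Local Notation phi := (ch_phi up dn).
Local Notation cf := (ch_f sw up dn).
Local Notation ce := (ch_e sw up dn).
Local Notation qn := (qint p).
Local Notation chwt := (chain_wt up dn).
Local Notation sgn := (site_sign up dn).

Definition psg (i : I) (t : T) : K := if up i t then p else if dn i t then p^-1 else 1.

(** The action of e and f of the quantum sl_2 on the functions on T, by the iterated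
    coproduct: T is a tensor product of doublets and singlets, one for each site. *)
Fixpoint qe (J : seq I) (x : T -> K) (t : T) : K :=
  if J is i :: J' then
    qe J' x t + (if up i t then p ^+ eps J' t / p ^+ phi J' t * x (sw i t) else 0)
  else 0.

Fixpoint qf (J : seq I) (x : T -> K) (t : T) : K :=
  if J is i :: J' then
    psg i t * qf J' x t + (if dn i t then x (sw i t) else 0)
  else 0.

(** A linear form on functions that differs from the evaluation at t by terms that
    vanish at p = 0.  In these coordinates e and f become the crystal operators up to
    q-integers (gam_qe and gam_qf); they are dual to a basis adapted to the strings,
    as it is built for the tensor product with a doublet by one more site i. *)
Fixpoint gam (J : seq I) (t : T) (x : T -> K) : K :=
  if J is i :: J' then
    let e := eps J' t in let f := phi J' t in
    if dn i t then
      p ^+ e * qn e.+1 * gam J' t x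
      + p ^+ (e + f) * qn f * oapp (fun t' => gam J' t' x) 0 (cf J' (sw i t))
    else if up i t then
      if e == 0%N then p ^+ f * qn f.+1 * gam J' t x
      else gam J' t x - p ^+ e * oapp (fun t' => gam J' t' x) 0 (ce J' (sw i t))
    else gam J' t x
  else x t.

Definition ogam J o x := oapp (fun t => gam J t x) 0 o.

Lemma eq_gam J t x y : x =1 y -> gam J t x = gam J t y.
Proof.
move=> xy; elim: J t => //= i J IH t.
have E o : oapp (fun t' => gam J t' x) 0 o = oapp (fun t' => gam J t' y) 0 o by case: o.
by rewrite !E !IH.
Qed.

Lemma gam_lin J t (a : K) x y :
  gam J t (fun s => a * x s + y s) = a * gam J t x + gam J t y.
Proof.
elim: J t => //= i J IH t.
have E o : oapp (fun t' => gam J t' (fun s => a * x s + y s)) 0 o =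
    a * oapp (fun t' => gam J t' x) 0 o + oapp (fun t' => gam J t' y) 0 o.
  by case: o => //=; rewrite mulr0 addr0.
by rewrite !E !IH; case: ifP => _; [ring|case: ifP => _ //; case: ifP => _; ring].
Qed.

Lemma gam_add J t x y : gam J t (fun s => x s + y s) = gam J t x + gam J t y.
Proof.
by have := gam_lin J t 1 x y; rewrite mul1r => <-; apply: eq_gam => s; rewrite /= mul1r.
Qed.

Lemma gam0 J t : gam J t (fun _ => 0) = 0.
Proof.
have := gam_add J t (fun _ => 0) (fun _ => 0).
rewrite (@eq_gam _ _ _ (fun _ => 0)) => [h|s]; last by rewrite addr0.
by apply: (@addrI _ (gam J t (fun _ => 0))); rewrite -h addr0.
Qed.

Lemma gam_scale J t (a : K) x : gam J t (fun s => a * x s) = a * gam J t x.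
Proof.
have := gam_lin J t a x (fun _ => 0); rewrite gam0 addr0 => <-.
by apply: eq_gam => s; rewrite /= addr0.
Qed.

(** gam J t only involves states reached from t by sites of J, all of the weight of
    t; so a function of the weight and of data that these sites preserve is a scalar
    for it. *)
Lemma gam_mul J t (psi : T -> int -> K) x : uniq J ->
  (forall j s z, j \in J -> psi (sw j s) z = psi s z) ->
  gam J t (fun s => psi s (chwt J s) * x s) = psi t (chwt J t) * gam J t x.
Proof.
elim: J t psi => //= i J IH t psi /andP[iJ uJ] psiJ.
pose psi' s z := psi s (sgn i s + z).
have psi'E s : psi s (chwt (i :: J) s) = psi' s (chwt J s) by rewrite (chwt_cons ch).
have psi'J j s z : j \in J -> psi' (sw j s) z = psi' s z.
  move=> jJ; have ij : i != j by apply: contraNneq iJ => ->.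
  by rewrite /psi' /site_sign (ch_upN ch) ?(ch_dnN ch) // psiJ // inE jJ orbT.
have E s : gam J s (fun s => psi s (chwt (i :: J) s) * x s) = psi' s (chwt J s) * gam J s x.
  by rewrite -IH //; apply: eq_gam => s'; rewrite psi'E.
have [eS fS _ _] := sg_swN ch t iJ.
have ud := ch_ud ch t i.
rewrite E psi'E; case: ifP => di.
  have ui : up i t = false by case: (up i t) ud; rewrite di.
  case Ef: (cf J (sw i t)) => [t'|] /=; last by ring.
  rewrite E; suff -> : psi' t' (chwt J t') = psi' t (chwt J t) by ring.
  have [j jJ t'E] := cf_mem Ef; have [_ h1 h2] := ch_fP ch uJ Ef.
  have ij : i != j by apply: contraNneq iJ => ->.
  rewrite /psi' t'E psiJ ?inE ?jJ ?orbT // psiJ ?inE ?eqxx // -t'E; congr (psi _ _).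
  rewrite /site_sign t'E (ch_upN ch) // (ch_dnN ch) // (ch_up ch) (ch_dn ch) -t'E di ui /chain_wt.
  by rewrite h1 -eS -fS h2; clear; lia.
case: ifP => ui; last by ring.
case: ifP => _; first by ring.
case Ee: (ce J (sw i t)) => [t'|] /=; last by ring.
rewrite E; suff -> : psi' t' (chwt J t') = psi' t (chwt J t) by ring.
have [j jJ t'E] := ce_mem Ee; have [_ h1 h2] := ch_eP ch uJ Ee.
have ij : i != j by apply: contraNneq iJ => ->.
rewrite /psi' t'E psiJ ?inE ?jJ ?orbT // psiJ ?inE ?eqxx // -t'E; congr (psi _ _).
rewrite /site_sign t'E (ch_upN ch) // (ch_dnN ch) // (ch_up ch) (ch_dn ch) -t'E di ui /chain_wt.
by rewrite h1 -eS -fS h2; clear; lia.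
Qed.

Lemma gam_sw i J t x : i \notin J ->
  gam J t (fun s => x (sw i s)) = gam J (sw i t) x.
Proof.
elim: J t => //= j J IH t; rewrite inE negb_or => /andP[ij iJ].
have [eS fS Ee Ef] := sg_swN ch t iJ.
have [_ _ Ee' Ef'] := sg_swN ch (sw j t) iJ.
have ji : j != i by rewrite eq_sym.
rewrite (ch_upN ch) // (ch_dnN ch) // eS fS !IH //.
rewrite (ch_swC ch j i) /ch_f /ch_e Ef' Ee'.
have E o : oapp (fun t' => gam J t' (fun s => x (sw i s))) 0 (omap (sw^~ (sw j t)) o) =
   oapp (fun t' => gam J t' x) 0 (omap (sw^~ (sw i (sw j t))) o).
  by case: o => //= k; rewrite IH // (ch_swC ch i k).
by rewrite !E.
Qed.

Lemma ch_f_cons i J t : cf (i :: J) t =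
  if up i t && (eps J t == 0%N) then Some (sw i t) else cf J t.
Proof.
by rewrite /ch_f /ch_eps /=; case: (up i t) => //=; rewrite ltnS leqn0; case: ifP.
Qed.

Lemma ch_e_cons i J t : ce (i :: J) t =
  if (eps J t <= up i t)%N then (if dn i t then Some (sw i t) else None) else ce J t.
Proof. by rewrite /ch_e /ch_eps /=; case: ifP => _ //; case: ifP. Qed.

Lemma expz_chwt J t : p ^ (- chwt J t) = p ^+ eps J t / p ^+ phi J t.
Proof. by rewrite /chain_wt opprB expfzDr // -exprnN exprnP. Qed.

Lemma gam_up i J t x : uniq (i :: J) ->
  gam J t (fun s => if up i s then p ^+ eps J s / p ^+ phi J s * x (sw i s) else 0)
  = if up i t then p ^+ eps J t / p ^+ phi J t * gam J (sw i t) x else 0.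
Proof.
move=> /= /andP[iJ uJ].
rewrite -expz_chwt -gam_sw //.
rewrite (@eq_gam _ _ _
  (fun s => (fun s z => if up i s then p ^ (- z) else 0) s (chwt J s) * x (sw i s))).
  rewrite (@gam_mul _ _ (fun s z => if up i s then p ^ (- z) else 0) _) //.
    by case: ifP; rewrite ?mul0r.
  by move=> j s z jJ; rewrite (ch_upN ch) //; apply: contraNneq iJ => ->.
by move=> s /=; case: ifP; rewrite ?mul0r // expz_chwt.
Qed.

Lemma gam_dn i J t x : uniq (i :: J) ->
  gam J t (fun s => if dn i s then x (sw i s) else 0)
  = if dn i t then gam J (sw i t) x else 0.
Proof.
move=> /= /andP[iJ uJ]; rewrite -gam_sw //.
rewrite (@eq_gam _ _ _
  (fun s => (fun s z => if dn i s then 1 else 0) s (chwt J s) * x (sw i s))).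
  rewrite (@gam_mul _ _ (fun s z => if dn i s then 1 else 0) _) //.
    by case: ifP; rewrite ?mul0r ?mul1r.
  by move=> j s z jJ; rewrite (ch_dnN ch) //; apply: contraNneq iJ => ->.
by move=> s /=; case: ifP; rewrite ?mul0r ?mul1r.
Qed.

Lemma gam_psg i J t x : uniq (i :: J) ->
  gam J t (fun s => psg i s * x s) = psg i t * gam J t x.
Proof.
move=> /= /andP[iJ uJ].
rewrite (@gam_mul _ _ (fun s z => psg i s) _) // => j s z jJ.
by rewrite /psg (ch_dnN ch) ?(ch_upN ch) //; apply: contraNneq iJ => ->.
Qed.

Lemma oapp_ogam J o x : oapp (fun t' => gam J t' x) 0 o = ogam J o x.
Proof. by []. Qed.

(** Induction on the sites.  For each of the three signs of the new site, both sides
    are combinations of the same coordinates for the shorter chain, and their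
    coefficients agree by the recurrences of the q-integers. *)
Lemma gam_qe J t x : uniq J -> gam J t (qe J x) = qn (phi J t) * ogam J (cf J t) x.
Proof.
elim: J t => [|i J IH] t uiJ; first by rewrite /ch_phi /= mulr0.
have /andP[iJ uJ] := uiJ.
have E s : gam J s (qe (i :: J) x) = qn (phi J s) * ogam J (cf J s) x +
   (if up i s then p ^+ eps J s / p ^+ phi J s * gam J (sw i s) x else 0).
  by rewrite -IH // -gam_up // -gam_add.
have [eS fS Ee Ef] := sg_swN ch t iJ.
have ud := ch_ud ch t i; have pX k : p ^+ k != 0 by rewrite expf_neq0.
have den := p1.
rewrite ch_f_cons [LHS]/= !oapp_ogam.
have phiE : phi (i :: J) t = (phi J t + (up i t - eps J t))%N by [].
rewrite phiE.
case di : (dn i t).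
  have ui : up i t = false by case: (up i t) ud; rewrite di.
  rewrite ui addn0 /= E ui addr0.
  case Ef2: (cf J (sw i t)) => [t1|]; last first.
    have -> : cf J t = None.
      by apply/(ch_fN ch); rewrite -fS; apply/(ch_fN ch).
    by rewrite /ogam /= !mulr0 addr0.
  have [j jJ t1E] := cf_mem Ef2; have ij : i != j by apply: contraNneq iJ => ->.
  have Ef3 : cf J t = Some (sw i t1).
    move: Ef2; rewrite /ch_f Ef; case: (sg_f _ _ _) => //= k [<-].
    by rewrite (ch_swC ch i k) (ch_swK ch).
  have [_ h1 h2] := ch_fP ch uJ Ef2; have [_ h3 h4] := ch_fP ch uJ Ef3.
  have [eS1 fS1 _ Ef1] := sg_swN ch t1 iJ.
  have ui1 : up i t1 by rewrite t1E (ch_upN ch) // (ch_up ch).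
  rewrite Ef3 /= E oapp_ogam ui1.
  have -> : dn i (sw i t1) by rewrite (ch_dn ch) t1E (ch_upN ch) // (ch_up ch).
  rewrite (ch_swK ch) eS1 h1 eS fS1.
  have := h2; rewrite fS => ->.
  set A := gam _ _ _; set B := ogam _ _ _; set f := phi J t1; set e := eps J t.
  rewrite !(qintS p0 p1) // !(exprS, exprD) /qint; field.
  by rewrite p0 -expr2 p1 !pX.
case ui : (up i t); last first.
  rewrite addn0 /= E ui addr0.
  case Ef3: (cf J t) => [t1|]; last by rewrite /=.
  have [j jJ t1E] := cf_mem Ef3; have ij : i != j by apply: contraNneq iJ => ->.
  by rewrite /= t1E (ch_upN ch) // (ch_dnN ch) // di ui.
case: ifP => [/eqP e0|e0].
  rewrite E ui e0 subn0 addn1 /= (ch_dn ch) ui eS fS e0 !oapp_ogam (ch_swK ch).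
  set A := gam _ _ _; set B := ogam _ _ _; set f := phi J t.
  by rewrite !add0n !expr0 (qint1 p0 p1) !mul1r; field; rewrite pX.
rewrite E ui /= (_ : 1 - eps J t = 0)%N ?addn0; last by move: e0; case: (eps J t).
case Ee2: (ce J (sw i t)) => [t1|]; last first.
  by move/(ch_eN ch): Ee2; rewrite eS => e00; rewrite e00 in e0.
have [j jJ t1E] := ce_mem Ee2; have ij : i != j by apply: contraNneq iJ => ->.
have [Ef1 h1 h2] := ch_eP ch uJ Ee2.
have ui1 : up i t1 = false by rewrite t1E (ch_upN ch) // (ch_up ch).
rewrite /= E ui1 addr0 Ef1 h1 fS /=.
case Ef3: (cf J t) => [t2|]; last first.
  move/(ch_fN ch): Ef3 => ->; rewrite (qint1 p0 p1) (qint0 p) expr0 /ogam /=; field; exact: oner_neq0.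
have [k kJ t2E] := cf_mem Ef3; have ik : i != k by apply: contraNneq iJ => ->.
have [Ee3 h3 h4] := ch_fP ch uJ Ef3.
rewrite /= t2E (ch_upN ch) // (ch_dnN ch) // ui di -t2E h3 /= oapp_ogam.
have -> : ce J (sw i t2) = Some (sw i t).
  have [_ _ Ee4 _] := sg_swN ch t2 iJ; move: Ee3; rewrite /ch_e Ee4.
  by case: (sg_e _ _ _) => //= l [<-]; rewrite (ch_swC ch i l).
rewrite /= h4; set A := gam _ _ _; set B := gam _ _ _; set f := phi J t2; set e := eps J t.
rewrite !(qintS' p0 p1) !exprS; field.
by rewrite p0 !pX.
Qed.

Lemma gam_qf J t x : uniq J -> gam J t (qf J x) = qn (eps J t) * ogam J (ce J t) x.
Proof.
elim: J t => [|i J IH] t uiJ; first by rewrite /ch_eps /= mulr0.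
have /andP[iJ uJ] := uiJ.
have E s : gam J s (qf (i :: J) x) = psg i s * (qn (eps J s) * ogam J (ce J s) x) +
   (if dn i s then gam J (sw i s) x else 0).
  by rewrite -IH // -gam_psg // -gam_dn // -gam_add.
have [eS fS Ee Ef] := sg_swN ch t iJ.
have ud := ch_ud ch t i; have pX k : p ^+ k != 0 by rewrite expf_neq0.
have den := p1.
set y := qf (i :: J) x in E *.
rewrite ch_e_cons [LHS]/= !oapp_ogam.
have epsE : eps (i :: J) t = (dn i t + (eps J t - up i t))%N by [].
rewrite epsE.
case di : (dn i t).
  have ui : up i t = false by case: (up i t) ud; rewrite di.
  rewrite ui subn0 add1n.
  have H2 : qn (phi J t) * ogam J (cf J (sw i t)) y =
     qn (phi J t) * (p * qn (eps J t).+1 * gam J (sw i t) x).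
    case Ef2: (cf J (sw i t)) => [t1|]; last first.
      by move/(ch_fN ch): Ef2; rewrite fS => ->; rewrite qint0 !mul0r.
    have [j jJ t1E] := cf_mem Ef2; have ij : i != j by apply: contraNneq iJ => ->.
    have [Ee1 h1 h2] := ch_fP ch uJ Ef2.
    have ui1 : up i t1 by rewrite t1E (ch_upN ch) // (ch_up ch).
    have di1 : dn i t1 = false by rewrite t1E (ch_dnN ch) // (ch_dn ch).
    by rewrite /= E di1 addr0 /psg ui1 Ee1 h1 eS /= !mulrA.
  rewrite -[X in _ + X]mulrA H2 E di /psg ui di.
  case: ifP => [|].
    rewrite leqn0 => /eqP e0; rewrite e0 /= (ch_dn ch) ui (ch_up ch) di eS e0 /= fS.
    rewrite (qint1 p0 p1) qint0 !add0n.
    set A := gam _ _ _; set f := phi J t.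
    by rewrite (qintS' p0 p1) expr0; field; rewrite ?oner_neq0 ?pX.
  case Ee3: (ce J t) => [t2|]; last by move/(ch_eN ch): Ee3 => ->.
  have [k kJ t2E] := ce_mem Ee3; have ik : i != k by apply: contraNneq iJ => ->.
  have [Ef3 h3 h4] := ch_eP ch uJ Ee3.
  move=> _; rewrite /= t2E (ch_upN ch) // (ch_dnN ch) // ui di -t2E /= oapp_ogam.
  have -> : cf J (sw i t2) = Some (sw i t).
    have [_ _ _ Ef4] := sg_swN ch t2 iJ; move: Ef3; rewrite /ch_f Ef4.
    by case: (sg_f _ _ _) => //= l [<-]; rewrite (ch_swC ch i l).
  rewrite /= h3 h4; set A := gam _ _ _; set B := gam _ _ _; set f := phi J t; set e := eps J t2.
  by rewrite !(qintS' p0 p1) !(exprS, exprD); field; rewrite p0 !pX.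
case ui : (up i t); last first.
  rewrite add0n subn0 /= E di addr0 /psg ui di mul1r.
  case: ifP => [|_].
    by rewrite leqn0 => /eqP ->; rewrite qint0 !mul0r.
  case Ee3: (ce J t) => [t1|]; last by rewrite /= mulr0.
  have [j jJ t1E] := ce_mem Ee3; have ij : i != j by apply: contraNneq iJ => ->.
  by rewrite /= t1E (ch_upN ch) // (ch_dnN ch) // di ui.
rewrite E di /psg ui addr0 add0n.
case: ifP => [/eqP e0|e0].
  by rewrite e0 qint0 !mul0r !mulr0.
case Ee2: (ce J (sw i t)) => [t1|]; last first.
  by move/(ch_eN ch): Ee2; rewrite eS => e00; rewrite e00 in e0.
have [j jJ t1E] := ce_mem Ee2; have ij : i != j by apply: contraNneq iJ => ->.
have [Ef1 h1 h2] := ch_eP ch uJ Ee2.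
have ui1 : up i t1 = false by rewrite t1E (ch_upN ch) // (ch_up ch).
have di1 : dn i t1 by rewrite t1E (ch_dnN ch) // (ch_dn ch).
have Ee3 : ce J t = Some (sw i t1).
  move: Ee2; rewrite /ch_e Ee; case: (sg_e _ _ _) => //= k [<-].
  by rewrite (ch_swC ch i k) (ch_swK ch).
have [eS1 fS1 Ee4 _] := sg_swN ch t1 iJ.
have e1 : eps J t = (eps J t1).+1 by rewrite -eS h2.
rewrite /= E di1 /psg ui1 di1 Ee3 e1 /= subn1 /= ltnS leqn0.
case: eqP => e2.
  rewrite e2 (qint1 p0 p1) qint0 expr1; set A := gam _ _ _; ring.
rewrite /ogam /= (ch_up ch) (ch_dn ch) ui1 di1 eS1 (ch_swK ch) /=.
case: eqP => // _.
set A := gam _ _ _; set B := oapp _ _ _; set e := eps J t1.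
by rewrite (qintS p0 p1) !exprS; field.
Qed.
End QChain.

(** * Rational functions without pole at 0 *)

Local Notation "p %:F" := (@FracField.tofrac {poly rat} p).

Lemma div_mulV (F : fieldType) (x y z : F) : x != 0 -> x^-1 * ((y * x) / z) = y / z.
Proof. by move=> x0; rewrite -mulrA mulrCA mulKf. Qed.

(** The value at 0 as a relation, so that any representative fraction with a
    denominator that is not zero there can be used. *)
Definition value0 (x : Qq) (c : rat) : Prop :=
  exists a b : {poly rat}, [/\ b.[0] != 0, x = a%:F / b%:F & c = a.[0] / b.[0]].

Lemma horner0_neq0 (b : {poly rat}) : b.[0] != 0 -> b != 0.
Proof. by apply: contraNneq => ->; rewrite horner0. Qed.

Lemma value0_fun x c d : value0 x c -> value0 x d -> c = d.
Proof.
move=> [a [b [b0 -> ->]]] [a' [b' [b0' /eqP E ->]]].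
have nb := horner0_neq0 b0; have nb' := horner0_neq0 b0'.
move: E; rewrite eqr_div ?tofrac_eq0 // -!tofracM tofrac_eq => /eqP/(congr1 (horner^~ 0)).
by rewrite !hornerM => E; apply/eqP; rewrite eqr_div // E.
Qed.

Definition ev0 (x : Qq) : rat :=
  if pselect (exists c, value0 x c) is left h then projT1 (cid h) else 0.

Lemma ev0P x c : value0 x c -> ev0 x = c.
Proof.
move=> h; rewrite /ev0; case: pselect => [h'|[]]; last by exists c.
by case: (cid h') => d /= hd; apply: value0_fun hd h.
Qed.

Lemma regularP x : regular0 x <-> value0 x (ev0 x).
Proof.
split=> [[a [b [b0 xE]]]|[a [b [b0 xE _]]]]; last by exists a, b.
by have h : value0 x (a.[0] / b.[0]); [exists a, b | rewrite (ev0P h)].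
Qed.

Lemma value0_reg x c : value0 x c -> regular0 x.
Proof. by move=> [a [b [b0 xE _]]]; exists a, b. Qed.

Lemma value0D x y c d : value0 x c -> value0 y d -> value0 (x + y) (c + d).
Proof.
move=> [a [b [b0 -> ->]]] [a' [b' [b0' -> ->]]].
have nb := horner0_neq0 b0; have nb' := horner0_neq0 b0'.
exists (a * b' + a' * b), (b * b'); rewrite !(hornerM, hornerD) mulf_neq0 //; split=> //.
  by rewrite tofracD !tofracM addf_div // tofrac_eq0.
by rewrite addf_div.
Qed.

Lemma value0M x y c d : value0 x c -> value0 y d -> value0 (x * y) (c * d).
Proof.
move=> [a [b [b0 -> ->]]] [a' [b' [b0' -> ->]]].
exists (a * a'), (b * b'); rewrite !hornerM mulf_neq0 //; split=> //.
  by rewrite !tofracM mulf_div.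
by rewrite mulf_div.
Qed.

Lemma value0_const c : value0 (const_Qq c) c.
Proof.
by exists c%:P, 1; rewrite !hornerE tofrac1 !divr1 oner_neq0.
Qed.

Lemma value0q : value0 q 0.
Proof. by exists 'X, 1; rewrite !hornerE tofrac1 !divr1 oner_neq0. Qed.

Lemma const_Qq_morph : [/\ const_Qq 0 = 0, const_Qq 1 = 1 & {morph const_Qq : x / - x}].
Proof.
by split; rewrite /const_Qq ?polyC0 ?tofrac0 ?polyC1 ?tofrac1 // => x;
   rewrite polyCN tofracN.
Qed.

Lemma Qq_frac (x : Qq) : exists a b : {poly rat}, b != 0 /\ x = a%:F / b%:F.
Proof.
elim/quotW: x => x; exists \n_x, \d_x; split; first exact: denom_ratioP.
have d0 := denom_ratioP x.
apply: (canRL (mulfK _)); first by rewrite tofrac_eq0.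
change (FracField.mul (\pi x)%qT (\d_x)%:F = (\n_x)%:F).
rewrite !piE; apply/eqmodP; rewrite /= FracField.equivfE /FracField.mulf.
by rewrite !numden_Ratio ?mulf_neq0 ?oner_neq0 // !mulr1 mulrC.
Qed.

Lemma poly_split0 (a : {poly rat}) : a != 0 ->
  exists m, exists2 b : {poly rat}, b.[0] != 0 & a = b * 'X^m.
Proof.
move=> a0; have [m [b]] := multiplicity_XsubC a 0.
by rewrite a0 /= subr0 => rb ->; exists m, b.
Qed.

Lemma Qq_val (x : Qq) : x != 0 -> exists k m, exists u,
  [/\ x = q ^+ k / q ^+ m * u, regular0 u, ev0 u != 0 & regular0 u^-1].
Proof.
have [a [b [nb ->]]] := Qq_frac x; move=> x0.
have na : a != 0 by apply: contraNneq x0 => ->; rewrite tofrac0 mul0r.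
have [k [a' a0 aE]] := poly_split0 na; have [m [b' b0 bE]] := poly_split0 nb.
have na' := horner0_neq0 a0; have nb' := horner0_neq0 b0.
have va : value0 (a'%:F / b'%:F) (a'.[0] / b'.[0]) by exists a', b'.
exists k, m, (a'%:F / b'%:F); rewrite (ev0P va) mulf_neq0 ?invr_eq0 //; split=> //.
- rewrite aE bE !tofracM !tofracXn -/q -mulf_div mulrC; congr (_ * _).
- exact: value0_reg va.
- by exists b', a'; rewrite invf_div.
Qed.

(** A discrete valuation ring reg in K with uniformizer q and residue map ev to the
    rational numbers, split by cst. *)
Record qring (K : fieldType) (q : K) (cst : rat -> K) (reg : K -> Prop)
    (ev : K -> rat) : Prop := {
  qr_q : q != 0;
  qr_rq : reg q;
  qr_eq : ev q = 0;
  qr_cst : forall c, reg (cst c) /\ ev (cst c) = c;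
  qr_cst0 : cst 0 = 0;
  qr_cst1 : cst 1 = 1;
  qr_cstN : {morph cst : x / - x};
  qr_D : forall x y, reg x -> reg y -> reg (x + y) /\ ev (x + y) = ev x + ev y;
  qr_M : forall x y, reg x -> reg y -> reg (x * y) /\ ev (x * y) = ev x * ev y;
  qr_V : forall x, reg x -> ev x = 0 -> reg (q^-1 * x);
  qr_val : forall x, x != 0 -> exists k m, exists u,
    [/\ x = q ^+ k / q ^+ m * u, reg u, ev u != 0 & reg u^-1] }.

Lemma Qq_qring : qring Defs.q const_Qq regular0 ev0.
Proof.
have [c0 c1 cN] := const_Qq_morph; have qn0 : q != 0 by rewrite tofrac_eq0 polyX_eq0.
have vc := value0_const; split; [exact: qn0| | | | | | | | | |exact: Qq_val].
- exact: value0_reg value0q.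
- exact: ev0P value0q.
- by move=> c; split; [exact: value0_reg (vc c)|exact: ev0P (vc c)].
- exact: c0.
- exact: c1.
- exact: cN.
- move=> x y /regularP hx /regularP hy; have h := value0D hx hy.
  by split; [exact: value0_reg h|exact: ev0P h].
- move=> x y /regularP hx /regularP hy; have h := value0M hx hy.
  by split; [exact: value0_reg h|exact: ev0P h].
move=> x /regularP [a [b [b0 -> ->]]] /eqP; rewrite mulf_eq0 invr_eq0 (negbTE b0) orbF => a0.
have /factor_theorem [c ->] : poly.root a 0 by [].
exists c, b; split; first exact: b0.
by rewrite subr0 tofracM -/q; exact: div_mulV.
Qed.

Section QRing.
Variables (K : fieldType) (q : K) (cst : rat -> K) (regular0 : K -> Prop) (ev0 : K -> rat).
Hypothesis qr : qring q cst regular0 ev0.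

Lemma q_neq0 : q != 0. Proof. exact: qr_q qr. Qed.
Lemma regular0q : regular0 q. Proof. exact: qr_rq qr. Qed.
Lemma ev0q : ev0 q = 0. Proof. exact: qr_eq qr. Qed.
Lemma regularD x y : regular0 x -> regular0 y -> regular0 (x + y).
Proof. by move=> rx ry; have [] := qr_D qr rx ry. Qed.
Lemma ev0D x y : regular0 x -> regular0 y -> ev0 (x + y) = ev0 x + ev0 y.
Proof. by move=> rx ry; have [] := qr_D qr rx ry. Qed.
Lemma regularM x y : regular0 x -> regular0 y -> regular0 (x * y).
Proof. by move=> rx ry; have [] := qr_M qr rx ry. Qed.
Lemma ev0M x y : regular0 x -> regular0 y -> ev0 (x * y) = ev0 x * ev0 y.
Proof. by move=> rx ry; have [] := qr_M qr rx ry. Qed.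
Lemma regular_const c : regular0 (cst c).
Proof. by have [] := qr_cst qr c. Qed.
Lemma ev0c c : ev0 (cst c) = c.
Proof. by have [] := qr_cst qr c. Qed.
Lemma regular0_0 : regular0 0.
Proof. by rewrite -(qr_cst0 qr); exact: regular_const. Qed.
Lemma regular0_1 : regular0 1.
Proof. by rewrite -(qr_cst1 qr); exact: regular_const. Qed.
Lemma regularN x : regular0 x -> regular0 (- x).
Proof.
move=> hx; rewrite -mulN1r; apply: regularM => //.
by rewrite -(qr_cst1 qr) -(qr_cstN qr); exact: regular_const.
Qed.
Lemma regularB x y : regular0 x -> regular0 y -> regular0 (x - y).
Proof. by move=> hx hy; apply/regularD/regularN. Qed.

Lemma regularX x k : regular0 x -> regular0 (x ^+ k).
Proof.
by move=> hx; elim: k => [|k IH]; rewrite ?expr0 ?exprS; [exact: regular0_1|apply: regularM].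
Qed.

Lemma ev0_0 : ev0 0 = 0.
Proof. by rewrite -(qr_cst0 qr) ev0c. Qed.

Lemma ev0_1 : ev0 1 = 1.
Proof. by rewrite -(qr_cst1 qr) ev0c. Qed.

Lemma ev0N x : regular0 x -> ev0 (- x) = - ev0 x.
Proof.
move=> hx; apply/eqP; rewrite -subr_eq0 opprK -ev0D //; last exact: regularN.
by rewrite addNr ev0_0.
Qed.

Lemma ev0B x y : regular0 x -> regular0 y -> ev0 (x - y) = ev0 x - ev0 y.
Proof. by move=> hx hy; rewrite ev0D ?ev0N //; apply: regularN. Qed.

Lemma ev0X x k : regular0 x -> ev0 (x ^+ k) = ev0 x ^+ k.
Proof.
move=> hx; elim: k => [|k IH]; first by rewrite !expr0 ev0_1.
by rewrite !exprS ev0M ?IH //; apply: regularX.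
Qed.

Lemma regular_qV x : regular0 x -> ev0 x = 0 -> regular0 (q^-1 * x).
Proof. exact: qr_V qr x. Qed.

Lemma regular_qVE x : regular0 (q^-1 * x) <-> regular0 x /\ ev0 x = 0.
Proof.
split=> [h|[]]; last exact: regular_qV.
have -> : x = q * (q^-1 * x) by rewrite mulrA mulfV ?mul1r // q_neq0.
by split; [apply: regularM|rewrite ev0M // ?ev0q ?mul0r] => //; exact: regular0q.
Qed.

Lemma regular_val (x : K) : x != 0 -> exists k m, exists u,
  [/\ x = q ^+ k / q ^+ m * u, regular0 u, ev0 u != 0 & regular0 u^-1].
Proof. exact: qr_val qr x. Qed.

Lemma regular_pole (x : K) : exists N, forall M, (N <= M)%N -> regular0 (q ^+ M * x).
Proof.
have [->|/regular_val [k [m [u [-> ru _ _]]]]] := eqVneq x 0.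
  by exists 0%N => M _; rewrite mulr0; exact: regular0_0.
exists m => M le_mM; rewrite -(subnK le_mM) exprD.
have -> : q ^+ (M - m) * q ^+ m * (q ^+ k / q ^+ m * u) = q ^+ (M - m) * (q ^+ k * u).
  by field; rewrite ?expf_neq0 ?q_neq0.
by apply/regularM/regularM => //; apply/regularX/regular0q.
Qed.

(** In a field with a valuation ring, an element outside the ring has its inverse in
    the maximal ideal. *)
Lemma regular_dicho (x : K) : x != 0 -> ~ regular0 x -> regular0 x^-1 /\ ev0 x^-1 = 0.
Proof.
move=> /regular_val [k [m [u [-> ru _ ruV]]]] nr.
have [le_mk|lt_km] := leqP m k.
  case: nr; rewrite -expfB_cond ?(negbTE q_neq0) //; apply: regularM => //.
  exact/regularX/regular0q.
apply/regular_qVE; rewrite !invfM invrK; move: (u^-1) ruV => w rw.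
have -> : q^-1 * ((q ^+ k)^-1 * q ^+ m * w) = q ^+ (m - k.+1) * w.
  by rewrite -{1}(subnK lt_km) exprD exprS; field; rewrite expf_neq0 q_neq0.
by apply: regularM => //; apply/regularX/regular0q.
Qed.

(** An entry t0 of least valuation: division by it makes the family regular, and not
    zero at q = 0. *)
Lemma min_val (A : eqType) (y : A -> K) (s : seq A) :
  (forall t, t \in s -> y t = 0) \/
  exists2 t0, t0 \in s & y t0 != 0 /\ forall t, t \in s -> regular0 (y t / y t0).
Proof.
elim: s => [|t s [IH|[t0 st0 [y0 IH]]]]; first by left.
- have [yt|yt] := eqVneq (y t) 0; first by left=> u; rewrite inE => /predU1P[->//|/IH].
  right; exists t; rewrite ?inE ?eqxx //; split=> // u; rewrite inE => /predU1P[->|/IH ->].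
    by rewrite divff //; exact: regular0_1.
  by rewrite mul0r; exact: regular0_0.
- have [r|nr] := pselect (regular0 (y t / y t0)).
    by right; exists t0; rewrite ?inE ?st0 ?orbT //; split=> // u; rewrite inE => /predU1P[->//|/IH].
  have yt : y t != 0 by apply/eqP => yt; apply: nr; rewrite yt mul0r; exact: regular0_0.
  right; exists t; rewrite ?inE ?eqxx //; split=> // u; rewrite inE => /predU1P[->|/IH h].
    by rewrite divff //; exact: regular0_1.
  have yy : y t / y t0 != 0 by rewrite mulf_neq0 // invr_eq0.
  have [r _] := regular_dicho yy nr.
  have -> : y u / y t = y u / y t0 * (y t / y t0)^-1 by field; rewrite yt y0.
  exact: regularM.
Qed.

(** Operators with a parameter p that vanishes at q = 0: it will be q for one family
    of operators and - q for the other one. *)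
Section ParamQ.
Variable p : K.
Hypotheses (p0 : p != 0) (rp : regular0 p) (evp : ev0 p = 0).

Lemma param_sq : p ^+ 2 - 1 != 0.
Proof.
apply/eqP => /(congr1 ev0)/eqP; rewrite ev0B; last exact: regular0_1.
  by rewrite ev0X // evp ev0_1 ev0_0 expr0n sub0r oppr_eq0 oner_eq0.
exact: regularX.
Qed.

Lemma qintX e : p ^+ e.+1 * qint p e.+2 = 1 * p ^+ (e.+1).*2 + p ^+ e * qint p e.+1.
Proof.
by rewrite (qintS p0 param_sq e.+1) -addnn exprD !exprS; field.
Qed.

Lemma qint_lead e : regular0 (p ^+ e * qint p e.+1) /\ ev0 (p ^+ e * qint p e.+1) = 1.
Proof.
elim: e => [|e [r1 e1]].
  by rewrite expr0 mul1r (qint1 p0 param_sq) ev0_1; split=> //; exact: regular0_1.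
rewrite qintX mul1r; have rX := regularX (e.+1).*2 rp.
split; first exact: regularD.
by rewrite ev0D // e1 ev0X // evp expr0n add0r.
Qed.

Lemma qint_small e f : regular0 (p ^+ (e + f) * qint p f) /\ ev0 (p ^+ (e + f) * qint p f) = 0.
Proof.
case: f => [|f]; first by rewrite qint0 mulr0 ev0_0; split=> //; exact: regular0_0.
have [r1 _] := qint_lead f; have rX := regularX e.+1 rp.
rewrite addnS -addSn exprD -mulrA; split; first exact: regularM.
by rewrite ev0M // ev0X // evp exprS !mul0r.
Qed.

Lemma qint_neq0 e : qint p e.+1 != 0.
Proof.
have [_ h] := qint_lead e; apply: contra_eq_neq h => ->.
by rewrite mulr0 ev0_0 eq_sym oner_eq0.
Qed.

Section Gam.
Variables (T : Type) (I : eqType) (sw : I -> T -> T) (up dn : I -> T -> bool).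

(** By qint_lead and qint_small the only coefficient of gam that survives at p = 0 is
    that of the value at t, and it is 1 there. *)
Lemma gam_reg J t x : (forall s, regular0 (x s)) ->
  regular0 (gam sw up dn p J t x) /\ ev0 (gam sw up dn p J t x) = ev0 (x t).
Proof.
move=> rx; elim: J t => //= i J IH t; have [r1 e1] := IH t.
have ro o : regular0 (oapp (fun t' => gam sw up dn p J t' x) 0 o).
  by case: o => [s|] /=; [have [] := IH s|exact: regular0_0].
case: ifP => _.
  have [r2 e2] := qint_lead (ch_eps up dn J t).
  have [r3 e3] := qint_small (ch_eps up dn J t) (ch_phi up dn J t).
  by split; [apply: regularD; apply: regularM|
    rewrite ev0D; [rewrite ev0M // e2 mul1r e1 ev0M // e3 mul0r addr0|exact: regularM|exact: regularM]].
case: ifP => _ //; case: eqP => e0.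
  have [r2 e2] := qint_lead (ch_phi up dn J t).
  by rewrite ev0M // e2 mul1r; split=> //; apply: regularM.
have rX := regularX (ch_eps up dn J t) rp.
split; first by apply/regularB/regularM.
rewrite ev0B ?ev0M ?ev0X // ?evp ?expr0n; last exact: regularM.
by move/eqP/negbTE: e0 => ->; rewrite mul0r subr0.
Qed.

End Gam.
End ParamQ.

End QRing.

(** * String decompositions of functions *)

Section Strings.
Variables (T : Type) (I : eqType) (sw : I -> T -> T) (up dn : I -> T -> bool).
Variables (K : fieldType) (q : K) (cst : rat -> K) (regular0 : K -> Prop) (ev0 : K -> rat).
Hypothesis qr : qring q cst regular0 ev0.
Variable (p : K).
Hypotheses (p0 : p != 0) (rp : regular0 p) (evp : ev0 p = 0).
Hypothesis ch : chain sw up dn.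
Variable J : seq I.
Hypothesis uJ : uniq J.
Let p1 := param_sq qr rp evp.
Let qintN e : qint p e.+1 != 0. Proof. exact: (qint_neq0 qr p0 rp evp). Qed.
Local Notation eps := (ch_eps up dn J).
Local Notation phi := (ch_phi up dn J).
Local Notation cf := (ch_f sw up dn J).
Local Notation ce := (ch_e sw up dn J).
Local Notation gam := (gam sw up dn p J).
Local Notation ogam := (ogam sw up dn p J).
Local Notation qe := (qe sw up dn p J).
Local Notation qf := (qf sw up dn p J).

Definition qfact k := \prod_(1 <= j < k.+1) qint p j.
Definition dvf k (x : T -> K) : T -> K := fun t => (qfact k)^-1 * iter k qf x t.

Lemma qfactS k : qfact k.+1 = qfact k * qint p k.+1.
Proof. by rewrite /qfact big_nat_recr. Qed.

Lemma qfact_neq0 k : qfact k != 0.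
Proof.
elim: k => [|k IH]; first by rewrite /qfact big_nil oner_neq0.
by rewrite qfactS mulf_neq0 // qintN.
Qed.

(** By gam_qe the coordinate at s is, up to a nonzero factor, the coordinate of the
    zero function qe x at the image of s under e. *)
Lemma gam_ker x s : (forall t, qe x t = 0) -> eps s != 0%N -> gam s x = 0.
Proof.
move=> ex; case E: (ce s) => [s'|]; last by move/(ch_eN ch): E => ->.
move=> _; have [f1 f2 f3] := ch_eP ch uJ E.
have := gam_qe ch p0 p1 s' x uJ; rewrite (eq_gam _ _ _ _ _ _ ex) gam0 f1 f2 /=.
by move/esym/eqP; rewrite mulf_eq0 (negbTE (qintN _)) //= => /eqP.
Qed.

Definition eiter k s := iter k (obind ce) (Some s).

Lemma eiterS k s : eiter k.+1 s = obind (eiter k) (ce s).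
Proof.
rewrite /eiter iterSr /=; case: (ce s) => [s'|] //=.
by elim: k => //= k ->.
Qed.

Lemma eiter_wt k s s' : eiter k s = Some s' ->
  chain_wt up dn J s' = chain_wt up dn J s + (k.*2)%:Z.
Proof.
elim: k s => [|k IH] s; first by case=> ->; rewrite addr0.
rewrite eiterS; case E: (ce s) => [s1|] //= /IH ->.
have [_ h1 h2] := ch_eP ch uJ E; rewrite /chain_wt h1 h2; lia.
Qed.

(** For a function killed by e, the divided powers of f move the coordinates along the
    strings without any factor: the q-integers of gam_qf make up the q-factorial. *)
Lemma gam_dvf k x s : (forall t, qe x t = 0) ->
  gam s (dvf k x) = if eps s == k then ogam (eiter k s) x else 0.
Proof.
move=> ex; rewrite gam_scale; elim: k s => [|k IH] s.
  rewrite /qfact big_geq // invr1 mul1r /=; case: eqP => [//|/eqP].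
  exact: gam_ker.
rewrite iterS gam_qf // eiterS qfactS.
case E: (ce s) => [s'|] /=; last first.
  by rewrite !mulr0; case: eqP.
have [h0 h1 h2] := ch_eP ch uJ E; rewrite h2 eqSS.
have -> : (qfact k * qint p k.+1)^-1 * (qint p (eps s').+1 * gam s' (iter k qf x))
  = qint p (eps s').+1 / qint p k.+1 * ((qfact k)^-1 * gam s' (iter k qf x)).
  by field; rewrite qintN qfact_neq0.
rewrite IH; case: eqP => [->|]; last by rewrite mulr0.
by rewrite divff ?mul1r // qintN.
Qed.

Variables (N : nat) (u : nat -> T -> K) (a : nat -> int).
Hypothesis ue : forall k t, (k < N)%N -> qe (u k) t = 0.
Hypothesis ua : forall k t, (k < N)%N -> u k t != 0 -> chain_wt up dn J t = a k.
Hypothesis uk : forall k t, (k < N)%N -> u k t != 0 -> k%:Z <= a k.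

Lemma gam_sum M (F : nat -> T -> K) t :
  gam t (fun s => \sum_(k < M) F k s) = \sum_(k < M) gam t (F k).
Proof.
elim: M => [|M IH]; first by rewrite big_ord0 -[RHS](gam0 sw up dn p J t); apply: eq_gam => s; rewrite big_ord0.
rewrite big_ord_recr /= -IH -gam_add; apply: eq_gam => s.
by rewrite big_ord_recr.
Qed.

(** Kashiwara's operators on functions are the crystal operators in the coordinates
    gam, exactly and not only at q = 0. *)
Lemma gam_string_e t :
  gam t (fun s => \sum_(k < N.-1) dvf k (u k.+1) s) =
  ogam (cf t) (fun s => \sum_(k < N) dvf k (u k) s).
Proof.
rewrite (gam_sum _ (fun k => dvf k (u k.+1))).
have -> : ogam (cf t) (fun s => \sum_(k < N) dvf k (u k) s) =
   \sum_(k < N) ogam (cf t) (dvf k (u k)).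
  by case: (cf t) => [s|] /=; [rewrite (gam_sum _ (fun k => dvf k (u k)))|rewrite big1].
move: ue ua uk; case: N => [|M] ue' ua' uk'; first by rewrite !big_ord0.
rewrite big_ord_recl /= [X in _ = X + _](_ : _ = 0).
  rewrite add0r; apply: eq_bigr => k _.
  have kM : (k.+1 < M.+1)%N by rewrite ltnS.
  rewrite gam_dvf; last by move=> s; apply: ue'.
  case E: (cf t) => [s|] /=.
    have [h1 h2 h3] := ch_fP ch uJ E.
    rewrite gam_dvf ?h2 ?eqSS; last by move=> s'; apply: ue'.
    by case: eqP => // _; rewrite eiterS h1.
  (* If f kills t, then t has weight - k, and e^k t weight k: less than the weight
     a k.+1, which is at least k.+1, so that the coordinate of u k.+1 vanishes. *)
  case: eqP => // ek; case E2: (eiter k t) => [s|] //=.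
  have := eiter_wt E2; move/(ch_fN ch): E => ph; rewrite /chain_wt ek ph => hw.
  apply/eqP; apply: contraT => g0.
  have : exists s', u k.+1 s' != 0.
    apply: contrapT => nex; move/negP: g0; apply.
    rewrite (eq_gam _ _ _ _ _ _ (y := fun _ => 0)) ?gam0 // => s'.
    by apply/eqP/negPn/negP => h; apply: nex; exists s'.
  move=> [s' us']; have h4 := uk' _ _ kM us'; have h5 := ua' _ _ kM us'.
  have h6 : chain_wt up dn J s = a k.+1.
    apply/eqP; apply: contraNT g0 => h6.
    have := @gam_mul _ _ _ _ _ _ p ch J s (fun _ z => (z == a k.+1)%:R) (u k.+1) uJ (fun _ _ _ _ => erefl).
    rewrite (negbTE h6) mul0r => <-; apply/eqP; apply: eq_gam => s''.
    have [->|h] := eqVneq (u k.+1 s'') 0; first by rewrite mulr0.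
    by rewrite (ua' _ _ kM h) eqxx mul1r.
  by move: h4; rewrite -h6 /chain_wt hw; lia.
case E: (cf t) => [s|] //=; have [h1 h2 h3] := ch_fP ch uJ E.
by rewrite gam_dvf ?h2 // => s'; apply: ue'.
Qed.

Lemma gam_string_f t :
  gam t (fun s => \sum_(k < N) dvf k.+1 (u k) s) =
  ogam (ce t) (fun s => \sum_(k < N) dvf k (u k) s).
Proof.
rewrite (gam_sum _ (fun k => dvf k.+1 (u k))).
have -> : ogam (ce t) (fun s => \sum_(k < N) dvf k (u k) s) =
   \sum_(k < N) ogam (ce t) (dvf k (u k)).
  by case: (ce t) => [s|] /=; [rewrite (gam_sum _ (fun k => dvf k (u k)))|rewrite big1].
apply: eq_bigr => k _; rewrite gam_dvf; last by move=> s; apply: ue.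
case E: (ce t) => [s|]; last by move/(ch_eN ch): E => -> /=.
rewrite eiterS E [ogam (Some _) _]/= [obind _ _]/=.
  have [h1 h2 h3] := ch_eP ch uJ E.
  rewrite gam_dvf; last by move=> s'; apply: ue.
  by rewrite h3 eqSS.
Qed.

End Strings.

(** * Quantum commutation relations *)

Section OneChain.
Variables (T : Type) (I : eqType) (sw : I -> T -> T) (up dn : I -> T -> bool).
Variables (K : fieldType) (p : K).
Hypothesis ch : chain sw up dn.
Hypothesis p0 : p != 0.
Local Notation qe := (qe sw up dn p).
Local Notation qf := (qf sw up dn p).
Local Notation chwt := (chain_wt up dn).
Local Notation sgn := (site_sign up dn).

Lemma psgE i t : psg up dn p i t = p ^ sgn i t.
Proof.
rewrite /psg /site_sign; have := ch_ud ch t i.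
by case: (up i t); case: (dn i t) => //= _; rewrite ?subr0 ?expr1z ?sub0r ?exprN1.
Qed.

Lemma chwt_sum J t : chwt J t = \sum_(i <- J) sgn i t.
Proof.
elim: J => [|i J IH]; first by rewrite big_nil.
by rewrite (chwt_cons ch) IH big_cons.
Qed.

Lemma chwt_cat J1 J2 t : chwt (J1 ++ J2) t = chwt J1 t + chwt J2 t.
Proof. by rewrite !chwt_sum big_cat. Qed.

Lemma qeS i J x t : qe (i :: J) x t =
  qe J x t + p ^ (- chwt J t) * (if up i t then x (sw i t) else 0).
Proof. by rewrite /= (expz_chwt _ _ p0); case: ifP; rewrite ?mulr0. Qed.

Lemma qfS i J x t : qf (i :: J) x t =
  p ^ sgn i t * qf J x t + (if dn i t then x (sw i t) else 0).
Proof. by rewrite /= psgE. Qed.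

Lemma qe_cat J1 J2 x t : qe (J1 ++ J2) x t = qe J2 x t + p ^ (- chwt J2 t) * qe J1 x t.
Proof.
elim: J1 => [|i J1 IH]; first by rewrite mulr0 addr0.
rewrite cat_cons !qeS IH chwt_cat (opprD (chwt J1 t)) (expfzDr _ _ p0).
move: (if up i t then _ else _) (p ^ _) (p ^ _) => A B C; ring.
Qed.

Lemma qf_cat J1 J2 x t : qf (J1 ++ J2) x t = p ^ chwt J1 t * qf J2 x t + qf J1 x t.
Proof.
elim: J1 => [|i J1 IH]; first by rewrite /chain_wt /= expr0z mul1r addr0.
rewrite cat_cons !qfS IH (chwt_cons ch) expfzDr //.
move: (if dn i t then _ else _) (p ^ _) (p ^ _) => A B C; ring.
Qed.

Lemma eq_qe J x y : x =1 y -> qe J x =1 qe J y.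
Proof. by move=> xy t; elim: J => //= i J ->; rewrite xy. Qed.
Lemma eq_qf J x y : x =1 y -> qf J x =1 qf J y.
Proof. by move=> xy t; elim: J => //= i J ->; rewrite xy. Qed.

Lemma qe0 J t : qe J (fun=> 0) t = 0.
Proof. by elim: J => //= a J ->; case: ifP => _; rewrite ?mulr0 addr0. Qed.
Lemma qf0 J t : qf J (fun=> 0) t = 0.
Proof. by elim: J => //= a J ->; rewrite mulr0 add0r; case: ifP. Qed.

Lemma qe_supp J x t : qe J x t != 0 -> exists2 a, up a t & x (sw a t) != 0.
Proof.
elim: J => [|a J IH] /=; first by rewrite eqxx.
have [->|h _] := eqVneq (qe J x t) 0; last exact: IH.
rewrite add0r; case: ifP => [ua|_]; last by rewrite eqxx.
by rewrite mulf_eq0 negb_or => /andP[_ h]; exists a.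
Qed.
Lemma qf_supp J x t : qf J x t != 0 -> exists2 a, dn a t & x (sw a t) != 0.
Proof.
elim: J => [|a J IH] /=; first by rewrite eqxx.
have [->|h _] := eqVneq (qf J x t) 0; last exact: IH.
by rewrite mulr0 add0r; case: ifP => [ua h|_]; [exists a|rewrite eqxx].
Qed.

Lemma qeD J x y t : qe J (fun s => x s + y s) t = qe J x t + qe J y t.
Proof. by elim: J => [|i J IH] /=; rewrite ?addr0 // IH; case: ifP => _; ring. Qed.
Lemma qfD J x y t : qf J (fun s => x s + y s) t = qf J x t + qf J y t.
Proof. by elim: J => [|i J IH] /=; rewrite ?addr0 // IH; case: ifP => _; ring. Qed.

Lemma qe_mul J m x t : (forall i, i \in J -> m (sw i t) = m t) ->
  qe J (fun s => m s * x s) t = m t * qe J x t.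
Proof.
elim: J => [|i J IH] h; first by rewrite mulr0.
rewrite !qeS IH => [|j jJ]; last by apply: h; rewrite inE jJ orbT.
by case: ifP => _; rewrite ?h ?inE ?eqxx //; ring.
Qed.

Lemma qf_mul J m c x t : (forall i, i \in J -> dn i t -> m (sw i t) = c * m t) ->
  qf J (fun s => m s * x s) t = c * m t * qf J x t.
Proof.
elim: J => [|i J IH] h; first by rewrite mulr0.
rewrite !qfS IH => [|j jJ]; last by apply: h; rewrite inE jJ orbT.
by case: ifP => di; rewrite ?h ?inE ?eqxx //; ring.
Qed.
End OneChain.

(** A partial step s, defined where b holds, that does not change the signs of a chain
    commutes with its operators. *)
Section Step.
Variables (T : Type) (I : eqType) (sw : I -> T -> T) (up dn : I -> T -> bool).
Variables (K : fieldType) (p : K).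
Hypothesis ch : chain sw up dn.
Hypothesis p0 : p != 0.
Variables (s : T -> T) (b : T -> bool) (J : seq I).
Hypothesis far : forall i t, i \in J ->
  [/\ up i (s t) = up i t, dn i (s t) = dn i t, sw i (s t) = s (sw i t) & b (sw i t) = b t].
Definition stp (K : fieldType) (x : T -> K) t := if b t then x (s t) else 0.

Lemma qe_stp x t : qe sw up dn p J (stp x) t = stp (qe sw up dn p J x) t.
Proof.
rewrite /stp; elim: J far => [|i J' IH] fr /=; first by case: ifP.
rewrite IH => [|j t' jJ]; last by apply: fr; rewrite inE jJ orbT.
have [|h1 h2 h3 h4] := fr i t; first by rewrite inE eqxx.
have [||e1 e2 _ _] := @eq_sg _ (up^~ (s t)) (dn^~ (s t)) (up^~ t) (dn^~ t) J'.
- by move=> j jJ; have [] := fr j t; rewrite ?inE ?jJ ?orbT.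
- by move=> j jJ; have [] := fr j t; rewrite ?inE ?jJ ?orbT.
rewrite /ch_eps /ch_phi e1 e2 h1 h3 h4.
by case: (b t); case: ifP; rewrite ?addr0 // mulr0 addr0.
Qed.

Lemma qf_stp x t : qf sw up dn p J (stp x) t = stp (qf sw up dn p J x) t.
Proof.
rewrite /stp; elim: J far => [|i J' IH] fr /=; first by case: ifP.
rewrite IH => [|j t' jJ]; last by apply: fr; rewrite inE jJ orbT.
have [|h1 h2 h3 h4] := fr i t; first by rewrite inE eqxx.
rewrite /psg h1 h2 h3 h4.
by case: (b t); case: (dn i t); rewrite ?mulr0 ?addr0.
Qed.
End Step.

(** Two chains A and B over the same sites, which interact only at equal sites; c is
    the entry of the Cartan matrix for A and B, and del says that they are equal. *)
Section Commutator.
Variables (T : Type) (I : eqType).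
Variables (swA : I -> T -> T) (upA dnA : I -> T -> bool).
Variables (swB : I -> T -> T) (upB dnB : I -> T -> bool).
Variables (K : fieldType) (p : K).
Hypothesis chA : chain swA upA dnA.
Hypothesis chB : chain swB upB dnB.
Hypotheses (p0 : p != 0) (p1 : p ^+ 2 - 1 != 0).
Hypothesis farA : forall a b t, a != b ->
  [/\ upA a (swB b t) = upA a t, dnA a (swB b t) = dnA a t,
      upB b (swA a t) = upB b t, dnB b (swA a t) = dnB b t &
      swA a (swB b t) = swB b (swA a t)].
Variables (c : int) (del : bool).
Local Notation sgA := (site_sign upA dnA).
Local Notation sgB := (site_sign upB dnB).
Hypothesis sgBA : forall a t, upA a t -> sgB a (swA a t) = sgB a t - c.
Hypothesis sgAB : forall a t, dnB a t -> sgA a (swB a t) = sgA a t + c.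
Hypothesis delE : del -> forall a t, sgB a t = sgA a t.
Hypothesis same : forall a (x : T -> K) t,
  (if upA a t then if dnB a (swA a t) then x (swB a (swA a t)) else 0 else 0)
  - (if dnB a t then if upA a (swB a t) then x (swA a (swB a t)) else 0 else 0)
  = if del then (sgA a t)%:~R * x t else 0.
Local Notation qeA := (qe swA upA dnA p).
Local Notation qfB := (qf swB upB dnB p).
Local Notation hA := (chain_wt upA dnA).
Local Notation zint := (fun z : int => (p ^ z - p ^ (- z)) / (p - p^-1)).

Lemma zint_add (s h : int) : s = 1 \/ s = 0 \/ s = -1 ->
  zint (s + h) = p ^ s * zint h + p ^ (- h) * s%:~R.
Proof.
have ph : p ^ h != 0 by rewrite expfz_eq0 (negbTE p0) andbF.
have pp : p * p - 1 != 0 by rewrite -expr2.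
have E z w : p ^ (z + w) = p ^ z * p ^ w by exact: expfzDr.
have V z : p ^ (- z) = (p ^ z)^-1 by rewrite invr_expz.
move=> [->|[->|->]]; rewrite !(V, E).
- by rewrite rmorph1 expr1z; field; rewrite p0 pp ph.
- by rewrite expr0z !mul1r rmorph0 mulr0 addr0.
- by rewrite rmorphN1 expr1z; field; rewrite p0 pp ph.
Qed.

Lemma sgn_cases a t : sgA a t = 1 \/ sgA a t = 0 \/ sgA a t = -1.
Proof.
have := ch_ud chA t a; rewrite /site_sign; case: (upA a t); case: (dnA a t) => //= _.
- by left. - by right; right. - by right; left.
Qed.

Lemma hA_swB b J t : uniq J -> b \in J -> dnB b t -> hA J (swB b t) = hA J t + c.
Proof.
move=> uJ bJ db; rewrite !(chwt_sum chA) !(big_rem b bJ) /= sgAB //.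
have -> : \sum_(a <- rem b J) sgA a (swB b t) = \sum_(a <- rem b J) sgA a t.
  rewrite big_seq [RHS]big_seq; apply: eq_bigr => a; rewrite mem_rem_uniq // inE => /andP[ab _].
  by have [h1 h2 _ _ _] := farA t ab; rewrite /site_sign h1 h2.
ring.
Qed.

(** Induction on the sites.  In the terms where e and f act on different parts of the
    sequence, moving one past the other produces p ^ (- c) twice, so that they cancel;
    the rest is the commutator at the first site and that of the shorter sequence,
    which zint_add combines into the q-integer of the weight. *)
Lemma commutator J x t : uniq J ->
  qeA J (qfB J x) t - qfB J (qeA J x) t = if del then zint (hA J t) * x t else 0.
Proof.
elim: J x t => [|a J IH] x t.
  rewrite /= subr0 /chain_wt /= => _; case: ifP => // _.
  by rewrite subrr !mul0r.
rewrite cons_uniq => /andP[aJ uJ].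
have aN b : b \in J -> a != b by apply: contraTneq => <-.
have bN b : b \in J -> b != a by rewrite eq_sym; exact: aN.
pose E (y : T -> K) t := if upA a t then y (swA a t) else 0.
pose F (y : T -> K) t := if dnB a t then y (swB a t) else 0.
pose g t := p ^ sgB a t.
pose k t := p ^ (- hA J t).
have qeE y s : qeA (a :: J) y s = qeA J y s + k s * E y s by rewrite (qeS _ _ _ p0).
have qfE y s : qfB (a :: J) y s = g s * qfB J y s + F y s by rewrite (qfS _ chB).
rewrite qeE qfE (eq_qe _ _ _ _ _ (qfE x)) (eq_qf _ _ _ _ _ (qeE x)) qeD qfD.
have -> : E (qfB (a :: J) x) t = E (fun s => g s * qfB J x s) t + E (F x) t.
  by rewrite /E; case: ifP => _; rewrite ?qfE ?addr0.
have -> : F (qeA (a :: J) x) t = F (qeA J x) t + F (fun s => k s * E x s) t.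
  by rewrite /F; case: ifP => _; rewrite ?qeE ?addr0.
rewrite (@qe_mul _ _ _ _ _ _ _ p0 _ g); last first.
  by move=> b bJ; rewrite /g; have [_ _ h1 h2 _] := farA t (bN b bJ); rewrite /site_sign h1 h2.
have -> : qeA J (F x) t = F (qeA J x) t.
  apply: (@qe_stp _ _ _ _ _ _ p (swB a) (dnB a)) => b s bJ.
  by have [h1 h2 h3 h4 h5] := farA s (bN b bJ).
have -> : qfB J (fun s => k s * E x s) t = p ^ (- c) * k t * E (qfB J x) t.
  rewrite (@qf_mul _ _ _ _ _ _ p chB _ _ (p ^ (- c))).
    congr (_ * _); apply: (@qf_stp _ _ _ _ _ _ p (swA a) (upA a)) => b s bJ.
    by have [h1 h2 h3 h4 h5] := farA s (aN b bJ).
  by move=> b bJ db; rewrite /k hA_swB // (opprD (hA J t)) (expfzDr _ _ p0) mulrC.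
have -> : E (fun s => g s * qfB J x s) t = p ^ (- c) * g t * E (qfB J x) t.
  by rewrite /E; case: ifP => ua; rewrite ?mulr0 // /g sgBA // expfzDr // [g t * _]mulrC.
have -> : F (fun s => k s * E x s) t = k t * F (E x) t.
  rewrite /F; case: ifP => da; rewrite ?mulr0 // /k; congr (p ^ (- _) * _).
  rewrite !(chwt_sum chA) big_seq [RHS]big_seq; apply: eq_bigr => b bJ.
  by have [h1 h2 _ _ _] := farA t (bN b bJ); rewrite /site_sign h1 h2.
have := same a x t; rewrite -/(E _ t).
have -> : (if upA a t then if dnB a (swA a t) then x (swB a (swA a t)) else 0 else 0) = E (F x) t by [].
have -> : (if dnB a t then if upA a (swB a t) then x (swA a (swB a t)) else 0 else 0) = F (E x) t by [].
move=> sE.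
transitivity (g t * (qeA J (qfB J x) t - qfB J (qeA J x) t) + k t * (E (F x) t - F (E x) t)).
  ring.
rewrite sE IH //; case: ifP => hd; last by rewrite !mulr0 addr0.
rewrite (chwt_cons chA) zint_add; last exact: sgn_cases.
by rewrite /g /k (delE hd); ring.
Qed.
End Commutator.

Section QCross.
Variables (T : Type) (Ic Ir : eqType).
Variables (swc : Ic -> T -> T) (upc dnc : Ic -> T -> bool).
Variables (swr : Ir -> T -> T) (upr dnr : Ir -> T -> bool).
Variables (J1 Mc J2 : seq Ic) (R1 Mr R2 : seq Ir).
Hypothesis cr : cross swc upc dnc swr upr dnr J1 Mc J2 R1 Mr R2.
Variables (K : fieldType) (p P : K).
Hypotheses (p0 : p != 0) (P0 : P != 0).
Local Notation qf := (qf swc upc dnc p).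
Local Notation qe := (qe swr upr dnr P).
Local Notation hc := (chain_wt upc dnc).
Local Notation hr := (chain_wt upr dnr).
Hypothesis hcM : forall i t, i \in Mr -> hc Mc (swr i t) = hc Mc t.
Hypothesis hrM : forall j t, j \in Mc -> hr Mr (swc j t) = hr Mr t.
Hypothesis mid : forall x t, qf Mc (qe Mr x) t = qe Mr (qf Mc x) t.
Let chc := cr_c cr.
Let chr := cr_r cr.

Lemma far_comm Ja Rb x t :
  (forall j i, j \in Ja -> i \in Rb -> (j \notin Mc) || (i \notin Mr)) ->
  qf Ja (qe Rb x) t = qe Rb (qf Ja x) t.
Proof.
elim: Ja t => [|j Ja IH] t far; first by rewrite (qe0 _ _ _ P).
rewrite (qfS _ chc) (eq_qe _ _ _ _ _ (qfS p chc j Ja x)) qeD.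
rewrite IH; last by move=> j' i jJ; apply: far; rewrite inE jJ orbT.
congr (_ + _); first rewrite (@qe_mul _ _ _ _ _ _ _ P0 _ (fun t => p ^ site_sign upc dnc j t)) //.
  move=> i iR; have [|_ _ h1 h2 _] := cr_far cr (i := i) (j := j) t; first by apply: far; rewrite ?inE ?eqxx.
  by rewrite /site_sign h1 h2.
symmetry; apply: (@qe_stp _ _ _ _ _ _ P (swc j) (dnc j)) => i s iR.
have [|h1 h2 h3 h4 h5] := cr_far cr (i := i) (j := j) s; first by apply: far; rewrite ?inE ?eqxx.
by [].
Qed.

Let J1N j : j \in J1 -> j \notin Mc.
Proof.
have := cr_J cr; rewrite cat_uniq => /and3P[_ /hasPn h _] jJ.
by apply: contraL jJ => jM; apply: h; rewrite mem_cat jM.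
Qed.
Let J2N j : j \in J2 -> j \notin Mc.
Proof. by have := cr_J cr; rewrite !cat_uniq => /and3P[_ _ /and3P[_ /hasPn h _]] /h. Qed.
Let R1N j : j \in R1 -> j \notin Mr.
Proof.
have := cr_R cr; rewrite cat_uniq => /and3P[_ /hasPn h _] jJ.
by apply: contraL jJ => jM; apply: h; rewrite mem_cat jM.
Qed.
Let R2N j : j \in R2 -> j \notin Mr.
Proof. by have := cr_R cr; rewrite !cat_uniq => /and3P[_ _ /and3P[_ /hasPn h _]] /h. Qed.

Let hr_far j R t : (forall i, i \in R -> (j \notin Mc) || (i \notin Mr)) -> hr R (swc j t) = hr R t.
Proof.
move=> far; rewrite !(chwt_sum chr) big_seq [RHS]big_seq; apply: eq_bigr => i iR.
by have [|h1 h2 _ _ _] := cr_far cr (i := i) (j := j) t; [exact: far|rewrite /site_sign h1 h2].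
Qed.
Let hc_far i J t : (forall j, j \in J -> (j \notin Mc) || (i \notin Mr)) -> hc J (swr i t) = hc J t.
Proof.
move=> far; rewrite !(chwt_sum chc) big_seq [RHS]big_seq; apply: eq_bigr => j jJ.
by have [|_ _ h1 h2 _] := cr_far cr (i := i) (j := j) t; [exact: far|rewrite /site_sign h1 h2].
Qed.

(** e for a sequence of sites is assembled from its parts with powers of P whose
    exponents are weights of parts; f on the block Mc preserves these weights. *)
Lemma mid_comm x t : qf Mc (qe (R1 ++ Mr ++ R2) x) t = qe (R1 ++ Mr ++ R2) (qf Mc x) t.
Proof.
have E y s : qe (R1 ++ Mr ++ R2) y s =
   qe R2 y s + P ^ (- hr R2 s) * (qe Mr y s + P ^ (- hr Mr s) * qe R1 y s).
  rewrite !(qe_cat chr P0) (chwt_cat chr) (opprD (hr Mr s)) (expfzDr _ _ P0).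
  move: (P ^ _) (P ^ _) => B C; ring.
rewrite (eq_qf _ _ _ _ _ (E x)) qfD E.
rewrite (@qf_mul _ _ _ _ _ _ p chc _ (fun s => P ^ (- hr R2 s)) 1); last first.
  by move=> j jM _; rewrite mul1r hr_far // => i /R2N ->; rewrite orbT.
rewrite qfD (@qf_mul _ _ _ _ _ _ p chc _ (fun s => P ^ (- hr Mr s)) 1); last first.
  by move=> j jM _; rewrite mul1r hrM.
rewrite !mul1r mid !far_comm // => j i _; first by move=> /R1N ->; rewrite orbT.
by move=> /R2N ->; rewrite orbT.
Qed.

Lemma qcross x t : qf (J1 ++ Mc ++ J2) (qe (R1 ++ Mr ++ R2) x) t =
  qe (R1 ++ Mr ++ R2) (qf (J1 ++ Mc ++ J2) x) t.
Proof.
have E y s : qf (J1 ++ Mc ++ J2) y s =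
   qf J1 y s + p ^ hc J1 s * (qf Mc y s + p ^ hc Mc s * qf J2 y s).
  rewrite !(qf_cat chc p0); move: (p ^ _) (p ^ _) => B C; ring.
rewrite (eq_qe _ _ _ _ _ (E x)) qeD E.
rewrite (@qe_mul _ _ _ _ _ _ _ P0 _ (fun s => p ^ hc J1 s)); last first.
  by move=> i iR; rewrite hc_far // => j /J1N ->.
rewrite qeD (@qe_mul _ _ _ _ _ _ _ P0 _ (fun s => p ^ hc Mc s)); last first.
  move=> i iR; have [iM|iM] := boolP (i \in Mr); first by rewrite hcM.
  by rewrite hc_far // => j _; rewrite iM orbT.
by rewrite mid_comm !far_comm // => j i; [move=> /J2N ->|move=> /J1N ->].
Qed.
End QCross.

(** The two families act on the four bits with the parameters p and - p: with this
    sign the actions of the two quantum groups commute, as in skew Howe duality. *)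
Section QBlock22.
Variables (T : Type) (A : eqType) (get : T -> A -> bool) (put : A -> bool -> T -> T).
Hypothesis gr : grid get put.
Variables (a b c d : A).
Hypothesis abcd : uniq [:: a; b; c; d].
Variables (Ic Ir : eqType) (k k' : Ic) (lo hi : Ir).
Variables (swc : Ic -> T -> T) (upc dnc : Ic -> T -> bool).
Variables (swr : Ir -> T -> T) (upr dnr : Ir -> T -> bool).
Hypothesis sck : swc k = swp get put a c. Hypothesis sck' : swc k' = swp get put b d.
Hypothesis uck : upc k = grid_up get a c. Hypothesis uck' : upc k' = grid_up get b d.
Hypothesis dck : dnc k = grid_dn get a c. Hypothesis dck' : dnc k' = grid_dn get b d.
Hypothesis srl : swr lo = swp get put a b. Hypothesis srh : swr hi = swp get put c d.
Hypothesis url : upr lo = grid_up get a b. Hypothesis urh : upr hi = grid_up get c d.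
Hypothesis drl : dnr lo = grid_dn get a b. Hypothesis drh : dnr hi = grid_dn get c d.
Variables (K : fieldType) (p : K).
Hypothesis p0 : p != 0.
Local Notation put4 := (put4 put a b c d).

Lemma qf_put4 x t v1 v2 v3 v4 :
  qf swc upc dnc p [:: k'; k] x (put4 t v1 v2 v3 v4) =
  (if v2 && ~~ v4 then p else if ~~ v2 && v4 then p^-1 else 1)
    * (if ~~ v1 && v3 then x (put4 t v3 v2 v1 v4) else 0)
  + (if ~~ v2 && v4 then x (put4 t v1 v4 v3 v2) else 0).
Proof.
have [s1 s2 s3 s4] := swp4 gr abcd t v1 v2 v3 v4; have [ga gb gc gd] := get4 gr abcd t v1 v2 v3 v4.
rewrite /= /psg !(uck, uck', dck, dck', sck, sck') /grid_up /grid_dn ga gb gc gd s3 s4.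
by rewrite mulr0 add0r.
Qed.

Lemma qe_put4 x t v1 v2 v3 v4 :
  qe swr upr dnr (- p) [:: lo; hi] x (put4 t v1 v2 v3 v4) =
  (if v3 && ~~ v4 then x (put4 t v1 v2 v4 v3) else 0)
  + (if v1 && ~~ v2 then (- p) ^+ (~~ v3 && v4) / (- p) ^+ (v3 && ~~ v4) * x (put4 t v2 v1 v3 v4) else 0).
Proof.
have [s1 s2 s3 s4] := swp4 gr abcd t v1 v2 v3 v4; have [ga gb gc gd] := get4 gr abcd t v1 v2 v3 v4.
rewrite /= /ch_eps /ch_phi /= !(url, urh, drl, drh, srl, srh) /grid_up /grid_dn ga gb gc gd s1 s2.
rewrite !sub0n !subn0 !addn0 !expr0 invr1 !mul1r add0r; congr (_ + _).
Qed.

Lemma qmid x t : qf swc upc dnc p [:: k'; k] (qe swr upr dnr (- p) [:: lo; hi] x) t =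
  qe swr upr dnr (- p) [:: lo; hi] (qf swc upc dnc p [:: k'; k] x) t.
Proof.
rewrite [t](put4E gr a b c d); move: (get t a) (get t b) (get t c) (get t d) => v1 v2 v3 v4.
rewrite qf_put4 qe_put4 !qe_put4 !qf_put4.
case: v1 v2 v3 v4 => -[] [] [] /=; rewrite ?expr0 ?expr1 ?invr1 ?mulr0 ?mul0r ?addr0 ?add0r ?mul1r ?mulr1 //; try (by field; rewrite ?oppr_eq0 ?p0).
Qed.

Lemma hmid_c i t : i \in [:: lo; hi] ->
  chain_wt upc dnc [:: k'; k] (swr i t) = chain_wt upc dnc [:: k'; k] t.
Proof.
rewrite [t](put4E gr a b c d); move: (get t a) (get t b) (get t c) (get t d) => v1 v2 v3 v4.
have [s1 s2 s3 s4] := swp4 gr abcd t v1 v2 v3 v4.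
rewrite !inE => /orP[]/eqP ->; rewrite ?srl ?srh ?s1 ?s2;
rewrite /chain_wt /ch_eps /ch_phi /= !(uck, uck', dck, dck') /grid_up /grid_dn;
have [-> -> -> ->] := get4 gr abcd t v1 v2 v3 v4.
  have [-> -> -> ->] := get4 gr abcd t v2 v1 v3 v4.
  by case: v1 v2 v3 v4 {s1 s2 s3 s4} => -[] [] [].
have [-> -> -> ->] := get4 gr abcd t v1 v2 v4 v3.
by case: v1 v2 v3 v4 {s1 s2 s3 s4} => -[] [] [].
Qed.

Lemma hmid_r j t : j \in [:: k'; k] ->
  chain_wt upr dnr [:: lo; hi] (swc j t) = chain_wt upr dnr [:: lo; hi] t.
Proof.
rewrite [t](put4E gr a b c d); move: (get t a) (get t b) (get t c) (get t d) => v1 v2 v3 v4.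
have [s1 s2 s3 s4] := swp4 gr abcd t v1 v2 v3 v4.
rewrite !inE => /orP[]/eqP ->; rewrite ?sck ?sck' ?s3 ?s4;
rewrite /chain_wt /ch_eps /ch_phi /= !(url, urh, drl, drh) /grid_up /grid_dn;
have [-> -> -> ->] := get4 gr abcd t v1 v2 v3 v4.
  have [-> -> -> ->] := get4 gr abcd t v1 v4 v3 v2.
  by case: v1 v2 v3 v4 {s1 s2 s3 s4} => -[] [] [].
have [-> -> -> ->] := get4 gr abcd t v3 v2 v1 v4.
by case: v1 v2 v3 v4 {s1 s2 s3 s4} => -[] [] [].
Qed.
End QBlock22.

(** Take a subspace of largest dimension among those whose vectors satisfy Q. *)
Lemma vspace_of_pred (K : fieldType) (V : vectType K) (Q : V -> Prop) :
  Q 0 -> (forall a u v, Q u -> Q v -> Q (a *: u + v)) ->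
  exists U : {vspace V}, forall u, u \in U <-> Q u.
Proof.
move=> Q0 Ql.
suff H k : (exists2 U : {vspace V}, forall u, u \in U -> Q u & (k <= \dim U)%N) \/
   exists U : {vspace V}, forall u, u \in U <-> Q u.
  have [[U _]|//] := H (\dim {:V}).+1.
  by have := dimvS (subvf U); lia.
elim: k => [|k [[U QU kU]|]]; [|have [h|h] := pselect (forall u, Q u -> u \in U)|by right].
- by left; exists 0%VS => // u; rewrite memv0 => /eqP ->.
- by right; exists U => u; split=> [/QU|/h].
- left; have [u] : exists u, Q u /\ u \notin U.
    apply: contrapT => nex; apply: h => u Qu; apply: contrapT => uU; apply: nex.
    by exists u; split=> //; apply/negP.
  move=> [Qu uU]; exists (<[u]> + U)%VS.
    by move=> w /memv_addP [_ /vlineP[a ->] [w2 /QU Qw2 ->]]; apply: Ql.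
  suff: (\dim U < \dim (<[u]> + U)%VS)%N by lia.
  rewrite ltn_neqAle dimvS ?addvSr // andbT; apply: contra uU => dU.
  have /eqP -> : (U == <[u]> + U)%VS by rewrite eqEdim addvSr /= (eqP dU).
  by rewrite (subvP (addvSl _ _)) ?memv_line.
Qed.

(** An irreducible module V with a highest weight vector v0 is compared with the
    functions on T, on which operators with the same commutation relations act, and
    where w0 is a function of the same weight killed by all e_i.  The vectors of V and
    the functions generated by w0 are both written as formal combinations of words in
    the f_i; the point is that these have the same relations. *)
Section Rep.
Variables (K : fieldType) (q : K) (cst : rat -> K) (reg : K -> Prop) (ev : K -> rat).
Hypothesis qr : qring q cst reg ev.
Variables (N : eqType) (P : finType) (lo hi : N -> P) (rho : P -> nat).
Hypothesis rho_root : forall i, rho (lo i) = (rho (hi i)).+1.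
Definition rootw (i : N) (j : P) : int := (j == lo i)%:Z - (j == hi i)%:Z.
Variables (V : vectType K) (e f : N -> 'End(V)) (t tV : P -> 'End(V)).
Hypothesis tK : forall j v, tV j (t j v) = v.
Hypothesis tf : forall j i v, t j (f i v) = q ^ (- rootw i j) *: f i (t j v).
Hypothesis ef : forall i k v, e i (f k v) - f k (e i v) =
    if i == k then (q - q^-1)^-1 *:
      (t (lo i) (tV (hi i) v) - tV (lo i) (t (hi i) v)) else 0.
Variable lam : P -> int.
Variable v0 : V.
Hypothesis v0_neq0 : v0 != 0.
Hypothesis v0_wt : forall j, t j v0 = q ^ lam j *: v0.
Hypothesis v0_e : forall i, e i v0 = 0.
Hypothesis irr : forall U : {vspace V},
  (forall i v, v \in U -> e i v \in U) -> (forall i v, v \in U -> f i v \in U) ->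
  (forall j v, v \in U -> t j v \in U) -> (forall j v, v \in U -> tV j v \in U) ->
  U = 0%VS \/ U = fullv.

Variables (T : finType) (I : eqType) (sw : N -> I -> T -> T) (up dn : N -> I -> T -> bool).
Variables (J : seq I) (wt : T -> P -> int) (b0 : T).
Hypothesis ch : forall i, chain (sw i) (up i) (dn i).
Hypothesis uJ : uniq J.
Hypothesis wt_sw : forall i a s j, dn i a s -> wt (sw i a s) j = wt s j + rootw i j.
Hypothesis b0_wt : forall j, wt b0 j = lam j.
Local Notation eW i := (qe (sw i) (up i) (dn i) q J).
Local Notation fW i := (qf (sw i) (up i) (dn i) q J).
Local Notation ceW i := (ch_e (sw i) (up i) (dn i) J).
Local Notation cfW i := (ch_f (sw i) (up i) (dn i) J).
Definition zint (z : int) : K := (q ^ z - q ^ (- z)) / (q - q^-1).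
Hypothesis efW : forall i k (x : T -> K) s, eW i (fW k x) s - fW k (eW i x) s =
  if i == k then zint (wt s (lo i) - wt s (hi i)) * x s else 0.
Definition w0 : T -> K := fun s => (s == b0)%:R.
Hypothesis w0_e : forall i s, eW i w0 s = 0.
(* A class of functions that contains the image of V and whose regular members are
   supported, at q = 0, on states that are highest only for b0. *)
Variable Zp : (T -> K) -> Prop.
Hypothesis Zp_w0 : Zp w0.
Hypothesis Zp_ext : forall x y, x =1 y -> Zp x -> Zp y.
Hypothesis Zp0 : Zp (fun _ => 0).
Hypothesis Zp_lin : forall (a : K) x y, Zp x -> Zp y -> Zp (fun s => a * x s + y s).
Hypothesis Zp_f : forall i x, Zp x -> Zp (fW i x).
Hypothesis Zp_hw : forall x, Zp x -> (forall s, reg (x s)) -> forall s, ev (x s) != 0 ->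
  (forall i, ceW i s = None) -> s = b0.

Let qn0 : q != 0 := qr_q qr.

Lemma qe_lin i (a : K) x y s :
  eW i (fun r => a * x r + y r) s = a * eW i x s + eW i y s.
Proof.
elim: J => [|b J' IH] /=; first by rewrite mulr0 addr0.
by rewrite IH; case: ifP => _; ring.
Qed.
Lemma qf_lin i (a : K) x y s :
  fW i (fun r => a * x r + y r) s = a * fW i x s + fW i y s.
Proof.
elim: J => [|b J' IH] /=; first by rewrite mulr0 addr0.
by rewrite IH; case: ifP => _; ring.
Qed.

Lemma qf_wt i x s : fW i x s != 0 ->
  exists2 r, x r != 0 & forall j, wt r j = wt s j + rootw i j.
Proof. by move=> nz; have [a da xs] := qf_supp nz; exists (sw i a s) => // j; exact: wt_sw. Qed.

Definition FV (A : seq N) : V := foldr (fun i v => f i v) v0 A.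
Definition FW (A : seq N) : T -> K := foldr (fun i x => fW i x) w0 A.
Definition awt (A : seq N) (j : P) : int := lam j - \sum_(i <- A) rootw i j.

Lemma awt_cons i A j : awt (i :: A) j = awt A j - rootw i j.
Proof. rewrite /awt big_cons; ring. Qed.

Lemma t_FV j A : t j (FV A) = q ^ awt A j *: FV A.
Proof.
elim: A => [|i A IH] /=; first by rewrite v0_wt /awt big_nil subr0.
rewrite tf IH linearZ scalerA -expfzDr // awt_cons; congr (q ^ _ *: _); ring.
Qed.

Lemma tV_FV j A : tV j (FV A) = q ^ (- awt A j) *: FV A.
Proof.
have := tK j (FV A); rewrite t_FV linearZ => /(congr1 (fun v => q ^ (- awt A j) *: v)).
by rewrite scalerA -expfzDr // addNr expr0z scale1r.
Qed.

Lemma FW_supp A s : FW A s != 0 -> forall j, wt s j = awt A j.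
Proof.
elim: A s => [|i A IH] s /=.
  rewrite /w0; case: (eqVneq s b0) => [-> _ j|_]; last by rewrite eqxx.
  by rewrite b0_wt /awt big_nil subr0.
move=> /qf_wt[r /IH h1 h2] j; have := h2 j; rewrite h1 awt_cons => ->; ring.
Qed.

Definition evV (X : seq (K * seq N)) : V := \sum_(c <- X) c.1 *: FV c.2.
Definition evW (X : seq (K * seq N)) (s : T) : K := \sum_(c <- X) c.1 * FW c.2 s.
Definition top (X : seq (K * seq N)) : K := \sum_(c <- X | c.2 == [::]) c.1.

Definition rhow (mu : P -> int) : int := \sum_j (rho j)%:Z * mu j.

Lemma rhow_root i : rhow (rootw i) = 1.
Proof.
rewrite /rhow (eq_bigr (fun j => (j == lo i)%:Z * (rho j)%:Z - (j == hi i)%:Z * (rho j)%:Z)); last first.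
  by move=> j _; rewrite /rootw; ring.
rewrite big_split /= sumrN.
have H l : \sum_(j : P) (j == l)%:Z * (rho j)%:Z = (rho l)%:Z.
  by rewrite (bigD1 l) //= eqxx mul1r big1 ?addr0 // => j /negbTE ->; rewrite mul0r.
by rewrite !H rho_root; move: (rho _) => z; clear; lia.
Qed.

Lemma rhow_awt A : rhow (awt A) = rhow lam - (size A)%:Z.
Proof.
elim: A => [|i A IH].
  by rewrite subr0; apply: eq_bigr => j _; rewrite /awt big_nil subr0.
transitivity (rhow (awt A) - rhow (rootw i)).
  by rewrite /rhow -sumrB; apply: eq_bigr => j _; rewrite awt_cons mulrBr.
rewrite IH rhow_root /=; lia.
Qed.

Lemma FW_b0 A : A != [::] -> FW A b0 = 0.
Proof.
move=> A0; apply/eqP; apply: contraNT A0 => /FW_supp h.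
have : rhow lam = rhow (awt A) by apply: eq_bigr => j _; rewrite -h b0_wt.
by rewrite rhow_awt; case: A {h} => //= i A; lia.
Qed.

Lemma evW_b0 X : evW X b0 = top X.
Proof.
rewrite /evW /top [RHS]big_mkcond; apply: eq_bigr => -[c A] _ /=.
by case: eqP => [->|/eqP/FW_b0 ->]; rewrite ?mulr0 //= /w0 eqxx mulr1.
Qed.

Definition Xf i (X : seq (K * seq N)) := [seq (c.1, i :: c.2) | c <- X].
Definition Xz (a : K) (X : seq (K * seq N)) := [seq (a * c.1, c.2) | c <- X].
Definition Xg (g : (P -> int) -> K) (X : seq (K * seq N)) :=
  [seq (g (awt c.2) * c.1, c.2) | c <- X].

Lemma evV_f i X : evV (Xf i X) = f i (evV X).
Proof.
by rewrite /evV big_map linear_sum; apply: eq_bigr => c _; rewrite linearZ.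
Qed.

Lemma evW_f i X s : evW (Xf i X) s = fW i (evW X) s.
Proof.
rewrite /evW big_map; elim: X s => [|c X IH] s.
  by rewrite big_nil -[LHS](qf0 (sw i) (up i) (dn i) q J s); apply: eq_qf => r; rewrite /evW big_nil.
rewrite big_cons IH -qf_lin; apply: eq_qf => r; by rewrite big_cons.
Qed.

Lemma evV_cat X Y : evV (X ++ Y) = evV X + evV Y.
Proof. by rewrite /evV big_cat. Qed.
Lemma evW_cat X Y s : evW (X ++ Y) s = evW X s + evW Y s.
Proof. by rewrite /evW big_cat. Qed.
Lemma evV_z a X : evV (Xz a X) = a *: evV X.
Proof. by rewrite /evV big_map scaler_sumr; apply: eq_bigr => c _; rewrite scalerA. Qed.
Lemma evW_z a X s : evW (Xz a X) s = a * evW X s.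
Proof. by rewrite /evW big_map mulr_sumr; apply: eq_bigr => c _; rewrite mulrA. Qed.

(** e_i applied to a word, moved to the right by the commutation relations. *)
Fixpoint ecomb (i : N) (A : seq N) : seq (K * seq N) :=
  if A is j :: A' then
    Xf j (ecomb i A') ++ (if i == j then [:: (zint (awt A' (lo i) - awt A' (hi i)), A')] else [::])
  else [::].

Lemma evV_ecomb i A : evV (ecomb i A) = e i (FV A).
Proof.
elim: A => [|j A IH] /=; first by rewrite v0_e /evV big_nil.
rewrite evV_cat evV_f IH; have /eqP := ef i j (FV A); rewrite subr_eq addrC => /eqP ->.
congr (_ + _); case: eqP => [_|_]; last by rewrite /evV big_nil.
rewrite /evV big_seq1 /= !(tV_FV, t_FV) !linearZ /= !(tV_FV, t_FV) !scalerA -!expfzDr //.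
rewrite scalerN scalerA -expfzDr // -scalerBl scalerA /zint mulrC; congr (_ * (q ^ _ - q ^ _) *: _); ring.
Qed.

Lemma evW_ecomb i A s : evW (ecomb i A) s = eW i (FW A) s.
Proof.
elim: A s => [|j A IH] s /=; first by rewrite w0_e /evW big_nil.
rewrite evW_cat evW_f (eq_qf _ _ _ _ _ IH); have /eqP := efW i j (FW A) s; rewrite subr_eq addrC => /eqP ->.
congr (_ + _); case: eqP => [_|_]; last by rewrite /evW big_nil.
rewrite /evW big_seq1 /=; have [->|/FW_supp h] := eqVneq (FW A s) 0; first by rewrite !mulr0.
by rewrite !h.
Qed.

Definition Xe i (X : seq (K * seq N)) := flatten [seq Xz c.1 (ecomb i c.2) | c <- X].

Lemma evV_e i X : evV (Xe i X) = e i (evV X).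
Proof.
elim: X => [|c X IH]; first by rewrite /evV !big_nil linear0.
rewrite /= evV_cat -/(Xe i X) IH evV_z evV_ecomb -linearZ -linearD.
by rewrite [in RHS]/evV big_cons.
Qed.

Lemma evW_e i X s : evW (Xe i X) s = eW i (evW X) s.
Proof.
elim: X => [|c X IH].
  by rewrite /evW big_nil -[LHS](qe0 (sw i) (up i) (dn i) q J s); apply: eq_qe => r; rewrite big_nil.
rewrite /= evW_cat -/(Xe i X) IH evW_z evW_ecomb -qe_lin.
by apply: eq_qe => r; rewrite [in RHS]/evW big_cons.
Qed.

Lemma ecomb_size i A c : c \in ecomb i A -> (size c.2).+1 = size A.
Proof.
elim: A c => //= j A IH c; rewrite mem_cat => /orP[/mapP[d /IH <- ->] //|].
by case: ifP => // _; rewrite inE => /eqP ->.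
Qed.

Lemma Xe_size i X M : (forall c, c \in X -> (size c.2 <= M)%N) ->
  forall c, c \in Xe i X -> (size c.2 < M)%N.
Proof.
move=> XM c /flattenP[_ /mapP[d dX ->] /mapP[g /ecomb_size gA ->]] /=.
by rewrite gA XM.
Qed.

(** The operator of weight rho, whose eigenvalue on a word depends on its length. *)
Definition Dop (u : V) : V := foldr (fun j u => iter (rho j) (t j) u) u (enum P).

Lemma iter_lin (g : 'End(V)) k a u v : iter k g (a *: u + v) = a *: iter k g u + iter k g v.
Proof. by elim: k => //= k ->; rewrite linearP. Qed.

Lemma Dop_lin a u v : Dop (a *: u + v) = a *: Dop u + Dop v.
Proof. by rewrite /Dop; elim: (enum P) => //= j s ->; rewrite iter_lin. Qed.

Lemma Dop0 : Dop 0 = 0.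
Proof. by have := Dop_lin (-1) 0 0; rewrite !scaleN1r !addNr. Qed.

Lemma Dop_FV A : Dop (FV A) = q ^ rhow (awt A) *: FV A.
Proof.
rewrite /Dop /rhow -big_enum /=; elim: (enum P) => [|j s IH]; first by rewrite big_nil expr0z scale1r.
rewrite /= IH big_cons expfzDr // -scalerA.
move: (\sum_(_ <- s) _) => z.
have it k : iter k (t j) (q ^ z *: FV A) = q ^ (k%:Z * awt A j) *: (q ^ z *: FV A).
  elim: k => [|k IHk]; first by rewrite mul0r expr0z scale1r.
  rewrite iterS IHk !linearZ /= t_FV !scalerA -!expfzDr //; congr (q ^ _ *: _).
  by rewrite intS mulrDl mul1r; ring.
by rewrite it.
Qed.

Lemma evV_D X : evV (Xg (fun mu => q ^ rhow mu) X) = Dop (evV X).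
Proof.
elim: X => [|c X IH]; first by rewrite /evV !big_nil Dop0.
rewrite /= /evV !big_cons /= -/(evV _) IH Dop_lin Dop_FV scalerA mulrC //.
Qed.

Lemma evV_gB g h X : evV (Xg (fun mu => g mu - h mu) X) = evV (Xg g X) - evV (Xg h X).
Proof.
rewrite /evV !big_map -sumrB; apply: eq_bigr => c _ /=.
by rewrite mulrBl scalerBl.
Qed.

Lemma expq_neq1 k : q ^+ k.+1 != 1.
Proof.
apply/eqP => /(congr1 ev); rewrite (ev0X qr k.+1 (regular0q qr)) (ev0q qr) (ev0_1 qr).
by rewrite exprS mul0r => /eqP; rewrite eq_sym oner_eq0.
Qed.

(** Apply Dop minus its eigenvalue on the words of maximal length, and descend: as q is
    not a root of unity, the coefficient of the empty word is only multiplied by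
    something nonzero. *)
Lemma top_evV X : evV X = 0 -> top X = 0.
Proof.
have [M] : exists M, forall c, c \in X -> (size c.2 <= M)%N.
  elim: X => [|c X [M IH]]; first by exists 0%N.
  exists (maxn (size c.2) M) => d; rewrite inE => /predU1P[->|/IH h]; rewrite leq_max ?leqnn ?h ?orbT //.
elim: M X => [|M IH] X XM X0.
  have : evV X = top X *: v0.
    rewrite /evV /top scaler_suml [RHS]big_mkcond /= big_seq [RHS]big_seq.
    apply: eq_bigr => c /XM; rewrite leqn0 size_eq0 => /eqP -> /=.
    by [].
  rewrite X0 => /esym/eqP; rewrite scaler_eq0 (negbTE v0_neq0) orbF => /eqP //.
pose g mu := q ^ rhow mu - q ^ (rhow lam - M.+1%:Z).
have gX0 : evV (Xg g X) = 0.
  have h : evV (Xg (fun=> q ^ (rhow lam - M.+1%:Z)) X) = q ^ (rhow lam - M.+1%:Z) *: evV X.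
    by rewrite -evV_z.
  by rewrite evV_gB evV_D h X0 Dop0 scaler0 subr0.
pose X' := [seq c <- Xg g X | size c.2 <= M]%N.
have X'0 : evV X' = 0.
  rewrite -gX0 /evV /X' big_filter big_mkcond /=; rewrite big_seq [RHS]big_seq.
  apply: eq_bigr => _ /mapP[c cX ->] /=; case: ifP => // cM.
  have := XM _ cX => cM'; have cE : size c.2 = M.+1 by apply/eqP; rewrite eqn_leq cM' ltnNge cM.
  by rewrite /g rhow_awt cE subrr mul0r scale0r.
have : top X' = 0.
  by apply: IH X'0 => c; rewrite mem_filter => /andP[].
have -> : top X' = g (awt [::]) * top X.
  rewrite /top /X' big_filter_cond big_map mulr_sumr; apply: eq_big => c /=.
    by case: eqP => [->|]; rewrite ?andbF.
  by move=> /andP[_ /eqP ->].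
move=> /eqP; rewrite mulf_eq0 => /orP[|/eqP //].
rewrite /g rhow_awt subr0 expfzDr // -{1}[q ^ _]mulr1 -mulrBr mulf_eq0 expfz_eq0 (negbTE qn0) andbF /=.
rewrite subr_eq0 eq_sym -invr_expz invr_eq1 => h; by have := expq_neq1 M; rewrite h.
Qed.

Lemma Zp_evW X : Zp (evW X).
Proof.
elim: X => [|c X IH].
  by apply: Zp_ext Zp0 => s; rewrite /evW big_nil.
have hF : Zp (FW c.2) by elim: c.2 => //= i A hA; exact: Zp_f.
apply: Zp_ext (Zp_lin c.1 hF IH) => s; by rewrite [in RHS]/evW big_cons.
Qed.

(** Scale y so that its values are regular, and one of them does not vanish at q = 0.
    If every e_i killed y, gam_ker would make the state of this value highest, hence
    equal to b0. *)
Lemma Zp_ker y s : Zp y -> y s != 0 -> y b0 = 0 -> exists i s, eW i y s != 0.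
Proof.
move=> yZ ys yb; apply: contrapT => nex.
have ye i r : eW i y r = 0 by apply/eqP; apply: contrapT => h; apply: nex; exists i, r; apply/negP.
have [y0|[s0 _ [ys0 ry]]] := min_val qr y (enum T).
  by move: ys; rewrite y0 ?mem_enum ?eqxx.
pose y' r := (y s0)^-1 * y r.
have ry' r : reg (y' r) by rewrite /y' mulrC; apply: ry; rewrite mem_enum.
have y'Z : Zp y'.
  by apply: Zp_ext (Zp_lin (y s0)^-1 yZ Zp0) => r; rewrite addr0.
have ev1 : ev (y' s0) = 1 by rewrite /y' mulVf // (ev0_1 qr).
have s0b : s0 = b0.
  apply: (Zp_hw y'Z ry'); first by rewrite ev1 oner_eq0.
  move=> i; apply/(ch_eN (ch i)); apply/eqP/contraT => es.
  have := gam_ker qr qn0 (regular0q qr) (ev0q qr) (ch i) uJ (ye i) es.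
  have [_] := gam_reg qr qn0 (regular0q qr) (ev0q qr) (sw i) (up i) (dn i) J s0 ry'.
  rewrite ev1 gam_scale => h1 h2; move: h1; rewrite h2 mulr0 (ev0_0 qr) => /eqP.
  by rewrite eq_sym oner_eq0.
by move: ys0; rewrite s0b yb eqxx.
Qed.

(** If evW X did not vanish, neither would evW (Xe i X) for some i by Zp_ker; but Xe i X
    is a relation in V between shorter words. *)
Lemma kerVW X : evV X = 0 -> forall s, evW X s = 0.
Proof.
have [M] : exists M, forall c, c \in X -> (size c.2 < M)%N.
  elim: X => [|c X [M IH]]; first by exists 0%N.
  exists (maxn (size c.2).+1 M) => d; rewrite inE => /predU1P[->|/IH h]; rewrite leq_max ?leqnn ?h ?orbT //.
elim: M X => [|M IH] X XM X0 s.
  case: X XM {X0} => [|c X] XM; first by rewrite /evW big_nil.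
  by have := XM c; rewrite inE eqxx => /(_ isT).
apply/eqP/contraT => Xs.
have [|i [r]] := Zp_ker (Zp_evW X) Xs; first by rewrite evW_b0 top_evV.
rewrite -evW_e IH ?eqxx //; last by rewrite evV_e X0 linear0.
by apply: Xe_size => c /XM.
Qed.

Lemma evV_g_t j X : evV (Xg (fun mu => q ^ mu j) X) = t j (evV X).
Proof.
rewrite /evV big_map linear_sum; apply: eq_bigr => c _ /=.
by rewrite linearZ /= t_FV scalerA mulrC.
Qed.
Lemma evV_g_tV j X : evV (Xg (fun mu => q ^ (- mu j)) X) = tV j (evV X).
Proof.
rewrite /evV big_map linear_sum; apply: eq_bigr => c _ /=.
by rewrite linearZ /= tV_FV scalerA mulrC.
Qed.

Lemma evW_g g X s : (forall mu nu, mu =1 nu -> g mu = g nu) ->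
  evW (Xg g X) s = g (wt s) * evW X s.
Proof.
move=> gE; rewrite /evW big_map mulr_sumr; apply: eq_bigr => c _ /=.
have [->|/FW_supp h] := eqVneq (FW c.2 s) 0; first by rewrite !mulr0.
by rewrite mulrA; congr (_ * _ * _); apply: gE => j; rewrite h.
Qed.

Lemma spanV u : exists X, evV X = u.
Proof.
have [|a v w [X <-] [Y <-]|U UP] := @vspace_of_pred K V (fun u => exists X, evV X = u).
- by exists [::]; rewrite /evV big_nil.
- by exists (Xz a X ++ Y); rewrite evV_cat evV_z.
have [|||||U1] := irr (U := U).
- by move=> i v /UP[X <-]; apply/UP; exists (Xe i X); rewrite evV_e.
- by move=> i v /UP[X <-]; apply/UP; exists (Xf i X); rewrite evV_f.
- by move=> i v /UP[X <-]; apply/UP; eexists; exact: evV_g_t.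
- by move=> i v /UP[X <-]; apply/UP; eexists; exact: evV_g_tV.
- move=> U0; have : v0 \in U by apply/UP; exists [:: (1, [::])]; rewrite /evV big_seq1 scale1r.
  by rewrite U0 memv0 (negbTE v0_neq0).
by apply/UP; rewrite U1 memvf.
Qed.

(** The vectors evV X with evW X = 0 form a submodule, which by top_evV does not
    contain v0. *)
Lemma kerWV X : (forall s, evW X s = 0) -> evV X = 0.
Proof.
have [|a v w [X1 [<- hX]] [Y [<- hY]]|U UP] := @vspace_of_pred K V
    (fun u => exists X, evV X = u /\ forall s, evW X s = 0).
- by exists [::]; split => [|s]; rewrite /evV /evW big_nil.
- exists (Xz a X1 ++ Y); rewrite evV_cat evV_z; split=> // s.
  by rewrite evW_cat evW_z hX hY mulr0 addr0.
have [|||||U1] := irr (U := U).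
- move=> i v /UP[X1 [<- h]]; apply/UP; exists (Xe i X1); rewrite evV_e; split=> // s.
  by rewrite evW_e -[RHS](qe0 (sw i) (up i) (dn i) q J s); apply: eq_qe.
- move=> i v /UP[X1 [<- h]]; apply/UP; exists (Xf i X1); rewrite evV_f; split=> // s.
  by rewrite evW_f -[RHS](qf0 (sw i) (up i) (dn i) q J s); apply: eq_qf.
- move=> j v /UP[X1 [<- h]]; apply/UP; exists (Xg (fun mu => q ^ mu j) X1).
  by rewrite evV_g_t; split=> // s; rewrite evW_g ?h ?mulr0 // => mu nu ->.
- move=> j v /UP[X1 [<- h]]; apply/UP; exists (Xg (fun mu => q ^ (- mu j)) X1).
  by rewrite evV_g_tV; split=> // s; rewrite evW_g ?h ?mulr0 // => mu nu ->.
- move=> U0 hX; have : evV X \in U by apply/UP; exists X.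
  by rewrite U0 memv0 => /eqP.
have /UP[Y [Yv YW]] : v0 \in U by rewrite U1 memvf.
have : top (Y ++ [:: (-1, [::])]) = 0.
  apply: top_evV; rewrite evV_cat Yv /evV big_seq1 /= scaleN1r subrr //.
rewrite /top big_cat -/(top Y) /= -evW_b0 YW big_mkcond big_seq1 /= add0r => /eqP.
by rewrite oppr_eq0 oner_eq0.
Qed.

(** Well defined by kerVW, and injective by kerWV. *)
Definition Phi (u : V) : T -> K := evW (projT1 (cid (spanV u))).

Lemma PhiE X u s : evV X = u -> Phi u s = evW X s.
Proof.
rewrite /Phi; case: (cid _) => Y /= Yu Xu; apply/eqP; rewrite -subr_eq0.
have := @kerVW (Y ++ Xz (-1) X); rewrite evV_cat evV_z Yu Xu scaleN1r subrr => /(_ erefl s).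
by rewrite evW_cat evW_z mulN1r => ->.
Qed.

Lemma Phi_lin a u v s : Phi (a *: u + v) s = a * Phi u s + Phi v s.
Proof.
have [X Xu] := spanV u; have [Y Yv] := spanV v.
by rewrite (PhiE s Xu) (PhiE s Yv) (@PhiE (Xz a X ++ Y)) ?evW_cat ?evW_z // evV_cat evV_z Xu Yv.
Qed.

Lemma Phi_inj u : (forall s, Phi u s = 0) -> u = 0.
Proof.
have [X Xu] := spanV u => h; rewrite -Xu; apply: kerWV => s; by rewrite -(PhiE s Xu).
Qed.

Lemma Phi_e i u s : Phi (e i u) s = eW i (Phi u) s.
Proof.
have [X Xu] := spanV u; rewrite (@PhiE (Xe i X)) ?evV_e ?Xu // evW_e.
by apply: eq_qe => r; rewrite (PhiE r Xu).
Qed.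

Lemma Phi_f i u s : Phi (f i u) s = fW i (Phi u) s.
Proof.
have [X Xu] := spanV u; rewrite (@PhiE (Xf i X)) ?evV_f ?Xu // evW_f.
by apply: eq_qf => r; rewrite (PhiE r Xu).
Qed.

Lemma Phi_t j u s : Phi (t j u) s = q ^ wt s j * Phi u s.
Proof.
have [X Xu] := spanV u; rewrite (@PhiE (Xg (fun mu => q ^ mu j) X)) ?evV_g_t ?Xu //.
by rewrite evW_g ?(PhiE s Xu) // => mu nu ->.
Qed.

Lemma Phi_v0 s : Phi v0 s = w0 s.
Proof.
rewrite (@PhiE [:: (1, [::])]) /evV ?big_seq1 ?scale1r //.
by rewrite /evW big_seq1 mul1r.
Qed.

Lemma Phi_Zp u : Zp (Phi u).
Proof. exact: Zp_evW. Qed.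

Lemma Phi_supp u s : Phi u s != 0 -> exists2 A, FW A s != 0 & forall j, wt s j = awt A j.
Proof.
rewrite /Phi; case: (cid _) => Y /= _ {u}; elim: Y => [|c Y IH].
  by rewrite /evW big_nil eqxx.
rewrite /evW big_cons; have [h|nz _] := eqVneq (FW c.2 s) 0.
  by rewrite h mulr0 add0r.
by exists c.2 => //; exact: FW_supp.
Qed.

Lemma Phi_b0 u s : (forall j, wt s j = wt b0 j) -> s != b0 -> Phi u s = 0.
Proof.
move=> hs sb; apply/eqP/negPn/negP => /Phi_supp[A FA h].
have : rhow lam = rhow (awt A) by apply: eq_bigr => j _; rewrite -h hs b0_wt.
rewrite rhow_awt; case: A FA {h} => [|i A] /=; last by lia.
by rewrite /w0 (negbTE sb) eqxx.
Qed.

Lemma Phi_depth u s : Phi u s != 0 -> exists d : nat, rhow (wt s) = rhow (wt b0) - d%:Z.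
Proof.
move=> /Phi_supp[A _ h]; exists (size A).
transitivity (rhow (awt A)); first by apply: eq_bigr => j _; rewrite h.
by rewrite rhow_awt; congr (_ - _); apply: eq_bigr => j _; rewrite b0_wt.
Qed.

Record intertwiner (F : V -> T -> K) : Prop := {
  it_lin : forall a u v s, F (a *: u + v) s = a * F u s + F v s;
  it_inj : forall u, (forall s, F u s = 0) -> u = 0;
  it_e : forall i u s, F (e i u) s = eW i (F u) s;
  it_f : forall i u s, F (f i u) s = fW i (F u) s;
  it_t : forall j u s, F (t j u) s = q ^ wt s j * F u s;
  it_v0 : forall s, F v0 s = w0 s;
  it_Zp : forall u, Zp (F u);
  it_b0 : forall u s, (forall j, wt s j = wt b0 j) -> s != b0 -> F u s = 0;
  it_depth : forall u s, F u s != 0 ->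
    exists d : nat, rhow (wt s) = rhow (wt b0) - d%:Z }.

Theorem intertwiner_exists : exists F, intertwiner F.
Proof.
exists Phi; split.
- exact: Phi_lin.
- exact: Phi_inj.
- exact: Phi_e.
- exact: Phi_f.
- exact: Phi_t.
- exact: Phi_v0.
- exact: Phi_Zp.
- exact: Phi_b0.
- exact: Phi_depth.
Qed.

End Rep.

(** * Matching a crystal base with a set of states *)

(** By induction on the number of times that one can still raise, which rk measures. *)
Lemma raise_ind (N T : Type) (ce : N -> T -> option T) (b0 : T) (Q : T -> Prop) (rk : T -> int)
    (R : T -> Prop) :
  (forall i s s', ce i s = Some s' -> rk s' = rk s + 1) ->
  (forall s, Q s -> exists d : nat, rk s = rk b0 - d%:Z) ->
  (forall i s s', Q s -> ce i s = Some s' -> Q s') ->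
  (forall s, Q s -> (forall i, ce i s = None) -> s = b0) ->
  R b0 -> (forall i s s', Q s -> ce i s = Some s' -> R s' -> R s) -> forall s, Q s -> R s.
Proof.
move=> rk_e Q_depth Q_e Q_hw Rb Re s Qs; have [d] := Q_depth s Qs.
elim: d s Qs => [|d IH] s Qs hd.
  have [hw|nhw] := pselect (forall i, ce i s = None); first by rewrite (Q_hw s Qs hw).
  case: nhw => i; case E: (ce i s) => [s1|] //.
  by have [d'] := Q_depth _ (Q_e _ _ _ Qs E); rewrite (rk_e _ _ _ E) hd; clear; lia.
have [hw|nhw] := pselect (forall i, ce i s = None); first by rewrite (Q_hw s Qs hw).
have [i [s1 hs1]] : exists i s1, ce i s = Some s1.
  apply: contrapT => nex; apply: nhw => i; case E: (ce i s) => [s1|] //.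
  by case: nex; exists i, s1.
apply: (Re _ _ _ Qs hs1); apply: IH; first exact: Q_e Qs hs1.
by rewrite (rk_e _ _ _ hs1) hd; clear; lia.
Qed.

Section Lattice.
Variables (K : fieldType) (q : K) (cst : rat -> K) (reg : K -> Prop) (ev : K -> rat).
Hypothesis qr : qring q cst reg ev.
Variables (N : eqType) (P : Type) (V : vectType K).
Variables (T : finType) (I : eqType) (sw : N -> I -> T -> T) (up dn : N -> I -> T -> bool).
Variables (J : seq I) (wt : T -> P -> int) (b0 : T) (rootw : N -> P -> int).
Hypothesis ch : forall i, chain (sw i) (up i) (dn i).
Hypothesis uJ : uniq J.
Local Notation ceW i := (ch_e (sw i) (up i) (dn i) J).
Local Notation cfW i := (ch_f (sw i) (up i) (dn i) J).
Local Notation gam i := (gam (sw i) (up i) (dn i) q J).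
Local Notation ogam i := (ogam (sw i) (up i) (dn i) q J).
Variables (rhow : (P -> int) -> int) (Q : T -> Prop).
Hypothesis rhow_ext : forall mu nu, mu =1 nu -> rhow mu = rhow nu.
Hypothesis rhowD : forall mu i, rhow (fun j => mu j + rootw i j) = rhow mu + 1.
Hypothesis wt_e : forall i s s', ceW i s = Some s' -> forall j, wt s' j = wt s j + rootw i j.
Hypothesis Q_e : forall i s s', Q s -> ceW i s = Some s' -> Q s'.
Hypothesis Q_hw : forall s, Q s -> (forall i, ceW i s = None) -> s = b0.
Hypothesis Q_depth : forall s, Q s -> exists d : nat, rhow (wt s) = rhow (wt b0) - d%:Z.

Variable L : V -> Prop.
Variable X : (\dim {:V}).-tuple V.
Hypothesis Xb : basis_of {:V} X.
Hypothesis LX : forall u, L u <-> forall k, reg (coord X k u).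

Variables (C : eqType) (r : C -> V) (wtC : C -> P -> int) (ceC cfC : N -> C -> option C).
Hypothesis Lr : forall b, L (r b).
Definition qL u := L (q^-1 *: u).
Hypothesis base_span : forall u, L u -> exists (s : seq C) (a : C -> rat),
    qL (u - \sum_(b <- s) cst (a b) *: r b).
Hypothesis base_free : forall (s : seq C) (a : C -> rat), uniq s ->
    qL (\sum_(b <- s) cst (a b) *: r b) -> forall b, b \in s -> a b = 0.
Hypothesis base_ef : forall i b b', cfC i b = Some b' <-> ceC i b' = Some b.

(** An embedding of V into functions for which Q contains the support at q = 0 of every
    vector with regular values, and through which Kashiwara's operators on the vectors
    r b are the crystal operators of T in the coordinates gam. *)
Record lat_embed (Phi : V -> T -> K) : Prop := {
  le_lin : forall a u v s, Phi (a *: u + v) s = a * Phi u s + Phi v s;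
  le_inj : forall u, (forall s, Phi u s = 0) -> u = 0;
  le_Q : forall u, (forall s, reg (Phi u s)) -> forall s, ev (Phi u s) != 0 -> Q s;
  le_wt : forall b s, Phi (r b) s != 0 -> forall j, wt s j = wtC b j;
  le_b0 : forall u s, (forall j, wt s j = wt b0 j) -> s != b0 -> Phi u s = 0;
  le_surj : exists u, Phi u b0 != 0;
  le_depth : forall u s, Phi u s != 0 ->
    exists d : nat, rhow (wt s) = rhow (wt b0) - d%:Z;
  le_e : forall i b, exists v, [/\ L v, qL (v - oapp r 0 (ceC i b)),
    forall s, Phi v s != 0 -> forall j, wt s j = wtC b j + rootw i j &
    forall s, gam i s (Phi v) = ogam i (cfW i s) (Phi (r b))];
  le_f : forall i b, exists v, [/\ L v, qL (v - oapp r 0 (cfC i b)) &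
    forall s, gam i s (Phi v) = ogam i (ceW i s) (Phi (r b))] }.

Let qn0 : q != 0 := qr_q qr.
Let rq := regular0q qr.
Let eq0 := ev0q qr.

Lemma L0 : L 0.
Proof. by apply/LX => k; rewrite linear0; exact: regular0_0 qr. Qed.
Lemma LD u v : L u -> L v -> L (u + v).
Proof. by move=> /LX hu /LX hv; apply/LX => k; rewrite linearD; apply: (regularD qr); [exact: hu|exact: hv]. Qed.
Lemma LZ a u : reg a -> L u -> L (a *: u).
Proof. by move=> ra /LX hu; apply/LX => k; rewrite linearZ; apply: (regularM qr) => //; exact: hu. Qed.
Lemma L_sumP (A : Type) (s : seq A) (Pr : pred A) (F : A -> V) :
  (forall a, Pr a -> L (F a)) -> L (\sum_(a <- s | Pr a) F a).
Proof. by move=> h; elim/big_ind: _ => //; [exact: L0|exact: LD]. Qed.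

Lemma reg_sum (A : Type) (s : seq A) (F : A -> K) :
  (forall a, reg (F a)) -> reg (\sum_(a <- s) F a).
Proof. by move=> h; elim/big_ind: _ => //; [exact: regular0_0 qr|exact: regularD qr]. Qed.

Lemma regX k : reg (q ^+ k).
Proof. exact: (regularX qr). Qed.

Lemma reg_unit x : x != 0 -> reg x -> ev x != 0 -> reg x^-1.
Proof.
move=> x0 rx ex; apply: contrapT => nr.
have x0' : x^-1 != 0 by rewrite invr_eq0.
have [_] := regular_dicho qr x0' nr.
by rewrite invrK => /eqP; rewrite (negbTE ex).
Qed.

Lemma pole_fin (A : finType) (x : A -> K) : exists M, forall a, reg (q ^+ M * x a).
Proof.
suff [M h] : exists M, forall a, a \in enum A -> reg (q ^+ M * x a).
  by exists M => a; apply: h; rewrite mem_enum.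
elim: (enum A) => [|a s [M IH]]; first by exists 0%N.
have [M' h] := regular_pole qr (x a).
exists (M + M')%N => b; rewrite inE => /predU1P[->|/IH hb]; first by apply: h; lia.
by rewrite addnC exprD -mulrA; apply: (regularM qr) => //; exact: regX.
Qed.

Lemma L_scale u : exists M, L (q ^+ M *: u).
Proof.
have [M h] := pole_fin (fun k => coord X k u).
by exists M; apply/LX => k; rewrite linearZ; exact: h.
Qed.

Section Embedded.
Variable Phi : V -> T -> K.
Hypothesis le : lat_embed Phi.

Lemma Phi0 s : Phi 0 s = 0.
Proof.
have := le_lin le 0 0 0 s; rewrite scale0r addr0 mul0r add0r => h.
have := le_lin le (-1) 0 0 s; rewrite scaleN1r addNr mulN1r addNr //.
Qed.
Lemma PhiZ a u s : Phi (a *: u) s = a * Phi u s.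
Proof. by rewrite -[a *: u]addr0 (le_lin le) Phi0 addr0. Qed.
Lemma PhiD u v s : Phi (u + v) s = Phi u s + Phi v s.
Proof. by rewrite -[u]scale1r (le_lin le) mul1r scale1r. Qed.
Lemma PhiB u v s : Phi (u - v) s = Phi u s - Phi v s.
Proof. by rewrite PhiD -scaleN1r PhiZ mulN1r. Qed.
Lemma Phi_sum (A : Type) (l : seq A) (Pr : pred A) (F : A -> V) s :
  Phi (\sum_(a <- l | Pr a) F a) s = \sum_(a <- l | Pr a) Phi (F a) s.
Proof.
elim: l => [|a l IH]; first by rewrite !big_nil Phi0.
by rewrite !big_cons; case: ifP => _; rewrite ?PhiD IH.
Qed.

Definition inW u := forall s, reg (Phi u s).

(** L and the lattice inW of the vectors with regular values are commensurable; this is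
    what makes divisions by q stop, here and in bound_W. *)
Lemma bound_L : exists M, forall u, L u -> forall s, reg (q ^+ M * Phi u s).
Proof.
have [M h] := pole_fin (fun ks : 'I_(\dim {:V}) * T => Phi X`_ks.1 ks.2).
exists M => u /LX hu s; rewrite (coord_basis Xb (memvf u)) Phi_sum mulr_sumr.
elim/big_ind: _ => [||k _]; [exact: regular0_0 qr|exact: regularD qr|].
by rewrite PhiZ mulrCA; apply: (regularM qr) => //; exact: (h (k, s)).
Qed.

(** As Phi is injective, the matrix of the values of the basis X has full rank. *)
Lemma Phi_dual k : exists c : T -> K, forall u, coord X k u = \sum_s c s * Phi u s.
Proof.
pose M := \matrix_(i < \dim {:V}, s < #|T|) Phi X`_i (enum_val s).
have fM : row_free M.
  rewrite -kermx_eq0; apply/eqP/row_matrixP => i; rewrite row0; set c := row i _.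
  have cM : c *m M = 0 by apply: sub_kermxP; exact: row_sub.
  pose u := \sum_j c 0 j *: X`_j.
  have u0 : u = 0.
    apply: (le_inj le) => s; rewrite Phi_sum.
    move/matrixP: cM => /(_ 0 (enum_rank s)); rewrite !mxE => cM.
    by rewrite -[RHS]cM; apply: eq_bigr => j _; rewrite PhiZ [M _ _]mxE enum_rankK.
  apply/rowP => j; rewrite [RHS]mxE.
  by rewrite -(coord_sum_free _ _ (basis_free Xb)) -/u u0 linear0.
exists (fun s => pinvmx M (enum_rank s) k) => u.
pose c := \row_j coord X j u.
have cM : c *m M = \row_s Phi u (enum_val s).
  apply/rowP => s; rewrite mxE [RHS]mxE [in RHS](coord_basis Xb (memvf u)) Phi_sum.
  by apply: eq_bigr => j _; rewrite PhiZ [c _ _]mxE [M _ _]mxE.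
have : c *m M *m pinvmx M = c by rewrite mulmxKp.
rewrite cM => /rowP /(_ k); rewrite !mxE => <-.
rewrite (reindex (@enum_val T T)) /=; last first.
  by exists enum_rank => s _; rewrite ?enum_valK ?enum_rankK.
by apply: eq_bigr => s _; rewrite !mxE enum_valK mulrC.
Qed.

Lemma bound_W : exists M, forall u, inW u -> L (q ^+ M *: u).
Proof.
have H k : exists M, forall u, inW u -> forall M', (M <= M')%N -> reg (q ^+ M' * coord X k u).
  have [c hc] := Phi_dual k; have [M h] := pole_fin c.
  exists M => u hu M' MM'; rewrite hc mulr_sumr.
  elim/big_ind: _ => [||s _]; [exact: regular0_0 qr|exact: (regularD qr)|].
  rewrite mulrA; apply: (regularM qr); last exact: hu.
  by rewrite -(subnK MM') exprD -mulrA; apply: (regularM qr) => //; exact: regX.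
pose M k := projT1 (cid (H k)).
have HM k : forall u, inW u -> forall M', (M k <= M')%N -> reg (q ^+ M' * coord X k u).
  by rewrite /M; case: (cid _).
exists (\sum_k M k)%N => u hu; apply/LX => k; rewrite linearZ; apply: HM => //.
by rewrite (bigD1 k) //= leq_addr.
Qed.
Lemma qLE u : qL u <-> exists2 u1, L u1 & u = q *: u1.
Proof.
split=> [h|[u1 h ->]]; last by rewrite /qL scalerA mulVf // scale1r.
by exists (q^-1 *: u) => //; rewrite scalerA mulfV // scale1r.
Qed.

Lemma r_neq0 b : r b != 0.
Proof.
apply/eqP => rb; have := @base_free [:: b] (fun=> 1) isT.
rewrite big_seq1 rb scaler0 /qL scaler0 => /(_ L0 b); rewrite inE eqxx => /(_ isT)/eqP.
by rewrite oner_eq0.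
Qed.

(** The vectors r b generate L modulo q.  Replacing u by combinations of them and q times
    a vector of L, repeatedly, one reaches q ^ M times a vector of L, which is regular. *)
Lemma nakayama mu :
  (forall b, (forall j, wtC b j = mu j) -> inW (r b)) ->
  forall u, L u -> forall s, (forall j, wt s j = mu j) -> reg (Phi u s).
Proof.
move=> hb u Lu s hs; have [M hM] := bound_L.
suff H k u' : (k <= M)%N -> L u' -> reg (q ^+ (M - k) * Phi u' s).
  by have := H M u (leqnn M) Lu; rewrite subnn expr0 mul1r.
elim: k u' => [|k IH] u' kM Lu'; first by rewrite subn0; exact: hM.
have [l [a /qLE[u1 L1 /eqP]]] := base_span Lu'.
rewrite subr_eq => /eqP ->; rewrite PhiD PhiZ Phi_sum mulrDr; apply: (regularD qr).
  rewrite mulrA -exprSr -subSn // subSS; apply: IH => //; exact: ltnW.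
rewrite mulr_sumr; apply: reg_sum => b; rewrite PhiZ.
have [->|/eqP nz] := eqVneq (Phi (r b) s) 0; first by rewrite !mulr0; exact: regular0_0 qr.
apply: (regularM qr); first exact: regX.
apply: (regularM qr); first exact: regular_const qr _.
by apply: hb => j; rewrite -(le_wt le (introN eqP nz)).
Qed.

(** Otherwise every r b would vanish at b0, and the values at b0 of the vectors of L
    would be divisible by all powers of q. *)
Lemma c0_exists : exists c0, forall j, wtC c0 j = wt b0 j.
Proof.
apply: contrapT => nex.
have H k u : L u -> reg (q ^- k * Phi u b0).
  elim: k u => [|k IH] u Lu.
    rewrite expr0 invr1 mul1r; apply: (@nakayama (wt b0)) => // b hb.
    by case: nex; exists b.
  have [l [a /qLE[u1 L1 /eqP]]] := base_span Lu.
  rewrite subr_eq => /eqP ->; rewrite PhiD PhiZ Phi_sum big1 ?addr0.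
    have -> : q ^- k.+1 * (q * Phi u1 b0) = q ^- k * Phi u1 b0.
      by rewrite exprS; field; rewrite expf_neq0 ?qn0.
    exact: IH.
  move=> b _; rewrite PhiZ; apply/eqP; rewrite mulf_eq0; apply/orP; right.
  apply/negPn/negP => nz; apply: nex; exists b => j.
  by rewrite (le_wt le nz).
have [u hu] := le_surj le; have [M LM] := L_scale u.
have x0 : (q ^+ M * Phi u b0)^-1 != 0 by rewrite invr_eq0 mulf_neq0 ?expf_neq0 ?qn0.
have [M' hM'] := regular_pole qr (q ^+ M * Phi u b0)^-1.
have r1 := hM' M' (leqnn _).
have := H M'.+1 _ LM; rewrite PhiZ => r2.
have := regularM qr r1 r2.
have -> : q ^+ M' * (q ^+ M * Phi u b0)^-1 * (q ^- M'.+1 * (q ^+ M * Phi u b0)) = q^-1 * 1.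
  by rewrite exprS; field; rewrite hu qn0 !expf_neq0 ?qn0.
by move/(regular_qVE qr) => [_]; rewrite (ev0_1 qr) => /eqP; rewrite oner_eq0.
Qed.

Lemma Phi_lam b s : (forall j, wtC b j = wt b0 j) -> s != b0 -> Phi (r b) s = 0.
Proof.
move=> hb sb; apply/eqP/negPn/negP => nz.
by move: (nz); rewrite (le_b0 le) ?eqxx // => j; rewrite -hb (le_wt le nz).
Qed.

Lemma Phi_lam_b0 b : (forall j, wtC b j = wt b0 j) -> Phi (r b) b0 != 0.
Proof.
move=> hb; apply: contra (r_neq0 b) => /eqP h; apply/eqP; apply: (le_inj le) => s.
by have [->//|/(Phi_lam hb)] := eqVneq s b0.
Qed.

Variable c0 : C.
Hypothesis c0_wt : forall j, wtC c0 j = wt b0 j.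
Hypothesis c0_norm : Phi (r c0) b0 = 1.

Lemma Phi_c0 s : Phi (r c0) s = (s == b0)%:R.
Proof. by have [->|/(Phi_lam c0_wt)] := eqVneq s b0. Qed.

(** The weight space is a line, so r b is a multiple of r c0 or conversely, with a
    regular factor; then the two are dependent modulo q L. *)
Lemma c0_uniq b : (forall j, wtC b j = wt b0 j) -> b = c0.
Proof.
move=> hb; apply/eqP/negPn/negP => bc.
have nz := Phi_lam_b0 hb; set be := Phi (r b) b0 in nz.
have rE : r b = be *: r c0.
  apply/eqP; rewrite -subr_eq0; apply/eqP; apply: (le_inj le) => s.
  rewrite PhiB PhiZ Phi_c0; have [->|sb] := eqVneq s b0; first by rewrite mulr1 subrr.
  by rewrite mulr0 subr0 Phi_lam.
have [rb|nrb] := pselect (reg be).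
  have := @base_free [:: b; c0] (fun c => if c == b then 1 else - ev be).
  rewrite /= inE bc big_cons big_seq1 eqxx eq_sym (negbTE bc) => /(_ isT).
  rewrite (qr_cst1 qr) scale1r rE -scalerDl /qL scalerA.
  have rd : reg (be + cst (- ev be)) by apply: (regularD qr) => //; exact: regular_const qr _.
  have ed : ev (be + cst (- ev be)) = 0.
    by rewrite (ev0D qr) ?(ev0c qr) ?subrr //; exact: regular_const qr _.
  move=> /(_ (LZ (regular_qV qr rd ed) (Lr c0)) b); rewrite inE eqxx => /(_ isT)/eqP.
  by rewrite oner_eq0.
have [rV eV] := regular_dicho qr nz nrb.
have := @base_free [:: c0] (fun=> 1) isT; rewrite big_seq1 (qr_cst1 qr) scale1r.
have -> : r c0 = be^-1 *: r b by rewrite rE scalerA mulVf // scale1r.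
rewrite /qL scalerA => /(_ (LZ (regular_qV qr rV eV) (Lr b)) c0); rewrite inE eqxx => /(_ isT)/eqP.
by rewrite oner_eq0.
Qed.

(** Induction from the highest weight downwards.  Scale r b to have regular values that
    do not all vanish at q = 0, and let s0 be a state where one survives.  If s0 is
    highest, it is b0, and b is c0.  Otherwise some e raises s0; it maps r b to a vector
    of higher weight, which is regular by induction, and its coordinate is that of r b
    at s0.  So the scaling factor was regular. *)
Lemma r_inW b : inW (r b).
Proof.
suff H (d : nat) b' : rhow (wtC b') = rhow (wt b0) - d%:Z -> inW (r b').
  have [s hs] : exists s, Phi (r b) s != 0.
    apply: contrapT => nex; have /eqP := r_neq0 b; apply; apply: (le_inj le) => s.
    by apply/eqP/negPn/negP => h; apply: nex; exists s.
  have [d] := le_depth le hs; rewrite (rhow_ext (le_wt le hs)); exact: H.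
elim/ltn_ind: d b' => d IH b' hd.
have [y0|[s0 _ [ys0 ry]]] := min_val qr (Phi (r b')) (enum T).
  by move=> s; rewrite y0 ?mem_enum //; exact: regular0_0 qr.
set y := Phi (r b') in ys0 ry.
have ry' s : reg ((y s0)^-1 * y s) by rewrite mulrC; apply: ry; rewrite mem_enum.
have ev1 : ev ((y s0)^-1 * y s0) = 1 by rewrite mulVf // (ev0_1 qr).
have Qs0 : Q s0.
  apply: (@le_Q _ le ((y s0)^-1 *: r b')); first by move=> s; rewrite PhiZ; exact: ry'.
  by rewrite PhiZ ev1 oner_eq0.
have [hw|nhw] := pselect (forall i, ceW i s0 = None).
  have s0b := Q_hw Qs0 hw.
  have -> : b' = c0 by apply: c0_uniq => j; rewrite -(le_wt le ys0) s0b.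
  by move=> s; rewrite Phi_c0; case: eqP => _; [exact: regular0_1 qr|exact: regular0_0 qr].
have [i [s1 hs1]] : exists i s1, ceW i s0 = Some s1.
  apply: contrapT => nex; apply: nhw => i; case E: (ceW i s0) => [s1|] //.
  by case: nex; exists i, s1.
have [fs1 _ _] := ch_eP (ch i) uJ hs1.
have [v [Lv _ vwt vgam]] := le_e le i b'.
have vW : inW v.
  move=> s; have [->|nz] := eqVneq (Phi v s) 0; first exact: regular0_0 qr.
  apply: (nakayama _ Lv (vwt s nz)) => b2 hb2.
  case: d IH hd => [|d] IH hd; last first.
    by apply: (IH d); rewrite // (rhow_ext hb2) rhowD hd; lia.
  have [d] := le_depth le nz; rewrite (rhow_ext (vwt s nz)) rhowD hd; lia.
have [rg1 _] := gam_reg qr qn0 rq eq0 (sw i) (up i) (dn i) J s1 vW.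
have [rg2 eg2] := gam_reg qr qn0 rq eq0 (sw i) (up i) (dn i) J s0 ry'.
have := vgam s1; rewrite fs1 /= -/y => vE.
have ys0r : reg (y s0).
  have gE : gam i s0 y = y s0 * gam i s0 (fun s => (y s0)^-1 * y s).
    by rewrite gam_scale mulVKf.
  set g := gam i s0 _ in rg2 eg2 gE.
  have g0 : g != 0.
    by apply/eqP => g0; move: eg2; rewrite g0 ev1 (ev0_0 qr) => /eqP; rewrite eq_sym oner_eq0.
  have -> : y s0 = gam i s1 (Phi v) * g^-1 by rewrite vE gE mulfK.
  apply: (regularM qr) => //; apply: reg_unit => //; by rewrite eg2 ev1 oner_eq0.
move=> s; have -> : Phi (r b') s = y s0 * ((y s0)^-1 * y s) by rewrite mulVKf.
exact: (regularM qr).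
Qed.

Lemma L_inW u : L u -> inW u.
Proof.
by move=> Lu s; apply: (@nakayama (wt s)) => // b _; exact: r_inW.
Qed.

Lemma qL_ev u s : qL u -> ev (Phi u s) = 0.
Proof.
move=> /qLE[u1 /L_inW h ->]; rewrite PhiZ (ev0M qr) //; by rewrite eq0 mul0r.
Qed.

Lemma ev_qL u v s : L u -> L v -> qL (u - v) -> ev (Phi u s) = ev (Phi v s).
Proof.
move=> /L_inW hu /L_inW hv /(@qL_ev _ s); rewrite PhiB (ev0B qr) // => /eqP.
by rewrite subr_eq0 => /eqP.
Qed.

Lemma ev_gam i u s : L u -> ev (Phi u s) = ev (gam i s (Phi u)).
Proof.
move=> /L_inW h.
by have [_ ->] := gam_reg qr qn0 rq eq0 (sw i) (up i) (dn i) J s h.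
Qed.

(** r b becomes the indicator function of s at q = 0. *)
Definition matched b s := forall s', ev (Phi (r b) s') = (s' == s)%:R.

Lemma ev_ogam i b o s : matched b s ->
  ev (ogam i o (Phi (r b))) = (o == Some s)%:R.
Proof.
move=> bs; case: o => [s'|] /=; last exact: ev0_0 qr.
by rewrite -ev_gam // bs.
Qed.

Lemma matched_c0 : matched c0 b0.
Proof. by move=> s; rewrite Phi_c0; case: eqP => _; [exact: ev0_1 qr|exact: ev0_0 qr]. Qed.

Lemma matched_inj b s s' : matched b s -> matched b s' -> s = s'.
Proof.
move=> h h'; apply/eqP; have := h' s; rewrite h eqxx.
by case: (s == s') => // /eqP; rewrite oner_eq0.
Qed.

Lemma matched_Q b s : matched b s -> Q s.
Proof.
by move=> h; apply: (le_Q le (r_inW b)); rewrite h eqxx oner_eq0.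
Qed.

Definition orel o1 o2 := match o1, o2 with
  | Some b, Some s => matched b s | None, None => True | _, _ => False end.

Lemma Lo o : L (oapp r 0 o). Proof. by case: o => //=; exact: L0. Qed.

Lemma ce_cf_eq i s s' : (ceW i s' == Some s) = (cfW i s == Some s').
Proof. by apply/eqP/eqP => /(ch_efP (ch i) uJ). Qed.

Lemma matched_f i b s : matched b s -> orel (cfC i b) (cfW i s).
Proof.
move=> bs; have [v [Lv vr vg]] := le_f le i b.
have E s' : ev (Phi (oapp r 0 (cfC i b)) s') = (cfW i s == Some s')%:R.
  rewrite -(ev_qL s' Lv (Lo _) vr) (ev_gam i) // vg (ev_ogam _ _ bs).
  by rewrite ce_cf_eq.
case Eb: (cfC i b) E => [b'|] /= E; case Es: (cfW i s) E => [s'|] //= E.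
- by move=> s2; rewrite E -[Some s' == _]/(s' == s2) eq_sym.
- have /base_ef Eb' := Eb.
  have [v' [Lv' vr' _ vg']] := le_e le i b'.
  move: vr'; rewrite Eb' /= => vr'.
  have := ev_qL s Lv' (Lr b) vr'; rewrite bs eqxx (ev_gam i) // vg' Es /= (ev0_0 qr) => /eqP.
  by rewrite eq_sym oner_eq0.
- have := E s'; rewrite Phi0 (ev0_0 qr) eqxx => /eqP; by rewrite eq_sym oner_eq0.
Qed.

Lemma matched_e i b s : matched b s -> orel (ceC i b) (ceW i s).
Proof.
move=> bs; have [v [Lv vr _ vg]] := le_e le i b.
have E s' : ev (Phi (oapp r 0 (ceC i b)) s') = (ceW i s == Some s')%:R.
  rewrite -(ev_qL s' Lv (Lo _) vr) (ev_gam i) // vg (ev_ogam _ _ bs).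
  by rewrite -ce_cf_eq.
case Eb: (ceC i b) E => [b'|] /= E; case Es: (ceW i s) E => [s'|] //= E.
- by move=> s2; rewrite E -[Some s' == _]/(s' == s2) eq_sym.
- have /base_ef Eb' := Eb.
  have [v' [Lv' vr' vg']] := le_f le i b'.
  move: vr'; rewrite Eb' /= => vr'.
  have := ev_qL s Lv' (Lr b) vr'; rewrite bs eqxx (ev_gam i) // vg' Es /= (ev0_0 qr) => /eqP.
  by rewrite eq_sym oner_eq0.
- have := E s'; rewrite Phi0 (ev0_0 qr) eqxx => /eqP; by rewrite eq_sym oner_eq0.
Qed.

Lemma Q_ind (R : T -> Prop) : R b0 ->
  (forall i s s', Q s -> ceW i s = Some s' -> R s' -> R s) -> forall s, Q s -> R s.
Proof.
apply: (raise_ind (rk := fun s => rhow (wt s))) => [i s s' E|s|i s s'|s].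
- by rewrite (rhow_ext (wt_e E)) rhowD.
- exact: Q_depth.
- exact: Q_e.
- exact: Q_hw.
Qed.

Lemma matched_surj s : Q s -> exists b, matched b s.
Proof.
apply: (Q_ind (R := fun s => exists b, matched b s)); first by exists c0; exact: matched_c0.
move=> i s1 s2 _ /(ch_efP (ch i) uJ) E [b /(matched_f i)]; rewrite E.
by case: (cfC i b) => // b' h; exists b'.
Qed.

Lemma matched_wt b s : matched b s -> forall j, wt s j = wtC b j.
Proof.
move=> bs j; apply: (le_wt le); apply/eqP => h.
by have := bs s; rewrite h (ev0_0 qr) eqxx => /eqP; rewrite eq_sym oner_eq0.
Qed.

Lemma matched_uniq b b' s : matched b s -> matched b' s -> b = b'.
Proof.
move=> bs; have Qs := matched_Q bs; move: s Qs b b' bs.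
apply: Q_ind => [b b' bb bb'|i s s' Qs E IH b b' bs bs'].
  have -> : b = c0 by apply: c0_uniq => j; rewrite -(matched_wt bb).
  by apply/esym/c0_uniq => j; rewrite -(matched_wt bb').
have := matched_e i bs; have := matched_e i bs'; rewrite E.
case Eb': (ceC i b') => [b1'|] // m1'; case Eb: (ceC i b) => [b1|] // m1.
have e := IH _ _ m1 m1'; move/base_ef: Eb => Eb; move/base_ef: Eb'; rewrite -e Eb.
by case.
Qed.

(** Subtracting the vectors matched with the states leaves something that vanishes at
    q = 0. *)
Lemma ev_split u (bs : T -> C) : (forall s, Q s -> matched (bs s) s) -> inW u ->
  exists2 u1, inW u1 &
   u = q *: u1 + \sum_(s <- enum T | `[< Q s >]) cst (ev (Phi u s)) *: r (bs s).
Proof.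
move=> hbs hu; set S := \sum_(s <- _ | _) _.
exists (q^-1 *: (u - S)); last by rewrite scalerA mulfV // scale1r subrK.
have SW : inW S.
  move=> s; rewrite /S Phi_sum; elim/big_ind: _ => [||s' _]; [exact: regular0_0 qr|exact: (regularD qr)|].
  by rewrite PhiZ; apply: (regularM qr); [exact: regular_const qr _|exact: r_inW].
move=> s; rewrite PhiZ PhiB; apply: (regular_qV qr); first exact: (regularB qr).
rewrite (ev0B qr) //; apply/eqP; rewrite subr_eq0; apply/eqP.
rewrite /S Phi_sum.
have -> : ev (\sum_(s' <- enum T | `[< Q s' >]) Phi (cst (ev (Phi u s')) *: r (bs s')) s)
   = \sum_(s' <- enum T | `[< Q s' >]) ev (Phi u s') * (s == s')%:R.
  have : reg (\sum_(s' <- enum T | `[< Q s' >]) Phi (cst (ev (Phi u s')) *: r (bs s')) s) /\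
   ev (\sum_(s' <- enum T | `[< Q s' >]) Phi (cst (ev (Phi u s')) *: r (bs s')) s)
   = \sum_(s' <- enum T | `[< Q s' >]) ev (Phi u s') * (s == s')%:R; last by case.
  elim/big_rec2: _ => [|s' y x /asboolP Qs' [rx ex]]; first by rewrite (ev0_0 qr); split=> //; exact: regular0_0 qr.
  have rc := regular_const qr (ev (Phi u s')).
  have rr := r_inW (bs s') s.
  rewrite PhiZ; split; first by apply: (regularD qr) => //; apply: (regularM qr).
  rewrite (ev0D qr) //; last exact: (regularM qr).
  by rewrite ex (ev0M qr) // (ev0c qr) (hbs _ Qs').
rewrite big_enum_cond /=.
have [Qs|nQs] := pselect (Q s).
  rewrite (bigD1 s) /=; last by apply/asboolP.
  rewrite eqxx mulr1 big1 ?addr0 // => s' /andP[_]; rewrite eq_sym => /negbTE ->.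
  by rewrite mulr0.
rewrite big1; last first.
  move=> s' /asboolP Qs'; case: eqP => [e|_]; rewrite ?mulr0 //.
  by case: nQs; rewrite e.
by apply/eqP/negPn/negP => h; apply: nQs; exact: (le_Q le hu).
Qed.

Lemma bs_exists : exists bs : T -> C, forall s, Q s -> matched (bs s) s.
Proof.
have H s : exists b, Q s -> matched b s.
  by have [/matched_surj[b hb]|nQ] := pselect (Q s); [exists b|exists c0].
by exists (fun s => projT1 (cid (H s))) => s; case: (cid _).
Qed.

(** ev_split can be repeated until the remainder is in q ^ M inW, which is in L. *)
Lemma inW_L u : inW u -> L u.
Proof.
move=> hu; have [M hM] := bound_W; have [bs hbs] := bs_exists.
suff H k u' : (k <= M)%N -> inW u' -> L (q ^+ (M - k) *: u').
  by have := H M u (leqnn M) hu; rewrite subnn expr0 scale1r.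
elim: k u' => [|k IH] u' kM hu'; first by rewrite subn0; exact: hM.
have [u1 h1 ->] := ev_split hbs hu'; rewrite scalerDr; apply: LD.
  rewrite scalerA -exprSr -subSn // subSS; apply: IH => //; exact: ltnW.
apply: LZ; first exact: regX.
apply: L_sumP => s _; apply: LZ; [exact: regular_const qr _|exact: Lr].
Qed.

(** Every state of Q is matched.  If b were not, r b would be congruent modulo q L to a
    combination of the vectors matched with states, against base_free. *)
Lemma matched_total b : exists s, matched b s.
Proof.
apply: contrapT => nex; have [bs hbs] := bs_exists.
have [u1 /inW_L L1 uE] := ev_split hbs (r_inW b).
pose sg c := if pselect (exists s, matched c s) is left h then projT1 (cid h) else b0.
have sgE c s : matched c s -> sg c = s.
  move=> h; rewrite /sg; case: pselect => [h'|[]]; last by exists s.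
  case: (cid h') => s' /= hs'; exact: matched_inj hs' h.
pose Qb := [seq s <- enum T | `[< Q s >]].
pose a c := if c == b then 1 else - ev (Phi (r b) (sg c)).
have Qm s : s \in Qb -> matched (bs s) s by rewrite mem_filter => /andP[/asboolP /hbs].
have bsb s : s \in Qb -> bs s != b.
  by move=> /Qm h; apply/eqP => e; apply: nex; exists s; rewrite -e.
have ul : uniq (b :: map bs Qb).
  rewrite cons_uniq; apply/andP; split.
    by apply/mapP => -[s /bsb/eqP h /esym e]; apply: h.
  rewrite map_inj_in_uniq ?filter_uniq -?enumT ?enum_uniq //.
  by move=> s s' /Qm h /Qm h' e; rewrite e in h; exact: matched_inj h h'.
have := @base_free (b :: map bs Qb) a ul.
rewrite big_cons big_map {1}/a eqxx (qr_cst1 qr) scale1r.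
have -> : r b + \sum_(s <- Qb) cst (a (bs s)) *: r (bs s) = q *: u1.
  rewrite {1}uE -addrA [X in _ + X](_ : _ = 0) ?addr0 //.
  rewrite /Qb big_filter -big_split /=.
  rewrite big_seq_cond big1 // => s /andP[sT Qs].
  have sQ : s \in Qb by rewrite mem_filter Qs.
  by rewrite /a (negbTE (bsb _ sQ)) (sgE _ _ (Qm _ sQ)) (qr_cstN qr) scaleNr subrr.
have qLu : qL (q *: u1) by apply/qLE; exists u1.
move=> /(_ qLu b); rewrite inE eqxx /a eqxx => /(_ isT)/eqP.
by rewrite oner_eq0.
Qed.
End Embedded.

(** Scaling F gives the highest weight vector r c0 the value 1 at b0. *)
Theorem lattice_crystal (F : V -> T -> K) :
  (forall a, a != 0 -> lat_embed (fun u s => a * F u s)) ->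
  exists h : C -> T, [/\ injective h, forall b, Q (h b),
     forall s, Q s -> exists b, h b = s,
     forall i b, ceW i (h b) = omap h (ceC i b) /\ cfW i (h b) = omap h (cfC i b) &
     forall b j, wt (h b) j = wtC b j].
Proof.
move=> leF; have le1 := leF 1 (oner_neq0 K).
have [c0 hc0] := c0_exists le1.
have a0 : F (r c0) b0 != 0 by have := Phi_lam_b0 le1 hc0; rewrite mul1r.
have le := leF _ (invr_neq0 a0).
have n0 : (F (r c0) b0)^-1 * F (r c0) b0 = 1 by rewrite mulVf.
have tot b := matched_total le hc0 n0 b.
pose h b := projT1 (cid (tot b)).
have hm b : matched (fun u s => (F (r c0) b0)^-1 * F u s) b (h b) by rewrite /h; case: (cid _).
have mo o o' : orel (fun u s => (F (r c0) b0)^-1 * F u s) o o' -> o' = omap h o.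
  case: o => [b|]; case: o' => [s|] //= m; congr Some.
  exact: matched_inj m (hm b).
exists h; split.
- by move=> b b' e; apply: (matched_uniq le hc0 n0 (hm b)); rewrite e; exact: hm.
- by move=> b; exact: (matched_Q le hc0 n0 (hm b)).
- move=> s Qs; have [b m] := matched_surj le hc0 n0 Qs; exists b; exact: matched_inj (hm b) m.
- by move=> i b; split; apply: mo; [apply: (matched_e le hc0 n0)|apply: (matched_f le hc0 n0)].
- by move=> b j; exact: (matched_wt le (hm b)).
Qed.
End Lattice.

(** * Boxes of bits as a model of highest weight crystals *)

Lemma enum_split n (i i' : 'I_n) : i' = i.+1 :> nat ->
  exists s1 s2, enum 'I_n = s1 ++ [:: i; i'] ++ s2.
Proof.
move=> ii'; exists (take i (enum 'I_n)), (drop i.+2 (enum 'I_n)).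
apply: (inj_map val_inj); rewrite !map_cat map_take map_drop val_enum_ord /= ii'.
have hn : (i.+1 < n)%N by rewrite -ii' ltn_ord.
rewrite -{1}(cat_take_drop i (iota 0 n)); congr (_ ++ _).
rewrite !drop_iota !add0n; have -> : (n - i = (n - i.+2).+2)%N by lia.
by [].
Qed.

(** An x in P and not in P' would make P contain P' and x. *)
Lemma sum_comparable (A : finType) (P P' : A -> bool) :
  (forall x y, P x -> ~~ P' x -> P' y -> P y) ->
  (\sum_x P x = \sum_x P' x)%N -> forall x, P x -> P' x.
Proof.
move=> cmp e x Px; apply: contraT => nP'x.
have h : (\sum_(y | y != x) P' y <= \sum_(y | y != x) P y)%N.
  by apply: leq_sum => y _; case P'y: (P' y) => //; rewrite (cmp x y).
by move: e; rewrite (bigD1 x) //= [RHS](bigD1 x) //= Px (negbTE nP'x); lia.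
Qed.

Lemma sum_ord_lt h m : (h <= m)%N -> (\sum_(j < m) (j < h)%N = h)%N.
Proof.
elim: m => [|m IH]; first by rewrite leqn0 big_ord0 => /eqP.
rewrite big_ord_recr /= leq_eqVlt => /orP[/eqP ->|]; last first.
  by rewrite ltnS => hm; rewrite IH // ltnNge hm addn0.
rewrite ltnSn addn1; congr S; rewrite (eq_bigr (fun=> 1%N)) ?sum_nat_const ?card_ord ?muln1 // => j _.
by rewrite ltnS ltnW.
Qed.

Section Box.
Variables (n m : nat).
Definition cell : Type := ('I_n * 'I_m)%type.
Definition box := {ffun cell -> bool}.
Definition bget (t : box) (x : cell) : bool := t x.
Definition bput (x : cell) (v : bool) (t : box) : box :=
  [ffun y => if y == x then v else t y].

Lemma box_grid : grid bget bput.
Proof.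
split=> [t t' h|x v t y]; first by apply/ffunP.
by rewrite /bget ffunE.
Qed.

Variables (N : eqType) (lo hi : N -> 'I_n).
Hypothesis lohi : forall i, hi i = (lo i).+1 :> nat.
Hypothesis lo_inj : injective lo.

(** The column operators exchange the rows lo i and hi i; their sites are the columns
    from right to left, cols_rl.  The row operators exchange the columns k and k'; their
    sites are the rows from top to bottom, rows_tb. *)
Definition csw (i : N) (j : 'I_m) : box -> box := swp bget bput (lo i, j) (hi i, j).
Definition cup (i : N) (j : 'I_m) (t : box) := grid_up bget (lo i, j) (hi i, j) t.
Definition cdn (i : N) (j : 'I_m) (t : box) := grid_dn bget (lo i, j) (hi i, j) t.
Definition rsw (k k' : 'I_m) (i : 'I_n) : box -> box := swp bget bput (i, k) (i, k').
Definition rup (k k' : 'I_m) (i : 'I_n) (t : box) := grid_up bget (i, k) (i, k') t.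
Definition rdn (k k' : 'I_m) (i : 'I_n) (t : box) := grid_dn bget (i, k) (i, k') t.
Definition cols_rl : seq 'I_m := rev (enum 'I_m).
Definition rows_tb : seq 'I_n := enum 'I_n.

Lemma lohiN i : lo i != hi i.
Proof. by rewrite -val_eqE /= lohi; lia. Qed.

Lemma chain_c i : chain (csw i) (cup i) (cdn i).
Proof.
apply: (grid_chain box_grid) => [j j' [] //|j j' [] //|j j'].
by rewrite xpair_eqE (negbTE (lohiN i)).
Qed.

Lemma chain_r (k k' : 'I_m) : k' = k.+1 :> nat -> chain (rsw k k') (rup k k') (rdn k k').
Proof.
move=> kk'; have kN : k != k' by rewrite -val_eqE /= kk'; lia.
apply: (grid_chain box_grid) => [j j' [] //|j j' [] //|j j'].
by rewrite xpair_eqE (negbTE kN) andbF.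
Qed.

Lemma uJ : uniq cols_rl. Proof. by rewrite rev_uniq enum_uniq. Qed.
Lemma uR : uniq rows_tb. Proof. by rewrite enum_uniq. Qed.

Lemma box_cross (i : N) (k k' : 'I_m) : k' = k.+1 :> nat ->
  exists J1 J2 R1 R2, [/\ cols_rl = J1 ++ [:: k'; k] ++ J2, rows_tb = R1 ++ [:: lo i; hi i] ++ R2 &
   cross (csw i) (cup i) (cdn i) (rsw k k') (rup k k') (rdn k k')
     J1 [:: k'; k] J2 R1 [:: lo i; hi i] R2].
Proof.
move=> kk'; have [s1 [s2 sE]] := enum_split kk'; have [R1 [R2 RE]] := enum_split (lohi i).
have kN : k != k' by rewrite -val_eqE /= kk'; lia.
exists (rev s2), (rev s1), R1, R2.
have JE : cols_rl = rev s2 ++ [:: k'; k] ++ rev s1 by rewrite /cols_rl sE !rev_cat -catA.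
have uq : uniq [:: (lo i, k); (lo i, k'); (hi i, k); (hi i, k')].
  have lN := lohiN i; have h : hi i != lo i by rewrite eq_sym.
  by rewrite /= !inE !xpair_eqE !eqxx (negbTE kN) (negbTE lN).
split=> //; split.
- exact: chain_c.
- exact: chain_r.
- by rewrite -JE uJ.
- by rewrite -RE; exact: uR.
- move=> r j t far.
  have D x y z w : (x, y) != (z, w) :> cell = (x != z) || (y != w) by rewrite xpair_eqE negb_and.
  move: far; rewrite !inE !negb_or => far.
  have G1 r' : (r' == r) -> bget (csw i j t) (r', k) = bget t (r', k) /\ bget (csw i j t) (r', k') = bget t (r', k').
    move=> /eqP ->; case/orP: far => /andP[h1 h2]; split;
      by rewrite (swpN box_grid) // D ?[k == _]eq_sym ?[k' == _]eq_sym ?h1 ?h2 ?orbT.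
  have [g1 g2] := G1 r (eqxx _).
  have G2 : bget (rsw k k' r t) (lo i, j) = bget t (lo i, j) /\ bget (rsw k k' r t) (hi i, j) = bget t (hi i, j).
    case/orP: far => /andP[h1 h2]; split;
      by rewrite (swpN box_grid) // D ?[lo i == _]eq_sym ?[hi i == _]eq_sym ?h1 ?h2 ?orbT.
  have [g3 g4] := G2.
  rewrite /rup /rdn /cup /cdn /grid_up /grid_dn g1 g2 g3 g4; split=> //.
  rewrite /csw /rsw (swpC box_grid) // D; case/orP: far => /andP[h1 h2];
    by rewrite ?h1 ?h2 ?orbT // ?[lo i == _]eq_sym ?[hi i == _]eq_sym ?h1 ?h2.
- by move=> t t'; apply: (mid_fc box_grid uq).
- by move=> t t'; apply: (mid_fr box_grid uq).
- by move=> t; apply: (mid_ff box_grid uq).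
Qed.
Definition row_sum (s : box) (i : 'I_n) : int := \sum_j (s (i, j))%:Z.
Definition col_sum (s : box) (j : 'I_m) : nat := \sum_i s (i, j).

Lemma csw_tperm i a s r j : csw i a s (r, j) = s (if j == a then tperm (lo i) (hi i) r else r, j).
Proof.
have /= := swpE box_grid (lo i, a) (hi i, a) s (r, j); rewrite /bget /csw => ->.
rewrite !xpair_eqE; have [->|ja] := eqVneq j a; last by rewrite !andbF.
rewrite !andbT; case: eqVneq => [->|rl]; first by rewrite tpermL.
by case: eqVneq => [->|rh]; rewrite ?tpermR // tpermD // eq_sym.
Qed.

Lemma rsw_tperm (k k' : 'I_m) i s r j : rsw k k' i s (r, j) = s (r, if r == i then tperm k k' j else j).
Proof.
have /= := swpE box_grid (i, k) (i, k') s (r, j); rewrite /bget /rsw => ->.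
rewrite !xpair_eqE; have [->|ri] := eqVneq r i; last by [].
rewrite /=; case: eqVneq => [->|rl]; first by rewrite tpermL.
by case: eqVneq => [->|rh]; rewrite ?tpermR // tpermD // eq_sym.
Qed.

Lemma col_sum_csw i a s j : col_sum (csw i a s) j = col_sum s j.
Proof.
rewrite /col_sum [RHS](reindex_inj (@perm_inj _ (if j == a then tperm (lo i) (hi i) else 1%g))) /=.
by apply: eq_bigr => r _; rewrite csw_tperm; case: ifP => _; rewrite ?perm1.
Qed.

Lemma row_sum_csw i a s j : cdn i a s -> row_sum (csw i a s) j = row_sum s j + rootw lo hi i j.
Proof.
rewrite /cdn /grid_dn /bget => /andP[/negbTE sl sh].
rewrite /row_sum (bigD1 a) //= [in RHS](bigD1 a) //=.
have -> : \sum_(j' | j' != a) (csw i a s (j, j'))%:Z = \sum_(j' | j' != a) (s (j, j'))%:Z.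
  by apply: eq_bigr => j' /negbTE ja; rewrite csw_tperm ja.
rewrite csw_tperm eqxx /rootw.
case: tpermP => [->|->|/eqP jl /eqP jh].
- by rewrite eqxx (negbTE (lohiN i)) sl sh; ring.
- by rewrite eqxx eq_sym (negbTE (lohiN i)) sl sh; ring.
- by rewrite (negbTE jl) (negbTE jh); ring.
Qed.

Lemma chwt_b i s : chain_wt (cup i) (cdn i) cols_rl s = row_sum s (lo i) - row_sum s (hi i).
Proof.
rewrite (chwt_sum (chain_c i)) /cols_rl (perm_big _ (permEl (perm_rev _))) /= big_enum /= /row_sum -sumrB.
apply: eq_bigr => j _; rewrite /site_sign /cup /cdn /grid_up /grid_dn /bget.
by case: (s _); case: (s _).
Qed.

(** The entries at natural indices, false outside of the box. *)
Definition ab (s : box) (i j : nat) : bool :=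
  oapp (fun i' : 'I_n => oapp (fun j' : 'I_m => s (i', j')) false (insub j)) false (insub i).

Lemma abE s (i : 'I_n) (j : 'I_m) : ab s i j = s (i, j).
Proof. by rewrite /ab !valK. Qed.

Lemma ab_supp s i j : ab s i j -> (i < n)%N && (j < m)%N.
Proof.
rewrite /ab; case: (insubP 'I_n i) => //= i' -> _.
by case: (insubP 'I_m j) => //= j' ->.
Qed.

Lemma ab_rows s : (forall k k' : 'I_m, k' = k.+1 :> nat -> ch_eps (rup k k') (rdn k k') rows_tb s = 0%N) ->
  forall k r, (r <= n)%N ->
  (count (fun i => ~~ ab s i k && ab s i k.+1) (iota 0 r)
  <= count (fun i => ab s i k && ~~ ab s i k.+1) (iota 0 r))%N.
Proof.
move=> hw k r rn; have [km|km] := ltnP k.+1 m; last first.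
  rewrite (_ : count _ _ = 0%N) //; apply/eqP; rewrite -leqn0 leqNgt -has_count.
  apply/hasPn => i _; rewrite negb_and orbC; case: (boolP (ab s i k.+1)) => // /ab_supp; lia.
pose k0 := Ordinal (ltnW km); pose k1 := Ordinal km.
have := @sg_eps0_count _ (fun i => rup k0 k1 i s) (fun i => rdn k0 k1 i s) (take r rows_tb) (drop r rows_tb).
rewrite cat_take_drop => /(_ (hw k0 k1 erefl)).
have -> : iota 0 r = map val (take r rows_tb).
  by rewrite map_take val_enum_ord take_iota (minn_idPl rn).
rewrite !count_map; congr (_ <= _)%N; apply: eq_count => i /=;
by rewrite /rup /rdn /grid_up /grid_dn /bget -!abE.
Qed.

Hypothesis lo_surj : forall l, (l.+1 < n)%N -> exists i, lo i = l :> nat.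

Lemma ab_cols s : (forall i, ch_eps (cup i) (cdn i) cols_rl s = 0%N) ->
  forall l c, (l.+1 < n)%N ->
    (count (fun j => ~~ ab s l j && ab s l.+1 j) (iota c (m - c))
    <= count (fun j => ab s l j && ~~ ab s l.+1 j) (iota c (m - c)))%N.
Proof.
move=> hw l c ln; have [i il] := lo_surj ln.
have E : rev (iota c (m - c)) = map val (take (m - c) cols_rl).
  rewrite map_take /cols_rl map_rev val_enum_ord take_rev size_iota drop_iota add0n.
  case: (leqP c m) => cm; first by rewrite subKn.
  have -> : (m - c = 0)%N by lia.
  by rewrite !subn0 subnn.
rewrite -[count _ _]count_rev -[X in (_ <= X)%N]count_rev E !count_map.
have := @sg_eps0_count _ (fun j => cup i j s) (fun j => cdn i j s) (take (m - c) cols_rl) (drop (m - c) cols_rl).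
rewrite cat_take_drop => /(_ (hw i)).
congr (_ <= _)%N; apply: eq_count => j /=;
by rewrite /cup /cdn /grid_up /grid_dn /bget -!abE lohi il.
Qed.

Variable lam : 'I_n -> nat.
Hypothesis lam_dec : forall i i' : 'I_n, (i <= i')%N -> (lam i' <= lam i)%N.
Definition diagram : box := [ffun x : cell => (x.2 < lam x.1)%N].

(** The boxes that are highest for the row operators, with the column sums of the
    diagram lam: in the end, the crystal of highest weight lam. *)
Definition row_highest (s : box) : Prop :=
  (forall k k' : 'I_m, k' = k.+1 :> nat -> ch_e (rsw k k') (rup k k') (rdn k k') rows_tb s = None) /\
  (forall j, col_sum s j = col_sum diagram j).

(** A box that is highest for both structures is a Young diagram, determined by its
    column sums. *)
Lemma row_highest_hw s : row_highest s -> (forall i, ch_e (csw i) (cup i) (cdn i) cols_rl s = None) -> s = diagram.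
Proof.
move=> [hr hs] hc.
have [||_ mono] := @highest_justified n m (ab s) (@ab_supp s).
- by apply: ab_rows => k k' kk'; apply/(ch_eN (chain_r kk')); exact: hr.
- by apply: ab_cols => i; apply/(ch_eN (chain_c i)).
have top (i i' : 'I_n) j : (i <= i')%N -> s (i', j) -> s (i, j).
  rewrite -!abE; move: (nat_of_ord i') (nat_of_ord i) => x y; elim: x => [|x IH].
    by rewrite leqn0 => /eqP ->.
  by rewrite leq_eqVlt => /orP[/eqP ->//|]; rewrite ltnS => /IH h /mono/h.
have top0 (i i' : 'I_n) j : (i <= i')%N -> diagram (i', j) -> diagram (i, j).
  by rewrite !ffunE /= => /lam_dec h /leq_trans; apply.
apply/ffunP => -[i j]; apply/idP/idP.
  apply: (@sum_comparable _ (fun i => s (i, j)) (fun i => diagram (i, j))) => [x y sx n0x y0|]; last exact: hs.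
  apply: (top y x) => //; rewrite leqNgt; apply: contra n0x => /ltnW xy; exact: top0 xy y0.
apply: (@sum_comparable _ (fun i => diagram (i, j)) (fun i => s (i, j))) => [x y sx n0x y0|]; last exact/esym/hs.
apply: (top0 y x) => //; rewrite leqNgt; apply: contra n0x => /ltnW xy; exact: top xy y0.
Qed.

Lemma diagram_cdn i j : cdn i j diagram = false.
Proof.
rewrite /cdn /grid_dn /bget !ffunE /=; apply/negbTE; rewrite negb_and negbK.
have : (lam (hi i) <= lam (lo i))%N by apply: lam_dec; rewrite lohi.
by case: ltnP => //= h1 h2; rewrite -leqNgt (leq_trans h2).
Qed.

Lemma diagram_rdn (k k' : 'I_m) i : k' = k.+1 :> nat -> rdn k k' i diagram = false.
Proof.
by move=> kk'; rewrite /rdn /grid_dn /bget !ffunE /= kk'; apply/negbTE; lia.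
Qed.

Lemma row_highest_e i s s' : row_highest s -> ch_e (csw i) (cup i) (cdn i) cols_rl s = Some s' -> row_highest s'.
Proof.
move=> [hr hs] E; split=> [k k' kk'|j]; last first.
  have [a _ ->] := ce_mem E; by rewrite col_sum_csw hs.
have [J1 [J2 [R1 [R2 [JE RE cr]]]]] := box_cross i kk'.
have := cross_ee cr s; rewrite -JE -RE E /= => ->.
by rewrite hr.
Qed.

(** The height: every simple root contributes 1. *)
Definition height (mu : 'I_n -> int) : int := rhow (fun i : 'I_n => (n - i)%N) mu.

Lemma row_sum_e i s s' : ch_e (csw i) (cup i) (cdn i) cols_rl s = Some s' ->
  forall j, row_sum s' j = row_sum s j + rootw lo hi i j.
Proof.
rewrite /ch_e; case E: (sg_e _ _ _) => [a|] //= [<-] j; apply: row_sum_csw.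
by have /andP[_] := sg_e_mem E.
Qed.

Lemma rho_root i : (n - lo i = (n - hi i).+1)%N.
Proof. have := ltn_ord (hi i); rewrite lohi; lia. Qed.

Lemma heightD mu i : height (fun j => mu j + rootw lo hi i j) = height mu + 1.
Proof.
transitivity (height mu + height (rootw lo hi i)).
  by rewrite /height /rhow -big_split /=; apply: eq_bigr => j _; rewrite mulrDr.
by congr (_ + _); exact: (rhow_root rho_root).
Qed.

Lemma height_ext mu nu : mu =1 nu -> height mu = height nu.
Proof. by move=> h; apply: eq_bigr => j _; rewrite h. Qed.

Lemma row_highest_depth s : row_highest s -> exists d : nat, height (row_sum s) = height (row_sum diagram) - d%:Z.
Proof.
have [B hB] : exists B : int, forall s, height (row_sum s) <= B.
  exists (\sum_s `|height (row_sum s)|) => s'; rewrite (bigD1 s') //=.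
  by apply: (le_trans (ler_norm _)); rewrite lerDl sumr_ge0.
have step i s1 s2 : ch_e (csw i) (cup i) (cdn i) cols_rl s1 = Some s2 -> height (row_sum s2) = height (row_sum s1) + 1.
  by move=> /row_sum_e h; rewrite (height_ext h) heightD.
suff H M s' : row_highest s' -> B - M%:Z <= height (row_sum s') -> exists d : nat, height (row_sum s') = height (row_sum diagram) - d%:Z.
  move=> Qs; apply: (H `|B - height (row_sum s)|%N s Qs); have := hB s; lia.
elim: M s' => [|M IH] s' Qs' hM.
  exists 0%N; rewrite subr0; congr (height (row_sum _)); apply: row_highest_hw => // i.
  case E: (ch_e _ _ _ _ _) => [s1|] //.
  by have := step _ _ _ E; have := hB s1; lia.
have [hw|nhw] := pselect (forall i, ch_e (csw i) (cup i) (cdn i) cols_rl s' = None).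
  by exists 0%N; rewrite subr0 (row_highest_hw Qs' hw).
have [i [s1 E]] : exists i s1, ch_e (csw i) (cup i) (cdn i) cols_rl s' = Some s1.
  apply: contrapT => nex; apply: nhw => i; case E: (ch_e _ _ _ _ _) => [s1|] //.
  by case: nex; exists i, s1.
have st := step _ _ _ E.
have [|d hd] := IH s1 (row_highest_e Qs' E); first by move: hM; rewrite st; lia.
by exists d.+1; move: hd; rewrite st; lia.
Qed.

Section Functions.
Variables (K : fieldType) (q : K) (cst : rat -> K) (reg : K -> Prop) (ev : K -> rat).
Hypothesis qr : qring q cst reg ev.
Local Notation eW i := (qe (csw i) (cup i) (cdn i) q cols_rl).
Local Notation fW i := (qf (csw i) (cup i) (cdn i) q cols_rl).
Local Notation eR k k' := (qe (rsw k k') (rup k k') (rdn k k') (- q) rows_tb).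
Let q0 : q != 0 := q_neq0 qr.
Let mq0 : - q != 0. Proof. by rewrite oppr_eq0. Qed.
Let rmq : reg (- q) := regularN qr (regular0q qr).
Let emq : ev (- q) = 0.
Proof. by rewrite (ev0N qr (regular0q qr)) (ev0q qr) oppr0. Qed.
Let q1 := param_sq qr (regular0q qr) (ev0q qr).

(** The quantum analogue of row_highest: functions killed by the raising row operators
    with the parameter - q, and supported on boxes with the right column sums. *)
Definition row_killed (x : box -> K) : Prop :=
  (forall k k' : 'I_m, k' = k.+1 :> nat -> forall s, eR k k' x s = 0) /\
  (forall s, x s != 0 -> forall j, col_sum s j = col_sum diagram j).

Definition diagram_fun : box -> K := fun s => (s == diagram)%:R.

Lemma diagram_fun_e i s : eW i diagram_fun s = 0.
Proof.
apply/eqP/negPn/negP => h; have [a ua] := qe_supp h; rewrite /diagram_fun {h}.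
case: (eqVneq (csw i a s) diagram) => [sE _|_]; last by rewrite eqxx.
by have := ch_dn (chain_c i) a s; rewrite sE diagram_cdn ua.
Qed.

Lemma row_killed_w0 : row_killed diagram_fun.
Proof.
split=> [k k' kk' s|s]; last by rewrite /diagram_fun; case: (eqVneq s diagram) => [-> //|_]; rewrite eqxx.
apply/eqP/negPn/negP => h; have [a ua] := qe_supp h; rewrite /diagram_fun {h}.
case: (eqVneq (rsw k k' a s) diagram) => [sE _|_]; last by rewrite eqxx.
by have := ch_dn (chain_r kk') a s; rewrite sE diagram_rdn // ua.
Qed.

Lemma row_killed_ext x y : x =1 y -> row_killed x -> row_killed y.
Proof.
move=> xy [h1 h2]; split=> [k k' kk' s|s]; last by rewrite -xy; exact: h2.
by rewrite -(eq_qe _ _ _ _ _ xy) h1.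
Qed.

Lemma row_killed0 : row_killed (fun=> 0).
Proof. by split=> [k k' _ s|s]; [exact: qe0|rewrite eqxx]. Qed.

Lemma row_killed_lin (a : K) x y : row_killed x -> row_killed y -> row_killed (fun s => a * x s + y s).
Proof.
move=> [h1 h2] [g1 g2]; split=> [k k' kk' s|s nz].
  rewrite qeD g1 // addr0.
  rewrite (@qe_mul _ _ _ _ _ _ _ mq0 _ (fun=> a)) // h1 // mulr0 //.
have [xs|xs] := eqVneq (x s) 0; last exact: h2.
by apply: g2; move: nz; rewrite xs mulr0 add0r.
Qed.

Lemma bcell_uniq i (k k' : 'I_m) : k' = k.+1 :> nat ->
  uniq [:: (lo i, k); (lo i, k'); (hi i, k); (hi i, k')].
Proof.
move=> kk'; have kN : k != k' by rewrite -val_eqE /= kk'; lia.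
have lN := lohiN i.
by rewrite /= !inE !xpair_eqE !eqxx (negbTE kN) (negbTE lN).
Qed.

Lemma row_killed_f i x : row_killed x -> row_killed (fW i x).
Proof.
move=> [h1 h2]; split=> [k k' kk' s|s]; last first.
  by move=> nz; have [a _ /h2 h] := qf_supp nz; move=> j; rewrite -h col_sum_csw.
have [J1 [J2 [R1 [R2 [JE RE cr]]]]] := box_cross i kk'.
rewrite JE RE -(qcross cr q0 mq0).
- by rewrite -JE -RE (eq_qf _ _ _ _ _ (h1 k k' kk')) qf0.
- by move=> r t; apply: (hmid_c box_grid (bcell_uniq i kk')).
- by move=> j t; apply: (hmid_r box_grid (bcell_uniq i kk')).
- by move=> y t; apply: (qmid box_grid (bcell_uniq i kk')).
Qed.

(** gam_ker for the row operators: a regular function that they kill is supported at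
    q = 0 on boxes that are highest for them. *)
Lemma row_killed_Q x : row_killed x -> (forall s, reg (x s)) -> forall s, ev (x s) != 0 -> row_highest s.
Proof.
move=> [h1 h2] rx s es; split=> [k k' kk'|]; last first.
  by apply: h2; apply: contra es => /eqP ->; rewrite (ev0_0 qr).
apply/(ch_eN (chain_r kk')); apply/eqP/negPn/negP => eps.
have := gam_ker qr mq0 rmq emq (chain_r kk') uR (h1 k k' kk') eps.
have [_] := gam_reg qr mq0 rmq emq (rsw k k') (rup k k') (rdn k k') rows_tb s rx.
by move=> + h; rewrite h (ev0_0 qr) => /esym/eqP; rewrite (negbTE es).
Qed.

(** An instance of commutator; the cases are those of equal, adjacent and distant simple
    roots. *)
Lemma efW_b i k (x : box -> K) s : eW i (fW k x) s - fW k (eW i x) s =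
  if i == k then zint q (row_sum s (lo i) - row_sum s (hi i)) * x s else 0.
Proof.
rewrite -chwt_b.
have cellN (r r' : 'I_n) (j j' : 'I_m) : j != j' -> (r, j) != (r', j').
  by move=> jj'; rewrite xpair_eqE (negbTE jj') andbF.
have far a b s' : a != b ->
  [/\ cup i a (csw k b s') = cup i a s', cdn i a (csw k b s') = cdn i a s',
      cup k b (csw i a s') = cup k b s', cdn k b (csw i a s') = cdn k b s' &
      csw i a (csw k b s') = csw k b (csw i a s')].
  move=> ab; have ba : b != a by rewrite eq_sym.
  rewrite /cup /cdn /grid_up /grid_dn /csw !(swpN box_grid) ?cellN //; split=> //.
  by rewrite (swpC box_grid) ?cellN.
have sv i' a b s' : bget (csw i' a s') (b, a) = bget s' (tperm (lo i') (hi i') b, a).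
  by rewrite /bget csw_tperm eqxx.
pose c : int := if i == k then 2%:Z else - ((lo k == hi i)%:Z + (hi k == lo i)%:Z).
have eN : i != k -> lo i != lo k by apply: contra_neq => /lo_inj.
have eN' : i != k -> hi i != hi k.
  by move=> ik; have := eN ik; rewrite -!val_eqE /= !lohi eqSS.
have lhN := lohiN.
have hlN i' : hi i' != lo i' by rewrite eq_sym.
rewrite (@commutator _ _ _ _ _ _ _ _ _ q (chain_c i) (chain_c k) q0 q1 far c (i == k)) //.
- move=> a s'; rewrite /site_sign /cup /cdn /grid_up /grid_dn !sv /c; case: (eqVneq i k) => [<-|ik].
    by rewrite tpermL tpermR => /andP[-> /negbTE ->].
  case: (tpermP _ _ (lo k)) => [e|e|/eqP h1 /eqP h2].
  - by have := eN ik; rewrite e eqxx.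
  - rewrite e; case: (tpermP _ _ (hi k)) => [e'|e'|/eqP h3 /eqP h4].
    + by have := lohi i; have := lohi k; rewrite e e'; lia.
    + by have := eN' ik; rewrite e' eqxx.
    + by rewrite eqxx (negbTE h3) => /andP[-> /negbTE ->] /=; case: (bget s' (hi k, a)).
  - rewrite (negbTE h2); case: (tpermP _ _ (hi k)) => [e'|e'|/eqP h3 /eqP h4].
    + by rewrite e' eqxx => /andP[-> /negbTE ->] /=; case: (bget s' (lo k, a)).
    + by have := eN' ik; rewrite e' eqxx.
    + by rewrite (negbTE h3) subr0.
- move=> a s'; rewrite /site_sign /cup /cdn /grid_up /grid_dn !sv /c; case: (eqVneq i k) => [<-|ik].
    by rewrite tpermL tpermR => /andP[/negbTE -> ->].
  case: (tpermP _ _ (lo i)) => [e|e|/eqP h1 /eqP h2].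
  - by have := eN ik; rewrite e eqxx.
  - rewrite e; case: (tpermP _ _ (hi i)) => [e'|e'|/eqP h3 /eqP h4].
    + by have := lohi i; have := lohi k; rewrite e e'; lia.
    + by have := eN' ik; rewrite e' eqxx.
    + by rewrite eqxx eq_sym (negbTE h3) => /andP[/negbTE -> ->] /=; case: (bget s' (hi i, a)).
  - rewrite [hi k == _]eq_sym (negbTE h2); case: (tpermP _ _ (hi i)) => [e'|e'|/eqP h3 /eqP h4].
    + by rewrite e' eqxx => /andP[/negbTE -> ->] /=; case: (bget s' (lo i, a)).
    + by have := eN' ik; rewrite e' eqxx.
    + by rewrite eq_sym (negbTE h3) addr0.
- by move=> /eqP ->.
- move=> a y s'; have [<-|ik] := eqVneq i k.
    rewrite /site_sign (ch_dn (chain_c i)) (ch_up (chain_c i)) (ch_swK (chain_c i)).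
    have := ch_ud (chain_c i) s' a.
    by case: (cup i a s'); case: (cdn i a s') => //= _; rewrite ?subr0 ?sub0r ?rmorph1 ?rmorphN1 ?mul1r ?mulN1r ?rmorph0 ?mul0r.
  have ifE (b1 b2 : bool) (z : K) : (if b1 then if b2 then z else 0 else 0) = if b1 && b2 then z else 0.
    by case: b1.
  rewrite !ifE.
  have [e|n1] := eqVneq (lo k) (hi i).
    have -> : cup i a s' && cdn k a (csw i a s') = false.
      rewrite /cup /cdn /grid_up /grid_dn !sv e tpermR.
      by case: (bget s' (lo i, a)); rewrite ?andbF.
    have -> : cdn k a s' && cup i a (csw k a s') = false.
      rewrite /cup /cdn /grid_up /grid_dn !sv -e tpermL.
      by case: (bget s' (hi k, a)); rewrite ?andbF.
    by rewrite subrr.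
  have [e|n2] := eqVneq (hi k) (lo i).
    have -> : cup i a s' && cdn k a (csw i a s') = false.
      rewrite /cup /cdn /grid_up /grid_dn !sv e tpermL.
      by case: (bget s' (hi i, a)); rewrite ?andbF.
    have -> : cdn k a s' && cup i a (csw k a s') = false.
      rewrite /cup /cdn /grid_up /grid_dn !sv -e tpermR.
      by case: (bget s' (lo k, a)); rewrite ?andbF.
    by rewrite subrr.
  have c1 (x1 x2 : 'I_n) : x1 != x2 -> (x1, a) != (x2, a) by rewrite xpair_eqE eqxx andbT.
  have [m1 m2] := (eN ik, eN' ik).
  have n1' : hi i != lo k by rewrite eq_sym.
  have n2' : lo i != hi k by rewrite eq_sym.
  have -> : cdn k a (csw i a s') = cdn k a s'.
    by rewrite /cdn /grid_dn /csw !(swpN box_grid) // c1 // eq_sym.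
  have -> : cup i a (csw k a s') = cup i a s'.
    by rewrite /cup /grid_up /csw !(swpN box_grid) // c1.
  have -> : csw i a (csw k a s') = csw k a (csw i a s').
    by rewrite /csw (swpC box_grid) // c1.
  by rewrite andbC subrr.
- exact: uJ.
Qed.
End Functions.
End Box.

(** V is an irreducible module of highest weight lam with a crystal base, which is given
    by L, r and C; dv and sdecomp are its divided powers and string decompositions. *)
Section BoxCrystal.
Variables (n m : nat) (N : eqType) (lo hi : N -> 'I_n).
Hypothesis lohi : forall i, hi i = (lo i).+1 :> nat.
Hypothesis lo_inj : injective lo.
Hypothesis lo_surj : forall l, (l.+1 < n)%N -> exists i, lo i = l :> nat.
Variable lam : 'I_n -> nat.
Hypothesis lam_dec : forall i i' : 'I_n, (i <= i')%N -> (lam i' <= lam i)%N.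
Hypothesis lam_m : forall i, (lam i <= m)%N.
Variables (K : fieldType) (q : K) (cst : rat -> K) (reg : K -> Prop) (ev : K -> rat).
Hypothesis qr : qring q cst reg ev.
Local Notation rootw := (rootw lo hi).
Local Notation ceW i := (ch_e (csw (m := m) lo hi i) (cup lo hi i) (cdn lo hi i) (cols_rl m)).
Local Notation cfW i := (ch_f (csw (m := m) lo hi i) (cup lo hi i) (cdn lo hi i) (cols_rl m)).

Variables (V : vectType K) (e f : N -> 'End(V)) (t tV : 'I_n -> 'End(V)).
Hypothesis tK : forall j v, tV j (t j v) = v.
Hypothesis tf : forall j i v, t j (f i v) = q ^ (- rootw i j) *: f i (t j v).
Hypothesis ef : forall i k v, e i (f k v) - f k (e i v) =
    if i == k then (q - q^-1)^-1 *:
      (t (lo i) (tV (hi i) v) - tV (lo i) (t (hi i) v)) else 0.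
Variable v0 : V.
Hypothesis v0_neq0 : v0 != 0.
Hypothesis v0_wt : forall j, t j v0 = q ^ (lam j)%:Z *: v0.
Hypothesis v0_e : forall i, e i v0 = 0.
Hypothesis irr : forall U : {vspace V},
  (forall i v, v \in U -> e i v \in U) -> (forall i v, v \in U -> f i v \in U) ->
  (forall j v, v \in U -> t j v \in U) -> (forall j v, v \in U -> tV j v \in U) ->
  U = 0%VS \/ U = fullv.

Variable L : V -> Prop.
Variable X : (\dim {:V}).-tuple V.
Hypothesis Xb : basis_of {:V} X.
Hypothesis LX : forall u, L u <-> forall k, reg (coord X k u).
Variables (C : eqType) (r : C -> V) (wtC : C -> 'I_n -> int) (ceC cfC : N -> C -> option C).
Hypothesis Lr : forall b, L (r b).
Hypothesis rt : forall b j, t j (r b) = q ^ wtC b j *: r b.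
Hypothesis base_span : forall u, L u -> exists (s : seq C) (a : C -> rat),
    L (q^-1 *: (u - \sum_(b <- s) cst (a b) *: r b)).
Hypothesis base_free : forall (s : seq C) (a : C -> rat), uniq s ->
    L (q^-1 *: \sum_(b <- s) cst (a b) *: r b) -> forall b, b \in s -> a b = 0.
Hypothesis base_ef : forall i b b', cfC i b = Some b' <-> ceC i b' = Some b.

Definition dv i k (v : V) : V := (qfact q k)^-1 *: iter k (f i) v.
Definition sdecomp i (la : 'I_n -> int) (u : V) (s : seq V) : Prop :=
  u = \sum_(k < size s) dv i k s`_k /\
  forall k, (k < size s)%N ->
    [/\ e i s`_k = 0, forall j, t j s`_k = q ^ (la j + rootw i j *+ k) *: s`_k
      & s`_k != 0 -> k%:Z <= (la (lo i) + rootw i (lo i) *+ k) - (la (hi i) + rootw i (hi i) *+ k)].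
Hypothesis He : forall i b, exists v s, [/\ sdecomp i (wtC b) (r b) s,
  v = \sum_(1 <= k < size s) dv i k.-1 s`_k, L v & L (q^-1 *: (v - oapp r 0 (ceC i b)))].
Hypothesis Hf : forall i b, exists v s, [/\ sdecomp i (wtC b) (r b) s,
  v = \sum_(k < size s) dv i k.+1 s`_k, L v & L (q^-1 *: (v - oapp r 0 (cfC i b)))].

Let q0 : q != 0 := q_neq0 qr.
Local Notation qeB i := (qe (csw (m := m) lo hi i) (cup lo hi i) (cdn lo hi i) q (cols_rl m)).
Local Notation qfB i := (qf (csw (m := m) lo hi i) (cup lo hi i) (cdn lo hi i) q (cols_rl m)).
Local Notation dvfB i := (dvf (csw (m := m) lo hi i) (cup lo hi i) (cdn lo hi i) q (cols_rl m)).
Local Notation gamB i := (gam (csw (m := m) lo hi i) (cup lo hi i) (cdn lo hi i) q (cols_rl m)).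
Local Notation ogamB i := (ogam (csw (m := m) lo hi i) (cup lo hi i) (cdn lo hi i) q (cols_rl m)).
Local Notation b0 := (diagram m lam).

Lemma wt_b0 j : row_sum b0 j = (lam j)%:Z.
Proof.
rewrite /row_sum (eq_bigr (fun j' : 'I_m => ((j' < lam j)%N : nat)%:Z)); last by move=> j' _; rewrite ffunE.
by rewrite -(big_morph Posz PoszD (erefl 0)) sum_ord_lt.
Qed.

Lemma expq_inj a b : q ^ a = q ^ b -> a = b.
Proof.
have H (z w : int) : (z < w)%R -> q ^ z != q ^ w.
  move=> zw; have -> : w = z + `|w - z|%N.-1.+1%:Z by lia.
  rewrite expfzDr //; apply/eqP => h; have := expq_neq1 qr (`|w - z|%N.-1).
  move/negP; apply; apply/eqP; apply: (@mulfI _ (q ^ z)); first by rewrite expfz_eq0 (negbTE q0) andbF.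
  by rewrite mulr1 {2}h.
move=> h; have [/H|/H|//] := ltgtP a b; by rewrite h eqxx.
Qed.

Section WithPhi.
Variable F : V -> box n m -> K.
Hypothesis it : intertwiner q (fun i : 'I_n => (n - i)%N) e f t v0
   (csw (m := m) lo hi) (cup lo hi) (cdn lo hi) (cols_rl m) (@row_sum n m) b0 (row_killed lam q) F.

Lemma F0 s : F 0 s = 0.
Proof. by have := it_lin it (-1) 0 0 s; rewrite scaleN1r addNr mulN1r addNr. Qed.
Lemma FZ a u s : F (a *: u) s = a * F u s.
Proof. by rewrite -[a *: u]addr0 (it_lin it) F0 addr0. Qed.
Lemma F_sum (A : Type) (l : seq A) (Pr : pred A) (G : A -> V) s :
  F (\sum_(a <- l | Pr a) G a) s = \sum_(a <- l | Pr a) F (G a) s.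
Proof.
elim: l => [|a l IH]; first by rewrite !big_nil F0.
rewrite !big_cons; case: ifP => _; rewrite ?IH //.
by rewrite -[G a]scale1r (it_lin it) mul1r scale1r IH.
Qed.

Lemma F_iter i k u s : F (iter k (f i) u) s =
  iter k (qfB i) (F u) s.
Proof.
elim: k s => //= k IH s; rewrite (it_f it).
by apply: eq_qf => s'; exact: IH.
Qed.

Lemma F_dv i k u s : F (dv i k u) s =
  dvfB i k (F u) s.
Proof. by rewrite /dv FZ F_iter. Qed.

Lemma F_wt mu u s : (forall j, t j u = q ^ mu j *: u) -> F u s != 0 -> forall j, row_sum s j = mu j.
Proof.
move=> hu nz j; apply: expq_inj; apply: (mulIf nz).
by rewrite -(it_t it) hu FZ.
Qed.

Section Strings.
Variables (i : N) (la : 'I_n -> int) (u : V) (s : seq V).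
Hypothesis hs : sdecomp i la u s.

Let chi := chain_c m lohi i.
Let Fs k := F s`_k.
Let ak k := (la (lo i) + rootw i (lo i) *+ k) - (la (hi i) + rootw i (hi i) *+ k).

Let s_e k x : (k < size s)%N -> qeB i (Fs k) x = 0.
Proof. by move=> ks; have [h _ _] := hs.2 k ks; rewrite -(it_e it) h F0. Qed.

Let s_wt k x : (k < size s)%N -> Fs k x != 0 -> forall j, row_sum x j = la j + rootw i j *+ k.
Proof. by move=> ks; have [_ h _] := hs.2 k ks; apply: F_wt. Qed.

Let s_a k x : (k < size s)%N -> Fs k x != 0 -> chain_wt (cup lo hi i) (cdn lo hi i) (cols_rl m) x = ak k.
Proof. by move=> ks nz; rewrite (chwt_b lohi) !(s_wt ks nz). Qed.

Let s_k k x : (k < size s)%N -> Fs k x != 0 -> k%:Z <= ak k.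
Proof.
move=> ks nz; have [_ _ h] := hs.2 k ks; apply: h.
by apply: contra nz => /eqP h; rewrite /Fs h F0.
Qed.

Let uE x : F u x = \sum_(k < size s)
  dvfB i k (Fs k) x.
Proof. by rewrite hs.1 F_sum; apply: eq_bigr => k _; rewrite F_dv. Qed.

(** F commutes with f, so it maps a string decomposition in V to one of functions. *)
Lemma string_e x :
  gamB i x
    (F (\sum_(1 <= k < size s) dv i k.-1 s`_k)) =
  ogamB i (cfW i x) (F u).
Proof.
have := gam_string_e qr q0 (regular0q qr) (ev0q qr) chi (uJ m) s_e s_a s_k x.
have -> : ogamB i (cfW i x) (F u) =
  ogamB i (cfW i x)
   (fun x => \sum_(k < size s) dvfB i k (Fs k) x).
  by case: (cfW i x) => //= y; apply: eq_gam => z; exact: uE.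
move=> <-; apply: eq_gam => y; rewrite F_sum.
case: (size s) => [|k]; first by rewrite big_geq ?big_ord0.
rewrite big_add1 /= big_mkord; apply: eq_bigr => j _; exact: F_dv.
Qed.

Lemma string_f x :
  gamB i x
    (F (\sum_(k < size s) dv i k.+1 s`_k)) =
  ogamB i (ceW i x) (F u).
Proof.
have := gam_string_f qr q0 (regular0q qr) (ev0q qr) chi (uJ m) s_e x.
have -> : ogamB i (ceW i x) (F u) =
  ogamB i (ceW i x)
   (fun x => \sum_(k < size s) dvfB i k (Fs k) x).
  by case: (ceW i x) => //= y; apply: eq_gam => z; exact: uE.
move=> <-; apply: eq_gam => y; rewrite F_sum.
by apply: eq_bigr => j _; exact: F_dv.
Qed.

Lemma string_e_wt x : F (\sum_(1 <= k < size s) dv i k.-1 s`_k) x != 0 ->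
  forall j, row_sum x j = la j + rootw i j.
Proof.
have tdv k j v mu : (forall j, t j v = q ^ mu j *: v) ->
    t j (dv i k v) = q ^ (mu j - rootw i j *+ k) *: dv i k v.
  move=> hv; rewrite /dv linearZ /= scalerA mulrC -scalerA; congr (_ *: _).
  elim: k => [|k IH] /=; first by rewrite mulr0n subr0.
  by rewrite tf IH linearZ /= scalerA -expfzDr // mulrS; congr (q ^ _ *: _); ring.
apply: F_wt => j; rewrite linear_sum scaler_sumr big_nat [RHS]big_nat.
apply: eq_bigr => -[//|k] /andP[_ ks]; have [_ h _] := hs.2 k.+1 ks.
by rewrite /= (tdv k j _ _ h) mulrS; congr (q ^ _ *: _); ring.
Qed.
End Strings.

Lemma embed_F (a : K) : a != 0 -> lat_embed q reg ev (csw (m := m) lo hi) (cup lo hi) (cdn lo hi)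
  (cols_rl m) (@row_sum n m) b0 rootw (@height n) (@row_highest n m lam) L r wtC ceC cfC (fun u s => a * F u s).
Proof.
move=> a0; split.
- by move=> c u v s; rewrite (it_lin it); ring.
- move=> u h; apply: (it_inj it) => s; apply/eqP; have /eqP := h s.
  by rewrite mulf_eq0 (negbTE a0).
- move=> u ru s; apply: (row_killed_Q qr (x := fun s => a * F u s)) => //.
  by apply: row_killed_ext (row_killed_lin qr a (it_Zp it u) (row_killed0 _ _ _)) => s'; rewrite addr0.
- move=> b s nz; apply: (F_wt (rt b)); apply: contra nz => /eqP ->; by rewrite mulr0.
- by move=> u s h1 h2; rewrite (it_b0 it) ?mulr0.
- exists v0; rewrite (it_v0 it) /w0 eqxx mulr1 //.
- move=> u s nz; apply: (it_depth (u := u) it); apply: contra nz => /eqP ->; by rewrite mulr0.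
- move=> i b; have [v [s [hs vE Lv Lvr]]] := He i b; exists v; split=> // [x nz j|x].
    apply: (string_e_wt hs); rewrite -vE; apply: contra nz => /eqP ->; by rewrite mulr0.
  rewrite gam_scale vE (string_e hs); case: (cfW i x) => [y|] /=; rewrite ?mulr0 //.
  by rewrite gam_scale.
- move=> i b; have [v [s [hs vE Lv Lvr]]] := Hf i b; exists v; split=> // x.
  rewrite gam_scale vE (string_f hs); case: (ceW i x) => [y|] /=; rewrite ?mulr0 //.
  by rewrite gam_scale.
Qed.
End WithPhi.

(** V embeds into the functions on the boxes, v0 going to the indicator function of the
    diagram, and the image consists of functions in row_killed; by row_killed_Q only the
    boxes in row_highest survive at q = 0, and lattice_crystal applies. *)
Theorem box_crystal : exists h : C -> box n m,
  [/\ injective h, forall b, row_highest lam (h b), forall s, row_highest lam s -> exists b, h b = s,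
     forall i b, ceW i (h b) = omap h (ceC i b) /\ cfW i (h b) = omap h (cfC i b) &
     forall b j, row_sum (h b) j = wtC b j].
Proof.
have [F it] : exists F, intertwiner q (fun i : 'I_n => (n - i)%N) e f t v0
   (csw (m := m) lo hi) (cup lo hi) (cdn lo hi) (cols_rl m) (@row_sum n m) b0 (row_killed lam q) F.
  apply: (intertwiner_exists (lam := fun j => (lam j)%:Z) qr _ tK tf ef v0_neq0 v0_wt v0_e irr).
  - exact: rho_root.
  - exact: chain_c.
  - exact: uJ.
  - exact: row_sum_csw.
  - exact: wt_b0.
  - exact: (efW_b lohi lo_inj qr).
  - exact: diagram_fun_e.
  - exact: row_killed_w0.
  - by move=> x y; exact: row_killed_ext.
  - exact: row_killed0.
  - exact: (row_killed_lin qr).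
  - by move=> i x; apply: (row_killed_f lohi qr).
  - move=> x xZ rx s es hw; apply: (row_highest_hw lohi lo_surj lam_dec (row_killed_Q qr xZ rx es) hw).
apply: (lattice_crystal (wt := @row_sum n m) (b0 := b0) (rootw := rootw) (rhow := @height n) (Q := @row_highest n m lam) qr _ (uJ m) _ _ _ _ _ _ Xb LX Lr base_span base_free base_ef (F := F)).
- exact: chain_c.
- exact: height_ext.
- exact: heightD.
- by move=> i s s'; exact: row_sum_e.
- by move=> i s s'; exact: row_highest_e.
- by move=> s; exact: row_highest_hw.
- by move=> s; exact: row_highest_depth.
- exact: (embed_F it).
Qed.
End BoxCrystal.

Lemma coeff_eps (D : gl_datum) (j k : pos D) : coeff j (eps_wt k) = (k == j)%:Z.
Proof. by rewrite /eps_wt coeffU mul1r; case: (k == j). Qed.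

Lemma coeff_root (D : gl_datum) (i : node D) j :
  coeff j (Defs.root i) = (j == lo i)%:Z - (j == hi i)%:Z.
Proof. by rewrite /Defs.root coeffB !coeff_eps ![_ == j]eq_sym. Qed.

Lemma coeff_omega n (la : 'I_n -> int) (j : 'I_n) : coeff j (omega la) = la j.
Proof.
rewrite /omega raddf_sum (bigD1 j) //= big1 ?addr0 => [|i ij].
  by rewrite raddfMz /= (@coeff_eps (gl_fin n)) eqxx intz.
by rewrite raddfMz /= (@coeff_eps (gl_fin n)) (negbTE ij) mul0rz.
Qed.

Section HighestWeight.
Variables (n m : nat) (lam : 'I_n -> nat).
Hypothesis lam_dec : forall i i' : 'I_n, (i <= i')%N -> (lam i' <= lam i)%N.
Hypothesis lam_m : forall i, (lam i <= m)%N.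
Let D := gl_fin n.
Local Notation lof := (@lo D : 'I_n.-1 -> 'I_n).
Local Notation hif := (@hi D : 'I_n.-1 -> 'I_n).
Local Notation ceW i := (ch_e (csw (m := m) lof hif i) (cup lof hif i) (cdn lof hif i) (cols_rl m)).
Local Notation cfW i := (ch_f (csw (m := m) lof hif i) (cup lof hif i) (cdn lof hif i) (cols_rl m)).

Lemma fin_lohi i : hif i = (lof i).+1 :> nat. Proof. by []. Qed.
Lemma fin_lo_inj : injective lof.
Proof. by move=> i i' /(congr1 val) /= h; apply: val_inj. Qed.
Lemma fin_lo_surj l : (l.+1 < n)%N -> exists i, lof i = l :> nat.
Proof. by rewrite -ltn_predRL => h; exists (Ordinal h). Qed.

Lemma decomp_wt (V : Uq_module n) (i : 'I_n.-1) (la : weight D) (v : V) k :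
  [/\ Uq_e V i v = 0, in_wt_space (la + Defs.root (i : node D) *+ k) v
      & v != 0 -> (k%:Z <= coroot (i : node D) (la + Defs.root (i : node D) *+ k))] ->
  [/\ Uq_e V i v = 0, forall j, Uq_t V j v = Defs.q ^ (coeff j la + rootw lof hif i j *+ k) *: v
      & v != 0 -> k%:Z <= (coeff (lof i) la + rootw lof hif i (lof i) *+ k)
                     - (coeff (hif i) la + rootw lof hif i (hif i) *+ k)].
Proof.
move=> [h1 h2 h3]; split; first exact: h1.
  by move=> j; rewrite (h2 j) coeffD coeffMn coeff_root.
by move=> /h3; rewrite /coroot !coeffD !coeffMn !coeff_root.
Qed.

Lemma q_factE k : q_fact k = qfact Defs.q k.
Proof. by rewrite /q_fact /qfact; apply: eq_bigr => j _; rewrite /q_int /qint. Qed.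

Lemma dvE (V : Uq_module n) (i : 'I_n.-1) k (v : V) :
  divided_f i k v = dv Defs.q (@Uq_f n V) i k v.
Proof. by rewrite /divided_f /dv q_factE. Qed.

Variable C : crystal D.

Theorem hw_box : is_hw_crystal (omega (fun i => (lam i)%:Z)) C ->
  exists h : C -> box n m,
  [/\ injective h, forall b, row_highest lam (h b), forall s, row_highest lam s -> exists b, h b = s,
     forall i b, ceW i (h b) = omap h (ce C i b) /\ cfW i (h b) = omap h (cf C i b) &
     forall b (j : 'I_n), row_sum (h b) j = coeff j (wt C b)].
Proof.
move=> [[V [L [r [[[v0 v0n [v0w v0e]] irr] cb]]]] _].
have [X Xb LX] := lattice_free (base_lattice cb).
apply: (@box_crystal n m _ lof hif fin_lohi fin_lo_inj fin_lo_surj lam lam_dec lam_m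
  _ _ _ _ _ Qq_qring V (@Uq_e n V) (@Uq_f n V) (@Uq_t n V) (@Uq_tV n V) _ _ _ v0 v0n _ v0e _
  L X Xb LX C r (fun b j => coeff j (wt C b)) (ce C) (cf C)).
- exact: Uq_tK.
- by move=> j i v; rewrite Uq_tf coeff_root.
- by move=> i k v; exact: Uq_ef.
- by move=> j; rewrite v0w coeff_omega.
- by move=> U h1 h2 h3 h4; apply: irr; split.
- by move=> b; have [] := base_mem cb b.
- by move=> b j; have [_] := base_mem cb b; apply.
- exact: base_span cb.
- exact: base_free cb.
- exact: base_ef cb.
- move=> i b; have [v kv qv] := base_e cb i b; have [s [sE sP] vE] := kv; exists v, s.
  split; [split| |exact: (lattice_e (base_lattice cb) (proj1 (base_mem cb b)) kv)|exact: qv].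
  - rewrite {1}sE; apply: eq_bigr => k _; exact: dvE.
  - move=> k /sP; exact: decomp_wt.
  - rewrite vE; apply: eq_bigr => k _; exact: dvE.
- move=> i b; have [v kv qv] := base_f cb i b; have [s [sE sP] vE] := kv; exists v, s.
  split; [split| |exact: (lattice_f (base_lattice cb) (proj1 (base_mem cb b)) kv)|exact: qv].
  - rewrite {1}sE; apply: eq_bigr => k _; exact: dvE.
  - move=> k /sP; exact: decomp_wt.
  - rewrite vE; apply: eq_bigr => k _; exact: dvE.
Qed.

End HighestWeight.

(** * Words *)

Section SmallCrystal.
Variables (D : gl_datum) (B : eqType) (c : crystal_on D B).
Variables (up dn : node D -> B -> bool) (E F : node D -> B -> B).

(** Crystals all of whose strings have length at most one, such as the letters and the
    vectors of bits; their words are governed by signatures. *)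
Record small_crystal : Prop := {
  sm_ud : forall i b, ~~ (up i b && dn i b);
  sm_eps : forall i b, ceps c i b = (dn i b)%:Z;
  sm_phi : forall i b, cphi c i b = (up i b)%:Z;
  sm_wt : forall i b, coroot i (wt c b) = (up i b)%:Z - (dn i b)%:Z;
  sm_e : forall i b, ce c i b = if dn i b then Some (E i b) else None;
  sm_f : forall i b, cf c i b = if up i b then Some (F i b) else None }.
Hypothesis sm : small_crystal.

Lemma coroot_word_wt i s :
  coroot i (word_wt c s) = (count (up i) s)%:Z - (count (dn i) s)%:Z.
Proof.
have cD : {morph coroot i : x y / x + y} by move=> x y; rewrite /coroot !coeffD; ring.
elim: s => [|b s IH]; first by rewrite /word_wt big_nil /coroot !coeff0.
by move: IH; rewrite /word_wt big_cons cD (sm_wt sm) => -> /=; lia.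
Qed.

Lemma word_epsE i s : word_eps c i s = (sg_eps (up i) (dn i) s)%:Z.
Proof.
elim: s => //= b s ->; rewrite (sm_eps sm) (sm_wt sm).
by have := sm_ud sm i b; case: (up i b); case: (dn i b) => //= _; lia.
Qed.

Lemma word_phiE i s : word_phi c i s = (sg_phi (up i) (dn i) s)%:Z.
Proof.
elim: s => //= b s ->; rewrite (sm_phi sm) coroot_word_wt.
have := sg_phi_eps (up i) (dn i) s.
by have := sm_ud sm i b; case: (up i b); case: (dn i b) => //= _; lia.
Qed.

Lemma word_phi_eps i s : word_phi c i s = word_eps c i s + coroot i (word_wt c s).
Proof.
by rewrite word_phiE word_epsE coroot_word_wt; have := sg_phi_eps (up i) (dn i) s; lia.
Qed.

Lemma word_eE i b s : word_e c i (b :: s) =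
  if (sg_eps (up i) (dn i) s <= up i b)%N
  then if dn i b then Some (E i b :: s) else None else omap (cons b) (word_e c i s).
Proof. by rewrite /= word_epsE (sm_phi sm) (sm_e sm) lez_nat; case: ifP => // _; case: ifP. Qed.

Lemma word_fE i b s : word_f c i (b :: s) =
  if (sg_eps (up i) (dn i) s < up i b)%N
  then if up i b then Some (F i b :: s) else None else omap (cons b) (word_f c i s).
Proof. by rewrite /= word_epsE (sm_phi sm) (sm_f sm) ltz_nat; case: ifP => // _; case: ifP. Qed.

Section Sites.
Variables (I : eqType) (g : I -> B).

Lemma word_e_map i J : uniq J -> word_e c i (map g J) =
  omap (fun j => [seq if j' == j then E i (g j') else g j' | j' <- J])
    (sg_e (up i \o g) (dn i \o g) J).
Proof.
elim: J => // j J IH /andP[jJ uJ]; rewrite map_cons word_eE (IH uJ) /=.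
have [-> _ _ _] := sg_map g (up i) (dn i) J.
have jE (j' : I) : j' \in J -> (j' == j) = false by apply: contraTF => /eqP ->.
case: ifP => _.
  case: ifP => //= _; rewrite eqxx; congr (Some (_ :: _)).
  by apply/eq_in_map => j' /jE ->.
case Ej: (sg_e _ _ _) => [j'|] //=; have /andP[j'J _] := sg_e_mem Ej.
by rewrite eq_sym jE.
Qed.

Lemma word_f_map i J : uniq J -> word_f c i (map g J) =
  omap (fun j => [seq if j' == j then F i (g j') else g j' | j' <- J])
    (sg_f (up i \o g) (dn i \o g) J).
Proof.
elim: J => // j J IH /andP[jJ uJ]; rewrite map_cons word_fE (IH uJ) /=.
have [-> _ _ _] := sg_map g (up i) (dn i) J.
have jE (j' : I) : j' \in J -> (j' == j) = false by apply: contraTF => /eqP ->.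
case: ifP => _.
  case: ifP => //= _; rewrite eqxx; congr (Some (_ :: _)).
  by apply/eq_in_map => j' /jE ->.
case Ej: (sg_f _ _ _) => [j'|] //=; have /andP[j'J _] := sg_f_mem Ej.
by rewrite eq_sym jE.
Qed.
End Sites.

Let su := sm_ud sm.

Lemma word_e_cat i s1 s2 : word_e c i (s1 ++ s2) =
  if (sg_eps (up i) (dn i) s2 <= sg_phi (up i) (dn i) s1)%N
  then omap (cat^~ s2) (word_e c i s1) else omap (cat s1) (word_e c i s2).
Proof.
have N s : sg_eps (up i) (dn i) s = 0%N -> word_e c i s = None.
  elim: s => // b s IH; rewrite word_eE /=; move: (su i b).
  by case: (up i b); case: (dn i b) => //=; case: ifP => // h _ h'; rewrite ?IH //; lia.
elim: s1 => [|b s1 IH].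
  by rewrite /=; case: ifP => [|_]; [rewrite leqn0 => /eqP /N ->|case: (word_e c i s2)].
rewrite cat_cons !word_eE {}IH sg_eps_cat /=; move: (su i b) {N}.
case: (up i b); case: (dn i b) => //= _; do ![case: ifP => ? //=];
  first [exfalso; lia | by case: (word_e _ _ _)].
Qed.

Lemma word_f_cat i s1 s2 : word_f c i (s1 ++ s2) =
  if (sg_eps (up i) (dn i) s2 < sg_phi (up i) (dn i) s1)%N
  then omap (cat^~ s2) (word_f c i s1) else omap (cat s1) (word_f c i s2).
Proof.
elim: s1 => [|b s1 IH]; first by rewrite /=; case: (word_f c i s2).
rewrite cat_cons !word_fE {}IH sg_eps_cat /=; move: (su i b).
case: (up i b); case: (dn i b) => //= _; do ![case: ifP => ? //=];
  first [exfalso; lia | by case: (word_f _ _ _)].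
Qed.

End SmallCrystal.

Section Flatten.
Variables (D : gl_datum) (B B' : eqType) (c : crystal_on D B) (c' : crystal_on D B').
Variables (up dn : node D -> B -> bool) (E F : node D -> B -> B).
Variables (up' dn' : node D -> B' -> bool) (E' F' : node D -> B' -> B').
Hypothesis sm : small_crystal c up dn E F.
Hypothesis sm' : small_crystal c' up' dn' E' F'.
Variable ka : B' -> seq B.
Hypothesis ka_wt : forall b, word_wt c (ka b) = wt c' b.
Hypothesis ka_eps : forall i b, sg_eps (up i) (dn i) (ka b) = dn' i b.
Hypothesis ka_phi : forall i b, sg_phi (up i) (dn i) (ka b) = up' i b.
Hypothesis ka_e : forall i b, word_e c i (ka b) = omap ka (ce c' i b).
Hypothesis ka_f : forall i b, word_f c i (ka b) = omap ka (cf c' i b).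
Local Notation fl s := (flatten (map ka s)).

Lemma flatten_sg i s : sg_eps (up i) (dn i) (fl s) = sg_eps (up' i) (dn' i) s /\
  sg_phi (up i) (dn i) (fl s) = sg_phi (up' i) (dn' i) s.
Proof.
elim: s => //= b s [h1 h2]; rewrite sg_eps_cat sg_phi_cat ka_eps ka_phi h1 h2.
by have := sm_ud sm' i b; case: (up' i b); case: (dn' i b) => //= _; split; lia.
Qed.

(** The tensor product rule sees of each factor only eps, phi, e and f; so a letter can be
    replaced by a word ka b in which these are the same. *)
Lemma flatten_preserves : preserves (word_crystal c') (word_crystal c) (fun s => fl s).
Proof.
split=> [s|i s|i s|i s|i s] /=.
- elim: s => [|b s IH]; first by rewrite /word_wt !big_nil.
  by move: IH; rewrite /= /word_wt big_cat big_cons /= => ->; rewrite -ka_wt.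
- by rewrite (word_epsE sm) (word_epsE sm'); have [->] := flatten_sg i s.
- by rewrite (word_phiE sm) (word_phiE sm'); have [_ ->] := flatten_sg i s.
- elim: s => // b s IH; rewrite (word_eE sm') /= (word_e_cat sm) ka_phi.
  have [-> _] := flatten_sg i s; rewrite IH ka_e (sm_e sm').
  by case: ifP => _; [case: ifP|case: (word_e c' i s)].
- elim: s => // b s IH; rewrite (word_fE sm') /= (word_f_cat sm) ka_phi.
  have [-> _] := flatten_sg i s; rewrite IH ka_f (sm_f sm').
  by case: ifP => _; [case: ifP|case: (word_f c' i s)].
Qed.
End Flatten.

Lemma natural_small : small_crystal natural_crystal (fun i (b : int) => b == i)
  (fun i (b : int) => b == i + 1) (fun i _ => i) (fun i _ => i + 1).
Proof.
split=> // i b.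
- by apply/negP => /andP[/eqP -> /eqP]; lia.
- by rewrite /coroot !(@coeff_eps gl_inf).
Qed.

Section Vec.
Variable D : gl_datum.

Definition vup (i : node D) (a : vec D) := a (lo i) && ~~ a (hi i).
Definition vdn (i : node D) (a : vec D) := ~~ a (lo i) && a (hi i).
Definition vE (i : node D) (a : vec D) : vec D := [fsfun a with lo i |-> true, hi i |-> false].
Definition vF (i : node D) (a : vec D) : vec D := [fsfun a with lo i |-> false, hi i |-> true].

Lemma coeff_vec_wt (a : vec D) j : coeff j (vec_wt a) = (a j)%:Z.
Proof.
rewrite /vec_wt raddf_sum /=; under eq_bigr do rewrite coeff_eps.
case: (boolP (a j)) => aj.
  have jf : j \in finsupp a by rewrite mem_finsupp aj.
  rewrite (big_fsetD1 j jf) /= eqxx big1_fset ?addr0 // => k.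
  by rewrite !inE => /andP[/negbTE ->].
rewrite big1_fset // => k; rewrite mem_finsupp => ak _.
by case: eqP => // e; move: ak; rewrite e (negbTE aj).
Qed.

Lemma vec_small : small_crystal (vec_crystal D) vup vdn vE vF.
Proof.
split=> // i a.
- by rewrite /vup /vdn; case: (a _); case: (a _).
- by rewrite /coroot /= !coeff_vec_wt /vup /vdn; case: (a _); case: (a _).
Qed.
End Vec.

(** A row of bits as a word of letters: the crystal of the rows of sum k is that of the
    tableaux with a single column of length k. *)
Definition row_word (a : vec gl_inf) : seq int := sort <=%R (finsupp a : seq int).

Lemma mem_kap (a : vec gl_inf) (x : int) : (x \in row_word a) = a x.
Proof. by rewrite mem_sort mem_finsupp; case: (a x). Qed.

Lemma row_word_sorted a : sorted <%R (row_word a).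
Proof.
rewrite lt_sorted_uniq_le sort_uniq fset_uniq /=.
by apply: sort_sorted => x y; exact: le_total.
Qed.

Lemma row_word_eq (a : vec gl_inf) (s : seq int) : sorted <%R s -> (forall x, (x \in s) = a x) -> s = row_word a.
Proof.
move=> ss h; apply: (@irr_sorted_eq _ <%R) ss (row_word_sorted a) _; [exact: lt_trans|exact: ltxx|].
by move=> x; rewrite h mem_kap.
Qed.

Lemma row_word_wt a : word_wt natural_crystal (row_word a) = vec_wt a.
Proof. by rewrite /word_wt /vec_wt (perm_big _ (permEl (perm_sort _ _))). Qed.

Section SortedWord.
Variable k : int.
Local Notation u := (fun b : int => b == k).
Local Notation d := (fun b : int => b == k + 1).

(** In an increasing word k is immediately followed by k + 1 if both occur, and they
    cancel in the signature. *)
Lemma sorted_eps w : sorted <%R w -> sg_eps u d w = ((k \notin w) && (k + 1 \in w)) :> nat.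
Proof.
elim: w => //= b w IH pw; rewrite (IH (path_sorted pw)).
have hw x : x \in w -> b < x by move/(order_path_min lt_trans)/allP: pw; apply.
rewrite !inE; case: (eqVneq b k) => [->|bk].
  rewrite [k == k + 1]eq_sym [k + 1 == k]eq_sym; have -> : (k == k + 1) = false by apply/eqP; clear; lia.
  by case: (_ && _).
case: (eqVneq b (k + 1)) => [e|bk1] /=.
  have h x : x <= b -> (x \in w) = false by move=> xb; apply: contraTF xb => /hw; rewrite ltNge.
  by rewrite (h k) ?(h (k + 1)) ?e ?lerDl.
by rewrite subn0.
Qed.

Lemma sorted_phi w : sorted <%R w -> sg_phi u d w = ((k \in w) && (k + 1 \notin w)) :> nat.
Proof.
move=> sw; have uw : uniq w by move: sw; rewrite lt_sorted_uniq_le => /andP[].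
have c1 : count u w = (k \in w) :> nat by rewrite -(count_uniq_mem k uw); apply: eq_count.
have c2 : count d w = (k + 1 \in w) :> nat by rewrite -(count_uniq_mem (k + 1) uw); apply: eq_count.
have := sg_phi_eps u d w; rewrite sorted_eps // c1 c2.
by case: (k \in w); case: (k + 1 \in w); rewrite /= ?addn0 ?addn1 ?add0n => // -[].
Qed.
End SortedWord.

Lemma vE_E k (a : vec gl_inf) x : vE (D := gl_inf) k a x =
  if x == k then true else if x == k + 1 then false else a x.
Proof. by rewrite /vE !fsfun_withE. Qed.
Lemma vF_E k (a : vec gl_inf) x : vF (D := gl_inf) k a x =
  if x == k then false else if x == k + 1 then true else a x.
Proof. by rewrite /vF !fsfun_withE. Qed.

Lemma sorted_repl (f : int -> int) w : sorted <%R w ->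
  {in w &, forall x y, x < y -> f x < f y} -> sorted <%R (map f w).
Proof.
move=> sw h; rewrite (sorted_pairwise lt_trans) pairwise_map.
move: sw; rewrite (sorted_pairwise lt_trans); apply: sub_in_pairwise (allss w) => x y xw yw.
exact: h.
Qed.

Lemma row_word_e k a : word_e natural_crystal k (row_word a) = omap row_word (ce (vec_crystal gl_inf) k a).
Proof.
have sw := row_word_sorted a.
have uw : uniq (row_word a) by move: sw; rewrite lt_sorted_uniq_le => /andP[].
have := word_e_map natural_small (@id int) k uw; rewrite map_id => ->.
rewrite (sm_e (vec_small gl_inf)) /vdn.
have := sg_eN (sm_ud natural_small k) (row_word a); rewrite sorted_eps // !mem_kap.
case E: (sg_e _ _ _) => [j|] /=; last first.
  by case: (a k); case: (a (k + 1)).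
move/esym/negbT; rewrite eqb0 negbK => h; rewrite h /=; congr Some.
have /andP[_ /eqP jk] := sg_e_mem E; rewrite jk.
case/andP: h => nk ak; apply: row_word_eq => [|x].
  apply: sorted_repl => // x y; rewrite !mem_kap => ax ay xy.
  have xk : x != k by apply: contraTneq ax => ->.
  have yk : y != k by apply: contraTneq ay => ->.
  by case: (eqVneq x (k + 1)) => [ex|_]; case: (eqVneq y (k + 1)) => [ey|_]; move: xy xk yk; rewrite ?ex ?ey; clear; lia.
rewrite vE_E; apply/mapP/idP => [[y]|].
  rewrite mem_kap => ay ->; case: (eqVneq y (k + 1)) => [_|yk1]; first by rewrite eqxx.
  by case: eqP => // _; rewrite (negbTE yk1).
case: eqP => [-> _|/eqP xk]; first by exists (k + 1); rewrite ?mem_kap ?eqxx.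
case: eqP => // /eqP xk1 ax; exists x; rewrite ?mem_kap //; by rewrite (negbTE xk1).
Qed.

Lemma row_word_f k a : word_f natural_crystal k (row_word a) = omap row_word (cf (vec_crystal gl_inf) k a).
Proof.
have sw := row_word_sorted a.
have uw : uniq (row_word a) by move: sw; rewrite lt_sorted_uniq_le => /andP[].
have := word_f_map natural_small (@id int) k uw; rewrite map_id => ->.
rewrite (sm_f (vec_small gl_inf)) /vup.
have := sg_fN (sm_ud natural_small k) (row_word a); rewrite sorted_phi // !mem_kap.
case E: (sg_f _ _ _) => [j|] /=; last first.
  by case: (a k); case: (a (k + 1)).
move/esym/negbT; rewrite eqb0 negbK => h; rewrite h /=; congr Some.
have /andP[_ /eqP jk] := sg_f_mem E; rewrite jk.
case/andP: h => ak nk; apply: row_word_eq => [|x].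
  apply: sorted_repl => // x y; rewrite !mem_kap => ax ay xy.
  have xk : x != k + 1 by apply: contraTneq ax => ->.
  have yk : y != k + 1 by apply: contraTneq ay => ->.
  by case: (eqVneq x k) => [ex|_]; case: (eqVneq y k) => [ey|_]; move: xy xk yk; rewrite ?ex ?ey; clear; lia.
rewrite vF_E; apply/mapP/idP => [[y]|].
  rewrite mem_kap => ay ->; case: (eqVneq y k) => [_|yk1].
    by case: eqP; [clear; lia|rewrite eqxx].
  by rewrite (negbTE yk1); case: eqP.
case: eqP => [//|/eqP xk]; case: eqP => [-> _|/eqP xk1 ax].
  by exists k; rewrite ?mem_kap ?eqxx.
by exists x; rewrite ?mem_kap //; rewrite (negbTE xk).
Qed.

Lemma row_word_preserves : preserves (word_crystal (vec_crystal gl_inf)) (word_crystal natural_crystal)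
  (fun s => flatten (map row_word s)).
Proof.
apply: (flatten_preserves natural_small (vec_small gl_inf)).
- exact: row_word_wt.
- by move=> k a; rewrite sorted_eps ?row_word_sorted // !mem_kap.
- by move=> k a; rewrite sorted_phi ?row_word_sorted // !mem_kap.
- exact: row_word_e.
- exact: row_word_f.
Qed.

(** * Matrices supported in a window of columns *)

Section MatEntries.
Variable n : nat.
Implicit Type A : mat01 n.

Lemma mk_matE J a i (x : int) : @mk_mat n J a (i, x) = (x \in J) && a i x.
Proof.
rewrite /mk_mat fsfun_fun in_fsetE /=.
have -> : ((i, x) \in [seq (i', x') | i' <- enum 'I_n, x' <- J]) = (x \in J).
  apply/allpairsP/idP => [[[i' x'] /= [_ h [_ ->]]] //|xJ].
  by exists (i, x); rewrite mem_enum.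
by case: (x \in J).
Qed.

Lemma mat_rowE A i x : mat_row A i x = A (i, x).
Proof.
rewrite /mat_row fsfun_fun; case: ifP => //= /negP h; apply/esym/negbTE/negP => Aix.
by apply: h; apply/imfsetP; exists (i, x); rewrite //= mem_finsupp Aix.
Qed.

Lemma mat_colE A i x : mat_col A x i = A (i, x).
Proof.
rewrite /mat_col fsfun_fun; case: ifP => //= /negP h; apply/esym/negbTE/negP => Aix.
by apply: h; apply/imfsetP; exists (i, x); rewrite //= mem_finsupp Aix.
Qed.

Lemma of_rowsE r i x : size r = n -> of_rows n r (i, x) = nth [fsfun] r i x.
Proof.
move=> rn; rewrite /of_rows mk_matE andbC; case: (boolP (nth _ r i x)) => //= h.
apply/flattenP; exists (finsupp (nth [fsfun] r i) : seq int); last by rewrite mem_finsupp h.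
by apply: (map_f (fun r : vec gl_inf => (finsupp r : seq int))); rewrite mem_nth // rn.
Qed.

Lemma of_colsE J r i x : @of_cols n J r (i, x) = (x \in J) && nth [fsfun] r (index x J) i.
Proof. by rewrite /of_cols mk_matE. Qed.

Lemma mem_col_index A x : (x \in col_index A) = [exists i, A (i, x)].
Proof.
rewrite mem_sort; apply/imfsetP/existsP => [[[i y] /=]|[i h]].
  by rewrite mem_finsupp => h ->; exists i; case: (A (i, y)) h.
by exists (i, x); rewrite //= mem_finsupp h.
Qed.

Lemma coeff_wt_inf A (x : int) : coeff x (wt (mat_inf_crystal n) A) = \sum_i (A (i, x))%:Z.
Proof.
rewrite /= /word_wt /rows big_map big_enum /= raddf_sum; apply: eq_bigr => i _.
by rewrite /= (@coeff_vec_wt gl_inf) mat_rowE.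
Qed.

Lemma coeff_wt_fin A (i : 'I_n) :
  coeff i (wt (mat_fin_crystal n) A) = \sum_(x <- col_index A) (A (i, x))%:Z.
Proof.
rewrite /= /word_wt /cols big_map raddf_sum; apply: eq_bigr => x _.
by rewrite /= (@coeff_vec_wt (gl_fin n)) mat_colE.
Qed.
End MatEntries.

Section Window.
Variables (n m : nat) (c : int).
Implicit Type s : box n m.
Local Notation lof := (@lo (gl_fin n) : 'I_n.-1 -> 'I_n).
Local Notation hif := (@hi (gl_fin n) : 'I_n.-1 -> 'I_n).
Local Notation pt j := (c + (nat_of_ord j)%:Z).

Lemma pt_inj : injective (fun j : 'I_m => pt j).
Proof. by move=> j j' /addrI [] /val_inj. Qed.

Lemma win_case x : (exists j : 'I_m, x = pt j) \/ (forall j : 'I_m, x != pt j).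
Proof.
have [h|nex] := pselect (exists j : 'I_m, x = pt j); [by left|right=> j].
by apply/eqP => e; apply: nex; exists j.
Qed.

(** The box s placed in the columns c, ..., c + m - 1.  Every matrix arises in this way,
    with room for any two adjacent columns given beforehand, so that the operators on
    matrices become those on boxes. *)
Definition win s : mat01 n := mk_mat [seq pt j | j <- enum 'I_m] (fun i x => ab s i `|x - c|%N).

Lemma winE s i (j : 'I_m) : win s (i, pt j) = s (i, j).
Proof.
rewrite /win mk_matE (map_f (fun j : 'I_m => pt j)) ?mem_enum //= -abE; congr (ab s i _).
by clear; lia.
Qed.

Lemma win_out s i x : (forall j : 'I_m, x != pt j) -> win s (i, x) = false.
Proof.
move=> h; rewrite /win mk_matE; case: mapP => // -[j _ e].
by have := h j; rewrite e eqxx.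
Qed.

Lemma winP s (A : mat01 n) : (forall i (j : 'I_m), A (i, pt j) = s (i, j)) ->
  (forall i x, (forall j : 'I_m, x != pt j) -> A (i, x) = false) -> A = win s.
Proof.
move=> h1 h2; apply/fsfunP => -[i x].
by have [[j ->]|h] := win_case x; rewrite ?h1 ?winE // h2 // win_out.
Qed.

Lemma win_inj : injective win.
Proof. by move=> s s' e; apply/ffunP => -[i j]; rewrite -!winE e. Qed.

Definition occupied s (j : 'I_m) := [exists i, s (i, j)].

Lemma win_cols s : col_index (win s) = [seq pt j | j <- filter (occupied s) (cols_rl m)].
Proof.
apply: (@sorted_eq _ >=%R).
- by move=> x y z h1 h2; exact: le_trans h2 h1.
- by move=> x y /andP[h1 h2]; apply/le_anti/andP.
- by apply: sort_sorted => x y; exact: le_total.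
- rewrite sorted_map; apply: sorted_filter.
    by move=> x y z /= h1 h2; apply: le_trans h2 h1.
  rewrite /cols_rl rev_sorted.
  have := iota_sorted 0 m; rewrite -val_enum_ord sorted_map.
  by apply: sub_sorted => j j' /= h; rewrite lerD2l lez_nat.
apply: uniq_perm.
- by rewrite sort_uniq fset_uniq.
- by rewrite map_inj_uniq ?filter_uniq ?uJ //; exact: pt_inj.
- move=> x; rewrite mem_col_index; apply/existsP/mapP => [[i]|[j]].
    have [[j ->]|nex] := win_case x; last by rewrite win_out.
    rewrite winE => h; exists j => //; rewrite mem_filter mem_rev mem_enum andbT.
    by apply/existsP; exists i.
  rewrite mem_filter => /andP[/existsP[i h] _] ->; exists i; by rewrite winE.
Qed.

Lemma wt_win_fin s (i : 'I_n) : coeff i (wt (mat_fin_crystal n) (win s)) = row_sum s i.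
Proof.
rewrite coeff_wt_fin win_cols big_map big_filter /row_sum.
rewrite [RHS](bigID (occupied s)) /= [X in _ + X]big1 ?addr0; last first.
  move=> j /existsPn h; by rewrite (negbTE (h i)).
rewrite /cols_rl (perm_big _ (permEl (perm_rev _))) /= big_enum_cond /=.
by apply: eq_big => // j _; rewrite winE.
Qed.

Lemma wt_win_inf s (j : 'I_m) : coeff (pt j) (wt (mat_inf_crystal n) (win s)) = (col_sum s j)%:Z.
Proof.
rewrite coeff_wt_inf /col_sum (big_morph Posz PoszD (erefl 0)).
by apply: eq_bigr => i _; rewrite winE.
Qed.

Lemma wt_win_inf0 s x : (forall j : 'I_m, x != pt j) -> coeff x (wt (mat_inf_crystal n) (win s)) = 0.
Proof. by move=> h; rewrite coeff_wt_inf big1 // => i _; rewrite win_out. Qed.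

Section Fin.
Variable l : 'I_n.-1.
Local Notation csw := (csw (m := m) lof hif l).
Local Notation cup := (cup (m := m) lof hif l).
Local Notation cdn := (cdn (m := m) lof hif l).

Let F := @vec_small (gl_fin n).

(** The zero columns, which the crystal structure of matrices leaves out, have sign
    zero. *)
Lemma fin_sg s : let u := vup (D := gl_fin n) l \o mat_col (win s) in
  let d := vdn (D := gl_fin n) l \o mat_col (win s) in
  [/\ sg_eps u d (col_index (win s)) = ch_eps cup cdn (cols_rl m) s,
      sg_phi u d (col_index (win s)) = ch_phi cup cdn (cols_rl m) s,
      sg_e u d (col_index (win s)) = omap (fun j => pt j) (sg_e (cup^~ s) (cdn^~ s) (cols_rl m)) &
      sg_f u d (col_index (win s)) = omap (fun j => pt j) (sg_f (cup^~ s) (cdn^~ s) (cols_rl m))].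
Proof.
move=> u d; rewrite win_cols; have [-> -> -> ->] := sg_map (fun j : 'I_m => pt j) u d (filter (occupied s) (cols_rl m)).
have [||-> -> -> ->] := @eq_sg _ (u \o (fun j => pt j)) (d \o (fun j => pt j)) (cup^~ s) (cdn^~ s) (filter (occupied s) (cols_rl m)).
- by move=> j _; rewrite /u /= /vup !mat_colE !winE.
- by move=> j _; rewrite /d /= /vdn !mat_colE !winE.
have [||-> -> -> ->] := @sg_filter _ (cup^~ s) (cdn^~ s) (occupied s) (cols_rl m).
- by move=> j; exact: (ch_ud (chain_c m (@fin_lohi n) l)).
- move=> j _ /existsPn h; rewrite /cup /cdn /grid_up /grid_dn /bget.
  by rewrite !(negbTE (h _)).
by [].
Qed.

Lemma win_eps_fin s : ceps (mat_fin_crystal n) l (win s) = (ch_eps cup cdn (cols_rl m) s)%:Z.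
Proof.
have [h _ _ _] := fin_sg s; rewrite -h /= /cols (word_epsE F).
by have [->] := sg_map (mat_col (win s)) (vup (D := gl_fin n) l) (vdn (D := gl_fin n) l) (col_index (win s)).
Qed.

Lemma win_phi_fin s : cphi (mat_fin_crystal n) l (win s) = (ch_phi cup cdn (cols_rl m) s)%:Z.
Proof.
have [_ h _ _] := fin_sg s; rewrite -h /= /cols (word_phiE F).
by have [_ ->] := sg_map (mat_col (win s)) (vup (D := gl_fin n) l) (vdn (D := gl_fin n) l) (col_index (win s)).
Qed.

Lemma of_cols_csw (V : vec (gl_fin n) -> vec (gl_fin n)) s j :
  occupied s j -> (forall i, V (mat_col (win s) (pt j)) i = s (tperm (lof l) (hif l) i, j)) ->
  of_cols (col_index (win s))
    [seq if x == pt j then V (mat_col (win s) x) else mat_col (win s) x | x <- col_index (win s)]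
  = win (csw j s).
Proof.
move=> oj hV; apply: winP => [i j'|i x h]; rewrite of_colsE; last first.
  by rewrite mem_col_index; case: existsP => // -[i']; rewrite win_out.
case: (boolP (pt j' \in _)) => [h|].
  rewrite (nth_map 0) ?index_mem // nth_index // csw_tperm (inj_eq pt_inj).
  by have [->|_] := eqVneq j' j; rewrite ?hV // mat_colE winE.
rewrite mem_col_index => /existsPn h; apply/esym/negbTE.
rewrite csw_tperm; have [e|_] := eqVneq j' j; last by rewrite -winE h.
by case/existsP: oj => i' oi'; have := h i'; rewrite e winE oi'.
Qed.

Lemma win_e_fin s : ce (mat_fin_crystal n) l (win s) = omap win (ch_e csw cup cdn (cols_rl m) s).
Proof.
rewrite /= /cols (word_e_map F) ?sort_uniq ?fset_uniq // /ch_e.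
have [_ _ -> _] := fin_sg s; case E: (sg_e _ _ _) => [j|] //=; congr Some.
have /andP[_ /andP[nl sh]] := sg_e_mem E; apply: of_cols_csw => [|i].
  by apply/existsP; exists (hif l).
rewrite /vE !fsfun_withE; case: tpermP => [->|->|/eqP h1 /eqP h2].
- by rewrite eqxx.
- by rewrite eq_sym (negbTE (lohiN (@fin_lohi n) l)) eqxx; rewrite /bget in nl; rewrite (negbTE nl).
- by rewrite (negbTE h1) (negbTE h2) mat_colE winE.
Qed.

Lemma win_f_fin s : cf (mat_fin_crystal n) l (win s) = omap win (ch_f csw cup cdn (cols_rl m) s).
Proof.
rewrite /= /cols (word_f_map F) ?sort_uniq ?fset_uniq // /ch_f.
have [_ _ _ ->] := fin_sg s; case E: (sg_f _ _ _) => [j|] //=; congr Some.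
have /andP[_ /andP[sl nh]] := sg_f_mem E; apply: of_cols_csw => [|i].
  by apply/existsP; exists (lof l).
rewrite /vF !fsfun_withE; case: tpermP => [->|->|/eqP h1 /eqP h2].
- by rewrite eqxx; rewrite /bget in nh; rewrite (negbTE nh).
- by rewrite eq_sym (negbTE (lohiN (@fin_lohi n) l)) eqxx.
- by rewrite (negbTE h1) (negbTE h2) mat_colE winE.
Qed.
End Fin.

Section Inf.
Variables k k' : 'I_m.
Hypothesis kk' : k' = k.+1 :> nat.
Local Notation rsw := (rsw (n := n) k k').
Local Notation rup := (rup (n := n) k k').
Local Notation rdn := (rdn (n := n) k k').
Local Notation K := (pt k : node gl_inf).

Let F := @vec_small gl_inf.
Let K1 : hi K = pt k'. Proof. by rewrite /= kk'; clear; lia. Qed.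
Let kN : k != k'. Proof. by rewrite -val_eqE /= kk'; clear; lia. Qed.

Lemma inf_sg s : let u := vup (D := gl_inf) K \o mat_row (win s) in
  let d := vdn (D := gl_inf) K \o mat_row (win s) in
  [/\ sg_eps u d (enum 'I_n) = ch_eps rup rdn (rows_tb n) s,
      sg_phi u d (enum 'I_n) = ch_phi rup rdn (rows_tb n) s,
      sg_e u d (enum 'I_n) = sg_e (rup^~ s) (rdn^~ s) (rows_tb n) &
      sg_f u d (enum 'I_n) = sg_f (rup^~ s) (rdn^~ s) (rows_tb n)].
Proof.
move=> u d; apply: eq_sg => i _.
- by rewrite /u /= /vup K1 !mat_rowE !winE.
- by rewrite /d /= /vdn K1 !mat_rowE !winE.
Qed.

Lemma win_eps_inf s : ceps (mat_inf_crystal n) K (win s) = (ch_eps rup rdn (rows_tb n) s)%:Z.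
Proof.
have [h _ _ _] := inf_sg s; rewrite -h /= /rows (word_epsE F).
by have [->] := sg_map (mat_row (win s)) (vup (D := gl_inf) K) (vdn (D := gl_inf) K) (enum 'I_n).
Qed.

Lemma win_phi_inf s : cphi (mat_inf_crystal n) K (win s) = (ch_phi rup rdn (rows_tb n) s)%:Z.
Proof.
have [_ h _ _] := inf_sg s; rewrite -h /= /rows (word_phiE F).
by have [_ ->] := sg_map (mat_row (win s)) (vup (D := gl_inf) K) (vdn (D := gl_inf) K) (enum 'I_n).
Qed.

Lemma of_rows_rsw (V : vec gl_inf -> vec gl_inf) s i :
  (forall x, V (mat_row (win s) i) x =
     if x == pt k then s (i, k') else if x == pt k' then s (i, k) else win s (i, x)) ->
  of_rows n [seq if i' == i then V (mat_row (win s) i') else mat_row (win s) i' | i' <- enum 'I_n]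
  = win (rsw i s).
Proof.
move=> hV.
have E (r : 'I_n) (x : int) : of_rows n [seq if i' == i then V (mat_row (win s) i') else mat_row (win s) i' | i' <- enum 'I_n] (r, x)
   = if r == i then V (mat_row (win s) r) x else win s (r, x).
  have sz : size [seq if i' == i then V (mat_row (win s) i') else mat_row (win s) i' | i' <- enum 'I_n] = n.
    by rewrite size_map; exact: size_enum_ord.
  rewrite of_rowsE //.
  have := @nth_map _ r _ [fsfun] (fun i' : 'I_n => if i' == i then V (mat_row (win s) i') else mat_row (win s) i') r (enum 'I_n).
  rewrite size_enum_ord nth_ord_enum => /(_ (ltn_ord r)) ->.
  by case: eqP => // _; rewrite mat_rowE.
apply: winP => [r j|r x h]; rewrite E; have [->|ri] := eqVneq r i.
- rewrite hV rsw_tperm eqxx !(inj_eq pt_inj) winE.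
  case: tpermP => [->|->|/eqP h1 /eqP h2]; rewrite ?eqxx //.
    by rewrite eq_sym (negbTE kN).
  by rewrite (negbTE h1) (negbTE h2).
- by rewrite winE rsw_tperm (negbTE ri).
- by rewrite hV (negbTE (h k)) (negbTE (h k')) win_out.
- by rewrite win_out.
Qed.

Lemma win_e_inf s : ce (mat_inf_crystal n) K (win s) = omap win (ch_e rsw rup rdn (rows_tb n) s).
Proof.
rewrite /= /rows (word_e_map F) ?enum_uniq // /ch_e.
have [_ _ -> _] := inf_sg s; case E: (sg_e _ _ _) => [i|] //=; congr Some.
have /andP[_ /andP[nl sh]] := sg_e_mem E; apply: of_rows_rsw => x.
rewrite /bget in nl sh; rewrite /vE K1 !fsfun_withE mat_rowE sh (negbTE nl).
by case: eqP => // _; case: eqP.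
Qed.

Lemma win_f_inf s : cf (mat_inf_crystal n) K (win s) = omap win (ch_f rsw rup rdn (rows_tb n) s).
Proof.
rewrite /= /rows (word_f_map F) ?enum_uniq // /ch_f.
have [_ _ _ ->] := inf_sg s; case E: (sg_f _ _ _) => [i|] //=; congr Some.
have /andP[_ /andP[sl nh]] := sg_f_mem E; apply: of_rows_rsw => x.
rewrite /bget in sl nh; rewrite /vF K1 !fsfun_withE mat_rowE sl (negbTE nh).
by case: eqP => // _; case: eqP.
Qed.
End Inf.
End Window.

(** * Gluing along commuting crystal structures *)

Section Run.
Variables (X : Type) (P : Type) (op : P -> X -> option X) (opV : P -> P).
Hypothesis opVP : forall p x y, op p x = Some y -> op (opV p) y = Some x.

Fixpoint run (ps : seq P) (x : X) : option X :=
  if ps is p :: ps' then obind (run ps') (op p x) else Some x.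

Definition conn x y := exists ps, run ps x = Some y.

Lemma run_cat ps ps' x : run (ps ++ ps') x = obind (run ps') (run ps x).
Proof. by elim: ps x => //= p ps IH x; case: (op p x). Qed.

Lemma runV ps x y : run ps x = Some y -> run (rev (map opV ps)) y = Some x.
Proof.
elim: ps x => [x [->] //|p ps IH x] /=; case E: (op p x) => [z|] //= /IH h.
by rewrite rev_cons -cats1 run_cat h /= (opVP E).
Qed.

Lemma run_inj ps x x' y : run ps x = Some y -> run ps x' = Some y -> x = x'.
Proof. by move=> /runV h /runV; rewrite h => -[]. Qed.

Lemma conn_refl x : conn x x. Proof. by exists [::]. Qed.
Lemma conn_sym x y : conn x y -> conn y x.
Proof. by case=> ps /runV h; eexists; exact: h. Qed.
Lemma conn_trans y x z : conn x y -> conn y z -> conn x z.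
Proof. by case=> ps h [ps' h']; exists (ps ++ ps'); rewrite run_cat h. Qed.
Lemma conn_step p x y : op p x = Some y -> conn x y.
Proof. by move=> h; exists [:: p]; rewrite /= h. Qed.

Lemma conn_ind (R : X -> Prop) : (forall p x y, op p x = Some y -> R x -> R y) ->
  forall x y, conn x y -> R x -> R y.
Proof.
move=> h x y [ps]; elim: ps x => [x [->] //|p ps IH x] /=.
by case E: (op p x) => [z|] //= /IH h' /(h _ _ _ E).
Qed.

Lemma conn_inv (Z : Type) (g : X -> Z) : (forall p x y, op p x = Some y -> g y = g x) ->
  forall x y, conn x y -> g y = g x.
Proof.
by move=> h x y cxy; apply: (conn_ind (R := fun z => g z = g x) _ cxy) => // p u v /h ->.
Qed.
End Run.

Lemma run_comm (X P P' : Type) (op : P -> X -> option X) (op' : P' -> X -> option X) :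
  (forall p p' x, obind (op' p') (op p x) = obind (op p) (op' p' x)) ->
  forall ps ps' x, obind (run op' ps') (run op ps x) = obind (run op ps) (run op' ps' x).
Proof.
move=> H; have H1 ps p' x : obind (op' p') (run op ps x) = obind (run op ps) (op' p' x).
  elim: ps x => [|p ps IH] x /=; first by case: (op' p' x).
  have := H p p' x; case: (op p x) => [y|] /=; case: (op' p' x) => [z|] //=.
  - by move=> h; rewrite IH h.
  - by move=> h; rewrite IH h.
  - by move=> <-.
move=> ps ps'; elim: ps' => [|p' ps' IH] x /=; first by case: (run op ps x).
have := H1 ps p' x; case: (run op ps x) => [y|] /=; case: (op' p' x) => [z|] //=.
- by rewrite -IH => ->.
- by move=> ->.
- by rewrite -IH => <-.
Qed.

Section Transport.
Variables (D1 D2 : gl_datum).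

Lemma transport_crystal (D : gl_datum) (B B' : Type) (c : crystal_on D B) (c' : crystal_on D B')
    (h : B -> B') : bijective h -> preserves c c' h -> is_crystal c' -> is_crystal c.
Proof.
move=> [g hg gh] [hw he hp hE hF] [pe ee ff ef]; split.
- by move=> i b; rewrite -hp -he -hw.
- move=> i b b' E; have := hE i b; rewrite E /= => /ee [].
  by rewrite !hw !he !hp.
- move=> i b b' E; have := hF i b; rewrite E /= => /ff [].
  by rewrite !hw !he !hp.
- have hi : injective h := can_inj hg.
  move=> i b b'; split=> E.
    have := hE i b'; have /ef -> := etrans (hF i b) (congr1 (omap h) E).
    by case: (ce c i b') => //= x [] /hi ->.
  have := hF i b; have /ef -> := etrans (hE i b') (congr1 (omap h) E).
  by case: (cf c i b) => //= x [] /hi ->.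
Qed.

Lemma preservesV (D : gl_datum) (B B' : Type) (c : crystal_on D B) (c' : crystal_on D B')
    (h : B -> B') (g : B' -> B) : cancel h g -> cancel g h -> preserves c c' h -> preserves c' c g.
Proof.
move=> hg gh [hw he hp hE hF]; split.
- by move=> b; rewrite -{2}(gh b) hw.
- by move=> i b; rewrite -{2}(gh b) he.
- by move=> i b; rewrite -{2}(gh b) hp.
- move=> i b; rewrite -{2}(gh b) hE; case: (ce c i (g b)) => //= x; by rewrite hg.
- move=> i b; rewrite -{2}(gh b) hF; case: (cf c i (g b)) => //= x; by rewrite hg.
Qed.

Lemma transport_bicrystal (X Y : bicrystal D1 D2) (h : Y -> X) : bijective h ->
  preserves (fst_str Y) (fst_str X) h -> preserves (snd_str Y) (snd_str X) h ->
  is_bicrystal X -> bicrystal_iso X Y.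
Proof.
move=> bh h1 h2 bX; have [g hg gh] := bh; have hi := can_inj hg.
have H (o1 o2 : Y -> option Y) (p1 p2 : X -> option X) :
    (forall y, p1 (h y) = omap h (o1 y)) -> (forall y, p2 (h y) = omap h (o2 y)) ->
    (forall x, obind p2 (p1 x) = obind p1 (p2 x)) ->
    forall y, obind o2 (o1 y) = obind o1 (o2 y).
  move=> e1 e2 c y; apply: (inj_omap hi); have := c (h y); rewrite e1 e2.
  case: (o1 y) => [y1|]; case: (o2 y) => [y2|] //=; rewrite ?e1 ?e2 //.
split=> //; last first.
  exists g; split; [by exists h|exact: preservesV h1|exact: preservesV h2].
case: bX => c1 c2 ee ef fe ff; split.
- exact: transport_crystal h1 c1.
- exact: transport_crystal h2 c2.
- by move=> k l; apply: H (preserves_e h1 k) (preserves_e h2 l) (ee k l).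
- by move=> k l; apply: H (preserves_e h1 k) (preserves_f h2 l) (ef k l).
- by move=> k l; apply: H (preserves_f h1 k) (preserves_e h2 l) (fe k l).
- by move=> k l; apply: H (preserves_f h1 k) (preserves_f h2 l) (ff k l).
Qed.
End Transport.

Section Assembly.
Variables (D1 D2 : gl_datum) (X : bicrystal D1 D2).
Hypothesis bX : is_bicrystal X.

Definition cop (D : gl_datum) (B : Type) (c : crystal_on D B) (p : bool * node D) (x : B) :=
  if p.1 then ce c p.2 x else cf c p.2 x.
Definition copV (D : gl_datum) (p : bool * node D) := (~~ p.1, p.2).

Lemma copVP (D : gl_datum) (B : Type) (c : crystal_on D B) : is_crystal c ->
  forall p x y, cop c p x = Some y -> cop c (copV p) y = Some x.
Proof. by move=> ic [[] i] x y /(crystal_ef ic). Qed.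

Local Notation op1 := (cop (fst_str X)).
Local Notation op2 := (cop (snd_str X)).
Local Notation conn1 := (conn op1).
Local Notation conn2 := (conn op2).

Let V1 := copVP (bicrystal_fst bX).
Let V2 := copVP (bicrystal_snd bX).

Lemma op_comm p p' x : obind (op2 p') (op1 p x) = obind (op1 p) (op2 p' x).
Proof.
case: p => -[] k; case: p' => -[] l; rewrite /cop /=.
- exact: bicrystal_ee. - exact: bicrystal_ef. - exact: bicrystal_fe. - exact: bicrystal_ff.
Qed.
Let comm := run_comm op_comm.

Hypothesis inv1 : forall p x y, op1 p x = Some y ->
  [/\ wt (snd_str X) y = wt (snd_str X) x, ceps (snd_str X) ^~ y =1 ceps (snd_str X) ^~ x
    & cphi (snd_str X) ^~ y =1 cphi (snd_str X) ^~ x].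
Hypothesis inv2 : forall p x y, op2 p x = Some y ->
  [/\ wt (fst_str X) y = wt (fst_str X) x, ceps (fst_str X) ^~ y =1 ceps (fst_str X) ^~ x
    & cphi (fst_str X) ^~ y =1 cphi (fst_str X) ^~ x].

Variables (J : choiceType) (B1 : J -> crystal D1) (B2 : J -> crystal D2).
Variables (al : forall j, B1 j -> X) (be : forall j, B2 j -> X) (a : J -> X).
Hypothesis al_pres : forall j, preserves (B1 j) (fst_str X) (@al j).
Hypothesis be_pres : forall j, preserves (B2 j) (snd_str X) (@be j).
Hypothesis al_inj : forall j, injective (@al j).
Hypothesis be_inj : forall j, injective (@be j).
Hypothesis al_conn : forall j T, conn1 (a j) (@al j T).
Hypothesis be_conn : forall j b, conn2 (a j) (@be j b).
Hypothesis a_be : forall j, exists b, @be j b = a j.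
Hypothesis sep : forall j j' B, conn1 (a j) B -> conn2 B (a j') -> j = j' /\ B = a j'.
Hypothesis al_surj : forall x, exists j T, conn2 (@al j T) x.

(** Let p lead from a j to al T in the first structure, and w from a j to be b in the
    second.  As the structures commute, p and then w, or w and then p, end at the same
    element; it does not depend on p in the first description, nor on w in the second. *)
Lemma glue_ex j T b : exists M, forall p w, run op1 p (a j) = Some (@al j T) ->
  run op2 w (a j) = Some (@be j b) -> run op1 p (be b) = Some M /\ run op2 w (al T) = Some M.
Proof.
have [p0 h0] := al_conn T; have [w0 k0] := be_conn b.
have E p w : run op1 p (a j) = Some (al T) -> run op2 w (a j) = Some (be b) ->
    run op1 p (be b) = run op2 w (al T).
  by move=> hp hw; have := comm p w (a j); rewrite hp hw.
case E0: (run op1 p0 (be b)) => [M|].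
  by exists M => p w hp hw; rewrite (E p w hp hw) -(E p0 w h0 hw) E0.
have [p1 h1] := conn_sym V1 (al_conn T).
by have := comm p1 w0 (al T); rewrite h1 /= k0 -(E p0 w0 h0 k0) E0.
Qed.

Definition glue j T b := projT1 (cid (@glue_ex j T b)).

Lemma glueP j T b p w : run op1 p (a j) = Some (@al j T) ->
  run op2 w (a j) = Some (@be j b) ->
  run op1 p (be b) = Some (glue T b) /\ run op2 w (al T) = Some (glue T b).
Proof. by rewrite /glue; case: cid => M; apply. Qed.

Lemma glue_conn1 j T b : conn1 (be b) (@glue j T b).
Proof.
by have [p hp] := al_conn T; have [w hw] := be_conn b; have [] := glueP hp hw; exists p.
Qed.
Lemma glue_conn2 j T b : conn2 (al T) (@glue j T b).
Proof.
by have [p hp] := al_conn T; have [w hw] := be_conn b; have [] := glueP hp hw; exists w.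
Qed.

Lemma glue_op1 j T b p : op1 p (@glue j T b) = omap (fun T' => glue T' b) (cop (B1 j) p T).
Proof.
have [w hw] := be_conn b; have [ps hps] := al_conn T.
have [_ h2] := glueP hps hw.
have cE : op1 p (al T) = omap (@al j) (cop (B1 j) p T).
  by rewrite /cop; case: p.1; [exact: preserves_e (al_pres j) _ _|exact: preserves_f (al_pres j) _ _].
have := comm [:: p] w (al T); rewrite h2 /= cE.
case: (cop (B1 j) p T) => [T'|] /=; last by case: (op1 p _).
have [ps' hps'] := al_conn T'; have [_ ->] := glueP hps' hw.
by case: (op1 p _).
Qed.

Lemma glue_op2 j T b p : op2 p (@glue j T b) = omap (fun b' => glue T b') (cop (B2 j) p b).
Proof.
have [w hw] := be_conn b; have [ps hps] := al_conn T.
have [h1 _] := glueP hps hw.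
have cE : op2 p (be b) = omap (@be j) (cop (B2 j) p b).
  by rewrite /cop; case: p.1; [exact: preserves_e (be_pres j) _ _|exact: preserves_f (be_pres j) _ _].
have := comm ps [:: p] (be b); rewrite h1 /= cE.
case: (cop (B2 j) p b) => [b'|] /=; last by case: (op2 p _).
have [w' hw'] := be_conn b'; have [-> _] := glueP hps hw'.
by case: (op2 p _).
Qed.

(** From be b one comes to the common element and back to be b' by the first structure.
    The same path r starts at a j as well, since the structures commute; its end B is
    connected to a j' by the second structure, and sep applies. *)
Lemma glue_inj j T b j' T' b' : @glue j T b = @glue j' T' b' ->
  existT (fun j => (B1 j * B2 j)%type) j (T, b) = existT _ j' (T', b').
Proof.
move=> e.
have [p hp] := al_conn T; have [w hw] := be_conn b; have [h1 h2] := glueP hp hw.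
have [p' hp'] := al_conn T'; have [w' hw'] := be_conn b'; have [h1' h2'] := glueP hp' hw'.
have /(runV V1) k1' := h1'; rewrite -e in k1'.
pose r := p ++ rev (map (@copV D1) p').
have hr : run op1 r (be b) = Some (be b') by rewrite run_cat h1.
have := comm r w (a j); rewrite hw /= hr; case E: (run op1 r (a j)) => [B|] //= hB.
have cB : conn2 B (a j').
  apply: (conn_trans (y := be b')); first by exists w.
  by apply: (conn_sym V2); exists w'.
have [jj Ba] : j = j' /\ B = a j' by apply: sep cB; exists r.
case: j' / jj T' b' e hp' hw' h1' h2' k1' @r hr E hB cB Ba => T' b' e hp' hw' h1' h2' k1' r hr E hB cB Ba.
have eb : b = b'.
  by apply: be_inj; move: hB; rewrite Ba hw => -[].
have eT : T = T'.
  apply: al_inj; apply: (run_inj V2 h2); rewrite e.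
  by have [] := glueP hp' (eq_ind b (fun b => run op2 w (a j) = Some (be b)) hw b' eb).
by rewrite eb eT.
Qed.

(** x is reached from some al T by a path w of the second structure.  As al T is connected
    to a j by the first one, w also starts at a j, and it ends in the image of be. *)
Lemma glue_surj x : exists j T b, @glue j T b = x.
Proof.
have [j [T [w hw]]] := al_surj x; have [p hp] := al_conn T.
have := comm p w (a j); rewrite hp /= hw; case E: (run op2 w (a j)) => [y|] //= hy.
have [b hb] : exists b, @be j b = y.
  have cy : conn2 (a j) y by exists w.
  apply: (conn_ind (R := fun y => exists b, @be j b = y) _ cy) (a_be j).
  move=> p' u v huv [b hb]; move: huv; rewrite -hb.
  have -> : op2 p' (be b) = omap (@be j) (cop (B2 j) p' b).
    by rewrite /cop; case: p'.1; [exact: preserves_e (be_pres j) _ _|exact: preserves_f (be_pres j) _ _].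
  by case: (cop _ _ _) => //= b' [<-]; exists b'.
exists j, T, b; rewrite -hb in E; have [_] := glueP hp E.
by rewrite hw => -[].
Qed.

(** The weights and string lengths of the first structure are constant along the second
    one, and conversely; so they can be read off al T and be b. *)
Theorem bicrystal_decomposition :
  bicrystal_iso X (sum_bicrystal (fun j => prod_bicrystal (B1 j) (B2 j))).
Proof.
pose Y := sum_bicrystal (fun j => prod_bicrystal (B1 j) (B2 j)).
pose h (y : Y) : X := glue (tagged y).1 (tagged y).2.
apply: (@transport_bicrystal _ _ X Y h) => //.
- have hs x : exists y, h y = x.
    by have [j [T [b <-]]] := glue_surj x; exists (Tagged (fun j => prod_bicrystal (B1 j) (B2 j)) (T, b)).
  have hi : injective h.
    by move=> [j [T b]] [j' [T' b']]; rewrite /h /=; exact: glue_inj.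
  exists (fun x => projT1 (cid (hs x))) => [y|x]; last by case: (cid _).
  by apply: hi; case: (cid _).
- have I j T b : [/\ wt (fst_str X) (@glue j T b) = wt (fst_str X) (al T),
     ceps (fst_str X) ^~ (@glue j T b) =1 ceps (fst_str X) ^~ (al T) &
     cphi (fst_str X) ^~ (@glue j T b) =1 cphi (fst_str X) ^~ (al T)].
    have c := glue_conn2 T b; split.
    - by apply: (conn_inv _ c) => p x y /inv2[].
    - by move=> k; apply: (conn_inv (g := ceps (fst_str X) k) _ c) => p x y /inv2[].
    - by move=> k; apply: (conn_inv (g := cphi (fst_str X) k) _ c) => p x y /inv2[].
  split=> [[j [T b]]|i [j [T b]]|i [j [T b]]|i [j [T b]]|i [j [T b]]]; rewrite /h /=.
  - by have [-> _ _] := I j T b; rewrite (preserves_wt (al_pres j)).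
  - by have [_ -> _] := I j T b; rewrite (preserves_eps (al_pres j)).
  - by have [_ _ ->] := I j T b; rewrite (preserves_phi (al_pres j)).
  - by have := glue_op1 T b (true, i); rewrite /cop /= => ->; case: (ce _ _ _).
  - by have := glue_op1 T b (false, i); rewrite /cop /= => ->; case: (cf _ _ _).
- have I j T b : [/\ wt (snd_str X) (@glue j T b) = wt (snd_str X) (be b),
     ceps (snd_str X) ^~ (@glue j T b) =1 ceps (snd_str X) ^~ (be b) &
     cphi (snd_str X) ^~ (@glue j T b) =1 cphi (snd_str X) ^~ (be b)].
    have c := glue_conn1 T b; split.
    - by apply: (conn_inv _ c) => p x y /inv1[].
    - by move=> k; apply: (conn_inv (g := ceps (snd_str X) k) _ c) => p x y /inv1[].
    - by move=> k; apply: (conn_inv (g := cphi (snd_str X) k) _ c) => p x y /inv1[].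
  split=> [[j [T b]]|i [j [T b]]|i [j [T b]]|i [j [T b]]|i [j [T b]]]; rewrite /h /=.
  - by have [-> _ _] := I j T b; rewrite (preserves_wt (be_pres j)).
  - by have [_ -> _] := I j T b; rewrite (preserves_eps (be_pres j)).
  - by have [_ _ ->] := I j T b; rewrite (preserves_phi (be_pres j)).
  - by have := glue_op2 T b (true, i); rewrite /cop /= => ->; case: (ce _ _ _).
  - by have := glue_op2 T b (false, i); rewrite /cop /= => ->; case: (cf _ _ _).
Qed.
End Assembly.

(** * The matrices form a bicrystal *)

Lemma window_exists (xs : seq int) : exists c m, forall x, x \in xs ->
  exists j : 'I_m, x = c + (nat_of_ord j)%:Z.
Proof.
have [M hM] : exists M : nat, forall x, x \in xs -> (`|x| <= M)%N.
  elim: xs => [|x xs [M hM]]; first by exists 0%N.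
  exists (`|x| + M)%N => y; rewrite inE => /orP[/eqP ->|/hM]; clear; lia.
exists (- M%:Z), (2 * M).+1 => x /hM xM.
have h : (absz (x + M%:Z)%R < (2 * M).+1)%N by move: xM; clear; lia.
by exists (Ordinal h) => /=; move: xM; clear; lia.
Qed.

Lemma win_of n m c (A : mat01 n) :
  (forall i x, A (i, x) -> exists j : 'I_m, x = c + (nat_of_ord j)%:Z) ->
  exists s : box n m, A = win c s.
Proof.
move=> h; exists [ffun x : cell n m => A (x.1, c + (nat_of_ord x.2)%:Z)].
apply: winP => [i j|i x hx]; first by rewrite ffunE.
by apply/negbTE/negP => /h[j e]; have := hx j; rewrite e eqxx.
Qed.

Lemma win_exists n (A : mat01 n) (k : int) : exists c m (s : box n m) (k0 k1 : 'I_m),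
  [/\ A = win c s, k = c + (nat_of_ord k0)%:Z & k1 = k0.+1 :> nat].
Proof.
have [c [m hm]] := window_exists (k :: k + 1 :: [seq x.2 | x <- finsupp A]).
have [s As] : exists s : box n m, A = win c s.
  apply: win_of => i x Ax; apply: hm; rewrite !inE; apply/orP; right; apply/orP; right.
  by apply/mapP; exists (i, x); rewrite // mem_finsupp Ax.
have [k0 h0] := hm k (mem_head _ _).
have [|k1 h1] := hm (k + 1); first by rewrite !inE eqxx orbT.
exists c, m, s, k0, k1; split=> //; move: h0 h1; clear; lia.
Qed.

Section MatCrystal.
Variable n : nat.
Local Notation lof := (@lo (gl_fin n) : 'I_n.-1 -> 'I_n).
Local Notation hif := (@hi (gl_fin n) : 'I_n.-1 -> 'I_n).

Lemma is_crystalI (D : gl_datum) (B : Type) (c : crystal_on D B) :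
  (forall i b, cphi c i b = ceps c i b + coroot i (wt c b)) ->
  (forall i b b', ce c i b = Some b' ->
    [/\ wt c b' = wt c b + Defs.root i, ceps c i b' = ceps c i b - 1
      & cphi c i b' = cphi c i b + 1]) ->
  (forall i b b', cf c i b = Some b' <-> ce c i b' = Some b) -> is_crystal c.
Proof.
move=> h1 h2 h3; split=> // i b b' /h3/h2[-> -> ->].
by rewrite addrK subrK addrK.
Qed.

Lemma col_sum_rsw m (k k' : 'I_m) i (s : box n m) j : k' = k.+1 :> nat -> rdn k k' i s ->
  (col_sum (rsw k k' i s) j)%:Z = (col_sum s j)%:Z + ((j == k)%:Z - (j == k')%:Z).
Proof.
move=> kk'; rewrite /rdn /grid_dn /bget => /andP[/negbTE sl sh].
have kN : k != k' by rewrite -val_eqE /= kk'; clear; lia.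
set S := (\sum_(i' | i' != i) s (i', j))%N.
have -> : col_sum s j = (s (i, j) + S)%N by rewrite /col_sum (bigD1 i).
have -> : col_sum (rsw k k' i s) j = (rsw k k' i s (i, j) + S)%N.
  rewrite /col_sum (bigD1 i) //=; congr (_ + _)%N.
  by apply: eq_bigr => i' /negbTE ii; rewrite rsw_tperm // ii.
move: S => S; rewrite rsw_tperm // eqxx; case: tpermP => [->|->|/eqP jl /eqP jh].
- by rewrite eqxx (negbTE kN) sl sh; clear; lia.
- by rewrite eqxx eq_sym (negbTE kN) sl sh; clear; lia.
- by rewrite (negbTE jl) (negbTE jh); rewrite subrr addr0.
Qed.

Lemma row_sum_rsw m (k k' : 'I_m) i (s : box n m) r : k' = k.+1 :> nat ->
  row_sum (rsw k k' i s) r = row_sum s r.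
Proof.
move=> kk'; rewrite /row_sum [RHS](reindex_inj (@perm_inj _ (if r == i then tperm k k' else 1%g))) /=.
by apply: eq_bigr => j _; rewrite rsw_tperm //; case: ifP => _; rewrite ?perm1.
Qed.

Lemma omap_Some (A B : Type) (f : A -> B) o y : omap f o = Some y -> exists2 x, o = Some x & y = f x.
Proof. by case: o => //= x [<-]; exists x. Qed.

Lemma mat_inf_e k A A' : ce (mat_inf_crystal n) k A = Some A' ->
  [/\ wt (mat_inf_crystal n) A' = wt (mat_inf_crystal n) A + Defs.root k,
      ceps (mat_inf_crystal n) k A' = ceps (mat_inf_crystal n) k A - 1
    & cphi (mat_inf_crystal n) k A' = cphi (mat_inf_crystal n) k A + 1].
Proof.
have [c [m [s [k0 [k1 [e1 e2 e3]]]]]] := win_exists A k.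
rewrite e1 e2 (win_e_inf _ e3) => E0; have [s' E ->] := omap_Some E0.
have [_ hp he] := ch_eP (chain_r n e3) (uR n) E.
rewrite !(win_eps_inf _ e3) !(win_phi_inf _ e3) hp he.
split; [|clear; lia|clear; lia].
apply/eqP/freeg_eqP => x; rewrite coeffD (@coeff_root gl_inf).
have [i si ->] : exists2 i, rdn k0 k1 i s & s' = rsw k0 k1 i s.
  move: E; rewrite /ch_e; case Ei: (sg_e _ _ _) => [i|] //= [<-].
  by have /andP[_ di] := sg_e_mem Ei; exists i.
have hE : hi (c + (nat_of_ord k0)%:Z : node gl_inf) = c + (nat_of_ord k1)%:Z.
  by rewrite /= e3; clear; lia.
have [[j ->]|h] := win_case m c x.
  by rewrite !wt_win_inf col_sum_rsw // hE !(inj_eq (@pt_inj m c)).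
by rewrite !wt_win_inf0 // hE (negbTE (h k0)) (negbTE (h k1)).
Qed.

Lemma mat_inf_ef k A A' : cf (mat_inf_crystal n) k A = Some A' <-> ce (mat_inf_crystal n) k A' = Some A.
Proof.
split.
  have [c [m [s [k0 [k1 [-> -> e3]]]]]] := win_exists A k.
  rewrite (win_f_inf _ e3) => E0; have [s' E' ->] := omap_Some E0; have E := proj1 (ch_efP (chain_r n e3) (uR n) _ _) E'.
  by rewrite (win_e_inf _ e3) E.
have [c [m [s [k0 [k1 [-> -> e3]]]]]] := win_exists A' k.
rewrite (win_e_inf _ e3) => E0; have [s' E' ->] := omap_Some E0; have E := proj2 (ch_efP (chain_r n e3) (uR n) _ _) E'.
by rewrite (win_f_inf _ e3) E.
Qed.

Lemma mat_inf_is_crystal : is_crystal (mat_inf_crystal n).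
Proof.
apply: is_crystalI => [k A|k A A'|k A A']; [|exact: mat_inf_e|exact: mat_inf_ef].
exact: word_phi_eps (vec_small gl_inf) k (rows A).
Qed.

Lemma mat_fin_e l A A' : ce (mat_fin_crystal n) l A = Some A' ->
  [/\ wt (mat_fin_crystal n) A' = wt (mat_fin_crystal n) A + Defs.root l,
      ceps (mat_fin_crystal n) l A' = ceps (mat_fin_crystal n) l A - 1
    & cphi (mat_fin_crystal n) l A' = cphi (mat_fin_crystal n) l A + 1].
Proof.
have [c [m [s [_ [_ [-> _ _]]]]]] := win_exists A 0.
rewrite win_e_fin => E0; have [s' E ->] := omap_Some E0.
have [_ hp he] := ch_eP (chain_c m (@fin_lohi n) l) (uJ m) E.
rewrite !win_eps_fin !win_phi_fin hp he.
split; [|clear; lia|clear; lia].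
apply/eqP/freeg_eqP => i; rewrite coeffD (@coeff_root (gl_fin n)) !wt_win_fin.
by rewrite (row_sum_e (@fin_lohi n) E).
Qed.

Lemma mat_fin_ef l A A' : cf (mat_fin_crystal n) l A = Some A' <-> ce (mat_fin_crystal n) l A' = Some A.
Proof.
split.
  have [c [m [s [_ [_ [-> _ _]]]]]] := win_exists A 0.
  rewrite win_f_fin => E0; have [s' E' ->] := omap_Some E0; have E := proj1 (ch_efP (chain_c m (@fin_lohi n) l) (uJ m) _ _) E'.
  by rewrite win_e_fin E.
have [c [m [s [_ [_ [-> _ _]]]]]] := win_exists A' 0.
rewrite win_e_fin => E0; have [s' E' ->] := omap_Some E0; have E := proj2 (ch_efP (chain_c m (@fin_lohi n) l) (uJ m) _ _) E'.
by rewrite win_f_fin E.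
Qed.

Lemma mat_fin_is_crystal : is_crystal (mat_fin_crystal n).
Proof.
apply: is_crystalI => [l A|l A A'|l A A']; [|exact: mat_fin_e|exact: mat_fin_ef].
exact: word_phi_eps (vec_small (gl_fin n)) l (cols A).
Qed.

Lemma obind_omap (A B : Type) (h : A -> B) (F : B -> option B) (f : A -> option A) o :
  (forall x, F (h x) = omap h (f x)) -> obind F (omap h o) = omap h (obind f o).
Proof. by move=> E; case: o => //= x; rewrite E. Qed.

Local Notation ei := (ce (mat_inf_crystal n)).
Local Notation fi := (cf (mat_inf_crystal n)).
Local Notation ef := (ce (mat_fin_crystal n)).
Local Notation ff := (cf (mat_fin_crystal n)).

(** In a window that contains A and the columns k and k + 1, the operators are those of
    boxes. *)
Lemma mat_comm k l A :
  [/\ obind (ef l) (ei k A) = obind (ei k) (ef l A), obind (ff l) (ei k A) = obind (ei k) (ff l A),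
      obind (ef l) (fi k A) = obind (fi k) (ef l A) & obind (ff l) (fi k A) = obind (fi k) (ff l A)].
Proof.
have [c [m [s [k0 [k1 [-> -> e3]]]]]] := win_exists A k.
have [J1 [J2 [R1 [R2 [JE RE cr]]]]] := box_cross (@fin_lohi n) l e3.
have IE (s' : box n m) := win_e_inf c e3 s'.
have IF (s' : box n m) := win_f_inf c e3 s'.
have FE s' := win_e_fin (m := m) c l s'.
have FF s' := win_f_fin (m := m) c l s'.
rewrite !IE !IF !FE !FF.
rewrite !(obind_omap _ FE) !(obind_omap _ FF) !(obind_omap _ IE) !(obind_omap _ IF).
rewrite JE RE; split; congr (omap _ _).
- by rewrite (cross_ee cr).
- by rewrite (cross_fe cr).
- by rewrite (cross_fe (cross_sym cr)).
- by rewrite (cross_ff cr).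
Qed.

Lemma mat_is_bicrystal : is_bicrystal (mat_bicrystal n).
Proof.
split; [exact: mat_inf_is_crystal|exact: mat_fin_is_crystal|..];
  by move=> k l A; have [] := mat_comm k l A.
Qed.

Lemma mat_fi_inv k A A' : fi k A = Some A' ->
  [/\ wt (mat_fin_crystal n) A' = wt (mat_fin_crystal n) A,
      ceps (mat_fin_crystal n) ^~ A' =1 ceps (mat_fin_crystal n) ^~ A &
      cphi (mat_fin_crystal n) ^~ A' =1 cphi (mat_fin_crystal n) ^~ A].
Proof.
have [c [m [s [k0 [k1 [-> -> e3]]]]]] := win_exists A k.
rewrite (win_f_inf c e3) => E0; have [s' E ->] := omap_Some E0.
have I l : ch_eps (cup lof hif l) (cdn lof hif l) (cols_rl m) s' = ch_eps (cup lof hif l) (cdn lof hif l) (cols_rl m) s /\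
           ch_phi (cup lof hif l) (cdn lof hif l) (cols_rl m) s' = ch_phi (cup lof hif l) (cdn lof hif l) (cols_rl m) s.
  have [J1 [J2 [R1 [R2 [JE RE cr]]]]] := box_cross (@fin_lohi n) l e3.
  by move: E; rewrite JE RE; exact: (cross_inv_fc (cross_sym cr)).
split=> [|l|l]; rewrite ?win_eps_fin ?win_phi_fin; last by have [_ ->] := I l.
- apply/eqP/freeg_eqP => i; rewrite !wt_win_fin.
  by move: E; rewrite /ch_f; case: (sg_f _ _ _) => //= i' [<-]; rewrite row_sum_rsw.
- by have [-> _] := I l.
Qed.

Lemma mat_ff_inv l A A' : ff l A = Some A' ->
  [/\ wt (mat_inf_crystal n) A' = wt (mat_inf_crystal n) A,
      ceps (mat_inf_crystal n) ^~ A' =1 ceps (mat_inf_crystal n) ^~ A &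
      cphi (mat_inf_crystal n) ^~ A' =1 cphi (mat_inf_crystal n) ^~ A].
Proof.
move=> E0.
have I k : ceps (mat_inf_crystal n) k A' = ceps (mat_inf_crystal n) k A /\
   cphi (mat_inf_crystal n) k A' = cphi (mat_inf_crystal n) k A.
  have [c [m [s [k0 [k1 [e1 -> e3]]]]]] := win_exists A k.
  move: E0; rewrite e1 (win_f_fin c l) => E0; have [s' E ->] := omap_Some E0.
  rewrite !(win_eps_inf c e3) !(win_phi_inf c e3).
  have [J1 [J2 [R1 [R2 [JE RE cr]]]]] := box_cross (@fin_lohi n) l e3.
  by move: E; rewrite JE RE => E; have [-> ->] := cross_inv_fc cr E.
split=> [|k|k]; last by have [_ ->] := I k.
- have [c [m [s [_ [_ [e1 _ _]]]]]] := win_exists A 0.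
  move: E0; rewrite e1 (win_f_fin c l) => E0; have [s' E ->] := omap_Some E0.
  apply/eqP/freeg_eqP => x; have [[j ->]|h] := win_case m c x; last by rewrite !wt_win_inf0.
  rewrite !wt_win_inf; congr Posz.
  by move: E; rewrite /ch_f; case: (sg_f _ _ _) => //= j' [<-]; rewrite col_sum_csw.
- by have [-> _] := I k.
Qed.

Lemma mat_op1_inv p A A' : cop (mat_inf_crystal n) p A = Some A' ->
  [/\ wt (mat_fin_crystal n) A' = wt (mat_fin_crystal n) A,
      ceps (mat_fin_crystal n) ^~ A' =1 ceps (mat_fin_crystal n) ^~ A &
      cphi (mat_fin_crystal n) ^~ A' =1 cphi (mat_fin_crystal n) ^~ A].
Proof.
case: p => -[] k; rewrite /cop /=; last exact: mat_fi_inv.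
move=> E; have [h1 h2 h3] := mat_fi_inv (proj2 (mat_inf_ef k A' A) E).
by split=> [|l|l]; [exact: esym h1|exact: esym (h2 l)|exact: esym (h3 l)].
Qed.

Lemma mat_op2_inv p A A' : cop (mat_fin_crystal n) p A = Some A' ->
  [/\ wt (mat_inf_crystal n) A' = wt (mat_inf_crystal n) A,
      ceps (mat_inf_crystal n) ^~ A' =1 ceps (mat_inf_crystal n) ^~ A &
      cphi (mat_inf_crystal n) ^~ A' =1 cphi (mat_inf_crystal n) ^~ A].
Proof.
case: p => -[] k; rewrite /cop /=; last exact: mat_ff_inv.
move=> E; have [h1 h2 h3] := mat_ff_inv (proj2 (mat_fin_ef k A' A) E).
by split=> [|l|l]; [exact: esym h1|exact: esym (h2 l)|exact: esym (h3 l)].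
Qed.
End MatCrystal.

(** * Lowest matrices are tableaux *)

Lemma count_lt_nth (s : seq int) (x : int) r : sorted <%R s ->
  (r < count (fun y : int => (y < x)%R) s)%N = (r < size s)%N && (s`_r < x).
Proof.
elim: s r => [|y s IH] r; first by rewrite /= ltn0.
move=> /= pw; have := order_path_min lt_trans pw; move=> /allP hw.
have [yx|yx] := ltP y x; first by case: r => [|r] /=; rewrite ?yx // add1n !ltnS IH ?(path_sorted pw).
have -> : count (fun y : int => (y < x)%R) s = 0%N.
  apply/eqP; rewrite -leqn0 leqNgt -has_count; apply/hasPn => z /hw yz.
  by rewrite -leNgt (le_trans yx) // ltW.
rewrite ltn0; apply/esym/negbTE; rewrite negb_and -leNgt -leqNgt.
case: r => [|r] /=; first by rewrite ?yx ?orbT.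
rewrite ltnS; case: (leqP (size s) r) => //= rs.
by rewrite (le_trans yx) // ltW // hw // mem_nth.
Qed.

(** Turns the signature condition on two adjacent rows of a matrix into the condition on
    two adjacent columns of a semistandard tableau. *)
Lemma count_lt_dom (s t : seq int) : sorted <%R s -> sorted <%R t ->
  (forall x, (count (fun y : int => (y < x)%R) s <= count (fun y : int => (y < x)%R) t)%N) <->
  (size s <= size t)%N /\ forall r, (r < size s)%N -> t`_r <= s`_r.
Proof.
move=> ss st; split=> [h|[h1 h2] x].
  have H r : (r < size s)%N -> (r < size t)%N && (t`_r <= s`_r).
    move=> rs; have : (r < count (fun y : int => (y < s`_r + 1)%R) s)%N.
      by rewrite count_lt_nth // rs ltzD1 lexx.
    by move=> /leq_trans/(_ (h _)); rewrite count_lt_nth // ltzD1.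
  split=> [|r /H/andP[]//]; case E: (size s) => [//|k].
  by have /andP[] := H k (eq_ind_r (fun z => (k < z)%N) (ltnSn k) E).
have H r : (r < count (fun y : int => (y < x)%R) s)%N -> (r < count (fun y : int => (y < x)%R) t)%N.
  rewrite !count_lt_nth // => /andP[rs sx].
  by rewrite (leq_trans rs h1) (le_lt_trans (h2 r rs)).
by case E: (count _ s) => [//|k]; apply: H; rewrite E.
Qed.

Lemma count_swap (P : pred nat) m c : (forall j, P j -> (j < m)%N) ->
  count (fun j => (j < c)%N && P j) (iota 0 m) = count P (iota 0 c).
Proof.
move=> h; rewrite -!size_filter; apply: perm_size; apply: uniq_perm; rewrite ?filter_uniq ?iota_uniq //.
move=> j; rewrite !mem_filter !mem_iota /= !add0n.
by case Pj: (P j); rewrite ?andbF // !andbT (h j Pj) andbT.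
Qed.

Lemma count_andN (T : Type) (a b : pred T) J :
  (count (fun j => a j && ~~ b j) J + count b J = count (fun j => ~~ a j && b j) J + count a J)%N.
Proof. by elim: J => //= j J; case: (a j); case: (b j) => /=; clear; lia. Qed.

Section BoxLowest.
Variables (n m : nat) (N : eqType) (lo hi : N -> 'I_n).
Hypothesis lohi : forall i, hi i = (lo i).+1 :> nat.
Variable s : box n m.

Lemma count_enum (P : pred nat) c : (forall j, P j -> (j < m)%N) ->
  count P (iota 0 c) = count (fun j : 'I_m => P j) (take c (enum 'I_m)).
Proof.
move=> h; rewrite -(count_swap c h).
have -> : count (fun j : 'I_m => P j) (take c (enum 'I_m)) = count P (iota 0 (minn c m)).
  by rewrite -(count_map val) map_take val_enum_ord take_iota.
have h' j : P j && (j < c)%N -> (j < m)%N by case/andP => /h.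
rewrite -(count_swap (minn c m) h); apply: eq_in_count => j; rewrite mem_iota add0n /= => jm.
by rewrite leq_min jm andbT.
Qed.

(** The sites go from right to left, so their suffixes are initial segments of the columns;
    the columns in which both rows have an entry can be added on both sides. *)
Lemma box_phi0 i : ch_phi (cup (m := m) lo hi i) (cdn lo hi i) (cols_rl m) s = 0%N <->
  forall c, (count (ab s (lo i)) (iota 0 c) <= count (ab s (hi i)) (iota 0 c))%N.
Proof.
have sm r j : ab s r j -> (j < m)%N by move=> /ab_supp/andP[].
have E c : (count (ab s (lo i)) (iota 0 c) <= count (ab s (hi i)) (iota 0 c))%N =
   (count ((cup (m := m) lo hi i)^~ s) (take c (enum 'I_m))
    <= count ((cdn (m := m) lo hi i)^~ s) (take c (enum 'I_m)))%N.
  rewrite !(count_enum _ (sm _)).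
  have := count_andN (fun j : 'I_m => ab s (lo i) j) (fun j : 'I_m => ab s (hi i) j) (take c (enum 'I_m)).
  rewrite (eq_count (a2 := (cup (m := m) lo hi i)^~ s)); last by move=> j; rewrite /= !abE.
  rewrite [X in _ = (X + _)%N](eq_count (a2 := (cdn (m := m) lo hi i)^~ s)); last by move=> j; rewrite /= !abE.
  by clear; lia.
have dE k : drop k (cols_rl m) = rev (take (m - k) (enum 'I_m)) by rewrite /cols_rl drop_rev size_enum_ord.
split=> [h c|h].
  rewrite E; have -> : take c (enum 'I_m) = take (m - (m - c)) (enum 'I_m).
    have [cm|cm] := leqP c m; first by rewrite subKn.
    by rewrite !take_oversize ?size_enum_ord //; move: cm; clear; lia.
  rewrite -[count _ _]count_rev -[X in (_ <= X)%N]count_rev -dE.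
  have := @sg_phi0_count _ ((cup (m := m) lo hi i)^~ s) ((cdn (m := m) lo hi i)^~ s) (take (m - c) (cols_rl m)) (drop (m - c) (cols_rl m)).
  by rewrite cat_take_drop; apply.
apply: sg_phi0 => [|k].
  by move=> j; exact: (ch_ud (chain_c m lohi i)).
by rewrite dE !count_rev -E.
Qed.
End BoxLowest.

Section Lowest.
Variable n : nat.
Local Notation lof := (@lo (gl_fin n) : 'I_n.-1 -> 'I_n).
Local Notation hif := (@hi (gl_fin n) : 'I_n.-1 -> 'I_n).

Definition lowest (A : mat01 n) := forall l, cphi (mat_fin_crystal n) l A = 0.

Lemma row_word_win m c (s : box n m) i :
  row_word (mat_row (win c s) i) = [seq c + j%:Z | j <- filter (ab s i) (iota 0 m)].
Proof.
apply/esym/row_word_eq => [|x].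
  rewrite sorted_map; apply: sorted_filter; first by move=> x y z /= h1 h2; apply: lt_trans h1 h2.
  by apply: sub_sorted (iota_ltn_sorted 0 m) => j j' /=; rewrite ltrD2l ltz_nat.
rewrite mat_rowE; have [[j ->]|h] := win_case m c x.
  rewrite winE -abE (mem_map (f := fun j : nat => c + j%:Z)) => [|j1 j2 /addrI[]//].
  by rewrite mem_filter mem_iota /= ltn_ord andbT.
rewrite win_out //; apply/negbTE/mapP => -[j]; rewrite mem_filter mem_iota /= => /andP[_ jm] e.
by have := h (Ordinal jm); rewrite e eqxx.
Qed.

Lemma count_kap_win m c (s : box n m) i x :
  count (fun y : int => (y < x)%R) (row_word (mat_row (win c s) i)) =
  count (ab s i) (iota 0 (if x <= c then 0%N else absz (x - c)%R)).
Proof.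
rewrite row_word_win count_map -(count_swap (m := m)); last by move=> j /ab_supp/andP[].
rewrite count_filter; apply: eq_count => j /=; congr (_ && _).
by case: (lerP x c); clear; lia.
Qed.

Lemma lowestP A : lowest A <-> forall l : 'I_n.-1,
  (size (row_word (mat_row A (lof l))) <= size (row_word (mat_row A (hif l))))%N /\
  forall r, (r < size (row_word (mat_row A (lof l))))%N ->
    (row_word (mat_row A (hif l)))`_r <= (row_word (mat_row A (lof l)))`_r.
Proof.
have [c [m [s [_ [_ [-> _ _]]]]]] := win_exists A 0.
have H l : cphi (mat_fin_crystal n) l (win c s) = 0 <->
  (size (row_word (mat_row (win c s) (lof l))) <= size (row_word (mat_row (win c s) (hif l))))%N /\
  forall r, (r < size (row_word (mat_row (win c s) (lof l))))%N ->
    (row_word (mat_row (win c s) (hif l)))`_r <= (row_word (mat_row (win c s) (lof l)))`_r.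
  rewrite -(count_lt_dom (row_word_sorted _) (row_word_sorted _)) win_phi_fin.
  have -> : ((ch_phi (cup lof hif l) (cdn lof hif l) (cols_rl m) s)%:Z = 0) <->
     ch_phi (cup lof hif l) (cdn lof hif l) (cols_rl m) s = 0%N by split=> [[]|->].
  rewrite (box_phi0 (@fin_lohi n)); split=> h; first by move=> x; rewrite !count_kap_win.
  move=> k; have := h (c + k%:Z); rewrite !count_kap_win.
  case: lerP => [k0|_]; first by have -> : k = 0%N by (move: k0; clear; lia).
  by have -> : absz (c + k%:Z - c)%R = k by (clear; lia).
by split=> h l; apply/H.
Qed.

Lemma wt_fin_row (A : mat01 n) i : coeff i (wt (mat_fin_crystal n) A) = (size (row_word (mat_row A i)))%:Z.
Proof.
rewrite coeff_wt_fin.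
have -> : size (row_word (mat_row A i)) = count (fun x => A (i, x)) (col_index A).
  rewrite -size_filter; apply: perm_size; apply: uniq_perm.
  - by rewrite sort_uniq fset_uniq.
  - by rewrite filter_uniq // sort_uniq fset_uniq.
  move=> x; rewrite mem_kap mat_rowE mem_filter mem_col_index.
  by case E: (A (i, x)) => //=; apply/esym/existsP; exists i.
by elim: (col_index A) => [|x l IH]; rewrite ?big_nil // big_cons IH.
Qed.

Lemma rows_of_rows (r : seq (vec gl_inf)) : size r = n -> rows (of_rows n r) = r.
Proof.
move=> rn; apply: (@eq_from_nth _ [fsfun]); first by rewrite size_map size_enum_ord.
rewrite size_map size_enum_ord => i ni; rewrite (nth_map (Ordinal ni)) ?size_enum_ord //.
by apply/fsfunP => x; rewrite mat_rowE of_rowsE // nth_enum_ord.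
Qed.

Lemma nth_rows (A : mat01 n) (i : 'I_n) : nth [fsfun] (rows A) i = mat_row A i.
Proof.
have := @nth_map _ i _ [fsfun] (mat_row A) i (enum 'I_n).
by rewrite size_enum_ord nth_ord_enum => /(_ (ltn_ord i)) <-.
Qed.

End Lowest.

Lemma count_ltn_sorted (s : seq nat) i j : sorted geq s ->
  (i < count (ltn j) s)%N = (j < nth 0%N s i)%N.
Proof.
elim: s i => [|y s IH] i; first by rewrite nth_nil.
move=> /= pw.
have hw z : z \in s -> (z <= y)%N.
  have tr : transitive geq by move=> a b c h1 h2; exact: leq_trans h2 h1.
  by move: z; apply/allP; exact: order_path_min tr pw.
have [jy|yj] := ltnP j y; first by case: i => [|i] /=; rewrite ?jy // add1n ltnS IH ?(path_sorted pw).
have -> : count (ltn j) s = 0%N.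
  apply/eqP; rewrite -leqn0 leqNgt -has_count; apply/hasPn => z /hw zy.
  by rewrite /= -leqNgt (leq_trans zy).
rewrite ltn0; apply/esym/negbTE; rewrite -leqNgt; case: i => [//|i] /=.
case: (leqP (size s) i) => si; first by rewrite nth_default.
by rewrite (leq_trans _ yj) // hw // mem_nth.
Qed.

Lemma eq_ltn a b : (forall i, (i < a)%N = (i < b)%N) -> a = b.
Proof.
by move=> h; apply/eqP; rewrite eqn_leq; apply/andP; split; rewrite leqNgt; [rewrite h|rewrite -h]; rewrite ltnn.
Qed.

Lemma part_sorted (mu : intpart) : sorted geq mu.
Proof. by have /andP[] := valP mu. Qed.

Lemma conj_partP mu i j : (i < conj_part mu j)%N = (j < part mu i)%N.
Proof. exact: count_ltn_sorted (part_sorted mu). Qed.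

Lemma conj_part0 mu : conj_part mu 0 = size mu.
Proof.
have /andP[_ h] := valP mu; apply/eqP; rewrite -all_count; apply/allP => x xm /=.
by case: x xm => // x0; case/negP: h.
Qed.

Lemma conj_part_le mu j j' : (j <= j')%N -> (conj_part mu j' <= conj_part mu j)%N.
Proof. by move=> h; apply: sub_count => x /=; apply: leq_ltn_trans. Qed.

Lemma conj_part_eq0 mu j : (part mu 0 <= j)%N -> conj_part mu j = 0%N.
Proof.
by move=> h; apply/eqP; rewrite -leqn0 leqNgt conj_partP -leqNgt.
Qed.

Lemma conj_part_inj mu mu' : conj_part mu =1 conj_part mu' -> mu = mu'.
Proof.
move=> h; apply: val_inj; apply: (@eq_from_nth _ 0%N).
  by have := h 0%N; rewrite !conj_part0.
by move=> i _; apply: eq_ltn => j; rewrite -!/(part _ i) -!conj_partP h.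
Qed.

Section Tableau.
Variable mu : intpart.
Implicit Type T : ssyt mu.

Lemma mem_cells i j : ((i, j) \in cells mu) = (j < part mu i)%N.
Proof.
apply/allpairsPdep/idP => [[j' [i' [_ h [-> ->]]]]|h].
  by move: h; rewrite mem_iota /= add0n conj_partP.
exists j, i; split=> //; last by rewrite mem_iota /= add0n conj_partP.
by rewrite mem_rev mem_iota /= add0n -conj_partP (leq_ltn_trans (leq0n i)) // conj_partP.
Qed.

Definition colT T j : seq int := [seq entry (val T) (i, j) | i <- iota 0 (conj_part mu j)].

Lemma nth_colT T j i : (i < conj_part mu j)%N -> (colT T j)`_i = entry (val T) (i, j).
Proof. by move=> h; rewrite (nth_map 0%N) ?size_iota // nth_iota. Qed.

Lemma size_colT T j : size (colT T j) = conj_part mu j.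
Proof. by rewrite size_map size_iota. Qed.

Lemma colT_sorted T j : sorted <%R (colT T j).
Proof.
apply/(sortedP 0) => i; rewrite size_colT => h.
rewrite !nth_colT ?(ltnW h) //; have /and3P[_ /allP hT _] := valP T.
by have /(_ _)/orP[|//|] := hT (i.+1, j); rewrite ?mem_cells -?conj_partP.
Qed.

Lemma colT_row T j i : (i < conj_part mu j.+1)%N -> (colT T j)`_i <= (colT T j.+1)`_i.
Proof.
move=> h; rewrite !nth_colT //; last exact: leq_trans h (conj_part_le _ (leqnSn j)).
have /and3P[_ _ /allP hT] := valP T.
by have /(_ _)/orP[|//|] := hT (i, j.+1); rewrite ?mem_cells -?conj_partP.
Qed.

Lemma rev_iota n : rev (iota 0 n) = [seq (n.-1 - i)%N | i <- iota 0 n].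
Proof.
apply: (@eq_from_nth _ 0%N); rewrite ?size_rev ?size_map // size_iota => i ni.
rewrite nth_rev ?size_iota // (nth_map 0%N) ?size_iota // !nth_iota //; move: ni; clear; lia.
Qed.

Lemma reading_colT T n : (part mu 0 <= n)%N ->
  reading T = flatten [seq colT T (n.-1 - i) | i <- iota 0 n].
Proof.
move=> mn; rewrite (map_comp (colT T) (fun i => n.-1 - i)%N) -rev_iota.
have -> : reading T = flatten [seq colT T j | j <- rev (iota 0 (part mu 0))].
  rewrite /reading /cells map_flatten -map_comp; congr flatten; apply: eq_map => j /=.
  by rewrite -map_comp.
rewrite -(subnKC mn) iotaD rev_cat map_cat flatten_cat add0n.
set s := flatten _; set s' := flatten (map _ (rev (iota (part mu 0) _))).
suff -> : s' = [::] by [].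
rewrite /s'; move: (n - part mu 0)%N => k.
have : all (fun j => part mu 0 <= j)%N (rev (iota (part mu 0) k)).
  by apply/allP => j; rewrite mem_rev mem_iota => /andP[].
by elim: (rev _) => //= j l IH /andP[h /IH ->]; rewrite /colT (conj_part_eq0 h).
Qed.

Lemma readingK T : unread mu (reading T) = Some T.
Proof.
have /and3P[/eqP sz _ _] := valP T.
rewrite /unread (_ : [seq _ | i <- iota 0 (size mu)] = val T) ?valK //.
have szT : size (val T) = size mu by rewrite -sz size_map.
apply: (@eq_from_nth _ [::]); rewrite size_map size_iota // => i im.
rewrite (nth_map 0%N) ?size_iota // nth_iota // add0n.
have si : size (nth [::] (val T) i) = part mu i by rewrite /part -sz (nth_map [::]) // szT.
apply: (@eq_from_nth _ 0); rewrite size_map size_iota ?si // => j ji.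
rewrite (nth_map 0%N) ?size_iota // nth_iota // add0n.
have cij : (i, j) \in cells mu by rewrite mem_cells.
by rewrite /reading (nth_map (0%N, 0%N)) ?index_mem // nth_index.
Qed.

Section Mat.
Variable n : nat.
Hypothesis mn : (part mu 0 <= n)%N.

(** Column j of T becomes row n - 1 - j, both counted from 0: the reading of a tableau
    takes the columns from right to left, the word of a matrix the rows downwards. *)
Definition tabmat T : mat01 n := mk_mat (reading T) (fun i x => x \in colT T (n.-1 - i)).

Lemma tabmatE T i x : tabmat T (i, x) = (x \in colT T (n.-1 - i)).
Proof.
rewrite /tabmat mk_matE andbC; case: (boolP (x \in colT _ _)) => //= h.
rewrite (reading_colT T mn); apply/flattenP; exists (colT T (n.-1 - i)) => //.
by apply: map_f; rewrite mem_iota /= add0n.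
Qed.

Lemma row_word_tabmat T i : row_word (mat_row (tabmat T) i) = colT T (n.-1 - i).
Proof. by apply/esym/row_word_eq; [exact: colT_sorted|move=> x; rewrite mat_rowE tabmatE]. Qed.

Lemma reading_tabmat T : flatten (map row_word (rows (tabmat T))) = reading T.
Proof.
rewrite (reading_colT T mn) /rows -map_comp -val_enum_ord -map_comp; congr flatten.
by apply: eq_map => i /=; rewrite row_word_tabmat.
Qed.

Lemma tabmat_inj : injective tabmat.
Proof.
by move=> T T' e; have := readingK T; rewrite -reading_tabmat e reading_tabmat readingK => -[].
Qed.

Lemma wt_tabmat T i : coeff i (wt (mat_fin_crystal n) (tabmat T)) = (conj_part mu (n.-1 - i))%:Z.
Proof. by rewrite wt_fin_row row_word_tabmat size_colT. Qed.

Lemma tabmat_lowest T : lowest (tabmat T).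
Proof.
apply/lowestP => l; rewrite !row_word_tabmat.
have -> : (n.-1 - lo (l : node (gl_fin n)) = (n.-1 - hi (l : node (gl_fin n))).+1)%N.
  by rewrite /=; have := ltn_ord l; clear; lia.
rewrite !size_colT; split; first exact: conj_part_le.
exact: colT_row.
Qed.
End Mat.
End Tableau.

Lemma count_down (P : pred nat) n i : (forall j, P j.+1 -> P j) ->
  (i < count P (iota 0 n))%N = (i < n)%N && P i.
Proof.
move=> h; have le j j' : (j <= j')%N -> P j' -> P j.
  elim: j' => [|j' IH]; first by rewrite leqn0 => /eqP ->.
  by rewrite leq_eqVlt => /orP[/eqP ->//|]; rewrite ltnS => /IH hj /h.
elim: n => [|n IH]; first by rewrite !ltn0.
have -> : iota 0 n.+1 = iota 0 n ++ [:: n] by rewrite -addn1 iotaD.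
rewrite count_cat /= addn0 [(i < n.+1)%N]ltnS; case Pn: (P n).
  have -> : count P (iota 0 n) = n.
    rewrite -[RHS](size_iota 0); apply/eqP; rewrite -all_count; apply/allP => j.
    by rewrite mem_iota => /andP[_ jn]; apply: le Pn; exact: ltnW.
  by rewrite addn1 ltnS; case: leqP => //= /le /(_ Pn) ->.
rewrite addn0 IH [(i <= n)%N]leq_eqVlt; case: eqVneq => [->|//].
by rewrite Pn andbF.
Qed.

Section LowestTableau.
Variables (n : nat) (A : mat01 n).
Hypothesis lw : lowest A.

Definition scol c : seq int := if (c < n)%N then row_word (nth [fsfun] (rows A) (n.-1 - c)) else [::].

Lemma scolE (i : 'I_n) : scol (n.-1 - i) = row_word (mat_row A i).
Proof.
have hi := ltn_ord i; rewrite /scol ifT; last by move: hi; clear; lia.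
by rewrite subKn ?nth_rows //; move: hi; clear; lia.
Qed.

Lemma scol_sorted c : sorted <%R (scol c).
Proof. by rewrite /scol; case: ifP => // _; exact: row_word_sorted. Qed.

Lemma scol_step c : (size (scol c.+1) <= size (scol c))%N /\
  forall r, (r < size (scol c.+1))%N -> (scol c)`_r <= (scol c.+1)`_r.
Proof.
have [cn|cn] := ltnP c.+1 n; last by rewrite {1 3}/scol ltnNge cn.
have h : (n.-1 - c.+1 < n.-1)%N by move: cn; clear; lia.
have := proj1 (lowestP A) lw (Ordinal h); rewrite -!scolE.
have -> : (n.-1 - lo (Ordinal h : node (gl_fin n)) = c.+1)%N by rewrite /=; move: cn; clear; lia.
by have -> : (n.-1 - hi (Ordinal h : node (gl_fin n)) = c)%N by rewrite /=; move: cn; clear; lia.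
Qed.

(** The length of row r in the shape whose columns have the lengths of the scol c. *)
Definition srow r : nat := count (fun c => r < size (scol c))%N (iota 0 n).

Lemma srowP c r : (c < srow r)%N = (r < size (scol c))%N.
Proof.
rewrite /srow count_down; last first.
  by move=> j h; apply: leq_trans h _; have [] := scol_step j.
by rewrite /scol; case: (ltnP c n).
Qed.

Definition sparts : seq nat := [seq srow r | r <- iota 0 (size (scol 0))].

Lemma sparts_part : sorted geq sparts && (0%N \notin sparts).
Proof.
apply/andP; split.
  apply/(sortedP 0%N) => r; rewrite size_map size_iota => h.
  rewrite !(nth_map 0%N) ?size_iota ?(ltnW h) // !nth_iota ?(ltnW h) // !add0n /geq /=.
  by apply: sub_count => c /=; apply: leq_ltn_trans.
apply/mapP => -[r]; rewrite mem_iota add0n => /andP[_ h] e.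
by have := srowP 0 r; rewrite -e h.
Qed.

Definition smu : intpart := IntPart sparts_part.

Lemma part_smu r : part smu r = srow r.
Proof.
rewrite /part /=; have [h|h] := ltnP r (size (scol 0)).
  by rewrite (nth_map 0%N) ?size_iota // nth_iota.
rewrite nth_default ?size_map ?size_iota //; apply/esym/eqP; rewrite -leqn0 leqNgt srowP.
by rewrite -leqNgt.
Qed.

Lemma conj_smu c : conj_part smu c = size (scol c).
Proof. by apply: eq_ltn => r; rewrite conj_partP part_smu srowP. Qed.

Lemma smu_le : (part smu 0 <= n)%N.
Proof. by rewrite part_smu /srow (leq_trans (count_size _ _)) // size_iota. Qed.

Definition stab : seq (seq int) :=
  [seq [seq (scol c)`_r | c <- iota 0 (srow r)] | r <- iota 0 (size (scol 0))].

Lemma entry_stab r c : (c < part smu r)%N -> entry stab (r, c) = (scol c)`_r.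
Proof.
rewrite part_smu => h; have r0 : (r < size (scol 0))%N by rewrite -srowP (leq_ltn_trans _ h).
by rewrite /entry /= (nth_map 0%N) ?size_iota // nth_iota // (nth_map 0%N) ?size_iota // nth_iota.
Qed.

Lemma stab_semistandard : semistandard smu stab.
Proof.
apply/and3P; split.
- by apply/eqP; rewrite /= -map_comp; apply: eq_map => r /=; rewrite size_map size_iota.
- apply/allP => -[[|r] c]; rewrite mem_cells //= => h; rewrite !entry_stab //; last first.
    by move: h; rewrite !part_smu !srowP; exact: ltnW.
  by apply: (sortedP 0 (scol_sorted c)); move: h; rewrite part_smu srowP.
- apply/allP => -[r [|c]]; rewrite mem_cells ?orbT //= => h; rewrite !entry_stab ?(ltnW h) //.
  by have [_] := scol_step c; apply; move: h; rewrite part_smu srowP.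
Qed.

Lemma lowest_tabmat : exists (mu : intpart) (T : ssyt mu), (part mu 0 <= n)%N /\ A = tabmat n T.
Proof.
exists smu, (exist _ stab stab_semistandard); split; first exact: smu_le.
apply/fsfunP => -[i x]; rewrite (tabmatE smu_le) /colT.
have -> : [seq entry (val (exist _ stab stab_semistandard : ssyt smu)) (r, (n.-1 - i)%N) | r <- iota 0 (conj_part smu (n.-1 - i))]
   = scol (n.-1 - i).
  rewrite conj_smu; apply: (@eq_from_nth _ 0); rewrite size_map size_iota // => r h.
  by rewrite (nth_map 0%N) ?size_iota // nth_iota // add0n entry_stab // part_smu srowP.
by rewrite scolE mem_kap mat_rowE.
Qed.
End LowestTableau.

Section TabPreserves.
Variables (n : nat) (mu : intpart).
Hypothesis mn : (part mu 0 <= n)%N.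

Lemma tabmat_shape (mu' : intpart) (T : ssyt mu) (T' : ssyt mu') : (part mu' 0 <= n)%N ->
  wt (mat_fin_crystal n) (tabmat n T') = wt (mat_fin_crystal n) (tabmat n T) -> mu' = mu.
Proof.
move=> mn' e; apply: conj_part_inj => c; have [cn|cn] := ltnP c n; last first.
  by rewrite !conj_part_eq0 // ?(leq_trans mn) ?(leq_trans mn').
have h : (n.-1 - c < n)%N by move: cn; clear; lia.
have := congr1 (coeff (Ordinal h : pos (gl_fin n))) e; rewrite !wt_tabmat //= => -[].
by have -> : (n.-1 - (n.-1 - c) = c)%N by move: cn; clear; lia.
Qed.

(** The row operators keep the matrix lowest, since they do not change phi of the column
    operators, and they keep its row sums, which are the column lengths of the shape. *)
Lemma tabmat_op (T : ssyt mu) (A : mat01 n) p : cop (mat_inf_crystal n) p (tabmat n T) = Some A ->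
  exists T' : ssyt mu, A = tabmat n T'.
Proof.
move=> E; have [hw _ hp] := mat_op1_inv E.
have [l|mu' [T' [mn' AE]]] := @lowest_tabmat n A.
  by rewrite -(tabmat_lowest mn T l); exact: (hp l).
have e : mu' = mu by apply: (@tabmat_shape mu' T T' mn'); rewrite -AE.
by case: mu / e {T E hw hp} T' AE => T'; exists T'.
Qed.

Lemma tabmat_preserves : preserves (ssyt_crystal mu) (mat_inf_crystal n) (@tabmat mu n).
Proof.
have [kw ke kp kE kF] := row_word_preserves.
have rd (T : ssyt mu) := reading_tabmat mn T.
split=> [T|k T|k T|k T|k T].
- by have h := kw (rows (tabmat n T)); rewrite rd in h; exact: esym h.
- by have h := ke k (rows (tabmat n T)); rewrite rd in h; exact: esym h.
- by have h := kp k (rows (tabmat n T)); rewrite rd in h; exact: esym h.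
- have h := kE k (rows (tabmat n T)); rewrite rd in h.
  rewrite /= [word_e _ k (reading T)]h.
  have op := @tabmat_op T _ (true, k); rewrite /cop /= in op.
  move: op; rewrite [ce (word_crystal _) k _]/=; case E: (word_e _ k _) => [r|] //= /(_ _ erefl)[T' hT'].
  have sr : size r = n.
    have := word_e_map (vec_small gl_inf) (mat_row (tabmat n T)) k (enum_uniq 'I_n).
    rewrite -/(rows _) E; case: (sg_e _ _ _) => //= i [->].
    by rewrite size_map size_enum_ord.
  have e : flatten (map row_word r) = reading T' by rewrite -rd -hT' rows_of_rows.
  by rewrite e readingK hT'.
- have h := kF k (rows (tabmat n T)); rewrite rd in h.
  rewrite /= [word_f _ k (reading T)]h.
  have op := @tabmat_op T _ (false, k); rewrite /cop /= in op.
  move: op; rewrite [cf (word_crystal _) k _]/=; case E: (word_f _ k _) => [r|] //= /(_ _ erefl)[T' hT'].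
  have sr : size r = n.
    have := word_f_map (vec_small gl_inf) (mat_row (tabmat n T)) k (enum_uniq 'I_n).
    rewrite -/(rows _) E; case: (sg_f _ _ _) => //= i [->].
    by rewrite size_map size_enum_ord.
  have e : flatten (map row_word r) = reading T' by rewrite -rd -hT' rows_of_rows.
  by rewrite e readingK hT'.
Qed.
End TabPreserves.

(** * Decomposition of the matrices *)

Section Strings.

Lemma iter_obind_None (B : Type) (g : B -> option B) k : iter k (obind g) None = None.
Proof. by elim: k => //= k ->. Qed.

Lemma string_length_uniq (B : Type) (g : B -> option B) b k k' :
  string_length g b k -> string_length g b k' -> k = k'.
Proof.
have H k1 k2 : (k1 < k2)%N -> iter k1.+1 (obind g) (Some b) = None -> iter k2 (obind g) (Some b) = None.
  by move=> kk h; rewrite -(subnK kk) iterD h iter_obind_None.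
move=> [h1 h2] [h3 h4]; have [kk|kk|//] := ltngtP k k'.
- by case: h3; exact: H kk h2.
- by case: h1; exact: H kk h4.
Qed.

Lemma string_length_map (B B' : Type) (g : B -> option B) (g' : B' -> option B') (h : B -> B') b k :
  (forall b, g' (h b) = omap h (g b)) -> string_length g b k -> string_length g' (h b) k.
Proof.
move=> H; have E j : iter j (obind g') (Some (h b)) = omap h (iter j (obind g) (Some b)).
  by elim: j => //= j ->; case: (iter j _ _) => //= b'; rewrite H.
by rewrite /string_length !E => -[h1 ->]; split=> //; case: (iter k _ _) h1.
Qed.

Variables (T : Type) (I : eqType) (sw : I -> T -> T) (up dn : I -> T -> bool) (J : seq I).
Hypotheses (ch : chain sw up dn) (uJ : uniq J).

Lemma ch_eps_string t : string_length (ch_e sw up dn J) t (ch_eps up dn J t).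
Proof.
move E: (ch_eps up dn J t) => k; elim: k t E => [|k IH] t E.
  by split=> //=; apply/(ch_eN ch).
case E1: (ch_e sw up dn J t) => [t'|]; last by move/(ch_eN ch): E1; rewrite E.
have [_ _ h] := ch_eP ch uJ E1; move: h; rewrite E => -[/esym /IH].
by rewrite /string_length !iterSr /= E1.
Qed.

Lemma ch_phi_string t : string_length (ch_f sw up dn J) t (ch_phi up dn J t).
Proof.
move E: (ch_phi up dn J t) => k; elim: k t E => [|k IH] t E.
  by split=> //=; apply/(ch_fN ch).
case E1: (ch_f sw up dn J t) => [t'|]; last by move/(ch_fN ch): E1; rewrite E.
have [_ _ h] := ch_fP ch uJ E1; move: h; rewrite E => -[/esym /IH].
by rewrite /string_length !iterSr /= E1.
Qed.

Lemma ch_eps0 t : (forall j, ~~ dn j t) -> ch_eps up dn J t = 0%N.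
Proof.
move=> h; apply/(ch_eN ch); rewrite /ch_e; case E: (sg_e _ _ _) => [j|] //.
by have := sg_e_mem E; rewrite (negbTE (h j)) andbF.
Qed.

Lemma ch_phi0 t : (forall j, ~~ up j t) -> ch_phi up dn J t = 0%N.
Proof.
move=> h; apply/(ch_fN ch); rewrite /ch_f; case E: (sg_f _ _ _) => [j|] //.
by have := sg_f_mem E; rewrite (negbTE (h j)) andbF.
Qed.
End Strings.

Section Final.
Variable n : nat.
Local Notation lof := (@lo (gl_fin n) : 'I_n.-1 -> 'I_n).
Local Notation hif := (@hi (gl_fin n) : 'I_n.-1 -> 'I_n).
Local Notation conn1 := (conn (cop (mat_inf_crystal n))).
Local Notation conn2 := (conn (cop (mat_fin_crystal n))).
Local Notation op2V := (copVP (@mat_fin_is_crystal n)).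
Local Notation op1V := (copVP (@mat_inf_is_crystal n)).
Local Notation wtf := (wt (mat_fin_crystal n)).
Local Notation wti := (wt (mat_inf_crystal n)).
Local Notation collow m t := (forall l : 'I_n.-1, ch_phi (cup (m := m) lof hif l) (cdn lof hif l) (cols_rl m) t = 0%N).
Local Notation rowtop m t := (forall k k' : 'I_m, k' = k.+1 :> nat -> ch_eps (rup k k') (rdn k k') (rows_tb n) t = 0%N).

Lemma conn1_wt A A' : conn1 A A' -> wtf A' = wtf A.
Proof. by apply: conn_inv => p x y /mat_op1_inv[]. Qed.
Lemma conn1_phi A A' l : conn1 A A' -> cphi (mat_fin_crystal n) l A' = cphi (mat_fin_crystal n) l A.
Proof. by apply: conn_inv => p x y /mat_op1_inv[_ _ h]; exact: h. Qed.
Lemma conn2_wt A A' : conn2 A A' -> wti A' = wti A.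
Proof. by apply: conn_inv => p x y /mat_op2_inv[]. Qed.
Lemma conn2_eps A A' k : conn2 A A' -> ceps (mat_inf_crystal n) k A' = ceps (mat_inf_crystal n) k A.
Proof. by apply: conn_inv => p x y /mat_op2_inv[_ h _]; exact: h. Qed.

Lemma win_lowest m c (t : box n m) :
  lowest (win c t) <-> forall l : 'I_n.-1, ch_phi (cup (m := m) lof hif l) (cdn lof hif l) (cols_rl m) t = 0%N.
Proof.
by split=> h l; have := h l; rewrite win_phi_fin; [case|move=> ->].
Qed.

Section Justified.
Variables (m : nat) (t : box n m).
Hypothesis low : forall l : 'I_n.-1, ch_phi (cup (m := m) lof hif l) (cdn lof hif l) (cols_rl m) t = 0%N.
Hypothesis top : rowtop m t.

Lemma box_justified : (forall i j j' : nat, (j' <= j)%N -> ab t i j -> ab t i j') /\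
  (forall (i i' : 'I_n) j, (i <= i')%N -> ab t i j -> ab t i' j).
Proof.
have [||h1 h2] := @lowest_justified n m (ab t) (@ab_supp n m t).
- by move=> k r rn; apply: ab_rows.
- move=> l c ln; have [i il] := fin_lo_surj ln.
  have := proj1 (box_phi0 (@fin_lohi n) t i) (low i) c; rewrite fin_lohi il.
  by have := count_andN (ab t l) (ab t l.+1) (iota 0 c); clear; lia.
split=> [i j j'|i i' j].
  by apply: justified_le => k; exact: h1.
case: i' => i' i'n /=; elim: i' i'n => [|i' IH] i'n; first by rewrite leqn0 => /eqP ->.
rewrite leq_eqVlt => /orP[/eqP ->//|]; rewrite ltnS => /(IH (ltnW i'n)) h /h.
exact: h2.
Qed.
End Justified.

(** The rows of both boxes are initial segments, so they can be compared. *)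
Lemma justified_rows m (t t' : box n m) :
  (collow m t) -> rowtop m t ->
  (collow m t') -> rowtop m t' ->
  (forall i, row_sum t i = row_sum t' i) -> t = t'.
Proof.
have H u u' : (collow m u) -> rowtop m u ->
  (collow m u') -> rowtop m u' ->
  (forall i, row_sum u i = row_sum u' i) -> forall x, u x -> u' x.
  move=> l1 t1 l2 t2 e [i j]; have [J1 _] := box_justified l1 t1; have [J2 _] := box_justified l2 t2.
  apply: (@sum_comparable _ (fun j => u (i, j)) (fun j => u' (i, j))) => [x y|].
    rewrite -!abE => ux nu'x u'y; apply: J1 ux; rewrite leqNgt; apply: contra nu'x => /ltnW xy.
    exact: J2 u'y.
  have PE (v : box n m) : row_sum v i = (\sum_j (v (i, j) : nat))%N%:Z by rewrite (big_morph Posz PoszD (erefl 0)).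
  by have := e i; rewrite !PE => -[].
by move=> l1 t1 l2 t2 e; apply/ffunP => x; apply/idP/idP; apply: H.
Qed.

Lemma justified_cols m (t t' : box n m) :
  (collow m t) -> rowtop m t ->
  (collow m t') -> rowtop m t' ->
  (forall j, col_sum t j = col_sum t' j) -> t = t'.
Proof.
have H u u' : (collow m u) -> rowtop m u ->
  (collow m u') -> rowtop m u' ->
  (forall j, col_sum u j = col_sum u' j) -> forall x, u x -> u' x.
  move=> l1 t1 l2 t2 e [i j]; have [_ J1] := box_justified l1 t1; have [_ J2] := box_justified l2 t2.
  apply: (@sum_comparable _ (fun i => u (i, j)) (fun i => u' (i, j))) => [x y|]; last exact: e.
  rewrite -!abE => ux nu'x u'y; apply: (J1 x) ux; rewrite leqNgt; apply: contra nu'x => /ltnW xy.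
  exact: (J2 y) u'y.
by move=> l1 t1 l2 t2 e; apply/ffunP => x; apply/idP/idP; apply: H.
Qed.

(** Every step lowers by one the sum of the column indices of the entries. *)
Lemma raise_rows m c (s : box n m) : exists t : box n m, conn1 (win c s) (win c t) /\ rowtop m t.
Proof.
pose P (t : box n m) : nat := (\sum_(j : 'I_m) nat_of_ord j * col_sum t j)%N.
move E: (P s) => p; elim/ltn_ind: p s E => p IH s E.
have [|] := pselect (rowtop m s); first by exists s; split=> //; exact: conn_refl.
move=> nt; have [k [k' [kk' eps]]] : exists k k' : 'I_m, k' = k.+1 :> nat /\ ch_eps (rup k k') (rdn k k') (rows_tb n) s != 0%N.
  apply: contrapT => nex; apply: nt => k k' kk'; apply/eqP/negPn/negP => h.
  by apply: nex; exists k, k'.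
case E1: (ch_e (rsw k k') (rup k k') (rdn k k') (rows_tb n) s) => [s'|]; last first.
  by move/(ch_eN (chain_r n kk')): E1 eps => ->.
have c1 : conn1 (win c s) (win c s').
  by apply: (@conn_step _ _ _ (true, c + (nat_of_ord k)%:Z)); rewrite /cop [LHS](win_e_inf c kk') E1.
have ps : (P s' < P s)%N.
  have [i di ->] : exists2 i, rdn k k' i s & s' = rsw k k' i s.
    move: E1; rewrite /ch_e; case Ei: (sg_e _ _ _) => [i|] //= [<-].
    by have /andP[_ di] := sg_e_mem Ei; exists i.
  suff : (P (rsw k k' i s))%:Z = (P s)%:Z - 1 by clear; lia.
  rewrite /P !(big_morph Posz PoszD (erefl 0)).
  under eq_bigr do rewrite PoszM col_sum_rsw // mulrDr.
  rewrite big_split /=; congr (_ + _).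
  rewrite (bigD1 k) //= (bigD1 k') /=; last by rewrite -val_eqE /= kk'; clear; lia.
  have kN : (k == k') = false by rewrite -val_eqE /= kk'; clear; lia.
  rewrite big1; last by move=> j /andP[/negbTE -> /negbTE ->]; rewrite subrr mulr0.
  by rewrite !eqxx kN eq_sym kN kk'; clear; lia.
have [t [c2 ht]] := IH (P s') (eq_ind _ (fun z => (P s' < z)%N) ps _ E) s' erefl.
by exists t; split=> //; exact: conn_trans c1 c2.
Qed.

(** Raised as far as possible inside a common window, both become justified boxes with the
    same row sums. *)
Lemma lowest_conn A A' : lowest A -> lowest A' -> wtf A = wtf A' -> conn1 A A'.
Proof.
move=> lA lA' e.
have [c [m hm]] := window_exists ([seq x.2 | x <- finsupp A] ++ [seq x.2 | x <- finsupp A']).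
have [s As] : exists s : box n m, A = win c s.
  apply: win_of => i x Ax; apply: hm; rewrite mem_cat; apply/orP; left.
  by apply/mapP; exists (i, x); rewrite // mem_finsupp Ax.
have [s' As'] : exists s : box n m, A' = win c s.
  apply: win_of => i x Ax; apply: hm; rewrite mem_cat; apply/orP; right.
  by apply/mapP; exists (i, x); rewrite // mem_finsupp Ax.
have [t [ct tt]] := raise_rows c s; have [t' [ct' tt']] := raise_rows c s'.
rewrite -As in ct; rewrite -As' in ct'.
apply: (conn_trans ct); apply: (conn_sym op1V).
suff -> : t = t' by [].
apply: justified_rows => //.
- by apply/(win_lowest c) => l; rewrite (conn1_phi l ct).
- by apply/(win_lowest c) => l; rewrite (conn1_phi l ct').
- by move=> i; rewrite -!(wt_win_fin c) (conn1_wt ct) (conn1_wt ct') e.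
Qed.

(** Every step lowers the height of the weight, which is not negative. *)
Lemma lower_cols m c (s : box n m) : exists t : box n m, conn2 (win c s) (win c t) /\ lowest (win c t).
Proof.
have pos (t : box n m) : 0 <= height (row_sum t).
  by apply: sumr_ge0 => i _; apply: mulr_ge0 => //; apply: sumr_ge0.
move E: (absz (height (row_sum s))) => p; elim: p s E => [|p IH] s E.
all: have [|nl] := pselect (lowest (win c s)); first by exists s; split=> //; exact: conn_refl.
all: have [l nz] : exists l : 'I_n.-1, ch_phi (cup (m := m) lof hif l) (cdn lof hif l) (cols_rl m) s != 0%N
  by apply: contrapT => nex; apply: nl; apply/win_lowest => l; apply/eqP/negPn/negP => h; apply: nex; exists l.
all: case E1: (ch_f (csw lof hif l) (cup lof hif l) (cdn lof hif l) (cols_rl m) s) => [s'|];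
  last by move/(ch_fN (chain_c m (@fin_lohi n) l)): E1 nz => ->.
all: have E2 := proj1 (ch_efP (chain_c m (@fin_lohi n) l) (uJ m) _ _) E1.
all: have hr : height (row_sum s) = height (row_sum s') + 1
  by rewrite (height_ext (row_sum_e (@fin_lohi n) E2)) (heightD (@fin_lohi n)).
  by move: (pos s') E; rewrite hr; clear; lia.
have [|t [ct lt]] := IH s'; first by move: (pos s') E; rewrite hr; clear; lia.
exists t; split=> //; apply: conn_trans ct.
by apply: (@conn_step _ _ _ (false, l)); rewrite /cop [LHS]win_f_fin E1.
Qed.
End Final.

Section Base.
Variable n : nat.
Local Notation lof := (@lo (gl_fin n) : 'I_n.-1 -> 'I_n).
Local Notation hif := (@hi (gl_fin n) : 'I_n.-1 -> 'I_n).
Local Notation conn1 := (conn (cop (mat_inf_crystal n))).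
Local Notation conn2 := (conn (cop (mat_fin_crystal n))).
Local Notation op2V := (copVP (@mat_fin_is_crystal n)).
Local Notation op1V := (copVP (@mat_inf_is_crystal n)).
Local Notation wtf := (wt (mat_fin_crystal n)).
Local Notation wti := (wt (mat_inf_crystal n)).
Local Notation rowtop m t := (forall k k' : 'I_m, k' = k.+1 :> nat -> ch_eps (rup k k') (rdn k k') (rows_tb n) t = 0%N).

Section Shape.
Variable mu : intpart.
Hypothesis mn : (part mu 0 <= n)%N.
Let m := size mu.
Let lam (i : 'I_n) : nat := conj_part mu i.

(** The diagram of mu upside down.  It is lowest for the column operators, like the
    matrices of the tableaux of shape mu, and it is in row_highest, like the elements of the
    crystal of highest weight mu'; so it is connected to both. *)
Definition base_box : box n (size mu) :=
  [ffun x : cell n (size mu) => (x.2 < conj_part mu (n.-1 - x.1))%N].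
Definition base_mat : mat01 n := win 0 base_box.

Lemma lam_dec (i i' : 'I_n) : (i <= i')%N -> (lam i' <= lam i)%N.
Proof. exact: conj_part_le. Qed.

Lemma lam_m i : (lam i <= m)%N.
Proof. by rewrite /m -conj_part0; apply: conj_part_le. Qed.

Lemma base_low (l : 'I_n.-1) : ch_phi (cup (m := m) lof hif l) (cdn lof hif l) (cols_rl m) base_box = 0%N.
Proof.
apply: (ch_phi0 _ (chain_c m (@fin_lohi n) l)) => j.
rewrite /cup /grid_up /bget !ffunE /= negb_and negbK.
have h : (n.-1 - l.+1 <= n.-1 - l)%N by clear; lia.
by have := conj_part_le mu h; case: ltnP => //= h1 h2; rewrite (leq_trans h1 h2).
Qed.

Lemma base_top : rowtop m base_box.
Proof.
move=> k k' kk'; apply: (ch_eps0 _ (chain_r n kk')) => i.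
rewrite /rdn /grid_dn /bget !ffunE /= kk'; apply/negP => /andP[/negP h1 h2]; apply: h1; exact: ltnW h2.
Qed.

Lemma base_lowest : lowest base_mat.
Proof. by apply/win_lowest => l; exact: base_low. Qed.

Lemma wt_base (i : 'I_n) : coeff i (wtf base_mat) = (conj_part mu (n.-1 - i))%:Z.
Proof.
rewrite wt_win_fin /row_sum; set h := conj_part _ _.
have hm : (h <= m)%N by rewrite /m -conj_part0; apply: conj_part_le.
rewrite (eq_bigr (fun j : 'I_m => ((j < h)%N : nat)%:Z)); last by move=> j _; rewrite ffunE.
rewrite -(big_morph Posz PoszD (erefl 0)); congr Posz.
by rewrite sum_ord_lt.
Qed.

Lemma base_Q : row_highest lam base_box.
Proof.
split=> [k k' kk'|j]; first by apply/(ch_eN (chain_r n kk')); exact: base_top.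
rewrite /col_sum (reindex_inj rev_ord_inj) /=; apply: eq_bigr => i _.
rewrite !ffunE /=; congr (nat_of_bool (_ < conj_part mu _)%N).
by have := ltn_ord i; clear; lia.
Qed.

Lemma Q_conn (s : box n m) : row_highest lam s -> conn2 (win 0 s) (win 0 (diagram m lam)).
Proof.
apply: (raise_ind (rk := fun s => height (row_sum s))
  (ce := fun i => ch_e (csw (m := m) lof hif i) (cup lof hif i) (cdn lof hif i) (cols_rl m))
  (R := fun s => conn2 (win 0 s) (win 0 (diagram m lam)))).
- by move=> i u u' E; rewrite (height_ext (row_sum_e (@fin_lohi n) E)) (heightD (@fin_lohi n)).
- by move=> u; exact: (row_highest_depth (@fin_lohi n) (@fin_lo_surj n) lam_dec).
- by move=> i u u'; exact: (row_highest_e (@fin_lohi n)).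
- by move=> u Qu; exact: (row_highest_hw (@fin_lohi n) (@fin_lo_surj n) lam_dec Qu).
- exact: conn_refl.
move=> i u u' _ E; apply: conn_trans.
by apply: (@conn_step _ _ _ (true, i)); rewrite /cop [LHS]win_e_fin E.
Qed.

Lemma tabmat_conn (T : ssyt mu) : conn1 base_mat (tabmat n T).
Proof.
apply: lowest_conn; [exact: base_lowest|exact: tabmat_lowest|].
by apply/eqP/freeg_eqP => i; rewrite wt_base wt_tabmat.
Qed.

Variable C : crystal (gl_fin n).
Hypothesis C_hw : is_hw_crystal (omega (fun i => (lam i)%:Z)) C.

(** The lengths of strings are preserved because the operators are. *)
Lemma hw_mat : exists h : C -> mat01 n, [/\ preserves C (mat_fin_crystal n) h, injective h,
  forall b, conn2 base_mat (h b) & exists b, h b = base_mat].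
Proof.
have [h [hi hQ hs hef hw]] := hw_box lam_dec lam_m C_hw; exists (fun b => win 0 (h b)).
have he i b := proj1 (hef i b); have hf i b := proj2 (hef i b).
split.
- split=> [b|i b|i b|i b|i b].
  + by apply/eqP/freeg_eqP => i; rewrite wt_win_fin hw.
  + have [[k -> sk] _] := C_hw.2 i b; rewrite win_eps_fin; congr Posz.
    have s1 := string_length_map (he i) sk.
    exact: string_length_uniq (ch_eps_string (chain_c m (@fin_lohi n) i) (uJ m) (h b)) s1.
  + have [_ [k -> sk]] := C_hw.2 i b; rewrite win_phi_fin; congr Posz.
    have s1 := string_length_map (hf i) sk.
    exact: string_length_uniq (ch_phi_string (chain_c m (@fin_lohi n) i) (uJ m) (h b)) s1.
  + by rewrite win_e_fin he; case: (ce C i b).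
  + by rewrite win_f_fin hf; case: (cf C i b).
- by move=> b b' /win_inj/hi.
- move=> b; apply: conn_trans (Q_conn base_Q) _; apply: (conn_sym op2V); exact: Q_conn (hQ b).
- by have [b hb] := hs _ base_Q; exists b; rewrite hb.
Qed.
End Shape.

(** A is lowest like base_mat mu; and it has the column sums of base_mat mu', and is like it
    highest for the row operators of its window.  So justified_cols identifies them, and
    the row sums then give mu = mu'. *)
Lemma base_sep mu mu' A : (part mu 0 <= n)%N -> (part mu' 0 <= n)%N ->
  conn1 (base_mat mu) A -> conn2 A (base_mat mu') -> mu = mu' /\ A = base_mat mu'.
Proof.
move=> mn mn' c1 c2; have wA := conn2_wt c2.
have sA : forall i x, A (i, x) -> exists j : 'I_(size mu'), x = 0 + (nat_of_ord j)%:Z.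
  move=> i x Ax; have [//|h] := win_case (size mu') 0 x.
  have /eqP := congr1 (coeff x) wA; rewrite wt_win_inf0 // coeff_wt_inf eq_sym.
  rewrite psumr_eq0 // => /allP /(_ i); rewrite mem_index_enum Ax => /(_ isT).
  by [].
have [t At] := win_of sA.
have e : t = base_box mu'.
  apply: justified_cols.
  - by apply/(win_lowest 0) => l; rewrite -At (conn1_phi l c1); exact: base_lowest.
  - move=> k k' kk'; have := conn2_eps (0 + (nat_of_ord k)%:Z) c2.
    by rewrite At !(win_eps_inf _ kk') (base_top kk') => -[].
  - exact: base_low.
  - exact: base_top.
  move=> j; have := congr1 (coeff (0 + (nat_of_ord j)%:Z)) wA.
  by rewrite At !wt_win_inf => -[].
have AE : A = base_mat mu' by rewrite At e.
split=> //; apply: conj_part_inj => c; have [cn|cn] := ltnP c n; last first.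
  by rewrite !conj_part_eq0 // ?(leq_trans mn) ?(leq_trans mn').
have h : (n.-1 - c < n)%N by move: cn; clear; lia.
have := congr1 (coeff (Ordinal h : pos (gl_fin n))) (conn1_wt c1).
rewrite AE !wt_base /= => -[].
by have -> : (n.-1 - (n.-1 - c) = c)%N by move: cn; clear; lia.
Qed.

Lemma tabmat_cover A : exists (mu : {mu : intpart | (part mu 0 <= n)%N}) (T : ssyt (sval mu)),
  conn2 (tabmat n T) A.
Proof.
have [c [m [s [_ [_ [-> _ _]]]]]] := win_exists A 0.
have [t [ct lt]] := lower_cols c s; have [mu [T [mn e]]] := lowest_tabmat lt.
by exists (exist _ mu mn), T; rewrite -e; exact: (conn_sym op2V ct).
Qed.
End Base.

Theorem proposition3p9 (n : nat) (n_ge1 : (1 <= n)%N)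
    (B : weight (gl_fin n) -> crystal (gl_fin n))
    (B_hw : forall la : 'I_n -> int,
       (forall i j : 'I_n, (i <= j)%N -> la j <= la i) ->
       is_hw_crystal (omega la) (B (omega la))) :
  bicrystal_iso (mat_bicrystal n)
    (sum_bicrystal (J := {mu : intpart | (part mu 0 <= n)%N})
       (fun mu => prod_bicrystal (ssyt_crystal (sval mu))
          (B (omega (fun i : 'I_n => (conj_part (sval mu) i)%:Z))))).
Proof.
have hw (mu : {mu : intpart | (part mu 0 <= n)%N}) := hw_mat (mu := sval mu) (C := B (omega (fun i : 'I_n => (conj_part (sval mu) i)%:Z)))
  (B_hw _ (fun i j ij => conj_part_le (sval mu) ij : (conj_part (sval mu) j)%:Z <= (conj_part (sval mu) i)%:Z)).
have be mu := projT2 (cid (hw mu)).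
apply: (bicrystal_decomposition (mat_is_bicrystal n) _ _
  (B1 := fun mu : {mu : intpart | (part mu 0 <= n)%N} => ssyt_crystal (sval mu))
  (B2 := fun mu => B (omega (fun i : 'I_n => (conj_part (sval mu) i)%:Z)))
  (al := fun mu => @tabmat (sval mu) n) (be := fun mu => projT1 (cid (hw mu)))
  (a := fun mu => base_mat n (sval mu))).
- by move=> p x y; exact: mat_op1_inv.
- by move=> p x y; exact: mat_op2_inv.
- by move=> mu; exact: tabmat_preserves (svalP mu).
- by move=> mu; have [] := be mu.
- by move=> mu; exact: tabmat_inj (svalP mu).
- by move=> mu; have [] := be mu.
- by move=> mu T; exact: tabmat_conn (svalP mu) T.
- by move=> mu; have [] := be mu.
- by move=> mu; have [] := be mu.
- move=> mu mu' A c1 c2; have [e ->] := base_sep (svalP mu) (svalP mu') c1 c2.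
  by split=> //; apply: val_inj.
- exact: tabmat_cover.
Qed.
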